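(* Let $\Gamma$ be a holomorphically nondegenerate real-analytic hypersurface in $\mathbf{C}^4$, let $\xi\in\Gamma$, and let $\mathrm{aut}\,\Gamma_\xi$ be the Lie algebra of infinitesimal holomorphic automorphisms of the germ $\Gamma_\xi$. Then: (1) $\dim\mathrm{aut}\,\Gamma_\xi\le 24$; (2) if $\Gamma$ is 2-nondegenerate at all points outside a proper real-analytic subset, then $\dim\mathrm{aut}\,\Gamma_\xi\le 17$; (3) if $\Gamma$ is 3-nondegenerate at all points outside a proper real-analytic subset, then $\dim\mathrm{aut}\,\Gamma_\xi\le 20$.
   Context: $\mathrm{aut}\,\Gamma_\xi$ is the real Lie algebra of germs at $\xi$ of real-analytic vector fields of the form $2\mathrm{Re}\,Z$, $Z$ a holomorphic vector field, tangent to $\Gamma$. A hypersurface is holomorphically nondegenerate if there is no nonzero holomorphic vector field tangent to it on any open piece; for hypersurfaces in $\mathbf{C}^4$ this is equivalent to being $l$-nondegenerate with $l\le 3$ outside a proper real-analytic subset. *)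

(* Defs.v *)
(* C^4 is modelled as R^8 = 'rV[R]_8,
   with z_j = x_j + i y_j, x_j = coordinate (lshift 4%N j), y_j = (rshift 4%N j). *)
From HB Require Import structures.
From mathcomp Require Import all_boot all_order all_algebra.
From mathcomp Require Import all_classical all_reals all_analysis.
From mathcomp Require Import complex.
Set Implicit Arguments. Unset Strict Implicit. Unset Printing Implicit Defensive.
Import Order.TTheory GRing.Theory Num.Theory.
Import numFieldNormedType.Exports.
Local Open Scope classical_set_scope.
Local Open Scope ring_scope.
Local Open Scope complex_scope.

Section CR.
Variable R : realType.
Local Notation V := 'rV[R]_8.
Local Notation C := R[i].

Definition xcoord (j : 'I_4) : 'I_8 := lshift 4%N j.
Definition ycoord (j : 'I_4) : 'I_8 := rshift 4%N j.

Definition ps_partial (c : ('I_8 -> nat) -> R) (a : V) (N : nat) (x : V) : R :=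
  \sum_(b : {ffun 'I_8 -> 'I_N})
     c (fun k => nat_of_ord (b k)) * \prod_(k < 8) (x 0 k - a 0 k) ^+ b k.
Definition ps_abs_partial (c : ('I_8 -> nat) -> R) (a : V) (N : nat) (x : V) : R :=
  \sum_(b : {ffun 'I_8 -> 'I_N})
     `|c (fun k => nat_of_ord (b k))| * \prod_(k < 8) `|x 0 k - a 0 k| ^+ b k.

Definition analytic_at (f : V -> R) (a : V) : Prop :=
  exists2 r : R, 0 < r & exists c : ('I_8 -> nat) -> R,
    forall x : V, `|x - a| < r ->
      (exists M : R, forall N, ps_abs_partial c a N x <= M) /\
      ((fun N => ps_partial c a N x) @ \oo --> f x).

Definition analytic_on (U : set V) (f : V -> R) : Prop :=
  forall a, U a -> analytic_at f a.

Definition canalytic_on (U : set V) (g : V -> C) : Prop :=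
  analytic_on U (fun x => complex.Re (g x)) /\ analytic_on U (fun x => complex.Im (g x)).

Definition evec (k : 'I_8) : V := delta_mx 0 k.
Definition pd (k : 'I_8) (f : V -> R) (a : V) : R := derive f a (evec k).
Definition cpd (k : 'I_8) (g : V -> C) (a : V) : C :=
  pd k (fun x => complex.Re (g x)) a +i* pd k (fun x => complex.Im (g x)) a.
Definition dz (j : 'I_4) (g : V -> C) (a : V) : C :=
  (1 / 2)%:C * (cpd (xcoord j) g a - 'i * cpd (ycoord j) g a).
Definition dzbar (j : 'I_4) (g : V -> C) (a : V) : C :=
  (1 / 2)%:C * (cpd (xcoord j) g a + 'i * cpd (ycoord j) g a).

Definition holomorphic_on (U : set V) (g : V -> C) : Prop :=
  forall a, U a ->
    differentiable (fun x => complex.Re (g x)) a /\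
    differentiable (fun x => complex.Im (g x)) a /\
    forall j, dzbar j g a = 0.

Definition local_defining (G : set V) (U : set V) (rho : V -> R) : Prop :=
  open U /\ analytic_on U rho /\
  (forall x, U x -> exists k, pd k rho x != 0) /\
  (forall x, U x -> (G x <-> rho x = 0)).

Definition real_analytic_hypersurface (G : set V) : Prop :=
  forall p, G p -> exists U rho, U p /\ local_defining G U rho.

Definition tangent_on (G : set V) (W : set V) (X : V -> V) : Prop :=
  forall U rho, local_defining G U rho ->
    forall p, W p -> U p -> G p -> \sum_(k < 8) X p 0 k * pd k rho p = 0.

(* a holomorphic vector field Z = sum_j Z_j d/dz_j ; its real part 2 Re Z
   = sum_j (Re Z_j) d/dx_j + (Im Z_j) d/dy_j *)
Definition hvf := 'I_4 -> V -> C.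
Definition re_field (Z : hvf) : V -> V :=
  fun x => \row_(k < 8) match @fintype.split 4%N 4%N k with
                        | inl j => complex.Re (Z j x)
                        | inr j => complex.Im (Z j x) end.
Definition hvf_holomorphic (U : set V) (Z : hvf) : Prop :=
  forall j, holomorphic_on U (Z j).

(* Z (complex vector field) tangent to Gamma: Re Z and Im Z = Re(-iZ) are tangent *)
Definition hvf_tangent (G : set V) (U : set V) (Z : hvf) : Prop :=
  tangent_on G U (re_field Z) /\ tangent_on G U (re_field (fun j x => 'i * Z j x)).

Definition holomorphically_nondegenerate (G : set V) : Prop :=
  forall p, G p -> forall (U : set V) (Z : hvf),
    open U -> U p -> hvf_holomorphic U Z -> hvf_tangent G U Z ->
    exists2 W : set V, open W /\ W p & forall x, W x -> forall j, Z j x = 0.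

Definition inf_aut (G : set V) (xi : V) (U : set V) (Z : hvf) : Prop :=
  open U /\ U xi /\ hvf_holomorphic U Z /\ tangent_on G U (re_field Z).

Definition dim_aut_le (G : set V) (xi : V) (n : nat) : Prop :=
  forall (U : set V) (Zs : 'I_n.+1 -> hvf), (forall i, inf_aut G xi U (Zs i)) ->
    exists c : 'I_n.+1 -> R, (exists i, c i != 0) /\
      exists2 W : set V, open W /\ W xi &
        forall x, W x -> forall j, \sum_(i < n.+1) (c i)%:C * Zs i j x = 0.

Definition cr_apply (L : 'I_4 -> V -> C) (g : V -> C) : V -> C :=
  fun x => \sum_(j < 4) L j x * dzbar j g x.

(* Ls : 3 = N-1 real-analytic (0,1) vector fields on U, tangent to Gamma,
   forming a basis of the CR bundle at each point of Gamma /\ U *)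
Definition cr_basis (G : set V) (U : set V) (rho : V -> R) (Ls : 'I_3 -> 'I_4 -> V -> C)
  : Prop :=
  (forall l j, canalytic_on U (Ls l j)) /\
  (forall x, U x -> G x -> forall l,
     \sum_(j < 4) Ls l j x * dzbar j (fun y => (rho y)%:C) x = 0) /\
  (forall x, U x -> G x -> forall c : 'I_3 -> C,
     (forall j, \sum_(l < 3) c l * Ls l j x = 0) -> forall l, c l = 0).

Definition cr_pow (Ls : 'I_3 -> 'I_4 -> V -> C) (alpha : 'I_3 -> nat) (g : V -> C) : V -> C :=
  iter (alpha ord0) (cr_apply (Ls ord0))
    (iter (alpha (lift ord0 ord0)) (cr_apply (Ls (lift ord0 ord0)))
      (iter (alpha ord_max) (cr_apply (Ls ord_max)) g)).

Definition cr_vec (rho : V -> R) (Ls : 'I_3 -> 'I_4 -> V -> C) (alpha : 'I_3 -> nat) (p : V)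
  : 'rV[C]_4 :=
  \row_(j < 4) cr_pow Ls alpha (dz j (fun y => (rho y)%:C)) p.

Definition E_full (rho : V -> R) (Ls : 'I_3 -> 'I_4 -> V -> C) (k : nat) (p : V) : Prop :=
  forall w : 'rV[C]_4, exists c : {ffun 'I_3 -> 'I_k.+1} -> C,
    w = \sum_(a : {ffun 'I_3 -> 'I_k.+1} | (\sum_(l < 3) nat_of_ord (a l) <= k)%N)
          c a *: cr_vec rho Ls (fun l => nat_of_ord (a l)) p.

Definition l_nondegenerate_at (G : set V) (l : nat) (p : V) : Prop :=
  (0 < l)%N /\ G p /\
  exists U rho Ls, U p /\ local_defining G U rho /\ cr_basis G U rho Ls /\
    E_full rho Ls l p /\ ~ E_full rho Ls l.-1 p.

Definition real_analytic_subset (G S : set V) : Prop :=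
  S `<=` G /\
  forall p, G p -> exists U f, open U /\ U p /\ analytic_on U f /\
    forall x, U x -> G x -> (S x <-> f x = 0).

Definition proper_subset_of (G S : set V) : Prop :=
  forall U : set V, open U -> (exists x, U x /\ G x) -> exists x, U x /\ G x /\ ~ S x.

Definition generically_l_nondegenerate (G : set V) (l : nat) : Prop :=
  exists S, real_analytic_subset G S /\ proper_subset_of G S /\
    forall p, G p -> ~ S p -> l_nondegenerate_at G l p.

End CR.

(* Main.v *)
(* An infinitesimal automorphism [2 Re Z] of the hypersurface [rho = 0] corresponds to the real
   function [h = i sum_j Z_j rho_j], and near a generic point [p] close to [xi] it is determined by
   the tangential derivatives of [h] at [p].  With commuting CR fields [L_a], their conjugates
   [Lb_a] (of weight 1) and a transversal field [T] (of weight 2), the equations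
   [Lb_b (Z_a) = 0] make most words in these fields, applied to [h], combinations of lower words.
   If the Levi form has rank 3, 2 or 1 at [p], only 24, 17 or 20 real parameters survive at [p],
   and when they vanish so do all tangential derivatives of [h].  Then [Z] vanishes near [p],
   and by uniform Gevrey-1 bounds near [xi].
   Every degenerate alternative (Levi form zero, or an identically vanishing second or third
   order tensor of the Levi kernel) yields a tangential field whose coefficients are CR functions.
   These extend holomorphically, contradicting holomorphic nondegeneracy.
   A 2-nondegenerate point excludes ranks 3 and 1, a 3-nondegenerate one excludes rank 3. *)

Require Import Defs.
From HB Require Import structures.
From mathcomp Require Import all_boot all_order all_algebra.
From mathcomp Require Import complex.
From mathcomp Require Import ring lra zify.
Set Implicit Arguments. Unset Strict Implicit. Unset Printing Implicit Defensive.
Import Order.TTheory GRing.Theory Num.Theory.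
Local Open Scope ring_scope.
Local Open Scope complex_scope.

(** * Symmetries in an abstract CR frame *)

Section Filtration.
Variable A : comPzRingType.

(** The algebra is done in a commutative ring with derivations, later the germs at a point of
    analytic functions restricted to the hypersurface. The obstacle is division: Levi minors, second
    order tensors and slopes must be inverted, so the base point is moved until each of these
    finitely many functions is nonzero there or identically zero nearby. Parameters are counted
    weight by weight: a relation matters only modulo lower weight, and two consecutive weights
    without generators end the count because [T] has weight 2. The real dimensions by weight are 1,
    6, 10, 6, 1 in rank three, 1, 4, 7, 4, 1 in rank two and 1, 2, 4, 6, 4, 2, 1 in rank one.
    Holomorphic means only real differentiable with vanishing [dzbar], so analyticity has to be
    derived. Limits and integrals are taken along an ultrafilter: they are then bounded linear
    functionals on all bounded families, and one lemma differentiates under all of them. Bounds must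
    be uniform because the generic point moves: the neighbourhood of [xi] on which a linear relation
    propagates is fixed before that point and the coefficients are known. *)

Definition derivation (D : A -> A) : Prop :=
  (forall x y, D (x + y) = D x + D y) /\ (forall x y, D (x * y) = D x * y + x * D y).

Lemma der0 D : derivation D -> D 0 = 0.
Proof. by move=> [hD _]; apply: (addrI (D 0)); rewrite -hD !addr0. Qed.
Lemma derN D x : derivation D -> D (- x) = - D x.
Proof. by move=> dD; apply: (addrI (D x)); rewrite -(proj1 dD) !subrr (der0 dD). Qed.
Lemma derB D x y : derivation D -> D (x - y) = D x - D y.
Proof. by move=> dD; rewrite (proj1 dD) (derN _ dD). Qed.
Lemma der1 D : derivation D -> D 1 = 0.
Proof. by move=> [_ hM]; apply: (addrI (D 1)); rewrite addr0 -[in RHS](mulr1 1) hM mulr1 mul1r. Qed.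
Lemma der_nat D n : derivation D -> D n%:R = 0.
Proof. by move=> dD; elim: n => [|n IH]; rewrite ?der0 // -natr1 (proj1 dD) IH der1 // addr0. Qed.

Variables (I : Type) (X : I -> A -> A) (T : A -> A) (h : A).
Hypothesis dX : forall i, derivation (X i).
Hypothesis dT : derivation T.

(* [Mo n] is the submodule spanned by the words of weight less than [n] applied to [h], where the
   letters [X i] have weight 1 and [T] has weight 2. *)
Inductive Mo : nat -> A -> Prop :=
| Mo_h : Mo 1 h
| Mo_0 n : Mo n 0
| Mo_lc n a x y : Mo n x -> Mo n y -> Mo n (a * x + y)
| Mo_S n x : Mo n x -> Mo n.+1 x
| Mo_X i n x : Mo n x -> Mo n.+1 (X i x)
| Mo_T n x : Mo n x -> Mo n.+2 (T x).

Lemma MoZ n a x : Mo n x -> Mo n (a * x).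
Proof. by move=> H; rewrite -[_ * _]addr0; apply: Mo_lc => //; exact: Mo_0. Qed.
Lemma MoD n x y : Mo n x -> Mo n y -> Mo n (x + y).
Proof. by move=> H1 H2; rewrite -[x]mul1r; exact: Mo_lc. Qed.
Lemma MoN n x : Mo n x -> Mo n (- x).
Proof. by move=> H; rewrite -mulN1r; exact: MoZ. Qed.
Lemma MoB n x y : Mo n x -> Mo n y -> Mo n (x - y).
Proof. by move=> H1 H2; apply: MoD => //; exact: MoN. Qed.
Lemma Mo_le m n x : (m <= n)%N -> Mo m x -> Mo n x.
Proof. by move=> /subnK <-; elim: (n - m)%N => //= k IH H; apply: Mo_S; exact: IH. Qed.
Lemma Mo_eq n x y : Mo n y -> x = y -> Mo n x.
Proof. by move=> H ->. Qed.
Lemma Mo_tr n x y : Mo n (x - y) -> Mo n y -> Mo n x.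
Proof. by move=> H1 H2; apply: Mo_eq (MoD H1 H2) _; rewrite subrK. Qed.
Lemma Mo_sym n x y : Mo n (x - y) -> Mo n (y - x).
Proof. by move=> H; rewrite -opprB; exact: MoN. Qed.
Lemma Mo_trans n x y z : Mo n (x - y) -> Mo n (y - z) -> Mo n (x - z).
Proof. by move=> H1 H2; apply: Mo_eq (MoD H1 H2) _; rewrite addrA subrK. Qed.
Lemma Mo_cancel n u v x : v * u = 1 -> Mo n (u * x) -> Mo n x.
Proof. by move=> uv H; apply: Mo_eq (MoZ v H) _; rewrite mulrA uv mul1r. Qed.

Lemma Mo_XZ i n a x : Mo n.+1 x -> Mo n.+1 (X i (a * x) - a * X i x).
Proof. by move=> H; apply: Mo_eq (MoZ (X i a) H) _; rewrite (proj2 (dX i)) addrK. Qed.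
Lemma Mo_TZ n a x : Mo n.+2 x -> Mo n.+2 (T (a * x) - a * T x).
Proof. by move=> H; apply: Mo_eq (MoZ (T a) H) _; rewrite (proj2 dT) addrK. Qed.
Lemma Mo_Tc n x y : Mo n (x - y) -> Mo n.+2 (T x - T y).
Proof. by move=> H; rewrite -(derB _ _ dT); exact: Mo_T. Qed.

Lemma Mo0 x : Mo 0 x -> x = 0.
Proof.
move=> H; have [n E] : exists n, n = 0%N by exists 0%N.
rewrite -E in H; elim: H E => // {n x} n a x y _ IHx _ IHy E.
by rewrite IHx // IHy // mulr0 addr0.
Qed.

(** Criterion for an operator of weight zero. It serves fields in the Levi kernel, whose brackets
    with the letters of weight 1 have no [T] component. *)
Lemma Mo_closed K : derivation K -> Mo 1 (K h) ->
  (forall i n x, Mo n x -> Mo n.+1 (K (X i x) - X i (K x))) ->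
  (forall n x, Mo n x -> Mo n.+2 (K (T x) - T (K x))) -> forall n x, Mo n x -> Mo n (K x).
Proof.
move=> dK Kh KX KT n x; elim=> {n x} [|n|n a x y Mx IHx My IHy|n x Mx IH|i n x Mx IH|n x Mx IH] //.
- by rewrite (der0 dK); exact: Mo_0.
- by rewrite (proj1 dK) (proj2 dK); apply: MoD => //; apply: MoD; exact: MoZ.
- exact: Mo_S.
- by apply: Mo_tr (KX i n x Mx) _; exact: Mo_X.
- by apply: Mo_tr (KT n x Mx) _; exact: Mo_T.
Qed.

Inductive Sp (n : nat) (E : seq A) : A -> Prop :=
| Sp_Mo x : Mo n x -> Sp n E x
| Sp_E i : (i < size E)%N -> Sp n E E`_i
| Sp_lc a x y : Sp n E x -> Sp n E y -> Sp n E (a * x + y).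

Lemma Sp0 n E : Sp n E 0. Proof. by apply: Sp_Mo; exact: Mo_0. Qed.
Lemma SpZ n E a x : Sp n E x -> Sp n E (a * x).
Proof. by move=> H; rewrite -[_ * _]addr0; apply: Sp_lc => //; exact: Sp0. Qed.
Lemma SpD n E x y : Sp n E x -> Sp n E y -> Sp n E (x + y).
Proof. by move=> H1 H2; rewrite -[x]mul1r; exact: Sp_lc. Qed.
Lemma SpN n E x : Sp n E x -> Sp n E (- x).
Proof. by move=> H; rewrite -mulN1r; exact: SpZ. Qed.
Lemma SpB n E x y : Sp n E x -> Sp n E y -> Sp n E (x - y).
Proof. by move=> H1 H2; apply: SpD => //; exact: SpN. Qed.
Lemma Sp_tr n E x y : Mo n (x - y) -> Sp n E y -> Sp n E x.
Proof. by move=> H1 H2; rewrite -(subrK y x); apply: SpD => //; exact: Sp_Mo. Qed.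

(** [E] generates the graded piece [Mo n / Mo n.-1], which holds the words of weight exactly
    [n.-1]. *)
Definition Gen (n : nat) (E : seq A) : Prop :=
  (forall i, (i < size E)%N -> Mo n E`_i) /\ (forall x, Mo n x -> Sp n.-1 E x).

Lemma Gen0 : Gen 0 [::]. Proof. by split=> // x; exact: Sp_Mo. Qed.

Lemma Sp_sub n E x : Gen n.+1 E -> Sp n E x -> Mo n.+1 x.
Proof.
by move=> [HE _]; elim=> {x} [x Mx|i iE|a x y _ IHx _ IHy]; [exact: Mo_S|exact: HE|exact: Mo_lc].
Qed.

Lemma Gen1 : Gen 1 [:: h].
Proof.
split=> [[|//] _|x H]; first exact: Mo_h.
have [n E] : exists n, n = 1%N by exists 1%N.
rewrite -E in H; elim: H E => // {n x}.
- by move=> _; exact: (@Sp_E 0 [:: h] 0).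
- by move=> n _; exact: Sp0.
- by move=> n a x y _ IHx _ IHy E; apply: Sp_lc; [exact: IHx|exact: IHy].
- by move=> n x Mx _ [n0]; rewrite n0 in Mx; exact: Sp_Mo.
- by move=> i n x Mx _ [n0]; rewrite n0 in Mx; rewrite (Mo0 Mx) (der0 (dX i)); exact: Sp0.
Qed.

(** A new word starts with a letter of weight 1 applied to the previous piece or with [T] applied to
    the piece before it, so two consecutive pieces determine the next one. Moving a coefficient
    through a letter costs only lower weight. *)
Lemma GenS n E E' E'' : Gen n E -> Gen n.+1 E' -> (forall i, (i < size E'')%N -> Mo n.+2 E''`_i) ->
  (forall i l, (l < size E')%N -> Sp n.+1 E'' (X i E'`_l)) ->
  (forall l, (l < size E)%N -> Sp n.+1 E'' (T E`_l)) -> Gen n.+2 E''.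
Proof.
move=> G G' HE HX HT; split=> // x H.
have [m Em] : exists m, m = n.+2 by exists n.+2.
rewrite -Em in H; elim: H Em => // {m x}.
- by move=> m _; exact: Sp0.
- by move=> m a x y _ IHx _ IHy e; apply: Sp_lc; [exact: IHx|exact: IHy].
- by move=> m x Mx _ [e]; rewrite e in Mx; exact: Sp_Mo.
- move=> i m x Mx _ [e]; rewrite e in Mx; have [_ /(_ _ Mx)] := G'.
  elim=> {m x Mx e} [x Mx|l lE|a x y Sx IHx Sy IHy]; first by apply: Sp_Mo; exact: Mo_X.
    exact: HX.
  rewrite (proj1 (dX i)) (proj2 (dX i)); apply: SpD => //; apply: SpD; last exact: SpZ.
  by apply: Sp_Mo; apply: MoZ; exact: Sp_sub Sx.
- move=> m x Mx _ [e]; rewrite e in Mx; have [_ /(_ _ Mx)] := G.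
  case: n {e Mx} G G' HE HX HT => [|n] G G' HE HX HT.
    elim=> {x} [x Mx|l lE|a x y Sx IHx Sy IHy]; first by rewrite (Mo0 Mx) (der0 dT); exact: Sp0.
      exact: HT.
    rewrite (proj1 dT) (proj2 dT); apply: SpD => //; apply: SpD; last exact: SpZ.
    apply: Sp_Mo; apply: MoZ; elim: Sx => {x IHx} [x Mx|l lE|b x z _ IHx _ IHy'].
    + exact: Mo_S.
    + by apply: Mo_S; case: G => HE0 _; exact: HE0.
    + exact: Mo_lc.
  elim=> {x} [x Mx|l lE|a x y Sx IHx Sy IHy]; first by apply: Sp_Mo; exact: Mo_T.
    exact: HT.
  rewrite (proj1 dT) (proj2 dT); apply: SpD => //; apply: SpD; last exact: SpZ.
  by apply: Sp_Mo; apply: MoZ; apply: Mo_S; exact: Sp_sub Sx.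
Qed.

(** Two consecutive empty pieces are required because [T] skips one weight; after them [GenS] yields
    only empty pieces. *)
Lemma Gen_stop n : Gen n.+1 [::] -> Gen n.+2 [::] -> forall m x, Mo m x -> Mo n x.
Proof.
have red k E x : Gen k.+1 E -> size E = 0%N -> Mo k.+1 x -> Mo k x.
  move=> [_ G] E0 /G; elim=> {x} [//|i|a x y _ IHx _ IHy]; first by rewrite E0.
  exact: Mo_lc.
move=> G1' G2'.
have GG k : Gen (n + k).+1 [::] /\ Gen (n + k).+2 [::].
  elim: k => [|k [g1 g2]]; first by rewrite addn0.
  by rewrite addnS; split=> //; exact: (GenS g1 g2).
move=> m x /(Mo_le (leq_addl n m)); elim: m => [|m IH]; first by rewrite addn0.
by rewrite addnS => Mx; apply: IH; apply: red (proj1 (GG m)) _ Mx.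
Qed.

Variables (F : fieldType) (ev : A -> F).
Hypothesis evD : forall x y, ev (x + y) = ev x + ev y.
Hypothesis evM : forall x y, ev (x * y) = ev x * ev y.

Lemma ev0 : ev 0 = 0. Proof. by apply: (addrI (ev 0)); rewrite -evD !addr0. Qed.
Lemma evN x : ev (- x) = - ev x. Proof. by apply: (addrI (ev x)); rewrite -evD !subrr ev0. Qed.

Definition van n : Prop := forall x, Mo n x -> ev x = 0.

Lemma van0 : van 0. Proof. by move=> x /Mo0 ->; exact: ev0. Qed.
Lemma vanS n E : van n -> Gen n.+1 E -> (forall i, (i < size E)%N -> ev E`_i = 0) -> van n.+1.
Proof.
move=> v [_ G] HE x /G; elim=> {x} [x /v //|i /HE //|a x y _ IHx _ IHy].
by rewrite evD evM IHx IHy mulr0 addr0.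
Qed.
Lemma van_eq n x y : van n -> Mo n (x - y) -> ev x = ev y.
Proof. by move=> v /v; rewrite evD evN => /eqP; rewrite subr_eq0 => /eqP. Qed.

End Filtration.

(** * Levi rank one: words in a single pair of letters *)

Section RankOne.
Variables (A : comPzRingType) (L Lb T : A -> A) (h : A).
Hypotheses (dL : derivation L) (dLb : derivation Lb) (dT : derivation T).
Variables (z zi ta tb : A) (qi : nat -> A).
Hypothesis LLb : forall f, Lb (L f) = L (Lb f) - z * T f.
Hypothesis LT : forall f, L (T f) = T (L f) + ta * T f.
Hypothesis LbT : forall f, Lb (T f) = T (Lb f) + tb * T f.
Hypothesis zE : zi * z = 1.
Hypothesis qE : forall n, qi n * n.+1%:R = 1.

Definition X1 (i : bool) : A -> A := if i then L else Lb.
Lemma dX1 i : derivation (X1 i). Proof. by case: i. Qed.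
Local Notation M := (Mo X1 T h).

Lemma MoL n x : M n x -> M n.+1 (L x). Proof. exact: (@Mo_X A bool X1 T h true n x). Qed.
Lemma MoLb n x : M n x -> M n.+1 (Lb x). Proof. exact: (@Mo_X A bool X1 T h false n x). Qed.
Lemma MoLc n x y : M n (x - y) -> M n.+1 (L x - L y).
Proof. by move=> H; rewrite -(derB _ _ dL); exact: MoL. Qed.
Lemma MoLbc n x y : M n (x - y) -> M n.+1 (Lb x - Lb y).
Proof. by move=> H; rewrite -(derB _ _ dLb); exact: MoLb. Qed.
Lemma MoTc n x y : M n (x - y) -> M n.+2 (T x - T y).
Proof. exact: Mo_Tc. Qed.

(** Normal order: [T], then [L], then [Lb]. Of all commutators only [[L, Lb] = z T] preserves the
    weight, so modulo lower weight every word is a combination of these. *)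
Definition N k a b := iter k T (iter a L (iter b Lb h)).

Lemma NT k a b : N k.+1 a b = T (N k a b). Proof. by []. Qed.
Lemma NL a b : N 0 a.+1 b = L (N 0 a b). Proof. by []. Qed.
Lemma NLb b : N 0 0 b.+1 = Lb (N 0 0 b). Proof. by []. Qed.

Lemma MoN_ k a b : M (2 * k + a + b).+1 (N k a b).
Proof.
elim: k => [|k IH]; last by rewrite mulnS; exact: Mo_T.
rewrite muln0 add0n; elim: a => [|a IH]; last by exact: MoL.
by elim: b => [|b IH]; [exact: Mo_h|exact: MoLb].
Qed.

Lemma MoNw w k a b : (2 * k + a + b < w)%N -> M w (N k a b).
Proof. by move=> H; apply: Mo_le H _; exact: MoN_. Qed.

Lemma LN k a b : M (2 * k + a + b).+1 (L (N k a b) - N k a.+1 b).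
Proof.
elim: k => [|k IH]; first by rewrite subrr; exact: Mo_0.
rewrite mulnS; have -> : L (N k.+1 a b) - N k.+1 a.+1 b = ta * T (N k a b) + (T (L (N k a b)) - T (N k a.+1 b)).
  by rewrite /= LT; ring.
by apply: MoD; [apply: MoZ; apply: Mo_T; exact: MoN_|exact: MoTc].
Qed.

(** Moving [Lb] right across [a] letters [L] gives [a] times [- z T]. The truncated index [a.-1] at
    [a = 0] is harmless, as its coefficient is zero. *)
Lemma LbN k a b : M (2 * k + a + b).+1 (Lb (N k a b) - (N k a b.+1 - a%:R * z * N k.+1 a.-1 b)).
Proof.
elim: k => [|k IH].
  rewrite muln0 add0n; elim: a => [|a IH]; first by rewrite !mul0r subr0 subrr; exact: Mo_0.
  rewrite (NL a b) LLb.
  have h1 := MoLc IH; rewrite (derB _ _ dL) (proj2 dL) in h1.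
  have h2 : M (a.+1 + b).+1 (L (a%:R * z) * N 1 a.-1 b).
    case: a {IH h1} => [|a]; first by rewrite mul0r (der0 dL) mul0r; exact: Mo_0.
    by apply: MoZ; apply: MoNw; rewrite /=; lia.
  have h3 : M (a.+1 + b).+1 (a%:R * z * (L (N 1 a.-1 b) - N 1 a b)).
    case: a {IH h1 h2} => [|a]; first by rewrite !mul0r; exact: Mo_0.
    by apply: MoZ; apply: Mo_le (LN 1 a b); lia.
  apply: Mo_eq (MoB h1 (MoD h2 h3)) _.
  rewrite (NL a b.+1) (NT 0 a b) -natr1 /=; ring.
rewrite mulnS (NT k a b) LbT.
have h1 := MoTc IH; rewrite (derB _ _ dT) (proj2 dT) in h1.
have h2 : M (2 * k + a + b).+3 (T (a%:R * z) * N k.+1 a.-1 b).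
  case: a {IH h1} => [|a]; first by rewrite mul0r (der0 dT) mul0r; exact: Mo_0.
  by apply: MoZ; apply: MoNw => /=; lia.
have h3 : M (2 * k + a + b).+3 (tb * T (N k a b)) by apply: MoZ; apply: Mo_T; exact: MoN_.
apply: Mo_eq (MoB (MoD h1 h3) h2) _.
by rewrite (NT k.+1 a.-1 b) (NT k a b.+1); ring.
Qed.

Lemma relL w c1 c2 c3 k1 a1 b1 k2 a2 b2 k3 a3 b3 :
  M w (c1 * N k1 a1 b1 + c2 * N k2 a2 b2 + c3 * N k3 a3 b3) ->
  (2 * k1 + a1 + b1 <= w)%N -> (2 * k2 + a2 + b2 <= w)%N -> (2 * k3 + a3 + b3 <= w)%N ->
  M w.+1 (c1 * N k1 a1.+1 b1 + c2 * N k2 a2.+1 b2 + c3 * N k3 a3.+1 b3).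
Proof.
move=> H w1 w2 w3; have := MoL H; rewrite !(proj1 dL) !(proj2 dL) => H'.
have t c k a b : (2 * k + a + b <= w)%N -> M w.+1 (L c * N k a b + c * (L (N k a b) - N k a.+1 b)).
  by move=> ww; apply: MoD; apply: MoZ; [exact: MoNw|apply: Mo_le (LN k a b)].
by apply: Mo_eq (MoB H' (MoD (MoD (t c1 _ _ _ w1) (t c2 _ _ _ w2)) (t c3 _ _ _ w3))) _; ring.
Qed.

Lemma relLb w c1 c2 c3 k1 a1 b1 k2 a2 b2 k3 a3 b3 :
  M w (c1 * N k1 a1 b1 + c2 * N k2 a2 b2 + c3 * N k3 a3 b3) ->
  (2 * k1 + a1 + b1 <= w)%N -> (2 * k2 + a2 + b2 <= w)%N -> (2 * k3 + a3 + b3 <= w)%N ->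
  M w.+1 (c1 * (N k1 a1 b1.+1 - a1%:R * z * N k1.+1 a1.-1 b1) + c2 * (N k2 a2 b2.+1 - a2%:R * z * N k2.+1 a2.-1 b2)
    + c3 * (N k3 a3 b3.+1 - a3%:R * z * N k3.+1 a3.-1 b3)).
Proof.
move=> H w1 w2 w3; have := MoLb H; rewrite !(proj1 dLb) !(proj2 dLb) => H'.
have t c k a b : (2 * k + a + b <= w)%N ->
    M w.+1 (Lb c * N k a b + c * (Lb (N k a b) - (N k a b.+1 - a%:R * z * N k.+1 a.-1 b))).
  by move=> ww; apply: MoD; apply: MoZ; [exact: MoNw|apply: Mo_le (LbN k a b)].
by apply: Mo_eq (MoB H' (MoD (MoD (t c1 _ _ _ w1) (t c2 _ _ _ w2)) (t c3 _ _ _ w3))) _; ring.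
Qed.

Variables (K : A -> A) (l s si th dd t : A).
Hypothesis dK : derivation K.
Hypothesis KL : forall f, K (L f) = L (K f) - l * L f.
Hypothesis KLb : forall f, K (Lb f) = Lb (K f) - s * L f.
Hypothesis KT : forall f, K (T f) = T (K f) + th * T f - dd * L f.
Hypothesis Kh : K h = - t * h.
Hypothesis Kz : K z = - (l + th) * z.
Hypothesis sE : si * s = 1.

Lemma K_Mo n x : M n x -> M n (K x).
Proof.
apply: Mo_closed => //; first by rewrite Kh; apply: MoZ; exact: Mo_h.
- case=> {}n {}x Mx /=; [rewrite KL|rewrite KLb]; rewrite addrAC subrr add0r; apply: MoN; apply: MoZ; exact: MoL.
- move=> m y My; have e1 : M m.+2 (th * T y) by apply: MoZ; apply: Mo_T.
  have e2 : M m.+2 (dd * L y) by apply: MoZ; apply: Mo_S; exact: MoL.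
  by apply: Mo_eq (MoB e1 e2) _; rewrite KT; ring.
Qed.

(** Action of [K] at top weight. It turns each of the [b] letters [Lb] into [- s L]; the new [L]
    must then be moved left across the letters [Lb] before it, and [0 + 1 + ... + b.-1] such
    commutators give the binomial. *)
Definition KNf k a b : A := (- t + k%:R * th - a%:R * l) * N k a b
  - s * (b%:R * N k a.+1 b.-1 - z * 'C(b, 2)%:R * N k.+1 a b.-2).

Lemma KN k a b : M (2 * k + a + b) (K (N k a b) - KNf k a b).
Proof.
elim: k a b => [|k IH] a b; last first.
  rewrite (NT k a b) KT mulnS -(NT k a b).
  have h1 := MoTc (IH a b).
  have h2 : M (2 + (2 * k) + a + b) (T (KNf k a b) - ((- t + k%:R * th - a%:R * l) * N k.+1 a b
      - s * (b%:R * N k.+1 a.+1 b.-1 - z * 'C(b, 2)%:R * N k.+2 a b.-2))).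
    rewrite /KNf; move: (- t + _ - _) => c1; rewrite !(derB _ _ dT) !(proj2 dT) !(derB _ _ dT) !(proj2 dT).
    have m1 : M (2 + 2 * k + a + b) (N k a b) by apply: MoNw; lia.
    have m2 : M (2 + 2 * k + a + b) (b%:R * N k a.+1 b.-1).
      by case: b {IH h1 m1} => [|b]; [rewrite mul0r; exact: Mo_0|apply: MoZ; apply: MoNw => /=; lia].
    have m3 : M (2 + 2 * k + a + b) ('C(b, 2)%:R * N k.+1 a b.-2).
      by case: b {IH h1 m1 m2} => [|[|b]]; rewrite ?mul0r; try exact: Mo_0; apply: MoZ; apply: MoNw => /=; lia.
    apply: Mo_eq (MoB (MoD (MoZ (T c1) m1) (MoZ (T s) (MoZ z m3))) (MoD (MoZ (T s) m2) (MoN (MoZ (s * T z) m3)))) _.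
    rewrite -(NT k a b) -(NT k a.+1 b.-1) -(NT k.+1 a b.-2) !(der_nat _ dT); ring.
  have h3 : M (2 + 2 * k + a + b) (dd * L (N k a b)) by apply: MoZ; apply: Mo_le (MoL (MoN_ k a b)); lia.
  apply: Mo_eq (MoB (MoD h1 h2) h3) _.
  by rewrite [KNf k.+1 a b]/KNf -[k.+1%:R]natr1; ring.
rewrite muln0 add0n; elim: a => [|a IH]; last first.
  rewrite (NL a b) KL -(NL a b).
  have h1 := MoLc IH.
  have h2 : M (a.+1 + b) (L (KNf 0 a b) - ((- t + 0%:R * th - a%:R * l) * N 0 a.+1 b
      - s * (b%:R * N 0 a.+2 b.-1 - z * 'C(b, 2)%:R * N 1 a.+1 b.-2))).
    rewrite /KNf; move: (- t + _ - _) => c1; rewrite !(derB _ _ dL) !(proj2 dL) !(derB _ _ dL) !(proj2 dL).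
    have m1 : M (a.+1 + b) (N 0 a b) by apply: MoNw; lia.
    have m2 : M (a.+1 + b) (b%:R * N 0 a.+1 b.-1).
      by case: b {IH h1 m1} => [|b]; [rewrite mul0r; exact: Mo_0|apply: MoZ; apply: MoNw => /=; lia].
    have m3 : M (a.+1 + b) ('C(b, 2)%:R * N 1 a b.-2).
      by case: b {IH h1 m1 m2} => [|[|b]]; rewrite ?mul0r; try exact: Mo_0; apply: MoZ; apply: MoNw => /=; lia.
    have m4 : M (a.+1 + b) ('C(b, 2)%:R * (L (N 1 a b.-2) - N 1 a.+1 b.-2)).
      case: b {IH h1 m1 m2 m3} => [|[|b]]; rewrite ?mul0r; try exact: Mo_0.
      by apply: MoZ; apply: Mo_le (LN 1 a b) => /=; lia.
    apply: Mo_eq (MoB (MoD (MoD (MoZ (L c1) m1) (MoZ (L s) (MoZ z m3))) (MoZ s (MoZ z m4))) (MoD (MoZ (L s) m2) (MoN (MoZ (s * L z) m3)))) _.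
    rewrite -(NL a b) -(NL a.+1 b.-1) !(der_nat _ dL); ring.
  apply: Mo_eq (MoD h1 h2) _.
  by rewrite [KNf 0 a.+1 b]/KNf -[a.+1%:R]natr1; ring.
rewrite add0n; elim: b => [|b IH].
  by apply: Mo_eq (Mo_0 _ _ _ 0) _; rewrite /KNf bin_small // /N /= Kh; ring.
rewrite (NLb b) KLb -(NL 0 b).
have h1 := MoLbc IH.
have h2 : M b.+1 (Lb (KNf 0 0 b) - ((- t + 0%:R * th - 0%:R * l) * N 0 0 b.+1
    - s * (b%:R * (N 0 1 b - z * N 1 0 b.-1) - z * 'C(b, 2)%:R * N 1 0 b.-1))).
  rewrite /KNf; move: (- t + _ - _) => c1; rewrite !(derB _ _ dLb) !(proj2 dLb) !(derB _ _ dLb) !(proj2 dLb).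
  have m1 : M b.+1 (N 0 0 b) by apply: MoNw; lia.
  have m2 : M b.+1 (b%:R * N 0 1 b.-1).
    by case: b {IH h1 m1} => [|b]; [rewrite mul0r; exact: Mo_0|apply: MoZ; apply: MoNw => /=; lia].
  have m3 : M b.+1 ('C(b, 2)%:R * N 1 0 b.-2).
    by case: b {IH h1 m1 m2} => [|[|b]]; rewrite ?mul0r; try exact: Mo_0; apply: MoZ; apply: MoNw => /=; lia.
  have m4 : M b.+1 (b%:R * (Lb (N 0 1 b.-1) - (N 0 1 b - z * N 1 0 b.-1))).
    case: b {IH h1 m1 m2 m3} => [|b]; first by rewrite mul0r; exact: Mo_0.
    by apply: MoZ; have := LbN 0 1 b; rewrite /= mul1r; apply: Mo_le; lia.
  have m5 : M b.+1 ('C(b, 2)%:R * (Lb (N 1 0 b.-2) - N 1 0 b.-1)).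
    case: b {IH h1 m1 m2 m3 m4} => [|[|b]]; rewrite ?mul0r; try exact: Mo_0.
    by apply: MoZ; have := LbN 1 0 b; rewrite /= !mul0r subr0; apply: Mo_le; lia.
  apply: Mo_eq (MoB (MoB (MoD (MoD (MoZ (Lb c1) m1) (MoZ (Lb s) (MoZ z m3))) (MoZ s (MoZ z m5))) (MoZ s m4))
    (MoD (MoZ (Lb s) m2) (MoN (MoZ (s * Lb z) m3)))) _.
  rewrite -(NLb b) !(der_nat _ dLb); ring.
apply: Mo_eq (MoD h1 h2) _.
by rewrite [KNf 0 0 b.+1]/KNf binS bin1 natrD -[b.+1%:R]natr1 /=; ring.
Qed.

Lemma MoK w c1 c2 c3 k1 a1 b1 k2 a2 b2 k3 a3 b3 :
  M w (c1 * N k1 a1 b1 + c2 * N k2 a2 b2 + c3 * N k3 a3 b3) ->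
  (2 * k1 + a1 + b1 <= w)%N -> (2 * k2 + a2 + b2 <= w)%N -> (2 * k3 + a3 + b3 <= w)%N ->
  M w (K c1 * N k1 a1 b1 + K c2 * N k2 a2 b2 + K c3 * N k3 a3 b3 +
    (c1 * KNf k1 a1 b1 + c2 * KNf k2 a2 b2 + c3 * KNf k3 a3 b3)).
Proof.
move=> H w1 w2 w3; have := K_Mo H; rewrite !(proj1 dK) !(proj2 dK) => H'.
have t' c k a b : (2 * k + a + b <= w)%N -> M w (c * (K (N k a b) - KNf k a b)).
  by move=> ww; apply: MoZ; apply: Mo_le (KN k a b).
by apply: Mo_eq (MoB H' (MoD (MoD (t' c1 _ _ _ w1) (t' c2 _ _ _ w2)) (t' c3 _ _ _ w3))) _; ring.
Qed.

Lemma Mo_div n k x : M n (k.+1%:R * x) -> M n x.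
Proof. exact: (Mo_cancel (qE k)). Qed.
Lemma Mo_divz n x : M n (z * x) -> M n x.
Proof. exact: (Mo_cancel zE). Qed.

Hypothesis S0 : M 4 (N 0 0 4).

Lemma bins : ('C(0, 2) = 0%N) * ('C(1, 2) = 0%N) * ('C(2, 2) = 1%N) * ('C(3, 2) = 3%N) * ('C(4, 2) = 6%N).
Proof. by []. Qed.

(** The single relation [S0] on [Lb^4 h] is propagated by [K], which replaces one [Lb] by [L] at a
    time: four applications give a relation for every word of weight 4 without [T]. The factors [s]
    and the integers met on the way are units. *)
Lemma syz1 : M 4 (4%:R * N 0 1 3 + (- 6%:R * z) * N 1 0 2 + 0 * N 0 0 0).
Proof.
have E : M 4 (1 * N 0 0 4 + 0 * N 0 0 0 + 0 * N 0 0 0) by apply: Mo_eq S0 _; ring.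
have h1 := MoK E erefl erefl erefl.
apply: (Mo_cancel sE); apply: Mo_eq (MoB (MoZ (- t) S0) h1) _.
by rewrite /KNf !bins (der1 dK) (der0 dK) /=; ring.
Qed.

Lemma syz2 : M 4 (6%:R * N 0 2 2 + (- 12%:R * z) * N 1 1 1 + (3%:R * z ^+ 2) * N 2 0 0).
Proof.
have h1 := MoK syz1 erefl erefl erefl.
apply: (@Mo_div _ 1); apply: (Mo_cancel sE); apply: Mo_eq (MoB (MoZ (- t - l) syz1) h1) _.
rewrite /KNf !bins (der0 dK) (der_nat _ dK) (proj2 dK) (derN _ dK) (der_nat _ dK) Kz /=; ring.
Qed.

Lemma syz3 : M 4 (4%:R * N 0 3 1 + (- 6%:R * z) * N 1 2 0 + 0 * N 0 0 0).
Proof.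
have h1 := MoK syz2 erefl erefl erefl.
apply: (@Mo_div _ 2); apply: (Mo_cancel sE); apply: Mo_eq (MoB (MoZ (- t - 2%:R * l) syz2) h1) _.
rewrite /KNf !bins !expr2 !(proj2 dK) (derN _ dK) !(der_nat _ dK) Kz /=; ring.
Qed.

Lemma syz4 : M 4 (N 0 4 0).
Proof.
have h1 := MoK syz3 erefl erefl erefl.
apply: (@Mo_div _ 3); apply: (Mo_cancel sE); apply: Mo_eq (MoB (MoZ (- t - 3%:R * l) syz3) h1) _.
rewrite /KNf !bins !(proj2 dK) (derN _ dK) !(der_nat _ dK) (der0 dK) Kz /=; ring.
Qed.

(** Here and below, [L] applied to one relation is compared with [Lb] applied to its neighbour: a
    common word cancels and the commutators leave an integer multiple of [z] times a relation on
    words with one more [T]. The argument of [Mo_div] is that integer minus one. *)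
Lemma T130 : M 5 (N 1 3 0).
Proof.
have E : M 4 (1 * N 0 4 0 + 0 * N 0 0 0 + 0 * N 0 0 0) by apply: Mo_eq syz4 _; ring.
have h1 := relLb E erefl erefl erefl; have h2 := relL syz3 erefl erefl erefl.
apply: (@Mo_div _ 9); apply: Mo_divz; apply: Mo_eq (MoB h2 (MoZ 4%:R h1)) _; rewrite /=; ring.
Qed.

Lemma T121 : M 5 (N 1 2 1 + (- z) * N 2 1 0 + 0 * N 0 0 0).
Proof.
have h1 := relLb syz3 erefl erefl erefl; have h2 := relL syz2 erefl erefl erefl.
apply: (@Mo_div _ 29); apply: Mo_divz; apply: Mo_eq (MoB (MoZ 2%:R h2) (MoZ 3%:R h1)) _; rewrite /=; ring.
Qed.

Lemma T112 : M 5 (N 1 1 2 + (- z) * N 2 0 1 + 0 * N 0 0 0).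
Proof.
have h1 := relL syz1 erefl erefl erefl; have h2 := relLb syz2 erefl erefl erefl.
apply: (@Mo_div _ 29); apply: Mo_divz; apply: Mo_eq (MoB (MoZ 3%:R h1) (MoZ 2%:R h2)) _; rewrite /=; ring.
Qed.

Lemma T103 : M 5 (N 1 0 3).
Proof.
have E : M 4 (1 * N 0 0 4 + 0 * N 0 0 0 + 0 * N 0 0 0) by apply: Mo_eq S0 _; ring.
have h1 := relL E erefl erefl erefl; have h2 := relLb syz1 erefl erefl erefl.
apply: (@Mo_div _ 9); apply: Mo_divz; apply: Mo_eq (MoB (MoZ 4%:R h1) h2) _; rewrite /=; ring.
Qed.

Lemma T220 : M 6 (N 2 2 0).
Proof.
have E : M 5 (1 * N 1 3 0 + 0 * N 0 0 0 + 0 * N 0 0 0) by apply: Mo_eq T130 _; ring.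
have E' : M 5 (1 * N 1 2 1 + (- z) * N 2 1 0 + 0 * N 0 0 0) by apply: Mo_eq T121 _; ring.
have h1 := relLb E erefl erefl erefl; have h2 := relL E' erefl erefl erefl.
apply: (@Mo_div _ 1); apply: Mo_divz; apply: Mo_eq (MoB h2 h1) _; rewrite /=; ring.
Qed.

Lemma T211 : M 6 (2%:R * N 2 1 1 + (- z) * N 3 0 0 + 0 * N 0 0 0).
Proof.
have E : M 5 (1 * N 1 1 2 + (- z) * N 2 0 1 + 0 * N 0 0 0) by apply: Mo_eq T112 _; ring.
have E' : M 5 (1 * N 1 2 1 + (- z) * N 2 1 0 + 0 * N 0 0 0) by apply: Mo_eq T121 _; ring.
have h1 := relL E erefl erefl erefl; have h2 := relLb E' erefl erefl erefl.
apply: Mo_divz; apply: Mo_eq (MoB h1 h2) _; rewrite /=; ring.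
Qed.

Lemma T202 : M 6 (N 2 0 2).
Proof.
have E : M 5 (1 * N 1 0 3 + 0 * N 0 0 0 + 0 * N 0 0 0) by apply: Mo_eq T103 _; ring.
have E' : M 5 (1 * N 1 1 2 + (- z) * N 2 0 1 + 0 * N 0 0 0) by apply: Mo_eq T112 _; ring.
have h1 := relL E erefl erefl erefl; have h2 := relLb E' erefl erefl erefl.
apply: (@Mo_div _ 1); apply: Mo_divz; apply: Mo_eq (MoB h1 h2) _; rewrite /=; ring.
Qed.

Lemma T310 : M 7 (N 3 1 0).
Proof.
have E : M 6 (1 * N 2 2 0 + 0 * N 0 0 0 + 0 * N 0 0 0) by apply: Mo_eq T220 _; ring.
have h1 := relLb E erefl erefl erefl; have h2 := relL T211 erefl erefl erefl.
apply: (@Mo_div _ 2); apply: Mo_divz; apply: Mo_eq (MoB h2 (MoZ 2%:R h1)) _; rewrite /=; ring.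
Qed.

Lemma T301 : M 7 (N 3 0 1).
Proof.
have E : M 6 (1 * N 2 0 2 + 0 * N 0 0 0 + 0 * N 0 0 0) by apply: Mo_eq T202 _; ring.
have h1 := relL E erefl erefl erefl; have h2 := relLb T211 erefl erefl erefl.
apply: (@Mo_div _ 2); apply: Mo_divz; apply: Mo_eq (MoB (MoZ 2%:R h1) h2) _; rewrite /=; ring.
Qed.

Lemma T400 : M 8 (N 4 0 0).
Proof.
have E : M 7 (1 * N 3 1 0 + 0 * N 0 0 0 + 0 * N 0 0 0) by apply: Mo_eq T310 _; ring.
have E' : M 7 (1 * N 3 0 1 + 0 * N 0 0 0 + 0 * N 0 0 0) by apply: Mo_eq T301 _; ring.
have h1 := relLb E erefl erefl erefl; have h2 := relL E' erefl erefl erefl.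
apply: Mo_divz; apply: Mo_eq (MoB h2 h1) _; rewrite /=; ring.
Qed.

Definition E1 := [:: N 0 1 0; N 0 0 1].
Definition E2 := [:: N 0 2 0; N 0 1 1; N 0 0 2; N 1 0 0].
Definition E3 := [:: N 0 3 0; N 0 2 1; N 0 1 2; N 0 0 3; N 1 1 0; N 1 0 1].
Definition E4 := [:: N 1 2 0; N 1 1 1; N 1 0 2; N 2 0 0].
Definition E5 := [:: N 2 1 0; N 2 0 1].
Definition E6 := [:: N 3 0 0].

Lemma SpN_ w E i k a b : (i < size E)%N -> E`_i = N k a b -> Sp X1 T h w E (N k a b).
Proof. by move=> iE <-; exact: Sp_E. Qed.

Lemma SpL w E k a b : (2 * k + a + b < w)%N -> Sp X1 T h w E (N k a.+1 b) -> Sp X1 T h w E (L (N k a b)).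
Proof. by move=> ww; apply: Sp_tr; apply: Mo_le (LN k a b). Qed.
Lemma SpLb w E k a b : (2 * k + a + b < w)%N -> Sp X1 T h w E (N k a b.+1) ->
  Sp X1 T h w E (a%:R * z * N k.+1 a.-1 b) -> Sp X1 T h w E (Lb (N k a b)).
Proof. by move=> ww syz1' syz2'; apply: Sp_tr (Mo_le ww (LbN k a b)) _; exact: SpB. Qed.

Lemma Sp_rel w E c c1 c2 k a b k1 a1 b1 k2 a2 b2 n : c = n.+1%:R ->
  M w (c * N k a b + c1 * N k1 a1 b1 + c2 * N k2 a2 b2) ->
  Sp X1 T h w E (c1 * N k1 a1 b1) -> Sp X1 T h w E (c2 * N k2 a2 b2) -> Sp X1 T h w E (N k a b).
Proof.
move=> -> H s1 s2.
have -> : N k a b = qi n * ((n.+1%:R * N k a b + c1 * N k1 a1 b1 + c2 * N k2 a2 b2) - c1 * N k1 a1 b1 - c2 * N k2 a2 b2).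
  by move: (qE n); move: (n.+1%:R : A) (qi n) => m q e; rewrite -[LHS]mul1r -e; ring.
by apply: SpZ; apply: SpB => //; apply: SpB => //; exact: Sp_Mo.
Qed.

Ltac inE n := apply (@SpN_ _ _ n); reflexivity.

Lemma G2 : Gen X1 T h 2 E1.
Proof.
apply: (GenS dX1 dT (Gen0 _ _ _) (Gen1 T h dX1)) => //; first by move=> [_|[_|i]] //; apply: MoNw.
case=> -[] // _; first exact: (@SpN_ 1 E1 0 0 1 0).
exact: (@SpN_ 1 E1 1 0 0 1).
Qed.

Lemma G3 : Gen X1 T h 3 E2.
Proof.
apply: (GenS dX1 dT (Gen1 T h dX1) G2).
- by move=> [_|[_|[_|[_|i]]]] //; apply: MoNw.
- case=> -[_|[_|i]] //.
  + by apply: SpL => //; inE 0%N.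
  + by apply: SpL => //; inE 1%N.
  + by apply: SpLb => //; [inE 1%N|apply: SpZ; inE 3%N].
  + by apply: SpLb => //; [inE 2%N|rewrite !mul0r; exact: Sp0].
- by move=> [_|i] //; exact: (@SpN_ 2 E2 3 1 0 0).
Qed.

Lemma G4 : Gen X1 T h 4 E3.
Proof.
apply: (GenS dX1 dT G2 G3).
- by move=> [_|[_|[_|[_|[_|[_|i]]]]]] //; apply: MoNw.
- case=> -[_|[_|[_|[_|i]]]] //.
  + by apply: SpL => //; inE 0%N.
  + by apply: SpL => //; inE 1%N.
  + by apply: SpL => //; inE 2%N.
  + by apply: SpL => //; inE 4%N.
  + by apply: SpLb => //; [inE 1%N|apply: SpZ; inE 4%N].
  + by apply: SpLb => //; [inE 2%N|apply: SpZ; inE 5%N].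
  + by apply: SpLb => //; [inE 3%N|rewrite !mul0r; exact: Sp0].
  + by apply: SpLb => //; [inE 5%N|rewrite !mul0r; exact: Sp0].
- by move=> [_|[_|i]] //; [exact: (@SpN_ 3 E3 4 1 1 0)|exact: (@SpN_ 3 E3 5 1 0 1)].
Qed.

Lemma R031 : Sp X1 T h 4 E4 (N 0 3 1).
Proof. by apply: (Sp_rel _ syz3) => //; [apply: SpZ; inE 0%N|rewrite mul0r; exact: Sp0]. Qed.
Lemma R022 : Sp X1 T h 4 E4 (N 0 2 2).
Proof. by apply: (Sp_rel _ syz2) => //; [apply: SpZ; inE 1%N|apply: SpZ; inE 3%N]. Qed.
Lemma R013 : Sp X1 T h 4 E4 (N 0 1 3).
Proof. by apply: (Sp_rel _ syz1) => //; [apply: SpZ; inE 2%N|rewrite mul0r; exact: Sp0]. Qed.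

Lemma G5 : Gen X1 T h 5 E4.
Proof.
apply: (GenS dX1 dT G3 G4).
- by move=> [_|[_|[_|[_|i]]]] //; apply: MoNw.
- case=> -[_|[_|[_|[_|[_|[_|i]]]]]] //.
  + by apply: SpL => //; apply: Sp_Mo; exact: syz4.
  + by apply: SpL => //; exact: R031.
  + by apply: SpL => //; exact: R022.
  + by apply: SpL => //; exact: R013.
  + by apply: SpL => //; inE 0%N.
  + by apply: SpL => //; inE 1%N.
  + by apply: SpLb => //; [exact: R031|apply: SpZ; inE 0%N].
  + by apply: SpLb => //; [exact: R022|apply: SpZ; inE 1%N].
  + by apply: SpLb => //; [exact: R013|apply: SpZ; inE 2%N].
  + by apply: SpLb => //; [apply: Sp_Mo; exact: S0|rewrite !mul0r; exact: Sp0].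
  + by apply: SpLb => //; [inE 1%N|apply: SpZ; inE 3%N].
  + by apply: SpLb => //; [inE 2%N|rewrite !mul0r; exact: Sp0].
- by move=> [_|[_|[_|[_|i]]]] //; [exact: (@SpN_ 4 E4 0 1 2 0)|exact: (@SpN_ 4 E4 1 1 1 1)|exact: (@SpN_ 4 E4 2 1 0 2)|exact: (@SpN_ 4 E4 3 2 0 0)].
Qed.

Lemma R121 : Sp X1 T h 5 E5 (N 1 2 1).
Proof.
apply: (@Sp_rel _ _ 1 (- z) 0 _ _ _ 2 1 0 0 0 0 0) => //; first by rewrite mul1r; exact: T121.
  by apply: SpZ; inE 0%N.
by rewrite mul0r; exact: Sp0.
Qed.
Lemma R112 : Sp X1 T h 5 E5 (N 1 1 2).
Proof.
apply: (@Sp_rel _ _ 1 (- z) 0 _ _ _ 2 0 1 0 0 0 0) => //; first by rewrite mul1r; exact: T112.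
  by apply: SpZ; inE 1%N.
by rewrite mul0r; exact: Sp0.
Qed.

Lemma G6 : Gen X1 T h 6 E5.
Proof.
apply: (GenS dX1 dT G4 G5).
- by move=> [_|[_|i]] //; apply: MoNw.
- case=> -[_|[_|[_|[_|i]]]] //.
  + by apply: SpL => //; apply: Sp_Mo; exact: T130.
  + by apply: SpL => //; exact: R121.
  + by apply: SpL => //; exact: R112.
  + by apply: SpL => //; inE 0%N.
  + by apply: SpLb => //; [exact: R121|apply: SpZ; inE 0%N].
  + by apply: SpLb => //; [exact: R112|apply: SpZ; inE 1%N].
  + by apply: SpLb => //; [apply: Sp_Mo; exact: T103|rewrite !mul0r; exact: Sp0].
  + by apply: SpLb => //; [inE 1%N|rewrite !mul0r; exact: Sp0].
- move=> [_|[_|[_|[_|[_|[_|i]]]]]] //.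
  + by apply: Sp_Mo; exact: T130.
  + exact: R121.
  + exact: R112.
  + by apply: Sp_Mo; exact: T103.
  + exact: (@SpN_ 5 E5 0 2 1 0).
  + exact: (@SpN_ 5 E5 1 2 0 1).
Qed.

Lemma R211 : Sp X1 T h 6 E6 (N 2 1 1).
Proof. by apply: (Sp_rel _ T211) => //; [apply: SpZ; inE 0%N|rewrite mul0r; exact: Sp0]. Qed.

Lemma G7 : Gen X1 T h 7 E6.
Proof.
apply: (GenS dX1 dT G5 G6).
- by move=> [_|i] //; apply: MoNw.
- case=> -[_|[_|i]] //.
  + by apply: SpL => //; apply: Sp_Mo; exact: T220.
  + by apply: SpL => //; exact: R211.
  + by apply: SpLb => //; [exact: R211|apply: SpZ; inE 0%N].
  + by apply: SpLb => //; [apply: Sp_Mo; exact: T202|rewrite !mul0r; exact: Sp0].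
- move=> [_|[_|[_|[_|i]]]] //.
  + by apply: Sp_Mo; exact: T220.
  + exact: R211.
  + by apply: Sp_Mo; exact: T202.
  + exact: (@SpN_ 6 E6 0 3 0 0).
Qed.

Lemma G8 : Gen X1 T h 8 [::].
Proof.
apply: (GenS dX1 dT G6 G7) => //.
- case=> -[_|i] //.
  + by apply: SpL => //; apply: Sp_Mo; exact: T310.
  + by apply: SpLb => //; [apply: Sp_Mo; exact: T301|rewrite !mul0r; exact: Sp0].
- by move=> [_|[_|i]] //; apply: Sp_Mo; [exact: T310|exact: T301].
Qed.

Lemma G9 : Gen X1 T h 9 [::].
Proof.
apply: (GenS dX1 dT G7 G8) => //.
by move=> [_|i] //; apply: Sp_Mo; exact: T400.
Qed.

Variables (R : rcfType) (ev : A -> R[i]) (cj : A -> A).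
Hypothesis evD : forall x y, ev (x + y) = ev x + ev y.
Hypothesis evM : forall x y, ev (x * y) = ev x * ev y.
Hypothesis evC : forall x, ev (cj x) = (ev x)^*.
Hypothesis cjL : forall x, cj (L x) = Lb (cj x).
Hypothesis cjLb : forall x, cj (Lb x) = L (cj x).
Hypothesis cjT : forall x, cj (T x) = T (cj x).
Hypothesis cjh : cj h = h.

Lemma ev_cj0 x y : cj x = y -> ev x = 0 -> ev y = 0.
Proof. by move=> <-; rewrite evC => ->; rewrite conjc0. Qed.
(** A word that is real at the point costs one real parameter instead of two. *)
Lemma ev_real x : ev (cj x) = ev x -> complex.Re (ev x) = 0 -> ev x = 0.
Proof.
rewrite evC; case: (ev x) => a b [hb] /= ->; congr (_ +i* _).
have : b + b = 0 by rewrite -{1}hb addNr.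
by move/eqP; rewrite -mulr2n mulrn_eq0 /= => /eqP.
Qed.

(* The real dimension of the symmetry algebra is at most [1 + 2 + 4 + 6 + 4 + 2 + 1 = 20] in this case. *)
Theorem rank_one_vanishing :
  complex.Re (ev h) = 0 -> ev (N 0 1 0) = 0 ->
  ev (N 0 2 0) = 0 -> complex.Re (ev (N 0 1 1)) = 0 -> complex.Re (ev (N 1 0 0)) = 0 ->
  ev (N 0 3 0) = 0 -> ev (N 0 2 1) = 0 -> ev (N 1 1 0) = 0 ->
  ev (N 1 2 0) = 0 -> complex.Re (ev (N 1 1 1)) = 0 -> complex.Re (ev (N 2 0 0)) = 0 ->
  ev (N 2 1 0) = 0 -> complex.Re (ev (N 3 0 0)) = 0 -> forall m x, M m x -> ev x = 0.
Proof.
move=> e0 e010 e020 e011 e100 e030 e021 e110 e120 e111 e200 e210 e300.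
have cjN k a b : cj (N k a b) = iter k T (iter a Lb (iter b L h)).
  elim: k => [|k IH]; last by rewrite NT cjT IH.
  elim: a => [|a IH]; last by rewrite NL cjL IH.
  by elim: b => [|b IH]; [rewrite /N /= cjh|rewrite NLb cjLb IH].
have realT k : complex.Re (ev (N k 0 0)) = 0 -> ev (N k 0 0) = 0 by apply: ev_real; rewrite cjN.
have v0 : van X1 T h ev 0 by move=> x; exact: van0.
have v1 : van X1 T h ev 1.
  by apply: (vanS evD evM v0 (Gen1 T h dX1)) => -[_|i] //; apply: (realT 0%N).
have v2 : van X1 T h ev 2.
  apply: (vanS evD evM v1 G2) => -[_|[_|i]] //.
  by apply: (ev_cj0 _ e010); rewrite cjN.
have v3 : van X1 T h ev 3.
  have e100' := realT 1%N e100.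
  apply: (vanS evD evM v2 G3) => -[_|[_|[_|[_|i]]]] //.
    (* [L Lb h] differs from its conjugate by [z T h], which already vanishes at the point. *)
    apply: ev_real => //; rewrite cjN; have := van_eq evD v2 (LbN 0 1 0).
    by rewrite /= evD mul1r (evN evD) evM e100' mulr0 oppr0 addr0.
  by apply: (ev_cj0 _ e020); rewrite cjN.
have e101 : ev (N 1 0 1) = 0 by apply: (ev_cj0 _ e110); rewrite cjN.
have v4 : van X1 T h ev 4.
  apply: (vanS evD evM v3 G4) => -[_|[_|[_|[_|[_|[_|i]]]]]] //=.
    have := van_eq evD v3 (LbN 0 2 0); rewrite /= evD (evN evD) !evM e110 mulr0 oppr0 addr0 e021 => h1.
    by apply: (ev_cj0 _ h1); rewrite cjLb !cjL cjh.
  by apply: (ev_cj0 _ e030); rewrite cjN.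
have v5 : van X1 T h ev 5.
  have e200' := realT 2%N e200.
  apply: (vanS evD evM v4 G5) => -[_|[_|[_|[_|i]]]] //=.
    apply: (@ev_real (N 1 1 1)) => //; rewrite cjN.
    have := van_eq evD v4 (MoTc (LbN 0 1 0)).
    rewrite /= mul1r (derB _ _ dT) (proj2 dT) evD (evN evD) evD !evM.
    have -> : ev (T h) = 0 by exact: (realT 1%N e100).
    have -> : ev (T (T h)) = 0 by exact: e200'.
    by rewrite !mulr0 addr0 oppr0 addr0.
  by apply: (ev_cj0 _ e120); rewrite cjN.
have v6 : van X1 T h ev 6.
  apply: (vanS evD evM v5 G6) => -[_|[_|i]] //=.
  by apply: (ev_cj0 _ e210); rewrite cjN.
have v7 : van X1 T h ev 7.
  by apply: (vanS evD evM v6 G7) => -[_|i] //=; exact: (realT 3%N).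
by move=> m x /(Gen_stop dX1 dT G8 G9); exact: v7.
Qed.

End RankOne.

(** * Frames with several letters *)

Section Frame.
Variables (A : comPzRingType) (n : nat) (L Lb : 'I_n -> A -> A) (T : A -> A) (h : A).
Hypotheses (dL : forall a, derivation (L a)) (dLb : forall a, derivation (Lb a)) (dT : derivation T).
Variables (z : 'I_n -> 'I_n -> A) (ta tb : 'I_n -> A) (qi : nat -> A).
Hypothesis LL : forall a b f, L a (L b f) = L b (L a f).
Hypothesis LbLb : forall a b f, Lb a (Lb b f) = Lb b (Lb a f).
Hypothesis LLb : forall a b f, Lb b (L a f) = L a (Lb b f) - z a b * T f.
Hypothesis LT : forall a f, L a (T f) = T (L a f) + ta a * T f.
Hypothesis LbT : forall a f, Lb a (T f) = T (Lb a f) + tb a * T f.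
Hypothesis qE : forall k, qi k * k.+1%:R = 1.

Definition X2 (i : bool * 'I_n) : A -> A := if i.1 then L i.2 else Lb i.2.
Lemma dX2 i : derivation (X2 i). Proof. by case: i => -[] a; [exact: dL|exact: dLb]. Qed.
Local Notation M := (Mo X2 T h).

Lemma MoLf m x a : M m x -> M m.+1 (L a x). Proof. exact: (@Mo_X A _ X2 T h (true, a) m x). Qed.
Lemma MoLbf m x a : M m x -> M m.+1 (Lb a x). Proof. exact: (@Mo_X A _ X2 T h (false, a) m x). Qed.
Lemma MoTf m x : M m x -> M m.+2 (T x). Proof. exact: Mo_T. Qed.

Lemma cgL m x y a : M m (x - y) -> M m.+1 (L a x - L a y).
Proof. by move=> H; rewrite -(derB _ _ (dL a)); exact: MoLf. Qed.
Lemma cgLb m x y a : M m (x - y) -> M m.+1 (Lb a x - Lb a y).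
Proof. by move=> H; rewrite -(derB _ _ (dLb a)); exact: MoLbf. Qed.
Lemma cgT m x y : M m (x - y) -> M m.+2 (T x - T y). Proof. exact: Mo_Tc. Qed.
Lemma cgLT m x a : M m x -> M m.+2 (L a (T x) - T (L a x)).
Proof. by move=> H; apply: Mo_eq (MoZ (ta a) (MoTf H)) _; rewrite LT; ring. Qed.
Lemma cgLbT m x a : M m x -> M m.+2 (Lb a (T x) - T (Lb a x)).
Proof. by move=> H; apply: Mo_eq (MoZ (tb a) (MoTf H)) _; rewrite LbT; ring. Qed.
Lemma cgLZ m c x a : M m.+1 x -> M m.+1 (L a (c * x) - c * L a x).
Proof. exact: (Mo_XZ dX2 (true, a)). Qed.
Lemma cgLbZ m c x a : M m.+1 x -> M m.+1 (Lb a (c * x) - c * Lb a x).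
Proof. exact: (Mo_XZ dX2 (false, a)). Qed.
Lemma cgTZ m c x : M m.+2 x -> M m.+2 (T (c * x) - c * T x). Proof. exact: Mo_TZ. Qed.
Lemma Mo_sum m (J : finType) (F : J -> A) : (forall j, M m (F j)) -> M m (\sum_j F j).
Proof. by move=> H; elim/big_ind: _ => [|x y|i _]; [exact: Mo_0|exact: MoD|exact: H]. Qed.
Lemma Mo_natdiv m k x : M m (k.+1%:R * x) -> M m x.
Proof. exact: (Mo_cancel (qE k)). Qed.

Lemma Sp_in w E x : x \in E -> Sp X2 T h w E x.
Proof. by move=> /(nthP 0)[i iE <-]; exact: Sp_E. Qed.

Lemma GenS_in k E E' E'' : Gen X2 T h k E -> Gen X2 T h k.+1 E' -> (forall e, e \in E'' -> M k.+2 e) ->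
  (forall e a, e \in E' -> Sp X2 T h k.+1 E'' (L a e)) -> (forall e a, e \in E' -> Sp X2 T h k.+1 E'' (Lb a e)) ->
  (forall e, e \in E -> Sp X2 T h k.+1 E'' (T e)) -> Gen X2 T h k.+2 E''.
Proof.
move=> G G' H1 H2 H3 H4; apply: (GenS dX2 dT G G').
- by move=> i iE; apply: H1; exact: mem_nth.
- by move=> [[] a] i iE; [apply: H2|apply: H3]; exact: mem_nth.
- by move=> i iE; apply: H4; exact: mem_nth.
Qed.

Variables (R : rcfType) (ev : A -> R[i]) (cj : A -> A).
Hypothesis evD : forall x y, ev (x + y) = ev x + ev y.
Hypothesis evM : forall x y, ev (x * y) = ev x * ev y.
Hypothesis evC : forall x, ev (cj x) = (ev x)^*.
Hypothesis cjL : forall a x, cj (L a x) = Lb a (cj x).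
Hypothesis cjLb : forall a x, cj (Lb a x) = L a (cj x).
Hypothesis cjT : forall x, cj (T x) = T (cj x).
Hypothesis cjh : cj h = h.

Lemma ev_T0 : complex.Re (ev (T h)) = 0 -> ev (T h) = 0.
Proof. by apply: (ev_real evC); rewrite cjT cjh. Qed.

(** Once [T h] vanishes at the point the commutator drops out and the values of [L a (Lb b h)] form
    a Hermitian matrix: the strict upper triangle and the real diagonal determine it. *)
Lemma ev_levi : ev (T h) = 0 -> (forall a b : 'I_n, (a < b)%N -> ev (L a (Lb b h)) = 0) ->
  (forall a, complex.Re (ev (L a (Lb a h))) = 0) -> forall a b, ev (L a (Lb b h)) = 0.
Proof.
move=> t0 off diag a b.
have E a' b' : ev (cj (L a' (Lb b' h))) = ev (L b' (Lb a' h)).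
  by rewrite cjL cjLb cjh LLb evD (evN evD) evM t0 mulr0 oppr0 addr0.
have [ab|ab|/val_inj ->] := ltngtP a b; first exact: off.
  by rewrite -E evC off // conjc0.
by apply: (ev_real evC) => //; exact: E.
Qed.

(** * Nondegenerate Levi form *)

Section FullRank.
Hypothesis LLh : forall a b, M 2 (L a (L b h)).
Hypothesis LbLbh : forall a b, M 2 (Lb a (Lb b h)).
Variable zi : 'I_n -> 'I_n -> A.
Hypothesis ziE : forall a c, \sum_b z a b * zi b c = (a == c)%:R.
Hypothesis ziE' : forall a c, \sum_b zi a b * z b c = (a == c)%:R.
Hypothesis n0 : (0 < n)%N.

Lemma z_cancel m x : (forall a b, M m (z a b * x)) -> M m x.
Proof.
move=> H; pose a := Ordinal n0.
have : M m (\sum_b zi b a * (z a b * x)) by apply: Mo_sum => b; exact: MoZ.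
by move=> HH; apply: Mo_eq HH _; under eq_bigr do rewrite mulrA (mulrC (zi _ _)); rewrite -mulr_suml ziE eqxx mul1r.
Qed.

(** After [Lb c] is commuted to the front, [L a (L b h)] is lower by [LLh], and only the two
    commutators remain. *)
Lemma fr3 a b c : M 3 (L a (L b (Lb c h)) - (z b c * T (L a h) + z a c * T (L b h))).
Proof.
have e1 : M 3 (Lb c (L a (L b h))) by exact: MoLbf.
have e2 := cgLZ (z b c) a (MoTf (Mo_h X2 T h)).
have e3 := MoZ (z b c) (cgLT a (Mo_h X2 T h)).
have E : L a (L b (Lb c h)) = Lb c (L a (L b h)) + z a c * T (L b h) + L a (z b c * T h).
  have -> : L b (Lb c h) = Lb c (L b h) + z b c * T h by rewrite LLb subrK.
  by rewrite (proj1 (dL a)) (LLb a c) subrK.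
by apply: Mo_eq (MoD e1 (MoD e2 e3)) _; rewrite E; ring.
Qed.

Lemma fr3b a b c : M 3 (Lb c (L a (Lb b h)) + z a c * T (Lb b h)).
Proof. by rewrite LLb subrK; apply: MoLf. Qed.

Lemma fr4 a b c d : let G a b := 2%:R * T (L a (Lb b h)) - z a b * T (T h) in
  M 4 (z b d * G a c + z a d * G b c + z b c * G a d + z a c * G b d).
Proof.
move=> G.
have m3 a' : M 4 (T (L a' h)) by apply: MoTf; apply: MoLf; exact: Mo_h.
have e1 := cgLb d (fr3 a b c); rewrite (proj1 (dLb d)) in e1.
have e2 := cgLbZ (z b c) d (m3 a); have e3 := cgLbZ (z a c) d (m3 b).
have e4 a' : M 4 (Lb d (T (L a' h)) - T (Lb d (L a' h))) by apply: cgLbT; apply: MoLf; exact: Mo_h.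
have e5 a' : M 4 (T (Lb d (L a' h)) - (T (L a' (Lb d h)) - z a' d * T (T h))).
  rewrite LLb (derB _ _ dT) opprB addrA -opprB opprB; have := cgTZ (z a' d) (Mo_S (MoTf (Mo_h X2 T h))).
  by move=> H; apply: Mo_eq (MoN H) _; ring.
have e6 : M 4 (L a (L b (Lb d (Lb c h)))) by do 2 apply: MoLf.
have e7 : M 4 (Lb d (L a (L b (Lb c h))) + (z b d * T (L a (Lb c h)) + z a d * T (L b (Lb c h)))).
  have k1 : M 4 (L a (z b d * T (Lb c h)) - z b d * L a (T (Lb c h))) by apply: cgLZ; apply: MoTf; apply: MoLbf; exact: Mo_h.
  have k2 : M 4 (L a (T (Lb c h)) - T (L a (Lb c h))) by apply: cgLT; apply: MoLbf; exact: Mo_h.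
  apply: Mo_eq (MoB e6 (MoD k1 (MoZ (z b d) k2))) _.
  by rewrite LLb (LLb b d) (derB _ _ (dL a)); ring.
have := MoD e1 (MoD e2 (MoD e3 (MoD (MoZ (z b c) (e4 a)) (MoZ (z a c) (e4 b))))) => F1.
have F2 := MoD F1 (MoD (MoZ (z b c) (e5 a)) (MoZ (z a c) (e5 b))).
apply: Mo_eq (MoZ 2%:R (MoB e7 F2)) _; rewrite /G; ring.
Qed.

(** The symmetrized product of [z] with [G] vanishes by [fr4]. One contraction with the inverse of
    [z] gives [(n+2) G + z tr], where [tr] is the trace of [G]; a second one gives [(2n+2) tr]. Both
    integers are units, so [tr] and then [G] are lower. *)
Lemma fr4' a b : M 4 (2%:R * T (L a (Lb b h)) - z a b * T (T h)).
Proof.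
set G := fun a b => 2%:R * T (L a (Lb b h)) - z a b * T (T h).
have F a1 b1 c d : M 4 (z b1 d * G a1 c + z a1 d * G b1 c + z b1 c * G a1 d + z a1 c * G b1 d) by exact: fr4.
pose tr := \sum_a \sum_d zi d a * G a d.
have H1 b' c : M 4 (n.+2%:R * G b' c + z b' c * tr).
  have : M 4 (\sum_a \sum_d zi d a * (z b' d * G a c + z a d * G b' c + z b' c * G a d + z a c * G b' d)).
    by apply: Mo_sum => a'; apply: Mo_sum => d; apply: MoZ; exact: F.
  move=> HH; apply: Mo_eq HH _.
  have s1 : \sum_a \sum_d zi d a * z b' d * G a c = G b' c.
    transitivity (\sum_a (b' == a)%:R * G a c).
      by apply: eq_bigr => a' _; rewrite -mulr_suml -ziE; congr (_ * _); apply: eq_bigr => d _; rewrite mulrC.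
    by rewrite (bigD1 b') //= eqxx mul1r big1 ?addr0 // => a' /negbTE; rewrite eq_sym => ->; rewrite mul0r.
  have s2 : \sum_a \sum_d zi d a * z a d * G b' c = n%:R * G b' c.
    transitivity (\sum_(a < n) G b' c); last by rewrite sumr_const card_ord mulr_natl.
    apply: eq_bigr => a' _; rewrite -mulr_suml; under eq_bigr do rewrite mulrC.
    by rewrite ziE eqxx mul1r.
  have s3 : \sum_a \sum_d zi d a * z b' c * G a d = z b' c * tr.
    rewrite /tr mulr_sumr; apply: eq_bigr => a' _; rewrite mulr_sumr; apply: eq_bigr => d _; ring.
  have s4 : \sum_a \sum_d zi d a * z a c * G b' d = G b' c.
    rewrite exchange_big /=; transitivity (\sum_d (d == c)%:R * G b' d).
      by apply: eq_bigr => d _; rewrite -mulr_suml ziE'.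
    by rewrite (bigD1 c) //= eqxx mul1r big1 ?addr0 // => d /negbTE ->; rewrite mul0r.
  symmetry; transitivity (\sum_a \sum_d (zi d a * z b' d * G a c + zi d a * z a d * G b' c + zi d a * z b' c * G a d + zi d a * z a c * G b' d)).
    by apply: eq_bigr => a' _; apply: eq_bigr => d _; ring.
  under eq_bigr do rewrite !big_split /=.
  by rewrite !big_split /= s1 s2 s3 s4 -addn2 natrD; ring.
have trM : M 4 tr.
  apply: (@Mo_natdiv _ (n + n).+1).
  have : M 4 (\sum_b' \sum_c zi c b' * (n.+2%:R * G b' c + z b' c * tr)).
    by apply: Mo_sum => b'; apply: Mo_sum => c; apply: MoZ; exact: H1.
  move=> HH; apply: Mo_eq HH _; under eq_bigr do under eq_bigr do rewrite mulrDr.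
  under eq_bigr do rewrite big_split /=.
  rewrite big_split /=.
  have -> : \sum_i \sum_j zi j i * (n.+2%:R * G i j) = n.+2%:R * tr.
    rewrite /tr mulr_sumr; apply: eq_bigr => a' _; rewrite mulr_sumr; apply: eq_bigr => d _; ring.
  have -> : \sum_i \sum_j zi j i * (z i j * tr) = n%:R * tr.
    transitivity (\sum_(a < n) tr); last by rewrite sumr_const card_ord mulr_natl.
    by apply: eq_bigr => a' _; under eq_bigr do rewrite mulrA (mulrC (zi _ _)); rewrite -mulr_suml ziE eqxx mul1r.
  by rewrite -mulrDl -natrD addSn addSn.
by apply: (@Mo_natdiv _ n.+1); apply: Mo_eq (MoB (H1 a b) (MoZ (z a b) trM)) _; rewrite addrK.
Qed.

(** [L c'] applied to [fr4'] relates two words [T T L h] with coefficients 1 and 2. Exchanging their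
    indices and eliminating leaves [3 z a b] times one of them. *)
Lemma fr5 c : M 5 (T (T (L c h))).
Proof.
have mT a' b' : M 5 (T (L a' (Lb b' h))) by apply: MoTf; apply: MoLf; apply: MoLbf; exact: Mo_h.
have mTT : M 5 (T (T h)) by do 2 apply: MoTf; exact: Mo_h.
have F a b c' : M 5 (z a b * T (T (L c' h)) + 2%:R * z c' b * T (T (L a h))).
  have e1' : M 5 (L c' (2%:R * T (L a (Lb b h))) - L c' (z a b * T (T h))).
    by apply: Mo_eq (MoLf c' (fr4' a b)) _; rewrite (derB _ _ (dL c')).
  have e2 := cgLZ 2%:R c' (mT a b); have e3 := cgLZ (z a b) c' mTT.
  have e4 : M 5 (L c' (T (L a (Lb b h))) - T (L c' (L a (Lb b h)))) by apply: cgLT; apply: MoLf; apply: MoLbf; exact: Mo_h.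
  have e5 : M 5 (L c' (T (T h)) - T (L c' (T h))) by apply: cgLT; apply: MoTf; exact: Mo_h.
  have e6 : M 5 (T (L c' (T h)) - T (T (L c' h))) by apply: cgT; apply: cgLT; exact: Mo_h.
  have e7 := cgT (fr3 c' a b); rewrite (proj1 dT) in e7.
  have mL a' : M 4 (T (L a' h)) by apply: MoTf; apply: MoLf; exact: Mo_h.
  have e8 := cgTZ (z a b) (Mo_S (mL c')); have e9 := cgTZ (z c' b) (Mo_S (mL a)).
  have G1 := MoB (MoD e2 (MoZ 2%:R (MoD e4 (MoD e7 (MoD e8 e9))))) (MoD e3 (MoZ (z a b) (MoD e5 e6))).
  by apply: Mo_eq (MoB e1' G1) _; ring.
apply: z_cancel => a b.
apply: (@Mo_natdiv _ 2); apply: Mo_eq (MoB (MoZ 2%:R (F c b a)) (F a b c)) _; ring.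
Qed.

Lemma fr5b c : M 5 (T (T (Lb c h))).
Proof.
have mT a' b' : M 5 (T (L a' (Lb b' h))) by apply: MoTf; apply: MoLf; apply: MoLbf; exact: Mo_h.
have mTT : M 5 (T (T h)) by do 2 apply: MoTf; exact: Mo_h.
have F a b c' : M 5 (z a b * T (T (Lb c' h)) + 2%:R * z a c' * T (T (Lb b h))).
  have e1' : M 5 (Lb c' (2%:R * T (L a (Lb b h))) - Lb c' (z a b * T (T h))).
    by apply: Mo_eq (MoLbf c' (fr4' a b)) _; rewrite (derB _ _ (dLb c')).
  have e2 := cgLbZ 2%:R c' (mT a b); have e3 := cgLbZ (z a b) c' mTT.
  have e4 : M 5 (Lb c' (T (L a (Lb b h))) - T (Lb c' (L a (Lb b h)))) by apply: cgLbT; apply: MoLf; apply: MoLbf; exact: Mo_h.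
  have e5 : M 5 (Lb c' (T (T h)) - T (Lb c' (T h))) by apply: cgLbT; apply: MoTf; exact: Mo_h.
  have e6 : M 5 (T (Lb c' (T h)) - T (T (Lb c' h))) by apply: cgT; apply: cgLbT; exact: Mo_h.
  have e7 := MoTf (fr3b a b c'); rewrite (proj1 dT) in e7.
  have mL : M 4 (T (Lb b h)) by apply: MoTf; apply: MoLbf; exact: Mo_h.
  have e8 := cgTZ (z a c') (Mo_S mL).
  have G1 := MoB (MoD e2 (MoZ 2%:R (MoD e4 (MoB e7 e8)))) (MoD e3 (MoZ (z a b) (MoD e5 e6))).
  by apply: Mo_eq (MoB G1 e1') _; ring.
apply: z_cancel => a b.
apply: (@Mo_natdiv _ 2); apply: Mo_eq (MoB (MoZ 2%:R (F a c b)) (F a b c)) _; ring.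
Qed.

(** [T T] applied to [L a (Lb b h)] and to [Lb b (L a h)] is lower in both cases, and the two differ
    by [T T (z a b * T h)]. *)
Lemma TTT_van : (forall c, M 5 (T (T (L c h)))) -> (forall c, M 5 (T (T (Lb c h)))) -> forall a b, M 6 (z a b * T (T (T h))).
Proof.
move=> H1 H2 a b.
have C m x : M m x -> M m.+4 (Lb b (T (T x)) - T (T (Lb b x))).
  by move=> Mx; apply: Mo_trans (cgLbT b (MoTf Mx)) (cgT (cgLbT b Mx)).
have C' m x : M m x -> M m.+4 (L a (T (T x)) - T (T (L a x))).
  by move=> Mx; apply: Mo_trans (cgLT a (MoTf Mx)) (cgT (cgLT a Mx)).
have e1 := MoLbf b (H1 a); have e2 := MoLf a (H2 b).
have e3 := C _ _ (MoLf a (Mo_h X2 T h)); have e4 := C' _ _ (MoLbf b (Mo_h X2 T h)).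
have e5 := cgT (cgTZ (z a b) (Mo_S (MoTf (Mo_h X2 T h)))).
have e6 : M 6 (T (z a b * T (T h)) - z a b * T (T (T h))) by apply: cgTZ; apply: Mo_S; do 2 apply: MoTf; exact: Mo_h.
apply: Mo_eq (MoB (MoB (MoB e2 e4) (MoB e1 e3)) (MoD e5 e6)) _.
by rewrite LLb !(derB _ _ dT); ring.
Qed.

(** Generators in weights 1 to 4. With [h] the real dimensions are [1, 2n, n^2 + 1, 2n, 1], in all
    [(n+2)^2 - 1]: the dimension of [su(p, q)] with [p + q = n + 2], the symmetry algebra of a
    nondegenerate hyperquadric. *)
Definition Ea1 := [seq L a h | a <- enum 'I_n] ++ [seq Lb a h | a <- enum 'I_n].
Definition Ea2 := T h :: [seq L a (Lb b h) | a <- enum 'I_n, b <- enum 'I_n].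
Definition Ea3 := [seq T (L a h) | a <- enum 'I_n] ++ [seq T (Lb a h) | a <- enum 'I_n].
Definition Ea4 := [:: T (T h)].

Lemma in_map (g : 'I_n -> A) a : g a \in [seq g a | a <- enum 'I_n].
Proof. by apply: map_f; rewrite mem_enum. Qed.
Lemma in_allpairs (g : 'I_n -> 'I_n -> A) a b : g a b \in [seq g a b | a <- enum 'I_n, b <- enum 'I_n].
Proof. by apply: allpairs_f; rewrite mem_enum. Qed.
Lemma in_E1P e : e \in Ea1 -> (exists a, e = L a h) \/ (exists a, e = Lb a h).
Proof. by rewrite mem_cat => /orP[] /mapP[a _ ->]; [left|right]; exists a. Qed.

Lemma Ga2 : Gen X2 T h 2 Ea1.
Proof.
apply: (GenS_in (Gen0 _ _ _) (Gen1 T h dX2)) => //.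
- by move=> e /in_E1P[][a ->]; [apply: MoLf|apply: MoLbf]; exact: Mo_h.
- by move=> e a; rewrite inE => /eqP ->; apply: Sp_in; rewrite mem_cat in_map.
- by move=> e a; rewrite inE => /eqP ->; apply: Sp_in; rewrite mem_cat in_map orbT.
Qed.

Lemma Ga3 : Gen X2 T h 3 Ea2.
Proof.
apply: (GenS_in (Gen1 T h dX2) Ga2).
- move=> e; rewrite inE => /orP[/eqP ->|/allpairsP[[a b] [_ _ ->]]]; first by apply: MoTf; exact: Mo_h.
  by apply: MoLf; apply: MoLbf; exact: Mo_h.
- move=> e a /in_E1P[][b ->]; first by apply: Sp_Mo; exact: LLh.
  by apply: Sp_in; rewrite inE in_allpairs orbT.
- move=> e a /in_E1P[][b ->]; last by apply: Sp_Mo; exact: LbLbh.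
  rewrite LLb; apply: SpB; first by apply: Sp_in; rewrite inE in_allpairs orbT.
  by apply: SpZ; apply: Sp_in; rewrite inE eqxx.
- by move=> e; rewrite inE => /eqP ->; apply: Sp_in; rewrite inE eqxx.
Qed.

Lemma Ga4 : Gen X2 T h 4 Ea3.
Proof.
have s1 a : Sp X2 T h 3 Ea3 (T (L a h)) by apply: Sp_in; rewrite mem_cat in_map.
have s2 a : Sp X2 T h 3 Ea3 (T (Lb a h)) by apply: Sp_in; rewrite mem_cat in_map orbT.
apply: (GenS_in Ga2 Ga3).
- by move=> e; rewrite mem_cat => /orP[] /mapP[a _ ->]; apply: MoTf; [apply: MoLf|apply: MoLbf]; exact: Mo_h.
- move=> e a; rewrite inE => /orP[/eqP ->|/allpairsP[[b c] [_ _ ->]]].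
    by apply: Sp_tr (cgLT a (Mo_h X2 T h)) _.
  by apply: Sp_tr (fr3 a b c) _; apply: SpD; apply: SpZ.
- move=> e a; rewrite inE => /orP[/eqP ->|/allpairsP[[b c] [_ _ ->]]].
    by apply: Sp_tr (cgLbT a (Mo_h X2 T h)) _.
  apply: (@Sp_tr _ _ X2 T h 3 _ _ (- (z b a * T (Lb c h)))); first by rewrite opprK; exact: fr3b.
  by apply: SpN; apply: SpZ.
- by move=> e /in_E1P[][a ->].
Qed.

Lemma SpTLLb a b : Sp X2 T h 4 Ea4 (T (L a (Lb b h))).
Proof.
have -> : T (L a (Lb b h)) = qi 1 * ((2%:R * T (L a (Lb b h)) - z a b * T (T h)) + z a b * T (T h)).
  by rewrite subrK mulrA qE mul1r.
apply: SpZ; apply: SpD; first by apply: Sp_Mo; exact: fr4'.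
by apply: SpZ; apply: Sp_in; rewrite inE eqxx.
Qed.

Lemma Ga5 : Gen X2 T h 5 Ea4.
Proof.
have st : Sp X2 T h 4 Ea4 (T (T h)) by apply: Sp_in; rewrite inE eqxx.
apply: (GenS_in Ga3 Ga4).
- by move=> e; rewrite inE => /eqP ->; do 2 apply: MoTf; exact: Mo_h.
- move=> e a; rewrite mem_cat => /orP[] /mapP[b _ ->].
    by apply: Sp_tr (cgLT a (MoLf b (Mo_h X2 T h))) _; apply: Sp_Mo; apply: MoTf.
  by apply: Sp_tr (cgLT a (MoLbf b (Mo_h X2 T h))) _; exact: SpTLLb.
- move=> e a; rewrite mem_cat => /orP[] /mapP[b _ ->].
    apply: Sp_tr (cgLbT a (MoLf b (Mo_h X2 T h))) _; rewrite LLb (derB _ _ dT); apply: SpB; first exact: SpTLLb.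
    by apply: Sp_tr (cgTZ (z b a) (Mo_S (MoTf (Mo_h X2 T h)))) _; exact: SpZ.
  by apply: Sp_tr (cgLbT a (MoLbf b (Mo_h X2 T h))) _; apply: Sp_Mo; apply: MoTf.
- by move=> e; rewrite inE => /orP[/eqP ->|/allpairsP[[b c] [_ _ ->]]] //; exact: SpTLLb.
Qed.

Lemma cgLTT m x a : M m x -> M m.+4 (L a (T (T x)) - T (T (L a x))).
Proof. by move=> Mx; apply: Mo_trans (cgLT a (MoTf Mx)) (cgT (cgLT a Mx)). Qed.
Lemma cgLbTT m x a : M m x -> M m.+4 (Lb a (T (T x)) - T (T (Lb a x))).
Proof. by move=> Mx; apply: Mo_trans (cgLbT a (MoTf Mx)) (cgT (cgLbT a Mx)). Qed.

Lemma Ga6 : Gen X2 T h 6 [::].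
Proof.
apply: (GenS_in Ga4 Ga5) => //.
- by move=> e a; rewrite inE => /eqP ->; apply: Sp_tr (cgLTT a (Mo_h X2 T h)) _; apply: Sp_Mo; exact: fr5.
- by move=> e a; rewrite inE => /eqP ->; apply: Sp_tr (cgLbTT a (Mo_h X2 T h)) _; apply: Sp_Mo; exact: fr5b.
- by move=> e; rewrite mem_cat => /orP[] /mapP[b _ ->]; apply: Sp_Mo; [exact: fr5|exact: fr5b].
Qed.

Lemma Ga7 : Gen X2 T h 7 [::].
Proof.
apply: (GenS_in Ga5 Ga6) => // e; rewrite inE => /eqP ->.
by apply: Sp_Mo; apply: z_cancel => a b; apply: TTT_van; [exact: fr5|exact: fr5b].
Qed.

(* For [n = 3] the real dimension is at most [1 + 6 + (9 + 1) + 6 + 1 = 24]. *)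
Theorem full_rank_vanishing : complex.Re (ev h) = 0 -> (forall a, ev (L a h) = 0) -> complex.Re (ev (T h)) = 0 ->
  (forall a b : 'I_n, (a < b)%N -> ev (L a (Lb b h)) = 0) -> (forall a, complex.Re (ev (L a (Lb a h))) = 0) ->
  (forall a, ev (T (L a h)) = 0) -> complex.Re (ev (T (T h))) = 0 -> forall m x, M m x -> ev x = 0.
Proof.
move=> e0 e1 et e2 e2' e3 e4.
have vv : forall k E, van X2 T h ev k -> Gen X2 T h k.+1 E -> (forall e, e \in E -> ev e = 0) -> van X2 T h ev k.+1.
  by move=> k E v G H; apply: (vanS evD evM v G) => i iE; apply: H; exact: mem_nth.
have v0 : van X2 T h ev 0 by move=> x; exact: van0.
have v1 : van X2 T h ev 1.
  by apply: (vv _ _ v0 (Gen1 T h dX2)) => e; rewrite inE => /eqP ->; apply: (ev_real evC) => //; rewrite cjh.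
have v2 : van X2 T h ev 2.
  by apply: (vv _ _ v1 Ga2) => e /in_E1P[][a ->] //; apply: (ev_cj0 evC) (e1 a); rewrite cjL cjh.
have et' := ev_T0 et; have el := ev_levi et' e2 e2'.
have v3 : van X2 T h ev 3.
  by apply: (vv _ _ v2 Ga3) => e; rewrite inE => /orP[/eqP ->|/allpairsP[[b c] [_ _ ->]]].
have v4 : van X2 T h ev 4.
  apply: (vv _ _ v3 Ga4) => e; rewrite mem_cat => /orP[] /mapP[b _ ->] //.
  by apply: (ev_cj0 evC) (e3 b); rewrite cjT cjL cjh.
have v5 : van X2 T h ev 5.
  by apply: (vv _ _ v4 Ga5) => e; rewrite inE => /eqP ->; apply: (ev_real evC) => //; rewrite !cjT cjh.
by move=> m x /(Gen_stop dX2 dT Ga6 Ga7); exact: v5.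
Qed.

End FullRank.

(** * Levi form of corank one: relations produced by the kernel field *)

Section RankTwo.
Hypothesis cjD : forall x y, cj (x + y) = cj x + cj y.
Hypothesis cjM : forall x y, cj (x * y) = cj x * cj y.
Hypothesis cjK : forall x, cj (cj x) = x.
Hypothesis cjz : forall a b, cj (z a b) = - z b a.
Variables (y : A) (Sc zi ll : 'I_n -> 'I_n -> A) (K : A -> A) (th kt : A) (dd : 'I_n -> A).
Hypothesis ziE : forall a c, \sum_b z a b * zi b c = (a == c)%:R.
Hypothesis dK : derivation K.
Hypothesis KL : forall l f, K (L l f) = L l (K f) - \sum_a ll l a * L a f.
Hypothesis KLb : forall l f, K (Lb l f) = Lb l (K f) - \sum_a Sc l a * L a f.
Hypothesis KT : forall f, K (T f) = T (K f) + th * T f - \sum_a dd a * L a f.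
Hypothesis Kh : K h = - kt * h.
Hypothesis Lby : forall l, Lb l y = 0.
(** [Sc] comes from the bracket of the kernel field with [Lb]. Lowering its index by the Levi form
    gives the symmetric second order tensor of the Levi kernel. *)
Definition Sm m b := \sum_a Sc m a * z a b.
Hypothesis Ssym : forall a b, Sm a b = Sm b a.
Hypothesis LbLbhy : forall m b, M 2 (Lb m (Lb b h) + Sm m b * y).
Variables (i j : 'I_n) (ui : A).
Hypothesis uiE : ui * Sm i j = 1.
Hypothesis Sij : i = j \/ Sm i i = 0 /\ Sm j j = 0.

Lemma cj_0 : cj 0 = 0. Proof. by apply: (addrI (cj 0)); rewrite -cjD !addr0. Qed.
Lemma cj_sum (J : finType) (F : J -> A) : cj (\sum_j F j) = \sum_j cj (F j).
Proof. by apply: (big_morph _ cjD cj_0). Qed.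
Lemma cj_nat k : cj k%:R = k%:R.
Proof.
have c1 : cj 1 = 1 by rewrite -[LHS]mulr1 -[X in _ * X]cjK -cjM mul1r cjK.
by elim: k => [|k IH]; rewrite ?cj_0 // -natr1 cjD IH c1.
Qed.

Lemma Mo_cj m x : M m x -> M m (cj x).
Proof.
elim=> {m x} [|m|m a x x' _ IHx _ IHx'|m x _ IH|[[] a] m x _ IH|m x _ IH].
- by rewrite cjh; exact: Mo_h.
- by rewrite cj_0; exact: Mo_0.
- by rewrite cjD cjM; exact: Mo_lc.
- exact: Mo_S.
- by rewrite /X2 /= cjL; exact: MoLbf.
- by rewrite /X2 /= cjLb; exact: MoLf.
- by rewrite cjT; exact: MoTf.
Qed.

Lemma der_sum (D : A -> A) (J : finType) (F : J -> A) : derivation D -> D (\sum_j F j) = \sum_j D (F j).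
Proof. by move=> dD; apply: (big_morph _ (proj1 dD) (der0 dD)). Qed.
Lemma sum_add (J : finType) (F G : J -> A) : \sum_j F j + \sum_j G j = \sum_j (F j + G j).
Proof. by rewrite big_split. Qed.
Lemma sum_opp (J : finType) (F : J -> A) : - (\sum_j F j) = \sum_j (- F j).
Proof. by rewrite sumrN. Qed.
Lemma Mo_sumB m (J : finType) (F G : J -> A) : (forall j, M m (F j - G j)) -> M m (\sum_j F j - \sum_j G j).
Proof. by move=> H; rewrite -sumrB; exact: Mo_sum. Qed.

Lemma K_Mo2 m x : M m x -> M m (K x).
Proof.
apply: (Mo_closed dK).
- by rewrite Kh; apply: MoZ; exact: Mo_h.
- move=> [[] a] k x' Mx; rewrite /X2 /= ?KL ?KLb addrAC subrr add0r; apply: MoN; apply: Mo_sum => b; apply: MoZ; exact: MoLf.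
- move=> k x' Mx; have e1 : M k.+2 (th * T x') by apply: MoZ; exact: MoTf.
  have e2 : M k.+2 (\sum_a dd a * L a x') by apply: Mo_sum => b; apply: MoZ; apply: Mo_S; exact: MoLf.
  by apply: Mo_eq (MoB e1 e2) _; rewrite KT; ring.
Qed.

Lemma MhL m a : M m.+2 (L a h). Proof. by apply: Mo_le (MoLf a (Mo_h X2 T h)). Qed.
Lemma MhLb m a : M m.+2 (Lb a h). Proof. by apply: Mo_le (MoLbf a (Mo_h X2 T h)). Qed.
Lemma Mhh m : M m.+1 h. Proof. by apply: Mo_le (Mo_h X2 T h). Qed.
Lemma MhT m : M m.+3 (T h). Proof. by apply: Mo_le (MoTf (Mo_h X2 T h)). Qed.
Lemma MLLbh m a b : M m.+3 (L a (Lb b h)).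
Proof. by apply: Mo_le (MoLf a (MoLbf b (Mo_h X2 T h))). Qed.
Lemma My m : M m.+3 y.
Proof.
apply: (@Mo_le _ _ _ _ _ 3) => //; apply: (Mo_cancel uiE).
have e : M 3 (Lb i (Lb j h)) by apply: MoLbf; exact: MhLb.
by apply: Mo_eq (MoB (Mo_S (LbLbhy i j)) e) _; ring.
Qed.
Lemma MLy m a : M m.+4 (L a y). Proof. by apply: (@Mo_le _ _ _ _ _ 4) => //; apply: MoLf; exact: My. Qed.

(** [K] has weight zero, so applying it to [LbLbhy] stays in [M 2]; the brackets of [K] with the two
    letters [Lb] supply the sums. *)
Lemma star l m : M 2 (Sm m l * K y + (K (Sm m l) + kt * Sm m l) * y + Sm l m * T h
  - (\sum_a Sc l a * L a (Lb m h) + \sum_a Sc m a * L a (Lb l h))).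
Proof.
have e0 := K_Mo2 (LbLbhy m l).
have e1 : M 2 (Lb m (Lb l (- kt * h)) + kt * Lb m (Lb l h)).
  have w1 := MoZ (Lb m (Lb l (- kt))) (Mhh 1); have w2 := MoZ (Lb l (- kt)) (MhLb 0 m).
  have w3 := MoZ (Lb m (- kt)) (MhLb 0 l).
  apply: Mo_eq (MoD w1 (MoD w2 w3)) _.
  by rewrite (proj2 (dLb l)) (proj1 (dLb m)) !(proj2 (dLb m)); ring.
have e2 : M 2 (Lb m (\sum_a Sc l a * L a h) - (\sum_a Sc l a * L a (Lb m h) - Sm l m * T h)).
  have -> : \sum_a Sc l a * L a (Lb m h) - Sm l m * T h = \sum_a Sc l a * Lb m (L a h).
    by rewrite /Sm mulr_suml -sumrB; apply: eq_bigr => a _; rewrite LLb; ring.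
  by rewrite (der_sum _ (dLb m)); apply: Mo_sumB => a; apply: cgLbZ; exact: MhL.
have e3 := MoZ kt (LbLbhy m l).
apply: Mo_eq (MoB (MoD e0 e2) (MoB e1 e3)) _.
rewrite (proj1 dK) (proj2 dK) KLb KLb Kh (derB _ _ (dLb m)).
by ring.
Qed.

Definition Ly l := \sum_a Sc l a * L a y.
Definition Xn l := Ly l + T (Lb l h).

Lemma LbSLLb l m k : M 3 (Lb k (\sum_a Sc l a * L a (Lb m h)) + Sm k m * Ly l + Sm l k * T (Lb m h)).
Proof.
have e a : M 3 (Lb k (Sc l a * L a (Lb m h)) - (- Sm k m * (Sc l a * L a y) - Sc l a * z a k * T (Lb m h))).
  have e1 := cgLbZ (Sc l a) k (MLLbh 0 a m).
  have e2 := MoZ (Sc l a) (MoLf a (LbLbhy k m)).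
  have e3 := MoZ (Sc l a) (cgLZ (Sm k m) a (My 0)).
  apply: Mo_eq (MoB (MoD e1 e2) e3) _.
  by rewrite LLb (proj1 (dL a)); ring.
rewrite (der_sum _ (dLb k)); have := Mo_sumB e.
rewrite sumrB -mulr_sumr -/(Ly l) -mulr_suml -/(Sm l k) => HH; apply: Mo_eq HH _; ring.
Qed.

Lemma LbKy k : Lb k (K y) = Ly k.
Proof. by have := KLb k y; rewrite Lby (der0 dK) => /esym/eqP; rewrite subr_eq0 => /eqP. Qed.

(** [Lb k] applied to [star], with [Lb k y = 0]. The expression is the polarization of the cubic
    form that is the product of the quadratic form [Sm] and the linear form [Xn]. *)
Lemma Xsym l m k : M 3 (Sm k m * Xn l + Sm k l * Xn m + Sm l m * Xn k).
Proof.
have e0 := MoLbf k (star l m).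
have e1 := cgLbZ (Sm m l) k (K_Mo2 (My 0)).
have e2 := MoZ (Lb k (K (Sm m l) + kt * Sm m l)) (My 0).
have e3 := cgLbZ (Sm l m) k (MhT 0).
have e4 := MoZ (Sm l m) (cgLbT k (Mo_h X2 T h)).
have G := MoB (MoD e0 (MoD (LbSLLb l m k) (LbSLLb m l k))) (MoD e1 (MoD e2 (MoD e3 e4))).
apply: Mo_eq G _; move: (LbKy k).
rewrite (derB _ _ (dLb k)) !(proj1 (dLb k)) (proj2 (dLb k) (_ + _) y) Lby => ->.
by rewrite !(proj1 (dLb k)) /Xn (Ssym k m) (Ssym k l) (Ssym l m); ring.
Qed.

(** A quadratic form with an invertible coefficient can be cancelled from its product with a linear
    form. [Sij] covers an invertible diagonal entry and, when both diagonal entries vanish, an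
    invertible mixed one. *)
Lemma XnM k : M 3 (Xn k).
Proof.
case: Sij => [ij|[Si Sj]].
  have uiE' := uiE; rewrite -ij in uiE'.
  have Xi : M 3 (Xn i).
    apply: (Mo_cancel uiE'); apply: (@Mo_natdiv _ 2); apply: Mo_eq (Xsym i i i) _; ring.
  apply: (Mo_cancel uiE'); apply: Mo_eq (MoB (Xsym i i k) (MoZ (2%:R * Sm k i) Xi)) _; ring.
have Xi : M 3 (Xn i).
  apply: (Mo_cancel uiE); apply: (@Mo_natdiv _ 1); apply: Mo_eq (Xsym i i j) _.
  by rewrite Si (Ssym j i); ring.
have Xj : M 3 (Xn j).
  apply: (Mo_cancel uiE); apply: (@Mo_natdiv _ 1); apply: Mo_eq (Xsym j j i) _.
  by rewrite Sj; ring.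
apply: (Mo_cancel uiE); apply: Mo_eq (MoB (Xsym i j k) (MoD (MoZ (Sm k j) Xi) (MoZ (Sm k i) Xj))) _; ring.
Qed.

Lemma LbLy k a : Lb k (L a y) = - z a k * T y.
Proof. by rewrite LLb Lby (der0 (dL a)); ring. Qed.

(** In [Lb i (Xn j)] the part [Ly j] contributes [- Sm j i * T y] and the part [T (Lb j h)]
    contributes [- Sm i j * T y]; the signs agree, so nothing cancels. *)
Lemma TyM : M 4 (T y).
Proof.
have e0 := MoLbf i (XnM j).
have e1 : M 4 (Lb i (Ly j) + Sm j i * T y).
  have -> : Sm j i * T y = - \sum_a Sc j a * Lb i (L a y).
    by rewrite /Sm mulr_suml -sumrN; apply: eq_bigr => a _; rewrite LbLy; ring.
  rewrite /Ly (der_sum _ (dLb i)); apply: Mo_sumB => a; apply: cgLbZ; exact: MLy.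
have e2 := cgLbT i (MhLb 0 j).
have e3 := MoTf (LbLbhy i j); rewrite (proj1 dT) in e3.
have e4 := cgTZ (Sm i j) (Mo_S (My 0)).
apply: (Mo_cancel uiE); apply: (@Mo_natdiv _ 1).
apply: Mo_eq (MoB (MoB (MoD e1 e3) (MoB e0 e2)) e4) _.
by rewrite /Xn (proj1 (dLb i)) (Ssym j i); ring.
Qed.

Local Notation D m a := (L m (L a y)).
Local Notation E m k := (T (L m (Lb k h))).
Local Notation tt := (T (T h)).

Lemma Mtt : M 5 tt. Proof. by apply: MoTf; exact: MhT. Qed.

Lemma rel1 m k : M 4 (\sum_a Sc k a * D m a + E m k).
Proof.
have e0 := MoLf m (XnM k).
have e1 : M 4 (L m (Ly k) - \sum_a Sc k a * D m a).
  by rewrite /Ly (der_sum _ (dL m)); apply: Mo_sumB => a; apply: cgLZ; exact: MLy.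
have e2 := cgLT m (MhLb 0 k).
by apply: Mo_eq (MoB (MoB e0 e1) e2) _; rewrite (proj1 (dL m)); ring.
Qed.

Lemma rel2 l m : M 4 (\sum_a Sc l a * E a m + \sum_a Sc m a * E a l - Sm l m * tt).
Proof.
have e0 := MoTf (star l m).
have e1 l' m' : M 4 (T (\sum_a Sc l' a * L a (Lb m' h)) - \sum_a Sc l' a * E a m').
  by rewrite (der_sum _ dT); apply: Mo_sumB => a; apply: cgTZ; exact: MLLbh.
have KyM : M 4 (K y) by apply: K_Mo2; exact: My.
have e2 : M 4 (T (Sm m l * K y)).
  apply: Mo_tr (cgTZ _ KyM) _; apply: MoZ.
  have k1 := K_Mo2 TyM.
  have k2 : M 4 (\sum_a dd a * L a y) by apply: Mo_sum => a; apply: MoZ; exact: MLy.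
  by apply: Mo_eq (MoD (MoB k1 (MoZ th TyM)) k2) _; rewrite KT; ring.
have e3 : M 4 (T ((K (Sm m l) + kt * Sm m l) * y)).
  by apply: Mo_tr (cgTZ _ (My 1)) _; apply: MoZ; exact: TyM.
have e4 := cgTZ (Sm l m) (MhT 1).
apply: Mo_eq (MoB (MoD (MoD e2 e3) e4) (MoD e0 (MoD (e1 l m) (e1 m l)))) _.
by rewrite (derB _ _ dT) !(proj1 dT); ring.
Qed.

(** By [rel1] the matrix [Sc E] equals minus [Sc D Sc^T], which is symmetric because the [L]
    commute. So the two sums in [rel2] coincide. *)
Lemma rel3 l m : M 4 (\sum_a Sc l a * (2%:R * E a m - z a m * tt)).
Proof.
have s1 l' m' : M 4 (\sum_a Sc l' a * E a m' + \sum_a \sum_b Sc l' a * Sc m' b * D a b).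
  rewrite -big_split /=; apply: Mo_sum => a.
  apply: Mo_eq (MoZ (Sc l' a) (rel1 a m')) _; rewrite mulrDr addrC mulr_sumr; congr (_ + _).
  by apply: eq_bigr => b _; rewrite mulrA.
have s2 : \sum_a \sum_b Sc m a * Sc l b * D a b = \sum_a \sum_b Sc l a * Sc m b * D a b.
  by rewrite exchange_big; apply: eq_bigr => a _; apply: eq_bigr => b _; rewrite LL; ring.
have s3 := s1 m l; rewrite s2 in s3.
apply: Mo_eq (MoD (rel2 l m) (MoB (s1 l m) s3)) _.
have -> : \sum_a Sc l a * (2%:R * E a m - z a m * tt) = 2%:R * (\sum_a Sc l a * E a m) - Sm l m * tt.
  by rewrite mulr_sumr /Sm mulr_suml -sumrB; apply: eq_bigr => a _; ring.
by ring.
Qed.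

Lemma cj_tt : cj tt = tt. Proof. by rewrite !cjT cjh. Qed.
Lemma cj_LLy m a : cj (D m a) = Lb m (Lb a (cj y)). Proof. by rewrite !cjL. Qed.
Lemma Lcjy a : L a (cj y) = 0. Proof. by rewrite -cjLb Lby cj_0. Qed.
Lemma LLhy m b : M 2 (L m (L b h) + cj (Sm m b) * cj y).
Proof. by have := Mo_cj (LbLbhy m b); rewrite cjD cjM !cjLb cjh. Qed.
Lemma TcjyM : M 4 (T (cj y)). Proof. by have := Mo_cj TyM; rewrite cjT. Qed.
Lemma Mcjy m : M m.+3 (cj y). Proof. by apply: Mo_cj; exact: My. Qed.

(** Compares [L k (L a (Lb l (Lb m h)))], a second derivative of [y], with
    [Lb l (Lb m (L k (L a h)))], a second derivative of the conjugate of [y]. The commutators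
    between the two orders are the [G] terms. *)
Lemma rel4 k a l m : let G a m := 2%:R * E a m - z a m * tt in
  M 4 (2%:R * cj (Sm k a) * cj (D l m) - 2%:R * Sm l m * D k a
    - (z a l * G k m + z k l * G a m + z a m * G k l + z k m * G a l)).
Proof.
move=> G.
have f1 : M 4 (L k (L a (Lb l (Lb m h))) + Sm l m * D k a).
  have g1 := MoLf k (MoLf a (LbLbhy l m)).
  have g2 := cgL k (cgLZ (Sm l m) a (My 0)); have g3 := cgLZ (Sm l m) k (MLy 0 a).
  by apply: Mo_eq (MoB (MoB g1 g2) g3) _; rewrite (proj1 (dL a)) (proj1 (dL k)); ring.
have f2 : M 4 (Lb l (Lb m (L k (L a h))) + cj (Sm k a) * cj (D l m)).
  have g1 := MoLbf l (MoLbf m (LLhy k a)).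
  have g2 := cgLb l (cgLbZ (cj (Sm k a)) m (Mcjy 0)).
  have g3 := cgLbZ (cj (Sm k a)) l (MoLbf m (Mcjy 0)).
  by apply: Mo_eq (MoB (MoB g1 g2) g3) _; rewrite cj_LLy (proj1 (dLb m)) (proj1 (dLb l)); ring.
have TLb c d : M 4 (L c (T (Lb d h)) - E c d) by apply: cgLT; exact: MhLb.
have LbT' c d : M 4 (Lb d (T (L c h)) - (E c d - z c d * tt)).
  have g1 := cgLbT d (MhL 0 c); rewrite LLb (derB _ _ dT) in g1.
  by apply: Mo_eq (MoB g1 (cgTZ (z c d) (MhT 1))) _; ring.
have LbLT c d : M 4 (Lb d (L c (T h)) - (E c d - z c d * tt)).
  by apply: Mo_trans (LbT' c d); apply: cgLb; apply: cgLT; exact: Mo_h.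
have f3 : M 4 (Lb l (L k (L a (Lb m h))) - (L k (L a (Lb l (Lb m h))) - z a l * E k m - z k l * E a m)).
  have g1 : M 4 (L k (z a l * T (Lb m h)) - z a l * L k (T (Lb m h))).
    by apply: cgLZ; apply: MoTf; exact: MhLb.
  have g2 := MoZ (z a l) (TLb k m).
  have g3 : M 4 (T (L a (Lb m h)) - E a m) by rewrite subrr; exact: Mo_0.
  apply: Mo_eq (MoN (MoD g1 g2)) _.
  by rewrite (LLb k l) (LLb a l) (derB _ _ (dL k)); ring.
have f4 c : M 4 (Lb l (L k (z c m * T h)) - z c m * (E k l - z k l * tt)).
  have g1 := cgLb l (cgLZ (z c m) k (MhT 0)).
  have g2 : M 4 (Lb l (z c m * L k (T h)) - z c m * Lb l (L k (T h))).
    by apply: cgLbZ; apply: MoLf; exact: MhT.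
  by apply: Mo_trans g1 (Mo_trans g2 _); rewrite -mulrBr; apply: MoZ; exact: LbLT.
have f5 : M 4 (Lb l (z k m * T (L a h)) - z k m * (E a l - z a l * tt)).
  have g2 : M 4 (Lb l (z k m * T (L a h)) - z k m * Lb l (T (L a h))).
    by apply: cgLbZ; apply: MoTf; exact: MhL.
  by apply: Mo_trans g2 _; rewrite -mulrBr; apply: MoZ; exact: LbT'.
apply: Mo_eq (MoZ 2%:R (MoB f2 (MoD f1 (MoB f3 (MoD (f4 a) f5))))) _.
rewrite (LLb k m) (derB _ _ (dLb l)) (LLb a m) (derB _ _ (dL k)) (derB _ _ (dLb l)) /G.
by ring.
Qed.

Lemma TLyM a : M 5 (T (L a y)).
Proof. by apply: Mo_tr (Mo_sym (cgLT a (My 0))) _; apply: MoLf; exact: TyM. Qed.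
Lemma TLbcjyM a : M 5 (T (Lb a (cj y))).
Proof. by have := Mo_cj (TLyM a); rewrite cjT cjL. Qed.
Lemma TTLbM k : M 5 (T (T (Lb k h))).
Proof.
have e0 := MoTf (XnM k).
have e1 : M 5 (T (Ly k)).
  rewrite /Ly (der_sum _ dT); apply: Mo_sum => a; apply: Mo_tr (cgTZ (Sc k a) (MLy 1 a)) _.
  by apply: MoZ; exact: TLyM.
by apply: Mo_eq (MoB e0 e1) _; rewrite (proj1 dT); ring.
Qed.
Lemma TTLM k : M 5 (T (T (L k h))).
Proof. by have := Mo_cj (TTLbM k); rewrite !cjT cjLb cjh. Qed.

(** For [n = 2] the real dimensions are 1 for [h], 4 in weight one, [1 + 2 + 4] here, 4 in weight
    three and a single one in weight four: 17 in all. *)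
Definition Eb2 := [:: T h; y; cj y] ++ [seq L a (Lb b h) | a <- enum 'I_n, b <- enum 'I_n].
Definition Eb3 := [seq L a y | a <- enum 'I_n] ++ [seq Lb a (cj y) | a <- enum 'I_n].

Lemma in_E2P e : e \in Eb2 -> [\/ e = T h, e = y, e = cj y | exists a b, e = L a (Lb b h)].
Proof.
rewrite mem_cat => /orP[|/allpairsP[[a b] [_ _ ->]]]; last by apply: Or44; exists a, b.
by rewrite !inE => /orP[/eqP ->|/orP[/eqP ->|/eqP ->]]; [exact: Or41|exact: Or42|exact: Or43].
Qed.
Lemma in_E3P e : e \in Eb3 -> (exists a, e = L a y) \/ (exists a, e = Lb a (cj y)).
Proof. by rewrite mem_cat => /orP[] /mapP[a _ ->]; [left|right]; exists a. Qed.

Lemma Gb3 : Gen X2 T h 3 Eb2.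
Proof.
have sT : Sp X2 T h 2 Eb2 (T h) by apply: Sp_in; rewrite mem_cat !inE eqxx.
have sE a b : Sp X2 T h 2 Eb2 (L a (Lb b h)) by apply: Sp_in; rewrite mem_cat in_allpairs orbT.
apply: (GenS_in (Gen1 T h dX2) Ga2).
- by move=> e /in_E2P[->|->|->|[a [b ->]]]; [exact: MhT|exact: My|exact: Mcjy|exact: MLLbh].
- move=> e a /in_E1P[][b ->] //; apply: (@Sp_tr _ _ X2 T h 2 _ _ (- (cj (Sm a b) * cj y))).
    by rewrite opprK; exact: LLhy.
  by apply: SpN; apply: SpZ; apply: Sp_in; rewrite mem_cat !inE eqxx !orbT.
- move=> e a /in_E1P[][b ->]; first by rewrite LLb; apply: SpB => //; exact: SpZ.
  apply: (@Sp_tr _ _ X2 T h 2 _ _ (- (Sm a b * y))); first by rewrite opprK; exact: LbLbhy.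
  by apply: SpN; apply: SpZ; apply: Sp_in; rewrite mem_cat !inE eqxx !orbT.
- by move=> e; rewrite inE => /eqP ->.
Qed.

Lemma Sp_sum w F0 (J : finType) (F : J -> A) : (forall j, Sp X2 T h w F0 (F j)) -> Sp X2 T h w F0 (\sum_j F j).
Proof. by move=> H; elim/big_ind: _ => [|x x'|k _]; [exact: Sp0|exact: SpD|exact: H]. Qed.

Lemma Gb4 : Gen X2 T h 4 Eb3.
Proof.
have s1 a : Sp X2 T h 3 Eb3 (L a y) by apply: Sp_in; rewrite mem_cat in_map.
have s2 a : Sp X2 T h 3 Eb3 (Lb a (cj y)) by apply: Sp_in; rewrite mem_cat in_map orbT.
have s3 k : Sp X2 T h 3 Eb3 (T (Lb k h)).
  apply: (@Sp_tr _ _ X2 T h 3 _ _ (- Ly k)); first by apply: Mo_eq (XnM k) _; rewrite /Xn; ring.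
  by apply: SpN; apply: Sp_sum => a; exact: SpZ.
have s4 k : Sp X2 T h 3 Eb3 (T (L k h)).
  apply: (@Sp_tr _ _ X2 T h 3 _ _ (- cj (Ly k))).
    by have := Mo_cj (XnM k); rewrite /Xn cjD cjT cjLb cjh => HH; apply: Mo_eq HH _; ring.
  by apply: SpN; rewrite cj_sum; apply: Sp_sum => a; rewrite cjM cjL; exact: SpZ.
apply: (GenS_in Ga2 Gb3).
- by move=> e /in_E3P[][a ->]; [exact: MLy|apply: MoLbf; exact: Mcjy].
- move=> e a /in_E2P[->|->|->|[b [c ->]]] //; first by apply: Sp_tr (cgLT a (Mo_h X2 T h)) _.
    by rewrite Lcjy; exact: Sp0.
  have e1 := MoLbf c (LLhy a b).
  have e2 := cgLbZ (cj (Sm a b)) c (Mcjy 0).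
  have e3 := cgLZ (z b c) a (MhT 0); have e4 := MoZ (z b c) (cgLT a (Mo_h X2 T h)).
  apply: (@Sp_tr _ _ X2 T h 3 _ _ (- (cj (Sm a b) * Lb c (cj y)) + z a c * T (L b h) + z b c * T (L a h))).
    apply: Mo_eq (MoD (MoB e1 e2) (MoD e3 e4)) _.
    rewrite (proj1 (dLb c)) (LLb a c) (LLb b c) (derB _ _ (dL a)); ring.
  by apply: SpD; [apply: SpD; [apply: SpN|]|]; apply: SpZ.
- move=> e a /in_E2P[->|->|->|[b [c ->]]] //; first by apply: Sp_tr (cgLbT a (Mo_h X2 T h)) _.
    by rewrite Lby; exact: Sp0.
  have e1 := MoLf b (LbLbhy a c); have e2 := cgLZ (Sm a c) b (My 0).
  apply: (@Sp_tr _ _ X2 T h 3 _ _ (- (Sm a c * L b y) - z b a * T (Lb c h))).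
    by apply: Mo_eq (MoB e1 e2) _; rewrite (proj1 (dL b)) LLb; ring.
  by apply: SpB; [apply: SpN|]; apply: SpZ.
- by move=> e /in_E1P[][a ->].
Qed.

(** The list [E4] stays abstract because the surviving word of weight four depends on the tensor
    [Sc]: it is [T (T h)] or a second derivative of [y]. *)
Lemma rank_two_core (E4 : seq A) : (forall e, e \in E4 -> M 5 e) ->
  (forall a b, Sp X2 T h 4 E4 (D a b)) -> (forall a b, Sp X2 T h 4 E4 (cj (D a b))) ->
  (forall a b, Sp X2 T h 4 E4 (E a b)) -> Sp X2 T h 4 E4 tt ->
  (forall e a, e \in E4 -> M 5 (L a e)) -> (forall e a, e \in E4 -> M 5 (Lb a e)) ->
  (forall e, e \in E4 -> M 6 (T e)) ->
  (van X2 T h ev 4 -> forall e, e \in E4 -> ev e = 0) ->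
  complex.Re (ev h) = 0 -> (forall a, ev (L a h) = 0) -> complex.Re (ev (T h)) = 0 ->
  (forall a b : 'I_n, (a < b)%N -> ev (L a (Lb b h)) = 0) -> (forall a, complex.Re (ev (L a (Lb a h))) = 0) ->
  ev y = 0 -> (forall a, ev (L a y) = 0) -> forall m x, M m x -> ev x = 0.
Proof.
move=> E4M sD sD' sE st E4L E4Lb E4T v4' e0 e1 et e2 e2' ey e3.
have G5 : Gen X2 T h 5 E4.
  apply: (GenS_in Gb3 Gb4) => //.
  - move=> e a /in_E3P[][b ->] //.
    rewrite -[L _ _](subrK (z a b * T (cj y))) -LLb Lcjy (der0 (dLb b)) add0r.
    by apply: Sp_Mo; apply: MoZ; exact: TcjyM.
  - move=> e a /in_E3P[][b ->]; last by rewrite -cj_LLy.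
    by rewrite LbLy; apply: Sp_Mo; apply: MoZ; exact: TyM.
  - by move=> e /in_E2P[->|->|->|[a [b ->]]] //; apply: Sp_Mo; [exact: TyM|exact: TcjyM].
have G6 : Gen X2 T h 6 [::].
  apply: (GenS_in Gb4 G5) => // [e a He|e a He|e].
  - by apply: Sp_Mo; exact: E4L.
  - by apply: Sp_Mo; exact: E4Lb.
  - by move=> /in_E3P[][a ->]; apply: Sp_Mo; [exact: TLyM|exact: TLbcjyM].
have G7 : Gen X2 T h 7 [::].
  by apply: (GenS_in G5 G6) => // e He; apply: Sp_Mo; exact: E4T.
have vv : forall k E, van X2 T h ev k -> Gen X2 T h k.+1 E -> (forall e, e \in E -> ev e = 0) -> van X2 T h ev k.+1.
  by move=> k E v G H; apply: (vanS evD evM v G) => k' kE; apply: H; exact: mem_nth.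
have v0 : van X2 T h ev 0 by move=> x; exact: van0.
have v1 : van X2 T h ev 1.
  by apply: (vv _ _ v0 (Gen1 T h dX2)) => e; rewrite inE => /eqP ->; apply: (ev_real evC) => //; rewrite cjh.
have v2 : van X2 T h ev 2.
  by apply: (vv _ _ v1 Ga2) => e /in_E1P[][a ->] //; apply: (ev_cj0 evC) (e1 a); rewrite cjL cjh.
have et' := ev_T0 et; have el := ev_levi et' e2 e2'.
have v3 : van X2 T h ev 3.
  apply: (vv _ _ v2 Gb3) => e /in_E2P[->|->|->|[a [b ->]]] //.
  exact: (ev_cj0 evC) ey.
have v4 : van X2 T h ev 4.
  apply: (vv _ _ v3 Gb4) => e /in_E3P[][a ->] //.
  by apply: (ev_cj0 evC) (e3 a); rewrite cjL.
have v5 := vv _ _ v4 G5 (v4' v4).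
by move=> m x /(Gen_stop dX2 dT G6 G7); exact: v5.
Qed.

Lemma Sp_cj w E x : {in E, forall e, cj e \in E} -> Sp X2 T h w E x -> Sp X2 T h w E (cj x).
Proof.
move=> HE; elim=> {x} [x Mx|k kE|a x x' _ IHx _ IHx'].
- by apply: Sp_Mo; exact: Mo_cj.
- by apply: Sp_in; apply: HE; exact: mem_nth.
- by rewrite cjD cjM; exact: Sp_lc.
Qed.

Lemma rank_two_tt : (forall a b, Sp X2 T h 4 [:: tt] (D a b)) ->
  (forall a b, Sp X2 T h 4 [:: tt] (E a b)) ->
  complex.Re (ev tt) = 0 ->
  complex.Re (ev h) = 0 -> (forall a, ev (L a h) = 0) -> complex.Re (ev (T h)) = 0 ->
  (forall a b : 'I_n, (a < b)%N -> ev (L a (Lb b h)) = 0) -> (forall a, complex.Re (ev (L a (Lb a h))) = 0) ->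
  ev y = 0 -> (forall a, ev (L a y) = 0) -> forall m x, M m x -> ev x = 0.
Proof.
move=> sD sE e4; apply: (@rank_two_core [:: tt]) => //.
- by move=> e; rewrite inE => /eqP ->; exact: Mtt.
- move=> a b; apply: Sp_cj => // e; rewrite !inE => /eqP ->; by rewrite cj_tt.
- by apply: Sp_in; rewrite inE.
- by move=> e a; rewrite inE => /eqP ->; apply: Mo_tr (cgLTT a (Mo_h X2 T h)) _; exact: TTLM.
- by move=> e a; rewrite inE => /eqP ->; apply: Mo_tr (cgLbTT a (Mo_h X2 T h)) _; exact: TTLbM.
- move=> e; rewrite inE => /eqP ->; apply: (z_cancel ziE (leq_ltn_trans (leq0n i) (ltn_ord i))) => a b.
  by apply: TTT_van; [exact: TTLM|exact: TTLbM].
- by move=> _ e; rewrite inE => /eqP ->; apply: (ev_real evC) => //; rewrite cj_tt.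
Qed.

(** With [Sc] invertible, [rel3] gives [2 E = z tt] modulo lower weight, and [rel1] then expresses
    [D] through [E]. *)
Theorem rank_two_regular (Sci : 'I_n -> 'I_n -> A) :
  (forall a c, \sum_b Sci a b * Sc b c = (a == c)%:R) ->
  complex.Re (ev tt) = 0 ->
  complex.Re (ev h) = 0 -> (forall a, ev (L a h) = 0) -> complex.Re (ev (T h)) = 0 ->
  (forall a b : 'I_n, (a < b)%N -> ev (L a (Lb b h)) = 0) -> (forall a, complex.Re (ev (L a (Lb a h))) = 0) ->
  ev y = 0 -> (forall a, ev (L a y) = 0) -> forall m x, M m x -> ev x = 0.
Proof.
move=> SciE.
have inv (F : 'I_n -> A) a : \sum_l Sci a l * \sum_b Sc l b * F b = F a.
  transitivity (\sum_b (a == b)%:R * F b).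
    under eq_bigr do rewrite mulr_sumr; rewrite exchange_big /=; apply: eq_bigr => b _.
    by rewrite -SciE mulr_suml; apply: eq_bigr => l _; rewrite mulrA.
  by rewrite (bigD1 a) //= eqxx mul1r big1 ?addr0 // => b /negbTE; rewrite eq_sym => ->; rewrite mul0r.
have st : Sp X2 T h 4 [:: tt] tt by apply: Sp_in; rewrite inE.
have sE a b : Sp X2 T h 4 [:: tt] (E a b).
  have g : M 4 (2%:R * E a b - z a b * tt).
    rewrite -(inv (fun a => 2%:R * E a b - z a b * tt) a); apply: Mo_sum => l; apply: MoZ; exact: rel3.
  have -> : E a b = qi 1 * (2%:R * E a b - z a b * tt) + qi 1 * z a b * tt.
    by rewrite mulrBr mulrA qE; ring.
  by apply: SpD; [apply: SpZ; exact: Sp_Mo|exact: SpZ].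
apply: rank_two_tt => // m a; rewrite -(inv (fun a => D m a) a).
apply: Sp_sum => k; apply: SpZ; apply: (@Sp_tr _ _ X2 T h 4 _ _ (- E m k)); last exact: SpN.
by rewrite opprK; exact: rel1.
Qed.

(** * Second order tensor of rank one *)

Section Singular.
Variables (s si : A) (xi eta : 'I_n -> A) (o : 'I_n).
Hypothesis sE : si * s = 1.
Hypothesis xio : xi o = 1.
Hypothesis ScE : forall l a, Sc l a = s * xi l * eta a.
Hypothesis xiE : forall m, xi m = \sum_a eta a * z a m.
Local Notation q := (\sum_a cj (xi a) * eta a).
Local Notation sb := (cj s).
Local Notation d a := (\sum_k eta k * D k a).
Local Notation del := (\sum_a eta a * d a).

Lemma SmE l m : Sm l m = s * xi l * xi m.
Proof. by rewrite /Sm (xiE m) mulr_sumr; apply: eq_bigr => a _; rewrite ScE; ring. Qed.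

Lemma sbE : cj si * sb = 1. Proof. by rewrite -cjM sE (cj_nat 1). Qed.

Lemma eta_G m : M 4 (\sum_a eta a * (2%:R * E a m - z a m * tt)).
Proof.
apply: (Mo_cancel sE); apply: Mo_eq (rel3 o m) _; rewrite mulr_sumr; apply: eq_bigr => a _.
by rewrite ScE xio; ring.
Qed.

Lemma rel1' m k : M 4 (s * xi k * d m + E m k).
Proof.
apply: Mo_eq (rel1 m k) _; congr (_ + _); rewrite mulr_sumr; apply: eq_bigr => a _.
by rewrite ScE LL; ring.
Qed.

Lemma rel5 : M 4 (2%:R * s * del + tt).
Proof.
have e : M 4 (\sum_a eta a * (2%:R * (s * xi o * d a + E a o))).
  by apply: Mo_sum => a; apply: MoZ; apply: MoZ; exact: rel1'.
apply: Mo_eq (MoB e (eta_G o)) _; rewrite -sumrB.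
transitivity (2%:R * s * del + (\sum_a eta a * z a o) * tt); first by rewrite -xiE xio mul1r.
rewrite mulr_sumr mulr_suml -big_split /=; apply: eq_bigr => a _; rewrite xio; move: (d a) => da; ring.
Qed.

(** [rel4] contracted with [eta], the remaining [G] terms being removed by [eta_G]. Since [xi] is
    [eta] lowered by [z], the factor [q] is minus the value of [z] on [eta] and its conjugate: it
    vanishes exactly when [eta] is null for the Levi form. *)
Lemma rel6 a l m : M 4 (2%:R * sb * q * cj (xi a) * cj (D l m) - 2%:R * s * xi l * xi m * d a
  - (xi l * (2%:R * E a m - z a m * tt) + xi m * (2%:R * E a l - z a l * tt))).
Proof.
set G := fun a m => 2%:R * E a m - z a m * tt.
have e : M 4 (\sum_k eta k * (2%:R * cj (s * xi k * xi a) * cj (D l m) - 2%:R * (s * xi l * xi m) * D k a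
    - (z a l * G k m + z k l * G a m + z a m * G k l + z k m * G a l))).
  by apply: Mo_sum => k; apply: MoZ; rewrite -!SmE; exact: rel4.
have e1 := MoZ (z a l) (eta_G m); have e2 := MoZ (z a m) (eta_G l).
apply: Mo_eq (MoD e (MoD e1 e2)) _; rewrite -/(G a m) -/(G a l).
rewrite (xiE l) (xiE m) -(xiE l) -(xiE m).
transitivity ((2%:R * sb * cj (xi a) * cj (D l m)) * q - (2%:R * s * xi l * xi m) * d a
  - ((\sum_k eta k * z k l) * G a m + (\sum_k eta k * z k m) * G a l)).
  by rewrite -!xiE; ring.
rewrite !(mulr_sumr, mulr_suml) !sum_add !sum_opp !sum_add; apply: eq_bigr => k _ /=.
by rewrite !cjM /G; ring.
Qed.

Lemma rel7 l m : M 4 (sb * q ^+ 2 * cj (D l m) - s * xi l * xi m * del).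
Proof.
set G := fun a m => 2%:R * E a m - z a m * tt.
have e : M 4 (\sum_a eta a * (2%:R * sb * q * cj (xi a) * cj (D l m) - 2%:R * s * xi l * xi m * d a
  - (xi l * G a m + xi m * G a l))).
  by apply: Mo_sum => a; apply: MoZ; exact: rel6.
have e1 := MoZ (xi l) (eta_G m); have e2 := MoZ (xi m) (eta_G l).
apply: (@Mo_natdiv _ 1); apply: Mo_eq (MoD e (MoD e1 e2)) _.
have -> : q ^+ 2 = q * q by [].
have aux q1 cD (Da : 'I_n -> A) (G1 G2 : 'I_n -> A) : 2%:R * (sb * (q1 * q) * cD - s * xi l * xi m * (\sum_a eta a * Da a))
    = \sum_a eta a * (2%:R * sb * q1 * cj (xi a) * cD - 2%:R * s * xi l * xi m * Da a - (xi l * G1 a + xi m * G2 a))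
      + (xi l * (\sum_a eta a * G1 a) + xi m * (\sum_a eta a * G2 a)).
  transitivity ((2%:R * sb * q1 * cD) * q - (2%:R * s * xi l * xi m) * (\sum_a eta a * Da a)); first by ring.
  rewrite !(mulr_sumr, mulr_suml) !sum_add !sum_opp !sum_add; apply: eq_bigr => a _ /=; ring.
exact: aux.
Qed.

(** For non-null [eta], [rel5] gives [del] in terms of [tt], [rel7] gives the conjugates of all
    [D l m] in terms of [del], and [rel1'] gives [E]. *)
Theorem rank_two_singular (v : A) : v * q = 1 ->
  complex.Re (ev tt) = 0 ->
  complex.Re (ev h) = 0 -> (forall a, ev (L a h) = 0) -> complex.Re (ev (T h)) = 0 ->
  (forall a b : 'I_n, (a < b)%N -> ev (L a (Lb b h)) = 0) -> (forall a, complex.Re (ev (L a (Lb a h))) = 0) ->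
  ev y = 0 -> (forall a, ev (L a y) = 0) -> forall m x, M m x -> ev x = 0.
Proof.
move=> vq.
have st : Sp X2 T h 4 [:: tt] tt by apply: Sp_in; rewrite inE.
have sdel : Sp X2 T h 4 [:: tt] del.
  have e : del = qi 1 * si * (2%:R * s * del + tt) - qi 1 * si * tt.
    transitivity ((qi 1 * 2%:R) * (si * s) * del); [by rewrite qE sE !mul1r|ring].
  by rewrite e; apply: SpB; apply: SpZ => //; apply: Sp_Mo; exact: rel5.
have sD' a b : Sp X2 T h 4 [:: tt] (cj (D a b)).
  have e : cj (D a b) = cj si * v ^+ 2 * (sb * q ^+ 2 * cj (D a b) - s * xi a * xi b * del)
      + cj si * v ^+ 2 * s * xi a * xi b * del.
    transitivity ((cj si * sb) * (v * q) ^+ 2 * cj (D a b)); first by rewrite sbE vq expr1n !mul1r.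
    by move: q del (cj (D a b)) => q0 d0 c0; ring.
  by rewrite e; apply: SpD; apply: SpZ => //; apply: Sp_Mo; exact: rel7.
have sD a b : Sp X2 T h 4 [:: tt] (D a b).
  rewrite -(cjK (D a b)); apply: Sp_cj => // e; rewrite !inE => /eqP ->; by rewrite cj_tt.
apply: rank_two_tt => // m k; apply: (@Sp_tr _ _ X2 T h 4 _ _ (- (s * xi k * d m))).
  by apply: Mo_eq (rel1' m k) _; rewrite opprK addrC.
by apply: SpN; apply: SpZ; apply: Sp_sum => a; apply: SpZ.
Qed.

(** For null [eta] the relations push [tt] and all [E] into lower weight, and [D o o] survives in
    their place. The relation [roo] makes [s * D o o] real modulo lower weight, so there is still
    only one real parameter in weight four. *)
Theorem rank_two_null : q = 0 ->
  complex.Re (ev (s * D o o)) = 0 ->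
  complex.Re (ev h) = 0 -> (forall a, ev (L a h) = 0) -> complex.Re (ev (T h)) = 0 ->
  (forall a b : 'I_n, (a < b)%N -> ev (L a (Lb b h)) = 0) -> (forall a, complex.Re (ev (L a (Lb a h))) = 0) ->
  ev y = 0 -> (forall a, ev (L a y) = 0) -> forall m x, M m x -> ev x = 0.
Proof.
move=> q0 e4.
have r6 a : M 4 (s * d a + z a o * tt).
  have := rel6 a o o; rewrite q0 xio => e.
  have e' := MoZ 2%:R (rel1' a o); rewrite xio in e'.
  apply: (@Mo_natdiv _ 1); apply: Mo_eq (MoD e (MoZ 2%:R e')) _.
  by move: (d a) => da; ring.
have ttM : M 4 tt.
  have e : M 4 (\sum_a eta a * (s * d a + z a o * tt)) by apply: Mo_sum => a; apply: MoZ; exact: r6.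
  apply: Mo_eq (MoB (MoZ 2%:R e) rel5) _.
  have -> : \sum_a eta a * (s * d a + z a o * tt) = s * del + (\sum_a eta a * z a o) * tt.
    by rewrite mulr_sumr mulr_suml -big_split /=; apply: eq_bigr => a _; move: (d a) => da; ring.
  by rewrite -xiE xio; move: del => d0; ring.
have dM a : M 4 (d a).
  apply: (Mo_cancel sE); apply: Mo_eq (MoB (r6 a) (MoZ (z a o) ttM)) _; by move: (d a) => da; ring.
have EM a b : M 4 (E a b).
  by apply: Mo_eq (MoB (rel1' a b) (MoZ (s * xi b) (dM a))) _; move: (d a) => da; ring.
have GM a b : M 4 (2%:R * E a b - z a b * tt) by apply: MoB; exact: MoZ.
have r4 k a l m : M 4 (cj (Sm k a) * cj (D l m) - Sm l m * D k a).
  apply: (@Mo_natdiv _ 1); apply: Mo_eq (MoD (rel4 k a l m) (MoD (MoD (MoD (MoZ (z a l) (GM k m))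
    (MoZ (z k l) (GM a m))) (MoZ (z a m) (GM k l))) (MoZ (z k m) (GM a l)))) _; ring.
have cxio : cj (xi o) = 1 by rewrite xio (cj_nat 1).
have roo : M 4 (sb * cj (D o o) - s * D o o).
  by apply: Mo_eq (r4 o o o o) _; rewrite !SmE !cjM cxio xio; ring.
have s0 : Sp X2 T h 4 [:: D o o] (D o o) by apply: Sp_in; rewrite inE.
have s0' : Sp X2 T h 4 [:: D o o] (cj (D o o)).
  have -> : cj (D o o) = cj si * (sb * cj (D o o) - s * D o o) + cj si * s * D o o.
    by rewrite mulrBr !mulrA sbE; ring.
  by apply: SpD; apply: SpZ => //; exact: Sp_Mo.
have sD a b : Sp X2 T h 4 [:: D o o] (D a b).
  have -> : D a b = - si * (cj (Sm a b) * cj (D o o) - Sm o o * D a b) + si * cj (Sm a b) * cj (D o o).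
    rewrite (SmE o o) xio; transitivity ((si * s) * D a b); [by rewrite sE mul1r|ring].
  by apply: SpD; apply: SpZ => //; exact: Sp_Mo.
have sD' a b : Sp X2 T h 4 [:: D o o] (cj (D a b)).
  have -> : cj (D a b) = cj si * (cj (Sm o o) * cj (D a b) - Sm a b * D o o) + cj si * Sm a b * D o o.
    rewrite (SmE o o) !cjM cxio; transitivity ((cj si * sb) * cj (D a b)); [by rewrite sbE mul1r|ring].
  by apply: SpD; apply: SpZ => //; exact: Sp_Mo.
have LTy a : M 5 (L a (T y)) by apply: MoLf; exact: TyM.
have LbDM a : M 5 (Lb a (D o o)).
  rewrite LLb LbLy; apply: MoB; last by apply: MoZ; exact: TLyM.
  by apply: MoLf; apply: MoZ; exact: TyM.
have LDM a : M 5 (L a (D o o)).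
  have e1 : M 5 (L a (cj (D o o))) by rewrite -cjLb; exact: Mo_cj.
  have e2 := MoLf a roo; rewrite (derB _ _ (dL a)) in e2.
  have mD : M 5 (D o o) by apply: MoLf; exact: MLy.
  have e3 := cgLZ s a mD; have e4' := cgLZ sb a (Mo_cj mD).
  apply: (Mo_cancel sE); apply: Mo_eq (MoB (MoD (MoZ sb e1) e4') (MoD e2 e3)) _; ring.
apply: (@rank_two_core [:: D o o]) => //.
- by move=> e; rewrite inE => /eqP ->; apply: MoLf; exact: MLy.
- by move=> a b; apply: Sp_Mo.
- exact: Sp_Mo.
- by move=> e a; rewrite inE => /eqP ->.
- by move=> e a; rewrite inE => /eqP ->.
- move=> e; rewrite inE => /eqP ->.
  apply: Mo_tr (Mo_sym (cgLT o (MLy 0 o))) _; apply: MoLf; exact: TLyM.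
- move=> v4 e; rewrite inE => /eqP ->.
  have e5 : ev (s * D o o) = 0.
    apply: (ev_real evC) => //; rewrite cjM; exact: (van_eq evD v4 roo).
  have := e5; rewrite evM => /eqP; rewrite mulf_eq0 => /orP[/eqP s0E|/eqP //].
  have := congr1 ev sE; rewrite evM s0E mulr0 => e1.
  by have := evM 1 (D o o); rewrite mul1r -e1 mul0r.
Qed.

End Singular.
End RankTwo.
End Frame.

(** * The frame of a hypersurface and dimension bounds at a point *)

Section Glue.
Variables (A : comPzRingType) (R : rcfType).
Variables (X0 : A -> A) (XX Lb : 'I_3 -> A -> A) (cj : A -> A) (io r0 w0 f0 : A) (r : 'I_3 -> A).
Variables (qi : nat -> A) (cst : R -> A) (ev : A -> R[i]) (j0 : 'I_4) (jj : 'I_3 -> 'I_4).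
Hypotheses (dX0 : derivation X0) (dXX : forall a, derivation (XX a)) (dLb : forall a, derivation (Lb a)).
Hypothesis LbX0 : forall b f, Lb b (X0 f) = X0 (Lb b f).
Hypothesis LbXX : forall a b f, Lb b (XX a f) = XX a (Lb b f).
Hypothesis LbLb : forall a b f, Lb a (Lb b f) = Lb b (Lb a f).
Hypothesis io2 : io * io = -1.
Hypothesis Lbio : forall b, Lb b io = 0.
Hypothesis r0w0 : r0 * w0 = 1.
Hypothesis cjD : forall x y, cj (x + y) = cj x + cj y.
Hypothesis cjM : forall x y, cj (x * y) = cj x * cj y.
Hypothesis cjK : forall x, cj (cj x) = x.
Hypothesis X0cst : forall c, X0 (cst c) = 0.
Hypothesis XXcst : forall a c, XX a (cst c) = 0.
Hypothesis Lbcst : forall a c, Lb a (cst c) = 0.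

(** [X0] and [XX] stand for the fields [d/dz_j] made tangential by a correction in one conjugate
    direction, which makes them commute with [Lb]. Subtracting [r a * X0] removes that correction
    and leaves a field of type (1,0); the factor [w0] in [T3] makes the transversal field real. *)
Definition L3 a f := XX a f - r a * X0 f.
Definition T3 f := - io * w0 * X0 f.
Local Notation L := L3.
Local Notation T := T3.
Hypothesis cjLb : forall a x, cj (Lb a x) = L a (cj x).
Hypothesis cjT : forall x, cj (T x) = T (cj x).
Hypothesis X0f0 : X0 f0 = 1.
Hypothesis Lbf0 : forall b, Lb b f0 = 0.
Hypothesis qE : forall k, qi k * k.+1%:R = 1.
Hypothesis evD : forall x y, ev (x + y) = ev x + ev y.
Hypothesis evM : forall x y, ev (x * y) = ev x * ev y.
Hypothesis evC : forall x, ev (cj x) = (ev x)^*.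
Hypothesis ev1 : ev 1 = 1.
Hypothesis unitA : forall x, ev x != 0 -> exists y, y * x = 1.

Lemma dL3 a : derivation (L a).
Proof.
split=> x y; rewrite /L3 ?(proj1 (dXX a)) ?(proj2 (dXX a)) ?(proj1 dX0) ?(proj2 dX0); ring.
Qed.
Lemma dT3 : derivation T.
Proof. by split=> x y; rewrite /T3 ?(proj1 dX0) ?(proj2 dX0); ring. Qed.

Lemma X0E f : X0 f = io * r0 * T f.
Proof.
rewrite /T3; transitivity (- (io * io) * (r0 * w0) * X0 f); first by rewrite io2 r0w0; ring.
by ring.
Qed.

(** The Levi matrix, normalized by [[L a, Lb b] = z a b T]. With a real [T] it is skew-Hermitian
    rather than Hermitian. *)
Definition z3 a b := io * r0 * Lb b (r a).
Definition tb3 b := r0 * Lb b w0.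
Definition ta3 b := cj (tb3 b).
Local Notation z := z3.
Local Notation tb := tb3.
Local Notation ta := ta3.

Lemma Lb_r b c : Lb b (r c) = - io * w0 * z c b.
Proof.
rewrite /z3; transitivity (- (io * io) * (r0 * w0) * Lb b (r c)); last by ring.
by rewrite io2 r0w0; ring.
Qed.
Lemma LLb3 a b f : Lb b (L a f) = L a (Lb b f) - z a b * T f.
Proof.
rewrite /L3 (derB _ _ (dLb b)) (proj2 (dLb b)) LbX0 LbXX /z3.
have -> : io * r0 * Lb b (r a) * T f = Lb b (r a) * (io * r0 * T f) by ring.
by rewrite -X0E; ring.
Qed.
Lemma LbT3 b f : Lb b (T f) = T (Lb b f) + tb b * T f.
Proof.
rewrite {1}/T3 !(proj2 (dLb b)) (derN _ (dLb b)) Lbio LbX0 X0E /T3 /tb3.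
transitivity (- io * w0 * X0 (Lb b f) + (- (io * io)) * (r0 * Lb b w0 * (- io * w0 * X0 f))).
  by ring.
by rewrite io2; ring.
Qed.
Lemma cjL3 a x : cj (L a x) = Lb a (cj x).
Proof. by rewrite -{1}(cjK x) -cjLb cjK. Qed.
Lemma LL3 a b f : L a (L b f) = L b (L a f).
Proof. by rewrite -(cjK f) -!cjLb LbLb. Qed.
Lemma LT3 a f : L a (T f) = T (L a f) + ta a * T f.
Proof. by have := congr1 cj (LbT3 a (cj f)); rewrite cjD cjM cjLb !cjT cjLb !cjK. Qed.

Lemma Tf0 : io * r0 * T f0 = 1. Proof. by rewrite -X0E. Qed.
Lemma T_inj x y : x * T f0 = y * T f0 -> x = y.
Proof.
move=> e; rewrite -[x]mulr1 -[y]mulr1 -Tf0; transitivity (io * r0 * (x * T f0)); first by ring.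
by rewrite e; ring.
Qed.

Lemma cj_0' : cj 0 = 0. Proof. by apply: (addrI (cj 0)); rewrite -cjD !addr0. Qed.
Lemma cj_N' x : cj (- x) = - cj x.
Proof. by apply: (addrI (cj x)); rewrite -cjD !subrr cj_0'. Qed.
Lemma cj_sum' (J : finType) (F : J -> A) : cj (\sum_j F j) = \sum_j cj (F j).
Proof. by apply: (big_morph _ cjD cj_0'). Qed.

(** Conjugating the bracket formula gives the same formula with exchanged indices; the coefficients
    of [T] are compared on [f0], where [T f0] is a unit. *)
Lemma cjz3 a b : cj (z a b) = - z b a.
Proof.
apply: T_inj; have := congr1 cj (LLb3 a b (cj f0)).
rewrite cjLb cjL3 cjK cjD cj_N' cjM cjT cjL3 cjLb cjK (LLb3 b a) => e.
transitivity (L b (Lb a f0) - z b a * T f0 - (L b (Lb a f0) - z b a * T f0 - cj (z a b) * T f0)); first by ring.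
by rewrite -e; ring.
Qed.

(** The term with [tb] compensates the factor [r0] of [z]: both sides equal [io * r0] times a second
    derivative of [r a], and the [Lb] commute. *)
Lemma zsym a b m : Lb m (z a b) + tb m * z a b = Lb b (z a m) + tb b * z a m.
Proof.
have E m' b' : Lb m' (z a b') + tb m' * z a b' = io * r0 * Lb m' (Lb b' (r a)).
  rewrite /z3 /tb3 !(proj2 (dLb m')) Lbio.
  have e : Lb m' r0 * w0 = - (r0 * Lb m' w0).
    by apply/eqP; rewrite -addr_eq0 -(proj2 (dLb m')) r0w0 (der1 (dLb m')).
  transitivity (io * r0 * Lb m' (Lb b' (r a)) + io * Lb b' (r a) * (Lb m' r0 * (r0 * w0) + r0 * (r0 * Lb m' w0))).
    by rewrite r0w0; ring.
  transitivity (io * r0 * Lb m' (Lb b' (r a)) + io * Lb b' (r a) * r0 * (Lb m' r0 * w0 + r0 * Lb m' w0)); first by ring.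
  by rewrite e; ring.
by rewrite !E LbLb.
Qed.

(** The function [i sum_j Z_j rho_j], with the gradient of [rho] written as [r0] and [r0 * r a]. The
    factor [i] turns tangency of the real part of the field into reality of [hh Z]. *)
Definition hh (Z : 'I_4 -> A) := io * (r0 * Z j0 + \sum_a r0 * r a * Z (jj a)).
Definition adm (Z : 'I_4 -> A) := (forall b j, Lb b (Z j) = 0) /\ cj (hh Z) = hh Z.

Lemma Lbh Z b : adm Z -> Lb b (hh Z) = \sum_a Z (jj a) * z a b - tb b * hh Z.
Proof.
move=> [HZ _]; pose S := Z j0 + \sum_a r a * Z (jj a).
have hS : hh Z = io * r0 * S.
  rewrite /hh /S; have -> : \sum_a r0 * r a * Z (jj a) = r0 * \sum_a r a * Z (jj a).
    by rewrite mulr_sumr; apply: eq_bigr => a _; ring.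
  by ring.
rewrite hS !(proj2 (dLb b)) Lbio /S (proj1 (dLb b)) HZ add0r (der_sum _ (dLb b)) -/S.
have -> : \sum_j Lb b (r j * Z (jj j)) = \sum_j Lb b (r j) * Z (jj j).
  by apply: eq_bigr => j _; rewrite (proj2 (dLb b)) HZ; ring.
have -> : \sum_a Z (jj a) * z a b = io * r0 * \sum_a Lb b (r a) * Z (jj a).
  by rewrite mulr_sumr; apply: eq_bigr => a _; rewrite /z3; ring.
have e : Lb b r0 * w0 = - (r0 * Lb b w0).
  by apply/eqP; rewrite -addr_eq0 -(proj2 (dLb b)) r0w0 (der1 (dLb b)).
rewrite /tb3; transitivity (io * r0 * (\sum_a Lb b (r a) * Z (jj a)) + io * S * (Lb b r0 * w0 * r0)); last by rewrite e; ring.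
transitivity (io * r0 * (\sum_a Lb b (r a) * Z (jj a)) + io * S * Lb b r0 * (r0 * w0)); first by rewrite r0w0; ring.
by ring.
Qed.

Definition linA (G : ('I_4 -> A) -> A) := (forall Z Z', G (fun j => Z j + Z' j) = G Z + G Z') /\
  (forall c Z, G (fun j => cst c * Z j) = cst c * G Z).
Lemma linA_j j : linA (fun Z => Z j). Proof. by []. Qed.
Lemma linA_hh : linA hh.
Proof.
split=> [Z Z'|c Z]; rewrite /hh.
  under eq_bigr do rewrite mulrDr.
  by rewrite big_split /=; ring.
have -> : \sum_a r0 * r a * (cst c * Z (jj a)) = cst c * \sum_a r0 * r a * Z (jj a).
  by rewrite mulr_sumr; apply: eq_bigr => a _; ring.
by ring.
Qed.
Lemma linA_der D G : derivation D -> (forall c, D (cst c) = 0) -> linA G -> linA (fun Z => D (G Z)).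
Proof.
move=> dD Dc [G1 G2]; split=> [Z Z'|c Z]; first by rewrite G1 (proj1 dD).
by rewrite G2 (proj2 dD) Dc mul0r add0r.
Qed.
Lemma linA_L a G : linA G -> linA (fun Z => L a (G Z)).
Proof. by apply: linA_der (dL3 a) _ => c; rewrite /L3 X0cst XXcst mulr0 subr0. Qed.
Lemma linA_Lb a G : linA G -> linA (fun Z => Lb a (G Z)).
Proof. exact: linA_der. Qed.
Lemma linA_T G : linA G -> linA (fun Z => T (G Z)).
Proof. by apply: linA_der dT3 _ => c; rewrite /T3 X0cst mulr0. Qed.
Lemma linA_M x G : linA G -> linA (fun Z => x * G Z).
Proof. by move=> [G1 G2]; split=> [Z Z'|c Z]; [rewrite G1 mulrDr|rewrite G2 mulrCA]. Qed.

(** A predicate rather than a filtration, since the three ranks use different letters: only closure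
    under the whole frame and vanishing at the point matter later. *)
Definition flat_module (h : A) := exists P : A -> Prop, [/\ P h, (forall c x y, P x -> P y -> P (c * x + y)),
  (forall a x, P x -> P (L a x) /\ P (Lb a x)), (forall x, P x -> P (T x)) & forall x, P x -> ev x = 0].

(** A dimension bound expressed by conditions at the point: those of [Gr] are real, those of [Gc]
    complex and counted twice. *)
Definition bounded n := exists Gr Gc : seq (('I_4 -> A) -> A),
  [/\ (size Gr + 2 * size Gc <= n)%N, forall G, List.In G (Gr ++ Gc) -> linA G &
   forall Z, adm Z -> (forall G, List.In G Gr -> complex.Re (ev (G Z)) = 0) ->
     (forall G, List.In G Gc -> ev (G Z) = 0) -> flat_module (hh Z)].

Section Letters.
Variables (n : nat) (l : 'I_n -> 'I_3) (Z : 'I_4 -> A).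
Hypothesis aZ : adm Z.
Variables (y : A) (Y : 'I_n -> A) (Sc zi : 'I_n -> 'I_n -> A).
Local Notation Ln := (fun i => L (l i)).
Local Notation Lbn := (fun i => Lb (l i)).
Local Notation zn := (fun i j => z (l i) (l j)).
Hypothesis hY : forall b, Lb (l b) (hh Z) = \sum_i Y i * zn i b - tb (l b) * hh Z.
Hypothesis LbY : forall m i, Lb (l m) (Y i) = - (Sc m i * y).
Hypothesis ziE : forall a c, \sum_b zn a b * zi b c = (a == c)%:R.

Lemma letters_Y i : Mo (X2 Ln Lbn) T (hh Z) 2 (Y i).
Proof.
have -> : Y i = \sum_b zi b i * (Lb (l b) (hh Z) + tb (l b) * hh Z).
  transitivity (\sum_b zi b i * \sum_j Y j * zn j b).
    under eq_bigr do rewrite mulr_sumr; rewrite exchange_big /=.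
    transitivity (\sum_j (j == i)%:R * Y j).
      by rewrite (bigD1 i) //= eqxx mul1r big1 ?addr0 // => j /negbTE ->; rewrite mul0r.
    by apply: eq_bigr => j _; rewrite -ziE mulr_suml; apply: eq_bigr => b _; ring.
  by apply: eq_bigr => b _; rewrite hY subrK.
apply: Mo_sum => b; apply: MoZ; apply: MoD; first by apply: (@Mo_X A _ (X2 Ln Lbn) T (hh Z) (false, b) 1); exact: Mo_h.
by apply: Mo_S; apply: MoZ; exact: Mo_h.
Qed.

(** Differentiating [hY], the only term that is not a combination of [hh Z] and its first
    derivatives is the derivative of [Y]; [Y] itself is such a combination because the Levi matrix
    of the chosen letters is invertible. *)
Lemma letters_LbLbh m b : Mo (X2 Ln Lbn) T (hh Z) 2 (Lb (l m) (Lb (l b) (hh Z)) + (\sum_a Sc m a * zn a b) * y).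
Proof.
have e1 : Mo (X2 Ln Lbn) T (hh Z) 2 (\sum_i Lb (l m) (zn i b) * Y i).
  by apply: Mo_sum => i; apply: MoZ; exact: letters_Y.
have e2 : Mo (X2 Ln Lbn) T (hh Z) 2 (Lb (l m) (tb (l b)) * hh Z + tb (l b) * Lb (l m) (hh Z)).
  apply: MoD; apply: MoZ; first by apply: Mo_S; exact: Mo_h.
  by apply: (@Mo_X A _ (X2 Ln Lbn) T (hh Z) (false, m) 1); exact: Mo_h.
apply: Mo_eq (MoB e1 e2) _.
rewrite hY (derB _ _ (dLb (l m))) (der_sum _ (dLb (l m))) (proj2 (dLb (l m)) (tb _)).
have -> : \sum_j Lb (l m) (Y j * zn j b) = \sum_j Lb (l m) (zn j b) * Y j - (\sum_a Sc m a * zn a b) * y.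
  by rewrite mulr_suml -sumrB; apply: eq_bigr => i _; rewrite (proj2 (dLb (l m))) LbY; ring.
by ring.
Qed.
End Letters.

Lemma In_cat (U : Type) (x : U) s t : List.In x (s ++ t) <-> List.In x s \/ List.In x t.
Proof. by elim: s => [|u s IH] /=; [split; [right|case]|rewrite IH; tauto]. Qed.
Lemma adm_real Z : adm Z -> cj (hh Z) = hh Z. Proof. by case. Qed.

Lemma in_map_list (I : finType) (F : I -> ('I_4 -> A) -> A) i : List.In (F i) [seq F i | i <- enum I].
Proof.
have : i \in enum I by rewrite mem_enum.
by elim: (enum I) => //= j s IH; rewrite inE => /orP[/eqP ->|/IH]; [left|right].
Qed.
Lemma in_map_listP (I : finType) (F : I -> ('I_4 -> A) -> A) G : List.In G [seq F i | i <- enum I] -> exists i, G = F i.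
Proof. by elim: (enum I) => //= j s IH [<-|/IH //]; exists j. Qed.

Lemma size_enum3 (F : 'I_3 -> ('I_4 -> A) -> A) : size [seq F i | i <- enum 'I_3] = 3%N.
Proof. by rewrite size_map size_enum_ord. Qed.

Theorem bounded_full_rank (zi : 'I_3 -> 'I_3 -> A) :
  (forall a c, \sum_b z a b * zi b c = (a == c)%:R) -> (forall a c, \sum_b zi a b * z b c = (a == c)%:R) -> bounded 24.
Proof.
move=> ziE ziE'.
(* Enumeration of the three index pairs above the diagonal. *)
pose p3 (i : 'I_3) : 'I_3 * 'I_3 := if i == 0 :> nat then (ord0, inord 1) else if i == 1%N :> nat then (ord0, inord 2) else (inord 1, inord 2).
exists ([:: hh; (fun Z => T (hh Z)); (fun Z => T (T (hh Z)))] ++ [seq (fun Z => L a (Lb a (hh Z))) | a <- enum 'I_3]),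
 ([seq (fun Z => L a (hh Z)) | a <- enum 'I_3] ++ [seq (fun Z => T (L a (hh Z))) | a <- enum 'I_3]
  ++ [seq (fun Z => L (p3 i).1 (Lb (p3 i).2 (hh Z))) | i <- enum 'I_3]); split.
- by rewrite !size_cat !size_enum3.
- move=> G; rewrite !In_cat => -[[|]|[|[|]]].
  + move=> /= [<-|[<-|[<-|//]]]; [exact: linA_hh|apply: linA_T; exact: linA_hh|do 2 apply: linA_T; exact: linA_hh].
  + by move=> /in_map_listP[a ->]; apply: linA_L; apply: linA_Lb; exact: linA_hh.
  + by move=> /in_map_listP[a ->]; apply: linA_L; exact: linA_hh.
  + by move=> /in_map_listP[a ->]; apply: linA_T; apply: linA_L; exact: linA_hh.
  + by move=> /in_map_listP[a ->]; apply: linA_L; apply: linA_Lb; exact: linA_hh.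
move=> Z aZ HGr HGc; have cjh := adm_real aZ.
have hY b : Lb b (hh Z) = \sum_i Z (jj i) * z i b - tb b * hh Z by exact: Lbh.
have LbY m i : Lb m (Z (jj i)) = - (0 * 0) by rewrite (proj1 aZ); ring.
have LbLbh a b : Mo (X2 L Lb) T (hh Z) 2 (Lb a (Lb b (hh Z))).
  have HH := @letters_LbLbh 3 id Z 0 (fun i => Z (jj i)) (fun _ _ => 0) zi hY LbY ziE a b.
  by apply: Mo_eq HH _; rewrite mulr0 addr0.
have LLh a b : Mo (X2 L Lb) T (hh Z) 2 (L a (L b (hh Z))).
  by have := Mo_cj cjL3 cjLb cjT cjh cjD cjM (LbLbh a b); rewrite !cjLb cjh.
have c3 G : List.In G ([:: hh; (fun Z => T (hh Z)); (fun Z => T (T (hh Z)))] ++ [seq (fun Z => L a (Lb a (hh Z))) | a <- enum 'I_3]) -> complex.Re (ev (G Z)) = 0 := HGr G.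
exists (fun x => exists m, Mo (X2 L Lb) T (hh Z) m x); split.
- by exists 1%N; exact: Mo_h.
- move=> c x x' [m Mx] [m' Mx']; exists (maxn m m'); apply: Mo_lc; [apply: Mo_le Mx|apply: Mo_le Mx']; lia.
- by move=> a x [m Mx]; split; exists m.+1; [exact: (@Mo_X A _ (X2 L Lb) T (hh Z) (true, a) m x Mx)|exact: (@Mo_X A _ (X2 L Lb) T (hh Z) (false, a) m x Mx)].
- by move=> x [m Mx]; exists m.+2; exact: Mo_T.
move=> x [m Mx].
apply: (full_rank_vanishing dL3 dLb dT3 LLb3 LT3 LbT3 qE evD evM evC cjL3 cjLb cjT cjh LLh LbLbh ziE ziE' _ _ _ _ _ _ _ _ Mx) => //.
- by apply: (HGr hh); left.
- by move=> a; apply: (HGc (fun Z => L a (hh Z))); rewrite In_cat; left; apply: (in_map_list (fun a Z => L a (hh Z))).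
- by apply: (HGr (fun Z => T (hh Z))); right; left.
- move=> a b ab.
  have [i Ei] : exists i, p3 i = (a, b).
    have [lt2 lt3] : (a < 2)%N /\ (b < 3)%N by split; [have := ltn_ord b; lia|exact: ltn_ord].
    have [E|E] : a = 0 :> nat \/ a = 1%N :> nat by lia.
      have [E'|E'] : b = 1%N :> nat \/ b = 2%N :> nat by lia.
        by exists (inord 0); rewrite /p3 inordK //=; congr (_, _); apply: val_inj; rewrite /= ?inordK.
      by exists (inord 1); rewrite /p3 inordK //=; congr (_, _); apply: val_inj; rewrite /= ?inordK.
    by exists (inord 2); rewrite /p3 inordK //=; congr (_, _); apply: val_inj; rewrite /= ?inordK //; lia.
  have -> : L a (Lb b (hh Z)) = (fun Z => L (p3 i).1 (Lb (p3 i).2 (hh Z))) Z by rewrite Ei.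
  apply: (HGc (fun Z => L (p3 i).1 (Lb (p3 i).2 (hh Z)))); rewrite !In_cat; right; right.
  exact: (in_map_list (fun i Z => L (p3 i).1 (Lb (p3 i).2 (hh Z)))).
- by move=> a; apply: (HGr (fun Z => L a (Lb a (hh Z)))); rewrite In_cat; right; apply: (in_map_list (fun a Z => L a (Lb a (hh Z)))).
- by move=> a; apply: (HGc (fun Z => T (L a (hh Z)))); rewrite !In_cat; right; left; apply: (in_map_list (fun a Z => T (L a (hh Z)))).
- by apply: (HGr (fun Z => T (T (hh Z)))); right; right; left.
Qed.

(** * Fields in the Levi kernel *)

Section Kernel.
Variables (n : nat) (l : 'I_n -> 'I_3) (k : 'I_3) (c : 'I_n -> A).
Hypothesis zK : forall b, z k b + \sum_i c i * z (l i) b = 0.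
Definition K3 f := L k f + \sum_i c i * L (l i) f.
Local Notation K := K3.

Lemma dK3 : derivation K.
Proof.
split=> x x'; rewrite /K3.
  rewrite (proj1 (dL3 k)); under eq_bigr do rewrite (proj1 (dL3 _)) mulrDr.
  by rewrite big_split /=; ring.
rewrite (proj2 (dL3 k)).
have -> : \sum_i c i * L (l i) (x * x') = (\sum_i c i * L (l i) x) * x' + x * \sum_i c i * L (l i) x'.
  by rewrite mulr_suml mulr_sumr -big_split; apply: eq_bigr => i _ /=; rewrite (proj2 (dL3 _)); ring.
by ring.
Qed.

Lemma K3L m f : K (L m f) = L m (K f) - \sum_i L m (c i) * L (l i) f.
Proof.
rewrite /K3 (proj1 (dL3 m)) (der_sum _ (dL3 m)).
have -> : \sum_j L m (c j * L (l j) f) = \sum_j L m (c j) * L (l j) f + \sum_j c j * L (l j) (L m f).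
  by rewrite -big_split; apply: eq_bigr => i _ /=; rewrite (proj2 (dL3 m)) (LL3 (l i) m).
by rewrite (LL3 k m); ring.
Qed.
(** The coefficient of [T] in the bracket is the left side of [zK], hence zero. *)
Lemma K3Lb m f : K (Lb m f) = Lb m (K f) - \sum_i Lb m (c i) * L (l i) f.
Proof.
rewrite /K3 (proj1 (dLb m)) (der_sum _ (dLb m)) LLb3.
have -> : \sum_j Lb m (c j * L (l j) f) = \sum_j Lb m (c j) * L (l j) f + \sum_j c j * L (l j) (Lb m f) - (\sum_j c j * z (l j) m) * T f.
  by rewrite mulr_suml -sumrN -!big_split; apply: eq_bigr => i _ /=; rewrite (proj2 (dLb m)) LLb3; ring.
have := zK m => /eqP; rewrite addr_eq0 => /eqP ->; ring.
Qed.
Definition th3 := ta k + \sum_i c i * ta (l i).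
Lemma K3T f : K (T f) = T (K f) + th3 * T f - \sum_i T (c i) * L (l i) f.
Proof.
rewrite /K3 (proj1 dT3) (der_sum _ dT3) LT3 /th3.
have -> : \sum_i c i * L (l i) (T f) = \sum_j T (c j * L (l j) f) + (\sum_i c i * ta (l i)) * T f - \sum_i T (c i) * L (l i) f.
  by rewrite mulr_suml -sumrN -!big_split; apply: eq_bigr => i _ /=; rewrite (proj2 dT3) LT3; ring.
by ring.
Qed.
Definition kt3 := cj (tb k + \sum_i cj (c i) * tb (l i)).
Lemma zKb a : z a k + \sum_i cj (c i) * z a (l i) = 0.
Proof.
have := congr1 cj (zK a); rewrite cjD cj_0' cj_sum' cjz3 => e; apply: oppr_inj.
by rewrite oppr0 -[RHS]e opprD -sumrN; congr (_ + _); apply: eq_bigr => i _; rewrite cjM cjz3 mulrN.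
Qed.
(** Since [hh Z] is real, the conjugate field can be applied through [Lbh]; the terms in [Z] are
    then contracted with a kernel vector of the Levi matrix and vanish by [zKb]. *)
Lemma K3h Z : adm Z -> K (hh Z) = - kt3 * hh Z.
Proof.
move=> aZ; rewrite -[in LHS](adm_real aZ) -[in RHS](adm_real aZ) /K3 /kt3.
rewrite -cj_N' -cjM -cjLb.
have -> : \sum_i c i * L (l i) (cj (hh Z)) = cj (\sum_i cj (c i) * Lb (l i) (hh Z)).
  by rewrite cj_sum'; apply: eq_bigr => i _; rewrite cjM cjK cjLb.
rewrite -cjD; congr (cj _); rewrite Lbh //.
have -> : \sum_i cj (c i) * Lb (l i) (hh Z) = \sum_a Z (jj a) * (\sum_i cj (c i) * z a (l i)) - (\sum_i cj (c i) * tb (l i)) * hh Z.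
  under [X in _ = X - _]eq_bigr do rewrite mulr_sumr; rewrite exchange_big mulr_suml -sumrB; apply: eq_bigr => i _.
  by rewrite Lbh // mulrBr mulr_sumr; congr (_ - _); [apply: eq_bigr => a _|]; ring.
have e : \sum_a Z (jj a) * z a k + \sum_a Z (jj a) * (\sum_i cj (c i) * z a (l i)) = 0.
  by rewrite -big_split big1 // => a _ /=; rewrite -mulrDr zKb mulr0.
move/eqP: e; rewrite addr_eq0 => /eqP ->; ring.
Qed.
(** Differentiating [zK] trades derivatives of [c] for derivatives of [z], and [zsym] makes the
    latter symmetric. This is the symmetry of the second order tensor of the Levi kernel. *)
Lemma Psym m b : \sum_i Lb m (c i) * z (l i) b = \sum_i Lb b (c i) * z (l i) m.
Proof.
have E m' b' : \sum_i Lb m' (c i) * z (l i) b' = - ((Lb m' (z k b') + tb m' * z k b') + \sum_i c i * (Lb m' (z (l i) b') + tb m' * z (l i) b')).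
  have := congr1 (Lb m') (zK b'); rewrite (der0 (dLb m')) (proj1 (dLb m')) (der_sum _ (dLb m')) => e1.
  have e2 := congr1 (fun x => tb m' * x) (zK b'); rewrite /= mulr0 in e2.
  have -> : \sum_i c i * (Lb m' (z (l i) b') + tb m' * z (l i) b') = \sum_j Lb m' (c j * z (l j) b') + tb m' * (\sum_i c i * z (l i) b') - \sum_i Lb m' (c i) * z (l i) b'.
    by rewrite mulr_sumr -sumrN -!big_split; apply: eq_bigr => i _ /=; rewrite (proj2 (dLb m')); ring.
  transitivity (- (Lb m' (z k b') + \sum_j Lb m' (c j * z (l j) b') + tb m' * (z k b' + \sum_i c i * z (l i) b')) + \sum_i Lb m' (c i) * z (l i) b').
    by rewrite e1 zK; ring.
  by ring.
rewrite !E; congr (- (_ + _)); first exact: zsym.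
by apply: eq_bigr => i _; rewrite zsym.
Qed.
(** By [Psym] the derivative along the conjugate kernel field can be put on the index [b], and what
    remains contains the contraction of [zKb]. Where the letters have an invertible Levi matrix, [c]
    is therefore constant along the conjugate kernel field. *)
Lemma KbC b : \sum_i (Lb k (c i) + \sum_j cj (c j) * Lb (l j) (c i)) * z (l i) b = 0.
Proof.
transitivity (\sum_i Lb k (c i) * z (l i) b + \sum_j cj (c j) * \sum_i Lb (l j) (c i) * z (l i) b).
  under [X in _ = _ + X]eq_bigr do rewrite mulr_sumr; rewrite exchange_big -big_split; apply: eq_bigr => i _ /=.
  by rewrite mulrDl mulr_suml; congr (_ + _); apply: eq_bigr => j _; ring.
rewrite (Psym k b); under [X in _ + X]eq_bigr do rewrite (Psym _ b) mulr_sumr.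
rewrite exchange_big -big_split big1 // => i _ /=.
transitivity (Lb b (c i) * (z (l i) k + \sum_j cj (c j) * z (l i) (l j))); last by rewrite zKb mulr0.
by rewrite mulrDr mulr_sumr; congr (_ + _); apply: eq_bigr => j _; ring.
Qed.
Lemma Kcjf0 : K (cj f0) = 0.
Proof.
by rewrite /K3 -cjLb Lbf0 cj_0' add0r big1 // => i _; rewrite -cjLb Lbf0 cj_0' mulr0.
Qed.

End Kernel.

Hypothesis nondeg : forall v : 'I_3 -> A, (forall a b, Lb b (v a) = 0) -> (forall b, \sum_a v a * z a b = 0) ->
  (exists a, ev (v a) != 0) -> False.
(** CR coefficients would make the kernel field one of those excluded by [nondeg]; it is nonzero
    because its coefficient at [k] is 1. *)
Lemma kernel_degenerate n (l : 'I_n -> 'I_3) k (c : 'I_n -> A) : (forall i, l i != k) ->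
  (forall b, z k b + \sum_i c i * z (l i) b = 0) -> (forall i m, Lb m (c i) = 0) -> False.
Proof.
move=> lk zK cz; apply: (nondeg (v := fun a => (a == k)%:R + \sum_i c i * (a == l i)%:R)).
- move=> a b; rewrite (proj1 (dLb b)) (der_nat _ (dLb b)) add0r (der_sum _ (dLb b)) big1 // => i _.
  by rewrite (proj2 (dLb b)) cz (der_nat _ (dLb b)) mul0r mulr0 addr0.
- move=> b; rewrite -[RHS](zK b).
  under eq_bigr do rewrite mulrDl mulr_suml; rewrite big_split /=; congr (_ + _).
    by rewrite (bigD1 k) //= eqxx mul1r big1 ?addr0 // => a /negbTE ->; rewrite mul0r.
  rewrite exchange_big; apply: eq_bigr => i _ /=.
  by rewrite (bigD1 (l i)) //= eqxx mulr1 big1 ?addr0 // => a /negbTE ->; rewrite mulr0 mul0r.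
- exists k; rewrite eqxx big1 ?addr0 => [|i _]; first by rewrite ev1 oner_neq0.
  by rewrite eq_sym (negbTE (lk i)) mulr0.
Qed.

Lemma ev_unit x y : y * x = 1 -> ev x != 0.
Proof.
move=> e; apply/eqP => x0; have := congr1 ev e; rewrite evM x0 mulr0 ev1 => /eqP.
by rewrite eq_sym oner_eq0.
Qed.
Lemma ev_0 : ev 0 = 0. Proof. by apply: (addrI (ev 0)); rewrite -evD !addr0. Qed.

(** What a generic point provides: a coefficient that is not identically zero is a unit. It takes
    the place of the case split available in a field. *)
Definition dec (x : A) := x = 0 \/ ev x != 0.

(** * Levi rank two *)

Section TwoLetters.
Variables (a b k : 'I_3) (di : A).
Hypothesis cov : forall F : 'I_3 -> A, \sum_c F c = F a + F b + F k.
Hypothesis cases3 : forall c : 'I_3, [\/ c = a, c = b | c = k].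
Hypotheses (ak : a != k) (bk : b != k).
Definition minor2 := z a a * z b b - z a b * z b a.
Definition minor3 := minor2 * z k k - z a k * (z k a * z b b - z k b * z b a) - z b k * (z k b * z a a - z k a * z a b).
Hypothesis diE : di * minor2 = 1.
Hypothesis m3 : minor3 = 0.
Definition l2 (i : 'I_2) := if i == ord0 then a else b.
Definition c2 (i : 'I_2) := if i == ord0 then - di * (z k a * z b b - z k b * z b a) else - di * (z k b * z a a - z k a * z a b).
Definition S2 m b := Sm (fun i j => z (l2 i) (l2 j)) (fun m i => Lb (l2 m) (c2 i)) m b.
Definition Sc2 m i := Lb (l2 m) (c2 i).
Definition detSc := Sc2 ord0 ord0 * Sc2 ord_max ord_max - Sc2 ord0 ord_max * Sc2 ord_max ord0.
(** The Levi norm that separates the two rank-one cases, with denominators cleared: there [xi] and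
    [eta] are the column [o] of [S2] and the row [o] of [Sc2], each divided by [S2 o o]. *)
Definition q2 o := \sum_i cj (S2 i o) * Sc2 o i.
Local Notation Ln := (fun i => L (l2 i)).
Local Notation Lbn := (fun i => Lb (l2 i)).
Local Notation zn := (fun i j => z (l2 i) (l2 j)).

Lemma sum2 (F : 'I_2 -> A) : \sum_i F i = F ord0 + F ord_max.
Proof. by rewrite !big_ord_recl big_ord0 addr0; congr (_ + F _); apply: val_inj. Qed.
Lemma case2 (i : 'I_2) : i = ord0 \/ i = ord_max.
Proof. by case: i => [[|[|//]] p]; [left|right]; apply: val_inj. Qed.
Lemma l20 : l2 ord0 = a. Proof. by []. Qed.
Lemma l21 : l2 ord_max = b. Proof. by []. Qed.

(** In the columns [a] and [b] this is Cramer's rule; in the column [k] it is the vanishing of the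
    full determinant [minor3]. *)
Lemma zK2 e : z k e + \sum_i c2 i * z (l2 i) e = 0.
Proof.
rewrite sum2 l20 l21 /c2 /=.
case: (cases3 e) => ->.
- transitivity (z k a - (di * minor2) * z k a); [by rewrite /minor2; ring|by rewrite diE; ring].
- transitivity (z k b - (di * minor2) * z k b); [by rewrite /minor2; ring|by rewrite diE; ring].
- transitivity (z k k - (di * minor2) * z k k + di * minor3); [by rewrite /minor3 /minor2; ring|by rewrite diE m3; ring].
Qed.

Definition zi2 (i j : 'I_2) := di * (if i == ord0 then if j == ord0 then z b b else - z a b
  else if j == ord0 then - z b a else z a a).
Lemma zi2E i j : \sum_m zn i m * zi2 m j = (i == j)%:R.
Proof.
rewrite sum2 l20 l21 /zi2.
case: (case2 i) => ->; case: (case2 j) => ->; rewrite ?l20 ?l21 /= -?diE /minor2; ring.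
Qed.

Section Field.
Variable Z : 'I_4 -> A.
Hypothesis aZ : adm Z.
Local Notation y := (Z (jj k)).
Local Notation Y := (fun i => Z (jj (l2 i)) - c2 i * Z (jj k)).

(** The component of [Z] along the kernel field does not show in the first derivatives of [hh Z]; it
    enters only through the derivative of [Y] in [LbY2]. *)
Lemma hY2 m : Lb (l2 m) (hh Z) = \sum_i Y i * zn i m - tb (l2 m) * hh Z.
Proof.
rewrite Lbh // cov; congr (_ - _); have := zK2 (l2 m); rewrite !sum2 l20 l21 => e.
transitivity (Z (jj a) * z a (l2 m) + Z (jj b) * z b (l2 m) + Z (jj k) * z k (l2 m)
   - Z (jj k) * (z k (l2 m) + (c2 ord0 * z a (l2 m) + c2 ord_max * z b (l2 m)))); first by rewrite e; ring.
by ring.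
Qed.
Lemma LbY2 m i : Lb (l2 m) (Y i) = - (Sc2 m i * y).
Proof. by rewrite (derB _ _ (dLb _)) (proj2 (dLb _)) !(proj1 aZ) /Sc2; ring. Qed.
Lemma LbLbh2 m i : Mo (X2 Ln Lbn) T (hh Z) 2 (Lb (l2 m) (Lb (l2 i) (hh Z)) + S2 m i * y).
Proof. exact: (letters_LbLbh hY2 LbY2 zi2E). Qed.
Lemma K2_Mo m x : Mo (X2 Ln Lbn) T (hh Z) m x -> Mo (X2 Ln Lbn) T (hh Z) m (K3 l2 k c2 x).
Proof.
apply: (K_Mo2 (dK3 l2 k c2) (fun m f => K3L l2 k c2 (l2 m) f) (fun m f => K3Lb zK2 (l2 m) f) (K3T l2 k c2)).
exact: (K3h zK2 aZ).
Qed.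
(** The missing letter is [L k = K - sum_i c_i L (l2 i)], and [K] preserves the filtration;
    conjugation then gives [Lb k]. *)
Lemma flat2 : (forall m x, Mo (X2 Ln Lbn) T (hh Z) m x -> ev x = 0) -> flat_module (hh Z).
Proof.
move=> v; exists (fun x => exists m, Mo (X2 Ln Lbn) T (hh Z) m x).
have Mcj m x : Mo (X2 Ln Lbn) T (hh Z) m x -> Mo (X2 Ln Lbn) T (hh Z) m (cj x).
  exact: (Mo_cj (fun i x => cjL3 (l2 i) x) (fun i x => cjLb (l2 i) x) cjT (adm_real aZ) cjD cjM).
have ML i m x : Mo (X2 Ln Lbn) T (hh Z) m x -> Mo (X2 Ln Lbn) T (hh Z) m.+1 (L (l2 i) x).
  exact: (@Mo_X A _ (X2 Ln Lbn) T (hh Z) (true, i) m x).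
have Mall e m x : Mo (X2 Ln Lbn) T (hh Z) m x -> Mo (X2 Ln Lbn) T (hh Z) m.+1 (L e x).
  move=> Mx; case: (cases3 e) => ->; [by rewrite -l20; apply: ML|by rewrite -l21; apply: ML|].
  have -> : L k x = K3 l2 k c2 x - \sum_i c2 i * L (l2 i) x by rewrite /K3; ring.
  by apply: MoB; [apply: Mo_S; exact: K2_Mo|apply: Mo_sum => i; apply: MoZ; exact: ML].
split.
- by exists 1%N; exact: Mo_h.
- move=> c x x' [m Mx] [m' Mx']; exists (maxn m m'); apply: Mo_lc; [apply: Mo_le Mx|apply: Mo_le Mx']; lia.
- move=> e x [m Mx]; split; exists m.+1; first exact: Mall.
  by rewrite -[Lb e x]cjK cjLb; have Mc := Mcj _ _ Mx; apply: Mcj; exact: Mall.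
- by move=> x [m Mx]; exists m.+2; exact: Mo_T.
- by move=> x [m Mx]; exact: v Mx.
Qed.
End Field.

(** The cases differ only in the functional [last] of weight four. The 5 real and 6 complex
    functionals give [5 + 12 = 17]. *)
Lemma rank_two_bounded last : linA last -> (forall Z, adm Z ->
  complex.Re (ev (last Z)) = 0 ->
  complex.Re (ev (hh Z)) = 0 -> (forall i, ev (L (l2 i) (hh Z)) = 0) -> complex.Re (ev (T (hh Z))) = 0 ->
  (forall i j : 'I_2, (i < j)%N -> ev (L (l2 i) (Lb (l2 j) (hh Z))) = 0) ->
  (forall i, complex.Re (ev (L (l2 i) (Lb (l2 i) (hh Z)))) = 0) ->
  ev (Z (jj k)) = 0 -> (forall i, ev (L (l2 i) (Z (jj k))) = 0) ->
  forall m x, Mo (X2 Ln Lbn) T (hh Z) m x -> ev x = 0) -> bounded 17.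
Proof.
move=> ll H.
exists [:: hh; (fun Z => T (hh Z)); (fun Z => L a (Lb a (hh Z))); (fun Z => L b (Lb b (hh Z))); last],
 [:: (fun Z => L a (hh Z)); (fun Z => L b (hh Z)); (fun Z => L a (Lb b (hh Z))); (fun Z => Z (jj k));
   (fun Z => L a (Z (jj k))); (fun Z => L b (Z (jj k)))]; split=> //.
  have lh := linA_hh; have lj := linA_j (jj k).
  move=> G; case=> [<-|]; first exact: lh.
  case=> [<-|]; first exact: linA_T.
  case=> [<-|]; first by apply: linA_L; exact: linA_Lb.
  case=> [<-|]; first by apply: linA_L; exact: linA_Lb.
  case=> [<-|]; first exact: ll.
  case=> [<-|]; first exact: linA_L.
  case=> [<-|]; first exact: linA_L.
  case=> [<-|]; first by apply: linA_L; exact: linA_Lb.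
  case=> [<-|]; first exact: lj.
  case=> [<-|]; first exact: linA_L.
  by case=> [<-|//]; exact: linA_L.
move=> Z aZ HGr HGc; apply: flat2 => //.
have r1 := HGr hh (or_introl erefl).
have r2 := HGr _ (or_intror (or_introl erefl)).
have r3 := HGr _ (or_intror (or_intror (or_introl erefl))).
have r4 := HGr _ (or_intror (or_intror (or_intror (or_introl erefl)))).
have r5 := HGr _ (or_intror (or_intror (or_intror (or_intror (or_introl erefl))))).
have c1 := HGc _ (or_introl erefl).
have c2 := HGc _ (or_intror (or_introl erefl)).
have c3 := HGc _ (or_intror (or_intror (or_introl erefl))).
have c4 := HGc _ (or_intror (or_intror (or_intror (or_introl erefl)))).
have c5 := HGc _ (or_intror (or_intror (or_intror (or_intror (or_introl erefl))))).
have c6 := HGc _ (or_intror (or_intror (or_intror (or_intror (or_intror (or_introl erefl)))))).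
apply: (H Z aZ) => //; try by move=> i; case: (case2 i) => ->.
by move=> i j; case: (case2 i) => ->; case: (case2 j) => ->.
Qed.

Hypotheses (dS00 : dec (S2 ord0 ord0)) (dS01 : dec (S2 ord0 ord_max)) (dS11 : dec (S2 ord_max ord_max)).
Hypotheses (dSc : dec detSc) (dq : forall o, dec (q2 o)).

Lemma S2sym i j : S2 i j = S2 j i.
Proof. exact: (Psym zK2 (l2 i) (l2 j)). Qed.
Lemma detS2 : S2 ord0 ord0 * S2 ord_max ord_max - S2 ord0 ord_max * S2 ord0 ord_max = detSc * minor2.
Proof.
by rewrite {2}(S2sym ord0 ord_max) /S2 /Sm /= !sum2 l20 l21 /detSc /Sc2 l20 l21 /minor2; ring.
Qed.

Lemma minor_Sc o l e i : detSc = 0 -> Sc2 o e * Sc2 l i - Sc2 l e * Sc2 o i = 0.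
Proof.
move=> d0; case: (case2 o) => ->; case: (case2 l) => ->; case: (case2 e) => ->; case: (case2 i) => ->; try ring.
- by rewrite -d0 /detSc; ring.
- by rewrite -[RHS]oppr0 -d0 /detSc; ring.
- by rewrite -[RHS]oppr0 -d0 /detSc; ring.
- by rewrite -d0 /detSc; ring.
Qed.

Theorem bounded_rank_two : bounded 17.
Proof.
have Lby Z : adm Z -> forall i, Lb (l2 i) (Z (jj k)) = 0 by move=> [HZ _] i.
have inv x : ev x != 0 -> exists u, u * x = 1 by exact: unitA.
have dLn i : derivation (L (l2 i)) by exact: dL3.
have dLbn i : derivation (Lb (l2 i)) by exact: dLb.
have LLn i j f : L (l2 i) (L (l2 j) f) = L (l2 j) (L (l2 i) f) by exact: LL3.
have LLbn i j f : Lb (l2 j) (L (l2 i) f) = L (l2 i) (Lb (l2 j) f) - zn i j * T f by exact: LLb3.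
have LTn i f : L (l2 i) (T f) = T (L (l2 i) f) + ta (l2 i) * T f by exact: LT3.
have LbTn i f : Lb (l2 i) (T f) = T (Lb (l2 i) f) + tb (l2 i) * T f by exact: LbT3.
have cjLn i x : cj (L (l2 i) x) = Lb (l2 i) (cj x) by exact: cjL3.
have cjLbn i x : cj (Lb (l2 i) x) = L (l2 i) (cj x) by exact: cjLb.
have KLn m f := K3L l2 k c2 (l2 m) f.
have KLbn m f := K3Lb zK2 (l2 m) f.
have [d0|du] := dSc; last first.
  have [dSi dSiE] := inv _ du.
  (* The determinant of [S2] is the unit [detSc * minor2], so the mixed entry is invertible when
     both diagonal entries vanish. *)
  have [i [j [ui uiE Sij]]] : exists i j, exists2 ui, ui * S2 i j = 1 & i = j \/ S2 i i = 0 /\ S2 j j = 0.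
    have [s0|/inv[u uE]] := dS00; last by exists ord0, ord0, u => //; left.
    have [s1|/inv[u uE]] := dS11; last by exists ord_max, ord_max, u => //; left.
    have [s01|/inv[u uE]] := dS01; last by exists ord0, ord_max, u => //; right.
    have := ev_unit dSiE; have := detS2; rewrite s0 s01 !mul0r subr0 => e.
    have e' : detSc = 0 by rewrite -[detSc]mulr1 -diE (mulrC di) mulrA -e mul0r.
    by rewrite e' ev_0 eqxx.
  apply: (@rank_two_bounded (fun Z => T (T (hh Z)))); first by do 2 apply: linA_T; exact: linA_hh.
  move=> Z aZ h1 h2 h3 h4 h5 h6 h7 h8 m x Mx.
  pose Sci (i j : 'I_2) := dSi * (if i == ord0 then if j == ord0 then Sc2 ord_max ord_max else - Sc2 ord0 ord_max
    else if j == ord0 then - Sc2 ord_max ord0 else Sc2 ord0 ord0).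
  have SciE i' j' : \sum_m Sci i' m * Sc2 m j' = (i' == j')%:R.
    rewrite sum2 /Sci; case: (case2 i') => ->; case: (case2 j') => ->; rewrite /= -?dSiE /detSc; ring.
  exact: (rank_two_regular dLn dLbn dT3 LLn LLbn LTn LbTn qE evD evM evC cjLn cjLbn cjT (adm_real aZ) cjD cjM
    zi2E (dK3 l2 k c2) KLn KLbn (K3T l2 k c2) (K3h zK2 aZ) (Lby Z aZ) S2sym (LbLbh2 aZ) uiE Sij SciE h1 h2 h3 h4 h5 h6 h7 h8 Mx).
have [o [si siE]] : exists o, exists si, si * S2 o o = 1.
  have [s0|/inv[u uE]] := dS00; last by exists ord0, u.
  have [s1|/inv[u uE]] := dS11; last by exists ord_max, u.
  have s01 : S2 ord0 ord_max = 0.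
    have [//|u] := dS01; have := congr1 ev detS2; rewrite s0 d0 !mul0r sub0r => e.
    have : ev (S2 ord0 ord_max * S2 ord0 ord_max) = 0 by rewrite -[X in ev X]opprK (evN evD) e ev_0 oppr0.
    by rewrite evM => /eqP; rewrite mulf_eq0 orbb (negbTE u).
  (* Now [S2 = 0]: its determinant is zero, so no mixed entry survives without a diagonal one. The
     coefficients [c2] are then CR along [a] and [b], and along [k] by [KbC]. *)
  exfalso; apply: (kernel_degenerate _ zK2) => [i|].
    by case: (case2 i) => ->; rewrite ?l20 ?l21.
  have Sz i j : S2 i j = 0.
    by case: (case2 i) => ->; case: (case2 j) => -> //; rewrite S2sym.
  have Scz m i : Sc2 m i = 0.
    transitivity (\sum_j S2 m j * zi2 j i); last by rewrite big1 // => j _; rewrite Sz mul0r.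
    rewrite /S2 /Sm; under eq_bigr do rewrite mulr_suml; rewrite exchange_big /=.
    rewrite (bigD1 i) //= [X in _ + X]big1 => [|j ji].
      by under eq_bigr do rewrite -mulrA; rewrite -mulr_sumr zi2E eqxx mulr1 addr0.
    by under eq_bigr do rewrite -mulrA; rewrite -mulr_sumr zi2E (negbTE ji) mulr0.
  move=> i m; case: (cases3 m) => ->; [exact: (Scz ord0)|exact: (Scz ord_max)|].
  have kz e : Lb k (c2 ord0) * z a e + Lb k (c2 ord_max) * z b e = 0.
    have := KbC zK2 e; rewrite sum2 l20 l21 !sum2 !l20 !l21.
    rewrite -/(Sc2 ord0 _) -/(Sc2 ord_max _) -![Lb a _]/(Sc2 ord0 _) -![Lb b _]/(Sc2 ord_max _).
    by rewrite !Scz !mulr0 !addr0.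
  have ka := kz a; have kb := kz b.
  case: (case2 i) => ->.
    transitivity (di * ((Lb k (c2 ord0) * z a a + Lb k (c2 ord_max) * z b a) * z b b
      - (Lb k (c2 ord0) * z a b + Lb k (c2 ord_max) * z b b) * z b a)); last by rewrite ka kb; ring.
    by rewrite -[LHS]mul1r -diE /minor2; ring.
  transitivity (di * ((Lb k (c2 ord0) * z a b + Lb k (c2 ord_max) * z b b) * z a a
      - (Lb k (c2 ord0) * z a a + Lb k (c2 ord_max) * z b a) * z a b)); last by rewrite ka kb; ring.
  by rewrite -[LHS]mul1r -diE /minor2; ring.
(* Factorization of a tensor of rank one, normalized by [xi o = 1]. *)
pose s := S2 o o; pose xi l := S2 l o * si; pose eta e := Sc2 o e * si.
have xio : xi o = 1 by rewrite /xi mulrC.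
have xiE m : xi m = \sum_e eta e * zn e m.
  by rewrite /xi S2sym /S2 /Sm mulr_suml; apply: eq_bigr => e _; rewrite /eta /Sc2; ring.
have ScE l e : Sc2 l e = s * xi l * eta e.
  have e1 : s * Sc2 l e = S2 l o * Sc2 o e.
    apply/eqP; rewrite -subr_eq0; apply/eqP; rewrite /s /S2 /Sm !mulr_suml -sumrB big1 // => i _.
    rewrite -!/(Sc2 _ _); transitivity (z (l2 i) (l2 o) * (Sc2 o i * Sc2 l e - Sc2 l i * Sc2 o e)); first by ring.
    by rewrite minor_Sc // mulr0.
  rewrite /xi /eta; transitivity ((si * s) * si * (S2 l o * Sc2 o e)); last by ring.
  by rewrite -e1 siE mul1r mulrA siE mul1r.
have qE' : \sum_e cj (xi e) * eta e = cj si * si * q2 o.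
  by rewrite /q2 mulr_sumr; apply: eq_bigr => e _; rewrite /xi cjM /eta; ring.
have Sij : o = o \/ S2 o o = 0 /\ S2 o o = 0 by left.
have [q0|/inv[u uE]] := dq o.
  apply: (@rank_two_bounded (fun Z => s * L (l2 o) (L (l2 o) (Z (jj k))))).
    by apply: linA_M; do 2 apply: linA_L; exact: linA_j.
  move=> Z aZ h1 h2 h3 h4 h5 h6 h7 h8 m x Mx.
  have q0' : \sum_e cj (xi e) * eta e = 0 by rewrite qE' q0 mulr0.
  exact: (rank_two_null dLn dLbn dT3 LLn LLbn LTn LbTn qE evD evM evC cjLn cjLbn cjT (adm_real aZ) cjD cjM cjK
    (dK3 l2 k c2) KLn KLbn (K3T l2 k c2) (K3h zK2 aZ) (Lby Z aZ) S2sym (LbLbh2 aZ) siE Sij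
    siE xio ScE xiE q0' h1 h2 h3 h4 h5 h6 h7 h8 Mx).
apply: (@rank_two_bounded (fun Z => T (T (hh Z)))); first by do 2 apply: linA_T; exact: linA_hh.
move=> Z aZ h1 h2 h3 h4 h5 h6 h7 h8 m x Mx.
have vq : u * cj s * s * (\sum_e cj (xi e) * eta e) = 1.
  have csi : cj si * cj s = 1.
    by rewrite -cjM siE -[LHS]mulr1 -[X in _ * X]cjK -cjM mul1r cjK.
  rewrite qE'; transitivity ((cj si * cj s) * (si * s) * (u * q2 o)); first by ring.
  by rewrite csi siE uE !mul1r.
exact: (rank_two_singular dLn dLbn dT3 LLn LLbn LTn LbTn qE evD evM evC cjLn cjLbn cjT (adm_real aZ) cjD cjM cjK
  zi2E (dK3 l2 k c2) KLn KLbn (K3T l2 k c2) (K3h zK2 aZ) (Lby Z aZ) S2sym (LbLbh2 aZ) siE Sij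
  siE xio ScE xiE vq h1 h2 h3 h4 h5 h6 h7 h8 Mx).
Qed.

End TwoLetters.

(** * Levi rank one: two kernel fields *)

Section OneLetter.
Variables (a k k' : 'I_3) (zi : A).
Hypothesis cov : forall F : 'I_3 -> A, \sum_c F c = F a + F k + F k'.
Hypothesis cases3 : forall c : 'I_3, [\/ c = a, c = k | c = k'].
Hypotheses (ak : a != k) (ak' : a != k') (kk' : k != k').
Hypothesis ziE : zi * z a a = 1.
Hypothesis cjx : forall x, x * cj x = 0 -> x = 0.
Hypotheses (mk : z a a * z k k - z a k * z k a = 0) (mk' : z a a * z k' k' - z a k' * z k' a = 0).
Hypothesis m3 : (z a a * z k k - z a k * z k a) * z k' k' - z a k' * (z k' a * z k k - z k' k * z k a)
  - z k k' * (z k' k * z a a - z k' a * z a k) = 0.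
Definition c1 e (_ : 'I_1) := - zi * z e a.
Definition s1 e := Lb a (- zi * z e a).
(** Numerator of the derivative of the slope [s1 k' / s1 k], the third order invariant. *)
Definition s1' := Lb a (s1 k') * s1 k - s1 k' * Lb a (s1 k).
Definition l1 (_ : 'I_1) := a.

(** By the Desnanot-Jacobi identity its product with its conjugate is the product of two vanishing
    principal minors minus [z a a] times the vanishing determinant; [cjx] concludes. *)
Lemma rank1_off : z a a * z k k' - z k a * z a k' = 0.
Proof.
apply: cjx; rewrite cjD cj_N' !(cjM (z _ _)) !cjz3.
transitivity ((z a a * z k k - z a k * z k a) * (z a a * z k' k' - z a k' * z k' a)
  - z a a * ((z a a * z k k - z a k * z k a) * z k' k' - z a k' * (z k' a * z k k - z k' k * z k a)
  - z k k' * (z k' k * z a a - z k' a * z a k))); first by ring.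
by rewrite m3 mk; ring.
Qed.
Lemma rank1_off' : z a a * z k' k - z k' a * z a k = 0.
Proof.
have := congr1 cj rank1_off; rewrite cjD cj_N' !(cjM (z _ _)) !cjz3 cj_0' => e; rewrite -[RHS]e; ring.
Qed.
Lemma zK1_of e b : z a a * z e b - z e a * z a b = 0 -> z e b + \sum_(i < 1) c1 e i * z (l1 i) b = 0.
Proof.
move=> h; rewrite big_ord1 /c1 /l1; transitivity (zi * (z a a * z e b - z e a * z a b)); last by rewrite h mulr0.
by transitivity ((zi * z a a) * z e b - zi * z e a * z a b); [rewrite ziE|]; ring.
Qed.
Lemma zK1 b : z k b + \sum_(i < 1) c1 k i * z (l1 i) b = 0.
Proof.
apply: zK1_of; case: (cases3 b) => ->; first by ring.
  by rewrite -[RHS]mk; ring.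
exact: rank1_off.
Qed.
Lemma zK1' b : z k' b + \sum_(i < 1) c1 k' i * z (l1 i) b = 0.
Proof.
apply: zK1_of; case: (cases3 b) => ->; first by ring.
  exact: rank1_off'.
by rewrite -[RHS]mk'; ring.
Qed.

Section OneKernel.
Variable e : 'I_3.
Hypothesis zKe : forall b, z e b + \sum_(i < 1) c1 e i * z (l1 i) b = 0.
Hypothesis ae : a != e.
Local Notation c := (- zi * z e a).
Local Notation K := (K3 l1 e (c1 e)).

(** [Psym] with a single letter. All first derivatives of the kernel coefficient are thus controlled
    by the one function [s1 e], and if it vanished the coefficient would be CR. *)
Lemma Lbc m : Lb m c = s1 e * (zi * z a m).
Proof.
have := Psym zKe m a; rewrite !big_ord1 /c1 /l1 => h.
transitivity (Lb m c * (zi * z a a)); first by rewrite ziE mulr1.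
by rewrite mulrCA h /s1; ring.
Qed.
Lemma s1_neq0 : s1 e != 0.
Proof.
apply/eqP => s0; apply: (@kernel_degenerate 1 l1 e (c1 e)) => // i m.
by rewrite /c1 Lbc s0 mul0r.
Qed.
Lemma zKe1 b : z b e + cj c * z b a = 0.
Proof. by have := zKb zKe b; rewrite big_ord1. Qed.
Lemma K1L f : K (L a f) = L a (K f) - L a c * L a f.
Proof. by have := K3L l1 e (c1 e) a f; rewrite big_ord1. Qed.
Lemma K1Lb f : K (Lb a f) = Lb a (K f) - s1 e * L a f.
Proof. by have := K3Lb zKe a f; rewrite big_ord1. Qed.
Lemma K1T f : K (T f) = T (K f) + th3 l1 e (c1 e) * T f - T c * L a f.
Proof. by have := K3T l1 e (c1 e) f; rewrite big_ord1. Qed.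
(** Apply [K] to [L a (Lb a (cj f0)) = z a a * T (cj f0)]: both [L a] and [K] annihilate [cj f0],
    and [T (cj f0)] is a unit. *)
Lemma K1z : K (z a a) = - (L a c + th3 l1 e (c1 e)) * z a a.
Proof.
have Lf : L a (cj f0) = 0 by rewrite -cjLb Lbf0 cj_0'.
have Kf : K (cj f0) = 0 by exact: Kcjf0.
have dK := dK3 l1 e (c1 e).
have h := LLb3 a a (cj f0); rewrite Lf (der0 (dLb a)) in h.
have h1 : L a (Lb a (cj f0)) = z a a * T (cj f0) by apply/eqP; rewrite -subr_eq0 -h.
have := congr1 K h1; rewrite K1L K1Lb (proj2 dK) K1T Kf Lf mulr0 !subr0 (der0 (dLb a)) (der0 dT3) (der0 (dL3 a)) h1 => h2.
have t1 : cj (io * r0) * T (cj f0) = 1.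
  by rewrite -cjT -cjM Tf0 -[LHS]mulr1 -[X in _ * X]cjK -cjM mul1r cjK.
transitivity (cj (io * r0) * (K (z a a) * T (cj f0))); first by rewrite mulrCA t1 mulr1.
transitivity (cj (io * r0) * T (cj f0) * (- (L a c + th3 l1 e (c1 e)) * z a a)); last by rewrite t1 mul1r.
have -> : K (z a a) * T (cj f0) = (0 - L a c * (z a a * T (cj f0))) - z a a * (0 + th3 l1 e (c1 e) * T (cj f0)).
  by rewrite h2; ring.
by ring.
Qed.
Lemma Kb1_eq0 j : (forall b, z b j + cj (- zi * z j a) * z b a = 0) -> Lb j c + cj (- zi * z j a) * Lb a c = 0.
Proof.
move=> h; rewrite !Lbc; transitivity (s1 e * zi * (z a j + cj (- zi * z j a) * z a a)); first by ring.
by rewrite h mulr0.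
Qed.
(** [Kb1_eq0] differentiated along [Lb a]. A conjugate kernel field multiplies [s1 e] by a factor
    that does not depend on [e], so it annihilates the slope [s1 k' / s1 k]. *)
Lemma Kb1_s j : (forall b, z b j + cj (- zi * z j a) * z b a = 0) ->
  Lb j (s1 e) + cj (- zi * z j a) * Lb a (s1 e) = - cj (L a (- zi * z j a)) * s1 e.
Proof.
move=> h; have := congr1 (Lb a) (Kb1_eq0 h).
rewrite (proj1 (dLb a)) (proj2 (dLb a)) (der0 (dLb a)) -/(s1 e) LbLb cjL3 => h1.
rewrite -/(s1 e); apply/eqP; rewrite -subr_eq0; apply/eqP; rewrite -[RHS]h1; ring.
Qed.
End OneKernel.

Hypotheses (dsk : dec (s1 k)) (dsk' : dec (s1 k')) (ds : dec s1').

Lemma s1_unit : exists si, si * s1 k = 1.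
Proof.
have := s1_neq0 zK1 ak; case: dsk => [->|u _]; first by rewrite eqxx.
exact: unitA.
Qed.

Section Slope.
Variable si : A.
Hypothesis siE : si * s1 k = 1.
Local Notation e := (si * s1 k').

Lemma der_e m : Lb m e = si * si * (Lb m (s1 k') * s1 k - s1 k' * Lb m (s1 k)).
Proof.
have h : Lb m si * s1 k + si * Lb m (s1 k) = 0 by rewrite -(proj2 (dLb m)) siE (der1 (dLb m)).
rewrite (proj2 (dLb m)).
transitivity (Lb m si * (si * s1 k) * s1 k' + si * Lb m (s1 k')); first by rewrite siE mulr1.
transitivity (si * (Lb m si * s1 k + si * Lb m (s1 k)) * s1 k' - si * si * Lb m (s1 k) * s1 k' + (si * s1 k) * si * Lb m (s1 k')).
  have -> : si * s1 k * si * Lb m (s1 k') = si * Lb m (s1 k') by rewrite siE mul1r.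
  by ring.
by rewrite h; ring.
Qed.

Lemma Lb_e_ker j : (forall b, z b j + cj (- zi * z j a) * z b a = 0) -> Lb j e = - cj (- zi * z j a) * Lb a e.
Proof.
move=> h; have h1 := Kb1_s zK1 h; have h2 := Kb1_s zK1' h.
have {}h1 : Lb j (s1 k) = - cj (L a (- zi * z j a)) * s1 k - cj (- zi * z j a) * Lb a (s1 k) by rewrite -h1; ring.
have {}h2 : Lb j (s1 k') = - cj (L a (- zi * z j a)) * s1 k' - cj (- zi * z j a) * Lb a (s1 k') by rewrite -h2; ring.
by rewrite !der_e h1 h2; ring.
Qed.

Lemma Lb_e m : Lb m e = Lb a e * (zi * z a m).
Proof.
have aux j : (forall b, z b j + cj (- zi * z j a) * z b a = 0) -> Lb j e = Lb a e * (zi * z a j).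
  move=> h; rewrite Lb_e_ker //; have := h a => /eqP; rewrite addr_eq0 => /eqP ->.
  by transitivity (- cj (- zi * z j a) * Lb a e * (zi * z a a)); [rewrite ziE mulr1|ring].
case: (cases3 m) => ->; first by rewrite ziE mulr1.
  by apply: aux => b; exact: (zKe1 zK1).
by apply: aux => b; exact: (zKe1 zK1').
Qed.

(* The coefficients of [K' - e K] on the frame. *)
Definition n1 (b : 'I_3) := (b == k')%:R - e * (b == k)%:R + (- zi * z k' a + e * (zi * z k a)) * (b == a)%:R.

(** The slope [e] is chosen so that the second order tensors of the two kernel fields cancel in
    [K' - e K]; only the derivative of [e] remains, multiplied by the coefficients of [K]. *)
Lemma Lb_n1 m b : Lb m (n1 b) = - Lb m e * ((b == k)%:R + (- zi * z k a) * (b == a)%:R).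
Proof.
have nat0 (q : bool) : Lb m q%:R = 0 by exact: (der_nat _ (dLb m)).
have h1 := Lbc zK1 m; have h2 := Lbc zK1' m.
have -> : n1 b = (b == k')%:R - e * (b == k)%:R + (- zi * z k' a - e * (- zi * z k a)) * (b == a)%:R by rewrite /n1; ring.
have es : e * s1 k = s1 k' by rewrite mulrAC siE mul1r.
move: (si * s1 k') es => e0 es.
rewrite !(proj1 (dLb m)) (derN _ (dLb m)) !(proj2 (dLb m)) !(proj1 (dLb m)) (derN _ (dLb m)) !nat0.
rewrite [Lb m (- zi * z k' a)]h2 [Lb m (e0 * (- zi * z k a))](proj2 (dLb m)) h1.
transitivity (- Lb m e0 * ((b == k)%:R + (- zi * z k a) * (b == a)%:R) + (s1 k' - e0 * s1 k) * (zi * z a m) * (b == a)%:R).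
  by ring.
by rewrite es; ring.
Qed.

Lemma n1_ker b : \sum_c n1 c * z c b = 0.
Proof.
have h1 := zK1 b; have h2 := zK1' b; rewrite !big_ord1 /c1 /l1 in h1 h2.
rewrite cov /n1 !eqxx (negbTE ak) (negbTE ak') (negbTE kk') !(eq_sym _ a) (negbTE ak) (negbTE ak') (eq_sym k') (negbTE kk') /=.
transitivity ((z k' b + - zi * z k' a * z a b) - e * (z k b + - zi * z k a * z a b)); first by ring.
by rewrite h1 h2; ring.
Qed.

(** With a CR slope [K' - e K] would have CR coefficients, against [nondeg]. *)
Lemma Lb_e_neq0 : Lb a e != 0.
Proof.
apply/eqP => h; apply: (nondeg (v := n1)).
- by move=> b m; rewrite Lb_n1 Lb_e h; ring.
- exact: n1_ker.
- exists k'; rewrite /n1 eqxx (eq_sym k' k) (negbTE kk') (eq_sym k' a) (negbTE ak') !mulr0 subr0 addr0 ev1.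
  by rewrite oner_neq0.
Qed.

Lemma Lb_e_unit : exists ri, ri * Lb a e = 1.
Proof.
have := Lb_e_neq0; rewrite der_e -/s1'; case: ds => [->|/unitA[u uE] _]; first by rewrite mulr0 eqxx.
exists (s1 k * s1 k * u); transitivity ((si * s1 k) * (si * s1 k) * (u * s1')); first by ring.
by rewrite siE uE !mul1r.
Qed.

(** A chain of unknowns: [Lb a (hh Z)] determines [Y'], the derivative of [Y'] determines [u], that
    of [u] determines [y2], and [Lb a y2 = 0]. Each step divides by a unit [z a a], [s1 k] or
    [Lb a e], and the fourth derivative brings nothing new. *)
Lemma S0_rank1 Z : adm Z -> Mo (X1 (L a) (Lb a)) T (hh Z) 4 (N (L a) (Lb a) T (hh Z) 0 0 4).
Proof.
move=> aZ; set M := Mo _ _ _; have [ri riE] := Lb_e_unit.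
have MLb n x : M n x -> M n.+1 (Lb a x) by exact: (@Mo_X A bool (X1 (L a) (Lb a)) T (hh Z) false n x).
pose y1 := Z (jj k); pose y2 := Z (jj k').
pose Y' := Z (jj a) - (- zi * z k a) * y1 - (- zi * z k' a) * y2.
have hE : Lb a (hh Z) = z a a * Y' - tb a * hh Z.
  rewrite Lbh // cov; congr (_ - _); rewrite /Y' -/y1 -/y2.
  transitivity (z a a * Z (jj a) + (zi * z a a) * (z k a * y1) + (zi * z a a) * (z k' a * y2)); last by ring.
  by rewrite ziE; ring.
have Ly1 : Lb a y1 = 0 by exact: (proj1 aZ).
have Ly2 : Lb a y2 = 0 by exact: (proj1 aZ).
pose u := y1 + e * y2.
have LY : Lb a Y' = - (s1 k * u).
  rewrite /Y' !(derB _ _ (dLb a)) (proj1 aZ) (proj2 (dLb a) (- zi * z k a)) (proj2 (dLb a) (- zi * z k' a)) Ly1 Ly2 -!/(s1 _) /u.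
  transitivity (- (s1 k * y1 + (si * s1 k) * (s1 k' * y2))); [by rewrite siE; ring|ring].
have Lu : Lb a u = Lb a e * y2.
  by rewrite /u (proj1 (dLb a)) (proj2 (dLb a) e) Ly1 Ly2; ring.
have h0 : M 1 (hh Z) by exact: Mo_h.
have h1 : M 2 (Lb a (hh Z)) by exact: MLb.
have MY : M 2 Y'.
  have -> : Y' = zi * (Lb a (hh Z) + tb a * hh Z).
    by rewrite hE subrK mulrA ziE mul1r.
  by apply: MoZ; apply: MoD => //; apply: MoZ; exact: Mo_S.
have g1 : M 2 (Lb a (Lb a (hh Z)) + z a a * s1 k * u).
  have w1 := MoZ (Lb a (z a a)) MY; have w2 := MoZ (Lb a (tb a)) (Mo_S h0); have w3 := MoZ (tb a) h1.
  apply: Mo_eq (MoB w1 (MoD w2 w3)) _.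
  by rewrite hE (derB _ _ (dLb a)) (proj2 (dLb a) (z a a)) (proj2 (dLb a) (tb a)) LY hE; ring.
have cu : si * zi * (z a a * s1 k) = 1 by transitivity ((si * s1 k) * (zi * z a a)); [ring|rewrite siE ziE mul1r].
have Mu : M 3 u.
  apply: (Mo_cancel cu); apply: Mo_eq (MoB (Mo_S g1) (MLb _ _ h1)) _; ring.
have g2 : M 3 (Lb a (Lb a (Lb a (hh Z))) + z a a * s1 k * Lb a e * y2).
  apply: Mo_eq (MoB (MLb _ _ g1) (MoZ (Lb a (z a a * s1 k)) Mu)) _.
  by rewrite (proj1 (dLb a)) (proj2 (dLb a) _ u) Lu; ring.
have cr : si * zi * ri * (z a a * s1 k * Lb a e) = 1.
  transitivity ((si * zi * (z a a * s1 k)) * (ri * Lb a e)); [ring|by rewrite cu riE mul1r].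
have My2 : M 4 y2.
  apply: (Mo_cancel cr); apply: Mo_eq (MoB (Mo_S g2) (MLb _ _ (MLb _ _ (MLb _ _ h0)))) _; ring.
apply: Mo_eq (MoB (MLb _ _ g2) (MoZ (Lb a (z a a * s1 k * Lb a e)) My2)) _.
by rewrite /N /= (proj1 (dLb a)) (proj2 (dLb a) _ y2) Ly2; ring.
Qed.

Lemma flat1 Z : adm Z -> (forall m x, Mo (X1 (L a) (Lb a)) T (hh Z) m x -> ev x = 0) -> flat_module (hh Z).
Proof.
move=> aZ v; exists (fun x => exists m, Mo (X1 (L a) (Lb a)) T (hh Z) m x).
have ML m x : Mo (X1 (L a) (Lb a)) T (hh Z) m x -> Mo (X1 (L a) (Lb a)) T (hh Z) m.+1 (L a x).
  exact: (@Mo_X A bool (X1 (L a) (Lb a)) T (hh Z) true m x).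
have MLb m x : Mo (X1 (L a) (Lb a)) T (hh Z) m x -> Mo (X1 (L a) (Lb a)) T (hh Z) m.+1 (Lb a x).
  exact: (@Mo_X A bool (X1 (L a) (Lb a)) T (hh Z) false m x).
have Mcj m x : Mo (X1 (L a) (Lb a)) T (hh Z) m x -> Mo (X1 (L a) (Lb a)) T (hh Z) m (cj x).
  elim=> {m x} [|m|m b x x' _ IHx _ IHx'|m x _ IH|[] m x _ IH|m x _ IH].
  - by rewrite (adm_real aZ); exact: Mo_h.
  - by rewrite cj_0'; exact: Mo_0.
  - by rewrite cjD cjM; exact: Mo_lc.
  - exact: Mo_S.
  - by rewrite /X1 cjL3; exact: MLb.
  - by rewrite /X1 cjLb; exact: ML.
  - by rewrite cjT; exact: Mo_T.
have MK d (zKd : forall b, z d b + \sum_(i < 1) c1 d i * z (l1 i) b = 0) m x :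
    Mo (X1 (L a) (Lb a)) T (hh Z) m x -> Mo (X1 (L a) (Lb a)) T (hh Z) m.+1 (L d x).
  move=> Mx; have -> : L d x = K3 l1 d (c1 d) x - (- zi * z d a) * L a x by rewrite /K3 big_ord1 /c1 /l1; ring.
  apply: MoB; last by apply: MoZ; exact: ML.
  apply: Mo_S; apply: (K_Mo (dK3 l1 d (c1 d)) (K1L d) (K1Lb zKd) (K1T d) (K3h zKd aZ) Mx).
have Mall d m x : Mo (X1 (L a) (Lb a)) T (hh Z) m x -> Mo (X1 (L a) (Lb a)) T (hh Z) m.+1 (L d x).
  by case: (cases3 d) => -> Mx; [exact: ML|apply: MK zK1 _ _ Mx|apply: MK zK1' _ _ Mx].
split.
- by exists 1%N; exact: Mo_h.
- move=> c x x' [m Mx] [m' Mx']; exists (maxn m m'); apply: Mo_lc; [apply: Mo_le Mx|apply: Mo_le Mx']; lia.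
- move=> d x [m Mx]; split; exists m.+1; first exact: Mall.
  by rewrite -[Lb d x]cjK cjLb; have Mc := Mcj _ _ Mx; apply: Mcj; exact: Mall.
- by move=> x [m Mx]; exists m.+2; exact: Mo_T.
- by move=> x [m Mx]; exact: v Mx.
Qed.
End Slope.

Theorem bounded_rank_one : bounded 20.
Proof.
have [si siE] := s1_unit.
exists [:: hh; (fun Z => L a (Lb a (hh Z))); (fun Z => T (hh Z)); (fun Z => T (L a (Lb a (hh Z)))); (fun Z => T (T (hh Z)));
     (fun Z => T (T (T (hh Z))))],
  [:: (fun Z => L a (hh Z)); (fun Z => L a (L a (hh Z))); (fun Z => L a (L a (L a (hh Z)))); (fun Z => L a (L a (Lb a (hh Z))));
     (fun Z => T (L a (hh Z))); (fun Z => T (L a (L a (hh Z)))); (fun Z => T (T (L a (hh Z))))]; split=> //.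
  have lh := linA_hh.
  move=> G; case=> [<-|]; first exact: lh.
  case=> [<-|]; first by apply: linA_L; exact: linA_Lb.
  case=> [<-|]; first exact: linA_T.
  case=> [<-|]; first by apply: linA_T; apply: linA_L; exact: linA_Lb.
  case=> [<-|]; first by do 2 apply: linA_T.
  case=> [<-|]; first by do 3 apply: linA_T.
  case=> [<-|]; first exact: linA_L.
  case=> [<-|]; first by do 2 apply: linA_L.
  case=> [<-|]; first by do 3 apply: linA_L.
  case=> [<-|]; first by do 2 apply: linA_L; exact: linA_Lb.
  case=> [<-|]; first by apply: linA_T; exact: linA_L.
  case=> [<-|]; first by apply: linA_T; do 2 apply: linA_L.
  by case=> [<-|//]; do 2 apply: linA_T; exact: linA_L.
move=> Z aZ HGr HGc; apply: (flat1 aZ) => m x Mx.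
have r1 := HGr hh (or_introl erefl).
have r2 := HGr _ (or_intror (or_introl erefl)).
have r3 := HGr _ (or_intror (or_intror (or_introl erefl))).
have r4 := HGr _ (or_intror (or_intror (or_intror (or_introl erefl)))).
have r5 := HGr _ (or_intror (or_intror (or_intror (or_intror (or_introl erefl))))).
have r6 := HGr _ (or_intror (or_intror (or_intror (or_intror (or_intror (or_introl erefl)))))).
have c1' := HGc _ (or_introl erefl).
have c2' := HGc _ (or_intror (or_introl erefl)).
have c3' := HGc _ (or_intror (or_intror (or_introl erefl))).
have c4' := HGc _ (or_intror (or_intror (or_intror (or_introl erefl)))).
have c5' := HGc _ (or_intror (or_intror (or_intror (or_intror (or_introl erefl))))).
have c6' := HGc _ (or_intror (or_intror (or_intror (or_intror (or_intror (or_introl erefl)))))).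
have c7' := HGc _ (or_intror (or_intror (or_intror (or_intror (or_intror (or_intror (or_introl erefl))))))).
exact: (rank_one_vanishing (dL3 a) (dLb a) dT3 (LLb3 a a) (LT3 a) (LbT3 a) ziE qE (dK3 l1 k (c1 k)) (K1L k) (K1Lb zK1)
  (K1T k) (K3h zK1 aZ) (K1z zK1) siE (S0_rank1 siE aZ) evD evM evC (cjL3 a) (cjLb a) cjT (adm_real aZ)
  r1 c1' c2' r2 r3 c3' c4' c5' c6' r4 r5 c7' r6 Mx).
Qed.

End OneLetter.
(** The vector consists of the coefficients of [K' - e K]. The first order condition is the kernel
    property; when it is differentiated, the derivative of the vector is a multiple of [K] and drops
    out as well. This is what contradicts 2-nondegeneracy. *)
Theorem rank_one_annihilator (a k k' : 'I_3) (zi : A) :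
  (forall F : 'I_3 -> A, \sum_c F c = F a + F k + F k') -> (forall c : 'I_3, [\/ c = a, c = k | c = k']) ->
  a != k -> a != k' -> k != k' -> zi * z a a = 1 -> (forall x, x * cj x = 0 -> x = 0) ->
  z a a * z k k - z a k * z k a = 0 -> z a a * z k' k' - z a k' * z k' a = 0 ->
  (z a a * z k k - z a k * z k a) * z k' k' - z a k' * (z k' a * z k k - z k' k * z k a)
    - z k k' * (z k' k * z a a - z k' a * z a k) = 0 -> dec (s1 a zi k) ->
  exists n : 'I_3 -> A, [/\ exists b, ev (n b) != 0, forall b, \sum_c n c * Lb b (r c) = 0 &
    forall b b', \sum_c n c * Lb b (Lb b' (r c)) = 0].
Proof.
move=> cov cases3 ak ak' kk' ziE cjx mk mk' m3 dsk.
have [si siE] : exists si, si * s1 a zi k = 1 by apply: s1_unit; try eassumption.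
have kerL (m : 'I_3 -> A) b : \sum_c m c * z c b = 0 -> \sum_c m c * Lb b (r c) = 0.
  move=> h; transitivity (- io * w0 * \sum_c m c * z c b); last by rewrite h mulr0.
  by rewrite mulr_sumr; apply: eq_bigr => c _; rewrite Lb_r; ring.
pose n := n1 a k k' zi si.
have n1' b : \sum_c n c * Lb b (r c) = 0.
  by apply: kerL; apply: n1_ker; try eassumption.
exists n; split=> //.
  exists k'; rewrite /n /n1 eqxx (eq_sym k' k) (negbTE kk') (eq_sym k' a) (negbTE ak') !mulr0 subr0 addr0 ev1.
  by rewrite oner_neq0.
move=> b b'; have := congr1 (Lb b) (n1' b'); rewrite (der0 (dLb b)) (der_sum _ (dLb b)).
under eq_bigr do rewrite (proj2 (dLb b)).
rewrite big_split /= [X in X + _](_ : _ = 0) ?add0r //.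
transitivity (- Lb b (si * s1 a zi k') * \sum_c ((c == k)%:R + (- zi * z k a) * (c == a)%:R) * Lb b' (r c)).
  rewrite mulr_sumr; apply: eq_bigr => c _; rewrite /n.
  rewrite [Lb b (n1 _ _ _ _ _ _)](_ : _ = - Lb b (si * s1 a zi k') * ((c == k)%:R + - zi * z k a * (c == a)%:R)).
    by rewrite mulrA.
  by apply: Lb_n1; try eassumption.
rewrite kerL ?mulr0 //.
have h : z k b' + - zi * z k a * z a b' = 0.
  have : z k b' + \sum_(i < 1) c1 a zi k i * z (l1 a i) b' = 0 by apply: zK1; try eassumption.
  by rewrite big_ord1.
rewrite cov !eqxx !(eq_sym _ a) (negbTE ak) (negbTE ak') (eq_sym k') (negbTE kk') /=.
by rewrite -[RHS]h; ring.
Qed.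

End Glue.

From mathcomp Require Import all_classical all_reals all_analysis.
From mathcomp Require Import complex.
From mathcomp Require Import ring lra zify.
Import Order.TTheory GRing.Theory Num.Theory.
Import numFieldNormedType.Exports.
Local Open Scope classical_set_scope.
Local Open Scope ring_scope.
Local Open Scope complex_scope.

(** * Real and complex differentiability *)

Section RealDiff.
Variable R : realType.
Local Notation V := 'rV[R]_8.

Lemma coord_le_norm (v : V) k : `|v 0 k| <= `|v|.
Proof. by rewrite [leRHS]/Num.norm /= mx_normrE; apply/bigmax_geP; right => /=; exists (0, k). Qed.

Lemma norm_le_coord (v : V) (e : R) : 0 <= e -> (forall k, `|v 0 k| <= e) -> `|v| <= e.
Proof.
move=> e0 H; rewrite [leLHS]/Num.norm /= mx_normrE; apply/bigmax_leP; split => // -[i k] _ /=.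
by rewrite (ord1 i).
Qed.

Lemma norm_evec k : `|@evec R k| = 1.
Proof.
apply/eqP; rewrite eq_le; apply/andP; split.
  apply: norm_le_coord => // j; rewrite /evec mxE eqxx /=.
  by case: (j == k); rewrite /= ?normr1 ?normr0.
by rewrite -[X in X <= _](normr1 R); have := coord_le_norm (evec R k) k; rewrite /evec mxE !eqxx.
Qed.

Lemma sum_evec (v : V) : v = \sum_(k < 8) v 0 k *: evec R k.
Proof. exact: row_sum_delta. Qed.

Lemma sum_norm_le (v : V) (G : 'I_8 -> R) (M : R) : (forall k, `|G k| <= M) ->
  `|\sum_(k < 8) v 0 k * G k| <= 8 * M * `|v|.
Proof.
move=> HG; apply: (le_trans (ler_norm_sum _ _ _)).
rewrite [leRHS](_ : _ = \sum_(k < 8) M * `|v|); last first.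
  by rewrite sumr_const card_ord -[RHS]mulr_natl mulrA.
apply: ler_sum => k _; rewrite normrM mulrC; apply: ler_pM => //.
exact: coord_le_norm.
Qed.

(** With [differentiable_estimate] this makes differentiability equivalent to an explicit remainder
    estimate, the form used for limits and integrals. *)
Lemma differentiable_of_estimate (f : V -> R) (x : V) (G : 'I_8 -> R) :
  (forall e : R, 0 < e -> \forall y \near x,
     `|f y - f x - \sum_(k < 8) (y - x) 0 k * G k| <= e * `|y - x|) ->
  differentiable f x /\ forall k, pd k f x = G k.
Proof.
move=> H.
pose L := fun v : V => (v *m (\col_k G k)) 0 0.
have LE v : L v = \sum_(k < 8) v 0 k * G k.
  by rewrite /L mxE; apply: eq_bigr => k _; rewrite mxE.
have Llin : linear L by move=> a u v; rewrite /L mulmxDl -scalemxAl !mxE.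
pose LL := HB.pack_for {linear V -> R} L (GRing.isLinear.Build _ _ _ _ L Llin).
have Lc : continuous LL.
  apply/linear_bounded_continuous/linear_boundedP.
  pose M := \sum_(k < 8) `|G k|.
  near=> r => v.
  apply: (@le_trans _ _ (8 * M * `|v|)); last first.
    by apply: ler_wpM2r => //; apply: ltW; near: r; exact: nbhs_pinfty_gt.
  rewrite /= LE; apply: sum_norm_le => k.
  by rewrite /M (bigD1 k) //= lerDl sumr_ge0.
have E : f \o shift x = cst (f x) + LL +o_ (0 : V) id.
  apply/eqaddoP => e e0; have := H e e0.
  rewrite (near_shift 0) subr0 => H1.
  near=> v; have := near H1 v; rewrite /= addrK => H2.
  rewrite !fctE /= opprD addrA LE; apply: H2 => //.
have dE := diff_unique Lc E.
have D : differentiable f x by apply/diff_locallyP; rewrite dE.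
split=> // k; rewrite /pd deriveE // dE /= LE (bigD1 k) //= big1 ?addr0.
  by rewrite /evec mxE !eqxx mul1r.
by move=> j jk; rewrite /evec mxE (negbTE jk) andbF mul0r.
Unshelve. all: by end_near.
Qed.

Lemma diff_linear_pd (f : V -> R) (x v : V) : differentiable f x ->
  'd f x v = \sum_(k < 8) v 0 k * pd k f x.
Proof.
move=> D; rewrite {1}(sum_evec v) linear_sum; apply: eq_bigr => k _.
by rewrite linearZ /= /pd deriveE.
Qed.

Lemma differentiable_estimate (f : V -> R) (x : V) : differentiable f x ->
  forall e : R, 0 < e -> \forall y \near x,
     `|f y - f x - \sum_(k < 8) (y - x) 0 k * pd k f x| <= e * `|y - x|.
Proof.
move=> D e e0; have /eqaddoP /(_ e e0) := diff_locally D.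
move=> H1; rewrite (near_shift 0) subr0; near=> v.
have : `|(f \o shift x - (cst (f x) + 'd f x)) v| <= e * `|v| by near: v.
by rewrite /= addrK !fctE /= opprD addrA diff_linear_pd.
Unshelve. all: by end_near.
Qed.

Lemma pdD k (f g : V -> R) x : differentiable f x -> differentiable g x ->
  pd k (fun y => f y + g y) x = pd k f x + pd k g x.
Proof. by move=> df dg; rewrite /pd -deriveD //; apply: diff_derivable. Qed.

Lemma pdB k (f g : V -> R) x : differentiable f x -> differentiable g x ->
  pd k (fun y => f y - g y) x = pd k f x - pd k g x.
Proof. by move=> df dg; rewrite /pd -deriveB //; apply: diff_derivable. Qed.

Lemma pdM k (f g : V -> R) x : differentiable f x -> differentiable g x ->
  pd k (fun y => f y * g y) x = pd k f x * g x + f x * pd k g x.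
Proof.
move=> df dg; rewrite /pd [LHS](@deriveM _ _ f g); [|exact: diff_derivable..].
by rewrite addrC [X in X + _]mulrC.
Qed.

Lemma pd_cst k (c : R) x : pd k (fun=> c) x = 0.
Proof. exact: derive_cst. Qed.

Lemma differentiable_near (f g : V -> R) x : (\forall y \near x, f y = g y) ->
  differentiable f x -> differentiable g x /\ forall k, pd k g x = pd k f x.
Proof.
move=> E D; apply: differentiable_of_estimate => e e0.
have H := differentiable_estimate D e0.
have fx : f x = g x by apply: nbhs_singleton E.
near=> y; have <- : f y = g y by near: y.
by rewrite -fx; near: y.
Unshelve. all: by end_near.
Qed.

End RealDiff.

Section ComplexDiff.
Variable R : realType.
Local Notation V := 'rV[R]_8.
Local Notation C := R[i].
Local Notation Re := complex.Re.
Local Notation Im := complex.Im.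

Lemma cReZ (a : R) (z : C) : Re (a%:C * z) = a * Re z.
Proof. by case: z => [x y] /=; rewrite mul0r subr0. Qed.
Lemma cImZ (a : R) (z : C) : Im (a%:C * z) = a * Im z.
Proof. by case: z => [x y] /=; rewrite mul0r addr0. Qed.
Lemma cReD (z w : C) : Re (z + w) = Re z + Re w. Proof. by case: z w => ? ? []. Qed.
Lemma cImD (z w : C) : Im (z + w) = Im z + Im w. Proof. by case: z w => ? ? []. Qed.
Lemma cReN (z : C) : Re (- z) = - Re z. Proof. by case: z. Qed.
Lemma cImN (z : C) : Im (- z) = - Im z. Proof. by case: z. Qed.
Lemma cReM (z w : C) : Re (z * w) = Re z * Re w - Im z * Im w. Proof. by case: z w => ? ? []. Qed.
Lemma cImM (z w : C) : Im (z * w) = Re z * Im w + Im z * Re w. Proof. by case: z w => ? ? []. Qed.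
Lemma Re_sum I (r : seq I) (F : I -> C) : Re (\sum_(i <- r) F i) = \sum_(i <- r) Re (F i).
Proof. by elim/big_rec2: _ => // i x y _ <-; rewrite cReD. Qed.
Lemma Im_sum I (r : seq I) (F : I -> C) : Im (\sum_(i <- r) F i) = \sum_(i <- r) Im (F i).
Proof. by elim/big_rec2: _ => // i x y _ <-; rewrite cImD. Qed.
Lemma Re_sumZ n (a : 'I_n -> R) (F : 'I_n -> C) : Re (\sum_i (a i)%:C * F i) = \sum_i a i * Re (F i).
Proof. by rewrite Re_sum; apply: eq_bigr => i _; rewrite cReZ. Qed.
Lemma Im_sumZ n (a : 'I_n -> R) (F : 'I_n -> C) : Im (\sum_i (a i)%:C * F i) = \sum_i a i * Im (F i).
Proof. by rewrite Im_sum; apply: eq_bigr => i _; rewrite cImZ. Qed.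
Lemma eqReIm (z w : C) : Re z = Re w -> Im z = Im w -> z = w.
Proof. by case: z w => ? ? [? ?] /= -> ->. Qed.

(* The l1 modulus: real valued and still submultiplicative. *)
Definition cn (z : C) : R := `|Re z| + `|Im z|.

Lemma cn_ge0 z : 0 <= cn z. Proof. by rewrite addr_ge0. Qed.
Lemma cn0 : cn 0 = 0. Proof. by rewrite /cn /= normr0 addr0. Qed.
Lemma cn1 : cn 1 = 1. Proof. by rewrite /cn /= normr0 normr1 addr0. Qed.
Lemma cni : cn 'i = 1. Proof. by rewrite /cn /= normr0 normr1 add0r. Qed.
Lemma cn_real (a : R) : cn a%:C = `|a|. Proof. by rewrite /cn /= normr0 addr0. Qed.
Lemma cnN z : cn (- z) = cn z. Proof. by rewrite /cn cReN cImN !normrN. Qed.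
Lemma cnD z w : cn (z + w) <= cn z + cn w.
Proof. by rewrite /cn cReD cImD addrACA lerD // ler_normD. Qed.
Lemma cnB z w : cn (z - w) <= cn z + cn w.
Proof. by rewrite -(cnN w) cnD. Qed.
Lemma cnM z w : cn (z * w) <= cn z * cn w.
Proof.
rewrite /cn cReM cImM mulrDl !mulrDr -!normrM.
apply: (@le_trans _ _ ((`|Re z * Re w| + `|Im z * Im w|) + (`|Re z * Im w| + `|Im z * Re w|))).
  by rewrite lerD // ?ler_normB ?ler_normD.
by rewrite le_eqVlt; apply/orP; left; apply/eqP; ring.
Qed.
Lemma cnX z n : cn (z ^+ n) <= cn z ^+ n.
Proof.
elim: n => [|n IH]; first by rewrite !expr0 cn1.
by rewrite !exprS (le_trans (cnM _ _)) // ler_wpM2l // cn_ge0.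
Qed.
Lemma cn_Zr (a : R) z : cn (a%:C * z) = `|a| * cn z.
Proof. by case: z => x y; rewrite /cn /= !mul0r subr0 addr0 !normrM mulrDr. Qed.
Lemma cn_sum I (r : seq I) (F : I -> C) : cn (\sum_(i <- r) F i) <= \sum_(i <- r) cn (F i).
Proof.
elim/big_rec2: _ => [|i x y _ H]; first by rewrite cn0.
by rewrite (le_trans (cnD _ _)) // lerD2l.
Qed.
Lemma cn_eq0 z : cn z = 0 -> z = 0.
Proof.
move/eqP; rewrite /cn paddr_eq0 // !normr_eq0 => /andP[/eqP a /eqP b]; exact: eqReIm.
Qed.
Lemma cn_gt0 z : (0 < cn z) = (z != 0).
Proof.
apply/idP/idP => [|nz]; first by apply: contraTneq => ->; rewrite cn0 ltxx.
by rewrite lt_neqAle cn_ge0 andbT; apply: contra nz => /eqP H; apply/eqP/cn_eq0.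
Qed.
Lemma cn_conj (z : C) : cn z^* = cn z.
Proof. by case: z => x y; rewrite /cn /= normrN. Qed.
Lemma Re_le_cn z : `|Re z| <= cn z. Proof. by rewrite lerDl. Qed.
Lemma Im_le_cn z : `|Im z| <= cn z. Proof. by rewrite lerDr. Qed.
(* [cn z <= 2 |z|] and [|z|^2 = z * conj z] *)
Lemma cnV_le (z : C) (d : R) : 0 < d -> d <= cn z -> cn z^-1 <= 2 / d.
Proof.
move=> d0 dz.
have z0 : z != 0 by rewrite -cn_gt0 (lt_le_trans d0).
have H : cn z ^+ 2 <= 2 * (Re z ^+ 2 + Im z ^+ 2).
  rewrite /cn -(real_normK (num_real (Re z))) -(real_normK (num_real (Im z))).
  have := sqr_ge0 (`|Re z| - `|Im z|); lra.
have N0 : 0 < Re z ^+ 2 + Im z ^+ 2.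
  have : 0 < cn z ^+ 2 by rewrite exprn_gt0 // (lt_le_trans d0).
  by lra.
have E : cn z^-1 = cn z / (Re z ^+ 2 + Im z ^+ 2).
  case: z {dz z0 H} N0 => x y /= N0; rewrite /cn /= normrN !normrM.
  by rewrite -mulrDl [X in _ * X]gtr0_norm // invr_gt0.
rewrite E ler_pdivrMr // mulrAC ler_pdivlMr //.
have : d * cn z <= cn z ^+ 2 by rewrite expr2 ler_wpM2r // cn_ge0.
by rewrite mulrC; lra.
Qed.

Definition cdiff (g : V -> C) (x : V) : Prop :=
  differentiable (fun y => Re (g y)) x /\ differentiable (fun y => Im (g y)) x.

Lemma cdiff_of_estimate (f : V -> C) (x : V) (G : 'I_8 -> C) :
  (forall e : R, 0 < e -> \forall y \near x,
     cn (f y - f x - \sum_(k < 8) ((y - x) 0 k)%:C * G k) <= e * `|y - x|) ->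
  cdiff f x /\ forall k, cpd k f x = G k.
Proof.
move=> H.
have [] := @differentiable_of_estimate R (fun y => Re (f y)) x (fun k => Re (G k)).
  move=> e e0; apply: filterS (H e e0) => y; apply: le_trans; apply: le_trans (Re_le_cn _); by rewrite !cReD !cReN Re_sumZ.
move=> d1 p1.
have [] := @differentiable_of_estimate R (fun y => Im (f y)) x (fun k => Im (G k)).
  move=> e e0; apply: filterS (H e e0) => y; apply: le_trans; apply: le_trans (Im_le_cn _); by rewrite !cImD !cImN Im_sumZ.
move=> d2 p2; split=> // k; apply: eqReIm; rewrite /cpd /= ?p1 ?p2 //.
Qed.

Lemma cdiff_estimate (f : V -> C) (x : V) : cdiff f x ->
  forall e : R, 0 < e -> \forall y \near x,
     cn (f y - f x - \sum_(k < 8) ((y - x) 0 k)%:C * cpd k f x) <= e * `|y - x|.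
Proof.
move=> [d1 d2] e e0; have e2 : 0 < e / 2 by lra.
have H1 := differentiable_estimate d1 e2; have H2 := differentiable_estimate d2 e2.
apply: filterS2 H1 H2 => y h1 h2.
rewrite /cn !cReD !cReN !cImD !cImN Re_sumZ Im_sumZ.
rewrite /cpd /=; lra.
Qed.

Lemma cdiff_near (f g : V -> C) x : (\forall y \near x, f y = g y) ->
  cdiff f x -> cdiff g x /\ forall k, cpd k g x = cpd k f x.
Proof.
move=> E [d1 d2].
have [a1 b1] : differentiable (fun y => Re (g y)) x /\ forall k, pd k (fun y => Re (g y)) x = pd k (fun y => Re (f y)) x.
  by apply: differentiable_near d1; apply: filterS E => y ->.
have [a2 b2] : differentiable (fun y => Im (g y)) x /\ forall k, pd k (fun y => Im (g y)) x = pd k (fun y => Im (f y)) x.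
  by apply: differentiable_near d2; apply: filterS E => y ->.
by split=> // k; rewrite /cpd b1 b2.
Qed.

Lemma cdiff_cst (c : C) x : cdiff (fun=> c) x.
Proof. by split; apply: differentiable_cst. Qed.
Lemma cpd_cst k (c : C) x : cpd k (fun=> c) x = 0.
Proof. by rewrite /cpd !pd_cst. Qed.

Lemma cdiffD f g x : cdiff f x -> cdiff g x ->
  cdiff (fun y => f y + g y) x /\ forall k, cpd k (fun y => f y + g y) x = cpd k f x + cpd k g x.
Proof.
move=> [f1 f2] [g1 g2]; split=> [|k].
  split; [under eq_fun do rewrite cReD|under eq_fun do rewrite cImD]; exact: differentiableD.
rewrite /cpd; under eq_fun do rewrite cReD; under [X in _ +i* pd _ X _]eq_fun do rewrite cImD.
by rewrite !pdD.
Qed.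

Lemma cdiffM f g x : cdiff f x -> cdiff g x ->
  cdiff (fun y => f y * g y) x /\
  forall k, cpd k (fun y => f y * g y) x = cpd k f x * g x + f x * cpd k g x.
Proof.
move=> [f1 f2] [g1 g2]; split=> [|k].
  split; [under eq_fun do rewrite cReM|under eq_fun do rewrite cImM].
    by apply: differentiableB; apply: differentiableM.
  by apply: differentiableD; apply: differentiableM.
rewrite /cpd; under eq_fun do rewrite cReM; under [X in _ +i* pd _ X _]eq_fun do rewrite cImM.
rewrite pdB ?pdD ?pdM //; try by apply: differentiableM.
by apply: eqReIm; rewrite !(cReD, cImD, cReM, cImM) /=; ring.
Qed.

Lemma cdiffN f x : cdiff f x ->
  cdiff (fun y => - f y) x /\ forall k, cpd k (fun y => - f y) x = - cpd k f x.
Proof.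
move=> df; have [d e] := cdiffM (cdiff_cst (-1) x) df.
have E : (fun y => -1 * f y) = (fun y => - f y) by apply/funext => y; rewrite mulN1r.
by rewrite -E; split=> // k; rewrite e cpd_cst mul0r add0r mulN1r.
Qed.

Lemma cdiff_conj f x : cdiff f x ->
  cdiff (fun y => (f y)^*) x /\ forall k, cpd k (fun y => (f y)^*) x = (cpd k f x)^*.
Proof.
move=> [d1 d2].
have E1 : (fun y => Re (f y)^*) = (fun y => Re (f y)) by apply/funext => y; case: (f y).
have E2 : (fun y => Im (f y)^*) = (fun y => - Im (f y)) by apply/funext => y; case: (f y).
split; first by rewrite /cdiff E1 E2; split=> //; exact: differentiableN.
move=> k; rewrite /cpd E1 E2; apply: eqReIm => //=.
by rewrite /pd [LHS]deriveN //; exact: diff_derivable.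
Qed.

Lemma cdiff_sum (I : Type) (r : seq I) (F : I -> V -> C) x : (forall i, cdiff (F i) x) ->
  cdiff (fun y => \sum_(i <- r) F i y) x /\
  forall k, cpd k (fun y => \sum_(i <- r) F i y) x = \sum_(i <- r) cpd k (F i) x.
Proof.
move=> dF; elim: r => [|i r [d e]].
  under eq_fun do rewrite big_nil; split=> [|k]; [exact: cdiff_cst|].
  by rewrite big_nil cpd_cst.
under eq_fun do rewrite big_cons; have [d' e'] := cdiffD (dF i) d.
by split=> // k; rewrite e' big_cons e.
Qed.

Lemma cdiff_cont (f : V -> C) x : cdiff f x ->
  forall e : R, 0 < e -> \forall y \near x, cn (f y - f x) < e.
Proof.
move=> [/differentiable_continuous d1 /differentiable_continuous d2] e e0.
have e2 : 0 < e / 2 by lra.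
move/cvgrPdist_lt: d1 => /(_ _ e2) h1; move/cvgrPdist_lt: d2 => /(_ _ e2) h2.
apply: filterS2 h1 h2 => y; rewrite /cn cReD cReN cImD cImN distrC (distrC (Im (f x))).
lra.
Qed.

(** Differentiability is read off the real and imaginary parts; the value comes from differentiating
    [f * f^-1 = 1] near [x]. *)
Lemma cdiffV f x : cdiff f x -> f x != 0 ->
  cdiff (fun y => (f y)^-1) x /\ forall k, cpd k (fun y => (f y)^-1) x = - cpd k f x * (f x)^-1 ^+ 2.
Proof.
move=> df fx.
have dN : differentiable (fun y => Re (f y) * Re (f y) + Im (f y) * Im (f y)) x.
  by case: df => *; apply: differentiableD; apply: differentiableM.
have N0 : Re (f x) * Re (f x) + Im (f x) * Im (f x) != 0.
  rewrite paddr_eq0 ?sqr_ge0 -?expr2 ?sqr_ge0 // !sqrf_eq0; apply: contra fx => /andP[/eqP a /eqP b].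
  by apply/eqP/eqReIm.
have d : cdiff (fun y => (f y)^-1) x.
  have E : (fun y => (f y)^-1) = (fun y =>
      (Re (f y) * (Re (f y) * Re (f y) + Im (f y) * Im (f y))^-1) +i*
      (- Im (f y) * (Re (f y) * Re (f y) + Im (f y) * Im (f y))^-1)).
    by apply/funext => y; case: (f y) => a b /=; rewrite -!expr2 mulNr.
  rewrite E; case: df => d1 d2; split => /=; apply: differentiableM => //.
  - exact: (differentiableV dN).
  - exact: differentiableN.
  - exact: (differentiableV dN).
split=> // k.
have E : \forall y \near x, (fun=> 1) y = f y * (f y)^-1.
  have := cdiff_cont df; have fx' := fx; rewrite -cn_gt0 in fx' => /(_ _ fx').
  apply: filterS => y H; rewrite mulfV //.
  by apply: contraTneq H => ->; rewrite sub0r cnN ltxx.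
have [_ /(_ k)] := cdiff_near E (cdiff_cst 1 x).
have [_ /(_ k) ->] := cdiffM df d; rewrite cpd_cst => H.
have {}H : f x * cpd k (fun y => (f y)^-1) x = - (cpd k f x * (f x)^-1).
  by apply/eqP; rewrite -addr_eq0 addrC H.
apply: (mulfI fx); rewrite {}H; field.
by [].
Qed.

End ComplexDiff.

(** * Gevrey-1 bounds and real-analytic functions *)

Section Segments.
Variable R : realType.
Local Notation V := 'rV[R]_8.
Local Notation C := R[i].
Local Notation Re := complex.Re.
Local Notation Im := complex.Im.

Lemma is_derive_line (u : V -> R) (x v : V) (t : R) : differentiable u (x + t *: v) ->
  is_derive t 1 (fun t : R => u (x + t *: v)) (\sum_(k < 8) v 0 k * pd k u (x + t *: v)).
Proof.
move=> D.
have E : (fun h : R => h^-1 *: (((fun t : R => u (x + t *: v)) \o shift t) (h *: 1) - u (x + t *: v)))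
       = (fun h : R => h^-1 *: ((u \o shift (x + t *: v)) (h *: v) - u (x + t *: v))).
  apply/funext => h /=; congr (_ *: (u _ - _)).
  by rewrite scalerDl /GRing.scale /= mulr1 addrCA.
apply: DeriveDef; first by rewrite /derivable E; exact: (diff_derivable D).
by rewrite /derive E -/(derive u (x + t *: v) v) deriveE // diff_linear_pd.
Qed.

Lemma segment_MVT (u : V -> R) (x v : V) :
  (forall t : R, 0 <= t <= 1 -> differentiable u (x + t *: v)) ->
  exists2 t : R, 0 <= t <= 1 & u (x + v) - u x = \sum_(k < 8) v 0 k * pd k u (x + t *: v).
Proof.
move=> D.
have := @MVT_segment R (fun t : R => u (x + t *: v)) (fun t : R => \sum_(k < 8) v 0 k * pd k u (x + t *: v)) 0 1 ler01.
case.
- move=> t; rewrite in_itv /= => /andP[t0 t1]; apply: is_derive_line; apply: D.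
  by rewrite !ltW.
- apply: continuous_in_subspaceT => t; rewrite inE /= in_itv /= => /D Dt.
  apply: differentiable_continuous; apply/derivable1_diffP.
  exact: (@ex_derive _ _ _ _ _ _ _ (is_derive_line Dt)).
move=> t; rewrite in_itv /= => tI H; exists t => //.
by move: H; rewrite scale1r scale0r addr0 subr0 mulr1.
Qed.

Lemma ball_segment (p x v : V) (r t : R) : ball p r x -> ball p r (x + v) -> 0 <= t <= 1 ->
  ball p r (x + t *: v).
Proof.
rewrite -!ball_normE /ball_ /= => hx hv /andP[t0 t1].
rewrite (_ : p - (x + t *: v) = (1 - t) *: (p - x) + t *: (p - (x + v))); last first.
  by apply/rowP => j; rewrite !mxE; ring.
apply: (le_lt_trans (ler_normD _ _)); rewrite !normrZ.
rewrite (ger0_norm t0) ger0_norm ?subr_ge0 //.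
have [->|tn0] := eqVneq t 0; first by rewrite mul0r addr0 subr0 mul1r.
have tp : 0 < t by rewrite lt_def tn0.
apply: (@lt_le_trans _ _ ((1 - t) * r + t * r)).
  by apply: ler_ltD; [rewrite ler_wpM2l ?subr_ge0 // ltW|rewrite ltr_pM2l].
by rewrite -mulrDl subrK mul1r.
Qed.

Variables (p : V) (r : R).
Local Notation O := (ball p r).

(* [gn n F f]: on the ball, [f] is n times differentiable, derivatives of order j being bounded by [F j]. *)
Fixpoint gn (n : nat) (F : nat -> R) (f : V -> C) : Prop :=
  (forall x, O x -> cdiff f x /\ cn (f x) <= F 0%N) /\
  (if n is m.+1 then forall k, gn m (fun j => F j.+1) (cpd k f) else True).

Lemma gn0 n F f : gn n F f -> forall x, O x -> cdiff f x /\ cn (f x) <= F 0%N.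
Proof. by case: n => [|n] []. Qed.
Lemma gnS n F f : gn n.+1 F f -> forall k, gn n (fun j => F j.+1) (cpd k f).
Proof. by case. Qed.

(** The constant is 2 (real and imaginary parts) times 8 (coordinates); applying this to the
    derivatives makes it 256 in [gn_quad]. *)
Lemma gn_lip (f : V -> C) F n x y : gn n.+1 F f -> O x -> O y ->
  cn (f y - f x) <= 16 * F 1%N * `|y - x|.
Proof.
move=> H Ox Oy; set v := y - x.
have yE : y = x + v by rewrite /v addrC subrK.
have D t : 0 <= t <= 1 -> O (x + t *: v) by apply: ball_segment => //; rewrite -yE.
have [t1 /D tI1 E1] := @segment_MVT (fun y => Re (f y)) x v (fun t tI => proj1 (proj1 (gn0 H (D t tI)))).
have [t2 /D tI2 E2] := @segment_MVT (fun y => Im (f y)) x v (fun t tI => proj2 (proj1 (gn0 H (D t tI)))).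
rewrite /cn cReD cReN cImD cImN yE E1 E2.
rewrite (_ : 16 * F 1%N * `|v| = 8 * F 1%N * `|v| + 8 * F 1%N * `|v|); last by ring.
have B z k : O z -> cn (cpd k f z) <= F 1%N by move=> /(gn0 (gnS H k))[].
apply: lerD; apply: sum_norm_le => k.
  by apply: (le_trans _ (B _ k tI1)); exact: (Re_le_cn (cpd k f _)).
by apply: (le_trans _ (B _ k tI2)); exact: (Im_le_cn (cpd k f _)).
Qed.

Lemma gn_quad (f : V -> C) F n x y : gn n.+2 F f -> O x -> O y ->
  cn (f y - f x - \sum_(k < 8) ((y - x) 0 k)%:C * cpd k f x) <= 256 * F 2%N * `|y - x| ^+ 2.
Proof.
move=> H Ox Oy; set v := y - x.
have yE : y = x + v by rewrite /v addrC subrK.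
have D t : 0 <= t <= 1 -> O (x + t *: v) by apply: ball_segment => //; rewrite -yE.
have [t1 tI1 E1] := @segment_MVT (fun y => Re (f y)) x v (fun t tI => proj1 (proj1 (gn0 H (D t tI)))).
have [t2 tI2 E2] := @segment_MVT (fun y => Im (f y)) x v (fun t tI => proj2 (proj1 (gn0 H (D t tI)))).
rewrite /cn !(cReD, cImD, cReN, cImN) Re_sumZ Im_sumZ yE E1 E2 -!sumrB.
under eq_bigr do rewrite -mulrBr; under [X in _ + `|X|]eq_bigr do rewrite -mulrBr.
have F2 : 0 <= F 2%N.
  by apply: le_trans (cn_ge0 _) (proj2 (gn0 (gnS (gnS H ord0) ord0) Ox)).
have B t k : 0 <= t <= 1 -> cn (cpd k f (x + t *: v) - cpd k f x) <= 16 * F 2%N * `|v|.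
  move=> tI; apply: le_trans (gn_lip (gnS H k) Ox (D t tI)) _.
  rewrite addrC addKr normrZ; case/andP: tI => t0 t1'; rewrite (ger0_norm t0).
  by rewrite ler_wpM2l ?mulr_ge0 // ler_piMl.
rewrite (_ : 256 * F 2%N * `|v| ^+ 2 = 8 * (16 * F 2%N * `|v|) * `|v| + 8 * (16 * F 2%N * `|v|) * `|v|); last by ring.
apply: lerD; apply: sum_norm_le => k.
  by apply: (le_trans _ (B _ k tI1)); have := Re_le_cn (cpd k f (x + t1 *: v) - cpd k f x); rewrite cReD cReN.
by apply: (le_trans _ (B _ k tI2)); have := Im_le_cn (cpd k f (x + t2 *: v) - cpd k f x); rewrite cImD cImN.
Qed.

Lemma gn_mono n F G f : (forall j, F j <= G j) -> gn n F f -> gn n G f.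
Proof.
elim: n F G f => [|n IH] F G f FG [H1 H2]; split=> //.
- by move=> x /H1[h1 h2]; split=> //; exact: le_trans (FG _).
- by move=> x /H1[h1 h2]; split=> //; exact: le_trans (FG _).
- by move=> k; apply: IH (H2 k) => j.
Qed.

Lemma gn_le m n F f : (m <= n)%N -> gn n F f -> gn m F f.
Proof.
elim: n m F f => [|n IH] [|m] F f //= mn [H1 H2]; split=> // k.
by apply: IH (H2 k).
Qed.

Lemma gn_eq n F f g : (forall x, O x -> f x = g x) -> gn n F f -> gn n F g.
Proof.
have nO (f' g' : V -> C) x : (forall x, O x -> f' x = g' x) -> O x -> \forall y \near x, f' y = g' y.
  move=> E Ox; apply: filterS (E) _; apply: open_nbhs_nbhs; split=> //; exact: ball_open.
elim: n F f g => [|n IH] F f g E [H1 H2]; split=> //.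
- by move=> x Ox; have [h1 h2] := H1 x Ox; have [d _] := cdiff_near (nO f g x E Ox) h1; rewrite -E.
- by move=> x Ox; have [h1 h2] := H1 x Ox; have [d _] := cdiff_near (nO f g x E Ox) h1; rewrite -E.
- move=> k; apply: IH (H2 k) => x Ox.
  by have [h1 h2] := H1 x Ox; have [_ ->] := cdiff_near (nO f g x E Ox) h1.
Qed.

Lemma near_in_ball (P : V -> Prop) x : (forall x, O x -> P x) -> O x -> \forall y \near x, P y.
Proof. by move=> H Ox; apply: filterS (H) _; apply: open_nbhs_nbhs; split=> //; exact: ball_open. Qed.

Lemma gn_of_cpd n F f (G : 'I_8 -> V -> C) :
  (forall x, O x -> cdiff f x /\ cn (f x) <= F 0%N) ->
  (forall k x, O x -> cpd k f x = G k x) ->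
  (forall k, gn n (fun j => F j.+1) (G k)) -> gn n.+1 F f.
Proof. by move=> H1 H2 H3; split=> // k; apply: gn_eq (H3 k) => x Ox; rewrite H2. Qed.

Lemma gnD n F G f g : gn n F f -> gn n G g -> gn n (fun j => F j + G j) (fun x => f x + g x).
Proof.
have H0 F0 G0 (f' g' : V -> C) : (forall x, O x -> cdiff f' x /\ cn (f' x) <= F0) ->
    (forall x, O x -> cdiff g' x /\ cn (g' x) <= G0) ->
    forall x, O x -> cdiff (fun x => f' x + g' x) x /\ cn (f' x + g' x) <= F0 + G0.
  move=> hf hg x Ox; have [d1 b1] := hf x Ox; have [d2 b2] := hg x Ox.
  by have [d _] := cdiffD d1 d2; split=> //; apply: le_trans (cnD _ _) _; rewrite lerD.
elim: n F G f g => [|n IH] F G f g [f1 f2] [g1 g2].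
  by split=> //; exact: H0.
apply: gn_of_cpd; [exact: H0| |by move=> k; exact: IH (f2 k) (g2 k)].
move=> k x Ox; have [d1 b1] := f1 x Ox; have [d2 b2] := g1 x Ox.
by have [_ ->] := cdiffD d1 d2.
Qed.

(** The Leibniz rule for bounds, in the recursive form that matches [gn]; it is the binomial
    convolution. *)
Fixpoint conv n (F G : nat -> R) : R :=
  if n is m.+1 then conv m (fun j => F j.+1) G + conv m F (fun j => G j.+1)
  else F 0%N * G 0%N.

Lemma gnM n F G f g : gn n F f -> gn n G g -> gn n (fun j => conv j F G) (fun x => f x * g x).
Proof.
have H0 F0 G0 (f' g' : V -> C) : (forall x, O x -> cdiff f' x /\ cn (f' x) <= F0) ->
    (forall x, O x -> cdiff g' x /\ cn (g' x) <= G0) ->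
    forall x, O x -> cdiff (fun x => f' x * g' x) x /\ cn (f' x * g' x) <= F0 * G0.
  move=> hf hg x Ox; have [d1 b1] := hf x Ox; have [d2 b2] := hg x Ox.
  have [d _] := cdiffM d1 d2; split=> //; apply: le_trans (cnM _ _) _.
  by rewrite ler_pM // cn_ge0.
elim: n F G f g => [|n IH] F G f g Hf Hg; have [f1 f2] := Hf; have [g1 g2] := Hg.
  by split=> //; exact: H0.
apply: (gn_of_cpd (G := fun k x => cpd k f x * g x + f x * cpd k g x)); first exact: H0.
  move=> k x Ox; have [d1 b1] := f1 x Ox; have [d2 b2] := g1 x Ox.
  by have [_ ->] := cdiffM d1 d2.
move=> k; apply: gnD; apply: IH; [exact: f2 k|exact: gn_le (leqnSn n) Hg|exact: gn_le (leqnSn n) Hf|exact: g2 k].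
Qed.

Lemma gn_cst n (c : C) : gn n (fun j => if j is 0%N then cn c else 0) (fun=> c).
Proof.
have Z m : gn m (fun=> 0) (fun=> 0 : C).
  elim: m => [|m IH].
    by split=> // x _; split; [exact: cdiff_cst|rewrite cn0].
  apply: (gn_of_cpd (G := fun _ _ => 0)) => // [x _|k x _].
    by split; [exact: cdiff_cst|rewrite cn0].
  by rewrite cpd_cst.
case: n => [|n].
  by split=> // x _; split=> //; exact: cdiff_cst.
apply: (gn_of_cpd (G := fun _ _ => 0)); last by move=> k; exact: Z.
  by move=> x _; split=> //; exact: cdiff_cst.
by move=> k x _; rewrite cpd_cst.
Qed.

Lemma gn_conj n F f : gn n F f -> gn n F (fun x => (f x)^*).
Proof.
elim: n F f => [|n IH] F f [f1 f2].
  split=> // x Ox; have [d b] := f1 x Ox; have [d' _] := cdiff_conj d.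
  by rewrite cn_conj.
apply: gn_of_cpd; last by move=> k; exact: IH (f2 k).
  by move=> x Ox; have [d b] := f1 x Ox; have [d' _] := cdiff_conj d; rewrite cn_conj.
by move=> k x Ox; have [d b] := f1 x Ox; have [_ ->] := cdiff_conj d.
Qed.

Lemma gnZ n F f (c : C) : gn n F f -> gn n (fun j => cn c * F j) (fun x => c * f x).
Proof.
elim: n F f => [|n IH] F f [f1 f2].
  split=> // x Ox; have [d b] := f1 x Ox; have [d' _] := cdiffM (cdiff_cst c x) d.
  by split=> //; apply: le_trans (cnM _ _) _; rewrite ler_wpM2l // cn_ge0.
apply: gn_of_cpd; last by move=> k; exact: IH (f2 k).
  move=> x Ox; have [d b] := f1 x Ox; have [d' _] := cdiffM (cdiff_cst c x) d.
  by split=> //; apply: le_trans (cnM _ _) _; rewrite ler_wpM2l // cn_ge0.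
move=> k x Ox; have [d b] := f1 x Ox; have [_ ->] := cdiffM (cdiff_cst c x) d.
by rewrite cpd_cst mul0r add0r.
Qed.

Lemma convE n F G : conv n F G = \sum_(j < n.+1) 'C(n, j)%:R * F j * G (n - j)%N.
Proof.
elim: n F G => [|n IH] F G; first by rewrite big_ord1 bin0 mul1r.
rewrite /= !IH.
transitivity (\sum_(j < n.+2) 'C(n, j)%:R * F j * G (n.+1 - j)%N
              + \sum_(j < n.+1) 'C(n, j)%:R * F j.+1 * G (n - j)%N).
  rewrite addrC [in RHS]big_ord_recr /= bin_small // !mul0r addr0; congr (_ + _).
  by apply: eq_bigr => j _; rewrite subSn // -ltnS.
rewrite big_ord_recl /= bin0 mul1r subn0 [RHS]big_ord_recl /= bin0 mul1r subn0 -addrA.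
congr (_ + _); rewrite -big_split; apply: eq_bigr => j _ /=.
by rewrite /bump /= add1n subSS binS natrD !mulrDl.
Qed.

(* The factor 2 is uniform in [n] because the second sequence has twice the radius of convergence. *)
Lemma conv_geo n (a e s : R) : 0 <= a -> 0 <= e -> 0 <= s ->
  conv n (fun j => a * s ^+ j * j`!%:R) (fun j => e * (s / 2) ^+ j * j`!%:R)
  <= 2 * a * e * s ^+ n * n`!%:R.
Proof.
move=> a0 e0 s0; rewrite convE.
apply: (@le_trans _ _ (\sum_(j < n.+1) a * e * s ^+ n * n`!%:R * 2^-1 ^+ (n - j))).
  rewrite le_eqVlt; apply/orP; left; apply/eqP; apply: eq_bigr => -[j jn] _ /=.
  rewrite ltnS in jn; rewrite -(bin_fact jn) !natrM exprMn.
  by rewrite -[X in _ = _ * _ * (s ^+ X) * _ * _](subnKC jn) exprD; ring.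
rewrite -mulr_sumr (_ : 2 * a * e * s ^+ n * n`!%:R = a * e * s ^+ n * n`!%:R * 2); last by ring.
apply: ler_wpM2l; first by rewrite !mulr_ge0 // exprn_ge0.
have -> : \sum_(j < n.+1) 2^-1 ^+ (n - j) = \sum_(j < n.+1) (2^-1 : R) ^+ j.
  rewrite (reindex_inj rev_ord_inj) /=; apply: eq_bigr => j _.
  by rewrite subSS subKn // -ltnS.
elim: n => [|n IH]; first by rewrite big_ord1 expr0; lra.
rewrite big_ord_recl expr0; under eq_bigr do rewrite lift0 exprS.
by rewrite -mulr_sumr; lra.
Qed.

(* Gevrey-1 bounds, i.e. quantitative real analyticity. *)
Definition gev (c s : R) (f : V -> C) : Prop := forall n, gn n (fun j => c * s ^+ j * j`!%:R) f.

Lemma gev_at c s f x : gev c s f -> O x -> cdiff f x /\ cn (f x) <= c.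
Proof. by move=> /(_ 0%N) H Ox; have := gn0 H Ox; rewrite expr0 fact0 !mulr1. Qed.

Lemma gev_eq c s f g : (forall x, O x -> f x = g x) -> gev c s f -> gev c s g.
Proof. by move=> E H n; exact: gn_eq E (H n). Qed.

Lemma gev_mono c s c' s' f : 0 <= c -> 0 <= s -> c <= c' -> s <= s' -> gev c s f -> gev c' s' f.
Proof.
move=> c0 s0 cc ss H n; apply: gn_mono (H n) => j.
by rewrite ler_wpM2r // ler_pM // ?exprn_ge0 // lerXn2r // nnegrE // (le_trans s0).
Qed.

Lemma gevD c c' s f g : gev c s f -> gev c' s g -> gev (c + c') s (fun x => f x + g x).
Proof.
move=> Hf Hg n; apply: gn_mono (gnD (Hf n) (Hg n)) => j.
by rewrite -!mulrDl.
Qed.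

Lemma gevZ a c s f : gev c s f -> gev (cn a * c) s (fun x => a * f x).
Proof. by move=> Hf n; apply: gn_mono (gnZ a (Hf n)) => j; rewrite !mulrA. Qed.

Lemma gevM a e s f g : 0 <= a -> 0 <= e -> 0 <= s -> gev a s f -> gev e (s / 2) g ->
  gev (2 * a * e) s (fun x => f x * g x).
Proof.
move=> a0 e0 s0 Hf Hg n; apply: gn_mono (gnM (Hf n) (Hg n)) => j.
exact: conv_geo.
Qed.

Lemma gev_cst c s : 0 <= s -> gev (cn c) s (fun=> c).
Proof.
move=> s0 n; apply: gn_mono (gn_cst n c) => -[|j]; first by rewrite expr0 fact0 !mulr1.
by rewrite !mulr_ge0 // ?cn_ge0 // exprn_ge0.
Qed.

Lemma gev_conj c s f : gev c s f -> gev c s (fun x => (f x)^*).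
Proof. by move=> H n; exact: gn_conj. Qed.

(** The factor [j.+1] of the shifted factorial is absorbed by doubling the rate. *)
Lemma gev_cpd c s f k : 0 <= c -> 0 <= s -> gev c s f -> gev (c * s) (2 * s) (cpd k f).
Proof.
move=> c0 s0 H n; apply: gn_mono (gnS (H n.+1) k) => j.
rewrite exprS factS natrM (_ : c * (s * s ^+ j) * (j.+1%:R * j`!%:R) = (c * s * s ^+ j * j`!%:R) * j.+1%:R); last by ring.
rewrite exprMn (_ : c * s * (2 ^+ j * s ^+ j) * j`!%:R = (c * s * s ^+ j * j`!%:R) * 2 ^+ j); last by ring.
rewrite ler_wpM2l ?mulr_ge0 ?exprn_ge0 // -natrX ler_nat.
exact: ltn_expl.
Qed.

End Segments.

(** * Bounded linear functionals and limits along an ultrafilter *)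

Section Functionals.
Variable R : realType.
Local Notation V := 'rV[R]_8.
Local Notation C := R[i].
Local Notation Re := complex.Re.
Local Notation Im := complex.Im.

Definition bnd (I : Type) (D : set I) (g : I -> C) : Prop := exists M, forall i, D i -> cn (g i) <= M.

(** Linear on all bounded families, with no regularity asked of them. Limits of sequences and
    contour integrals are both of this kind. *)
Definition blf (I : Type) (D : set I) (l : R) (Phi : (I -> C) -> C) : Prop :=
  [/\ 0 <= l,
   forall g1 g2 a, bnd D g1 -> bnd D g2 -> Phi (fun i => g1 i + a * g2 i) = Phi g1 + a * Phi g2
   & forall g M, (forall i, D i -> cn (g i) <= M) -> cn (Phi g) <= l * M].

Lemma bndD (I : Type) (D : set I) (g1 g2 : I -> C) : bnd D g1 -> bnd D g2 -> bnd D (fun i => g1 i + g2 i).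
Proof.
by move=> [M1 H1] [M2 H2]; exists (M1 + M2) => i Di; apply: le_trans (cnD _ _) _; rewrite lerD ?H1 ?H2.
Qed.
Lemma bndB (I : Type) (D : set I) (g1 g2 : I -> C) : bnd D g1 -> bnd D g2 -> bnd D (fun i => g1 i - g2 i).
Proof.
by move=> [M1 H1] [M2 H2]; exists (M1 + M2) => i Di; apply: le_trans (cnB _ _) _; rewrite lerD ?H1 ?H2.
Qed.
Lemma bndM (I : Type) (D : set I) (g1 g2 : I -> C) : bnd D g1 -> bnd D g2 -> bnd D (fun i => g1 i * g2 i).
Proof.
move=> [M1 H1] [M2 H2]; exists (M1 * M2) => i Di; apply: le_trans (cnM _ _) _.
by rewrite ler_pM ?cn_ge0 ?H1 ?H2.
Qed.
Lemma bnd_cst (I : Type) (D : set I) (a : C) : bnd D (fun=> a).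
Proof. by exists (cn a). Qed.

Section Linear.
Variables (I : Type) (D : set I) (l : R) (Phi : (I -> C) -> C).
Hypothesis HPhi : blf D l Phi.

Lemma blf0 : Phi (fun=> 0) = 0.
Proof.
case: HPhi => l0 _ B; apply: cn_eq0; apply/eqP; rewrite eq_le cn_ge0 andbT.
by rewrite -(mulr0 l); apply: B => i _; rewrite cn0.
Qed.
Lemma blfZ a g : bnd D g -> Phi (fun i => a * g i) = a * Phi g.
Proof.
move=> bg; case: (HPhi) => _ L _; have := L _ _ a (bnd_cst D 0) bg.
by rewrite blf0 add0r; under eq_fun do rewrite add0r.
Qed.
Lemma blfD g1 g2 : bnd D g1 -> bnd D g2 -> Phi (fun i => g1 i + g2 i) = Phi g1 + Phi g2.
Proof.
move=> b1 b2; case: (HPhi) => _ L _; have := L _ _ 1 b1 b2.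
by rewrite mul1r; under eq_fun do rewrite mul1r.
Qed.
Lemma blfB g1 g2 : bnd D g1 -> bnd D g2 -> Phi (fun i => g1 i - g2 i) = Phi g1 - Phi g2.
Proof.
move=> b1 b2; case: (HPhi) => _ L _; have := L _ _ (-1) b1 b2.
by rewrite mulN1r; under eq_fun do rewrite mulN1r.
Qed.
Lemma blf_sum (J : Type) (r : seq J) (a : J -> C) (g : J -> I -> C) : (forall j, bnd D (g j)) ->
  bnd D (fun i => \sum_(j <- r) a j * g j i) /\
  Phi (fun i => \sum_(j <- r) a j * g j i) = \sum_(j <- r) a j * Phi (g j).
Proof.
move=> bg; elim: r => [|j r [b IH]].
  rewrite big_nil; under eq_fun do rewrite big_nil; split; [exact: bnd_cst|exact: blf0].
rewrite big_cons; under eq_fun do rewrite big_cons.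
have b' : bnd D (fun i => a j * g j i) by apply: bndM => //; exact: bnd_cst.
by split; [exact: bndD|rewrite blfD // blfZ // IH].
Qed.

(** Differentiation under the functional: the quadratic remainder of [gn_quad] is uniform in the
    parameter, so [Phi] carries it to the result. *)
Lemma gn_blf (p : V) (r : R) n F (f : I -> V -> C) :
  (forall i, D i -> forall m, gn p r m F (f i)) ->
  gn p r n (fun j => l * F j) (fun x => Phi (fun i => f i x)) /\
  forall k x, ball p r x -> cpd k (fun x => Phi (fun i => f i x)) x = Phi (fun i => cpd k (f i) x).
Proof.
case: (HPhi) => l0 _ B.
have bf F' (f' : I -> V -> C) : (forall i, D i -> forall m, gn p r m F' (f' i)) ->
    forall x, ball p r x -> bnd D (fun i => f' i x).
  by move=> H x Ox; exists (F' 0%N) => i Di; have [] := gn0 (H i Di 0%N) Ox.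
have key F' (f' : I -> V -> C) : (forall i, D i -> forall m, gn p r m F' (f' i)) ->
    forall x, ball p r x -> (cdiff (fun x => Phi (fun i => f' i x)) x /\
      forall k, cpd k (fun x => Phi (fun i => f' i x)) x = Phi (fun i => cpd k (f' i) x)) /\
      cn (Phi (fun i => f' i x)) <= l * F' 0%N.
  move=> H x Ox; split; last first.
    by apply: B => i Di; have [] := gn0 (H i Di 0%N) Ox.
  have H' k i : D i -> forall m, gn p r m (fun j => F' j.+1) (cpd k (f' i)).
    by move=> Di m; exact: gnS (H i Di m.+1) k.
  apply: cdiff_of_estimate => e e0.
  pose K := l * (256 * F' 2%N).
  have N1 : \forall y \near x, `|K| * `|y - x| < e.
    have [->|Kn] := eqVneq K 0; first by near=> y; rewrite normr0 mul0r.
    near=> y; rewrite mulrC -ltr_pdivlMr ?normr_gt0 // distrC.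
    near: y; apply: cvgr_dist_lt; [exact: cvg_id|by rewrite divr_gt0 // normr_gt0].
  have N2 : \forall y \near x, ball p r y by exact: near_in_ball Ox.
  apply: filterS2 N1 N2 => y Hy Oy.
  have -> : Phi (fun i => f' i y) - Phi (fun i => f' i x) -
      \sum_(k < 8) ((y - x) 0 k)%:C * Phi (fun i => cpd k (f' i) x)
    = Phi (fun i => f' i y - f' i x - \sum_(k < 8) ((y - x) 0 k)%:C * cpd k (f' i) x).
    have [b E] := blf_sum (index_enum 'I_8) (fun k => ((y - x) 0 k)%:C) (fun k => bf _ _ (H' k) x Ox).
    have by_ := bf _ _ H y Oy; have bx := bf _ _ H x Ox.
    by rewrite -E [RHS]blfB ?blfB //; exact: bndB.
  apply: (@le_trans _ _ (l * (256 * F' 2%N * `|y - x| ^+ 2))).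
    by apply: B => i Di; apply: gn_quad (H i Di 2%N) Ox Oy.
  rewrite expr2 !mulrA -(mulrA l) -/K ler_wpM2r //; apply: le_trans (ltW Hy).
  by rewrite ler_wpM2r // ler_norm.
move=> H; split; last by move=> k x Ox; have [[_ ->]] := key _ _ H x Ox.
elim: n F f H => [|n IH] F f H.
  by split=> // x Ox; have [[d _] b] := key _ _ H x Ox.
apply: (gn_of_cpd (G := fun k x => Phi (fun i => cpd k (f i) x))).
- by move=> x Ox; have [[d _] b] := key _ _ H x Ox.
- by move=> k x Ox; have [[_ ->] b] := key _ _ H x Ox.
- by move=> k; apply: IH => i Di m; exact: gnS (H i Di m.+1) k.
Unshelve. all: by end_near.
Qed.

Lemma gev_blf (p : V) (r : R) c s (f : I -> V -> C) :
  (forall i, D i -> gev p r c s (f i)) -> gev p r (l * c) s (fun x => Phi (fun i => f i x)).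
Proof.
by move=> H n; apply: gn_mono (proj1 (gn_blf n H)) => j; rewrite !mulrA.
Qed.

End Linear.

(** Along an ultrafilter every bounded sequence converges, which makes [ulim] linear without
    convergence hypotheses; it agrees with ordinary limits by [ulim_eq]. *)
Definition ultra : set_system nat := sval (cid (ultraFilterLemma eventually_filter)).
Lemma ultraU : UltraFilter ultra. Proof. by case: (svalP (cid (ultraFilterLemma eventually_filter))). Qed.
Lemma ultra_sub : eventually `<=` ultra. Proof. by case: (svalP (cid (ultraFilterLemma eventually_filter))). Qed.
#[local] Instance ultraP : ProperFilter ultra. Proof. by case: ultraU. Qed.

Definition rlim (u : nat -> R) : R := lim (u @ ultra).
Definition ulim (u : nat -> C) : C := rlim (fun n => Re (u n)) +i* rlim (fun n => Im (u n)).

Lemma rlim_cvg (u : nat -> R) (M : R) : (forall n, `|u n| <= M) -> u @ ultra --> rlim u.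
Proof.
move=> H; have := @segment_compact R (- M) M; rewrite compact_ultra => /(_ (u @ ultra)).
have UU : UltraFilter (u @ ultra).
  split=> [|G GF sG]; first exact: fmap_proper_filter.
  rewrite predeqE => A; split=> [GA|]; last exact: sG.
  have [//|nA] := in_ultra_setVsetC (u @^-1` A) ultraU.
  have /filter_ex [? []//] : G (A `&` ~` A) by apply: filterI => //; exact: sG.
move=> /(_ UU); case.
  apply: (@filterS _ ultra _ [set n | `|u n| <= M]); last exact: filterE.
  by move=> n /=; rewrite in_itv /= ler_norml.
by move=> l [_ /= cl]; apply/cvg_ex; exists l.
Qed.

Lemma rlim_eq (u : nat -> R) l : u @ \oo --> l -> rlim u = l.
Proof. by move=> H; apply/cvg_lim => //; apply: cvg_trans H => A /= ?; exact: ultra_sub. Qed.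

Lemma ulim_eq (u : nat -> C) l : (forall e : R, 0 < e -> exists N, forall n, (N <= n)%N -> cn (u n - l) < e) ->
  ulim u = l.
Proof.
move=> H; apply: eqReIm => /=; apply: rlim_eq; apply/cvgrPdist_lt => e e0;
  have [N HN] := H e e0; exists N => // n /= Nn; apply: le_lt_trans (HN n Nn);
  rewrite distrC -?cReN -?cImN -?cReD -?cImD; [exact: Re_le_cn|exact: Im_le_cn].
Qed.

Lemma ulim_blf : blf setT 1 ulim.
Proof.
have bR (g : nat -> C) M : (forall i : nat, setT i -> cn (g i) <= M) -> forall n, `|Re (g n)| <= M.
  by move=> H n; apply: le_trans (H n I); exact: Re_le_cn.
have bI (g : nat -> C) M : (forall i : nat, setT i -> cn (g i) <= M) -> forall n, `|Im (g n)| <= M.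
  by move=> H n; apply: le_trans (H n I); exact: Im_le_cn.
split=> [|g1 g2 a [M1 H1] [M2 H2]|g M H]; first exact: ler01.
  have c1 := rlim_cvg (bR _ _ H1); have c2 := rlim_cvg (bR _ _ H2).
  have d1 := rlim_cvg (bI _ _ H1); have d2 := rlim_cvg (bI _ _ H2).
  apply: eqReIm; rewrite !(cReD, cImD, cReM, cImM) /=; apply/cvg_lim => //.
    under eq_fun do rewrite cReD cReM.
    apply: cvgD => //; apply: cvgB; apply: cvgM => //; exact: cvg_cst.
  under eq_fun do rewrite cImD cImM.
  apply: cvgD => //; apply: cvgD; apply: cvgM => //; exact: cvg_cst.
have c1 := rlim_cvg (bR _ _ H); have d1 := rlim_cvg (bI _ _ H).
rewrite mul1r /cn /=.
have c : (fun n => cn (g n)) @ ultra --> `|rlim (fun n => Re (g n))| + `|rlim (fun n => Im (g n))|.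
  by apply: cvgD; apply: cvg_norm.
rewrite -(cvg_lim _ c) //; apply: limr_le; first by apply/cvg_ex; eexists; exact: c.
by apply: filterE => n; exact: H.
Qed.

End Functionals.

(** * Uniform bounds on smaller balls and for inverses *)

Section Germs.
Variable R : realType.
Local Notation V := 'rV[R]_8.
Local Notation C := R[i].
Local Notation Re := complex.Re.
Local Notation Im := complex.Im.

Lemma geo_small (q K e : R) : 0 <= q <= 1 / 2 -> 0 < e ->
  exists N, forall n, (N <= n)%N -> K * q ^+ n < e.
Proof.
move=> /andP[q0 q1] e0; exists (Num.truncn (`|K| / e)).+1 => n Nn.
have K1 : `|K| / e < n%:R.
  by apply: lt_le_trans (truncnS_gt _) _; rewrite ler_nat.
have H : q ^+ n <= (2 ^+ n)^-1.
  by rewrite -exprVn lerXn2r ?nnegrE ?invr_ge0 //; lra.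
apply: (@le_lt_trans _ _ (`|K| * (2 ^+ n)^-1)).
  apply: (@le_trans _ _ (`|K| * q ^+ n)); first by rewrite ler_wpM2r ?exprn_ge0 // ler_norm.
  by rewrite ler_wpM2l.
rewrite ltr_pdivrMr ?exprn_gt0 // -ltr_pdivrMl // mulrC; apply: lt_trans K1 _.
by rewrite -natrX ltr_nat ltn_expl.
Qed.

Lemma gn_sub (p q : V) (r r' : R) n F f : ball q r' `<=` ball p r -> gn p r n F f -> gn q r' n F f.
Proof.
move=> S; elim: n F f => [|n IH] F f [H1 H2].
  by split=> // x /S; exact: H1.
split=> [x /S|k]; first exact: H1.
exact: IH (H2 k).
Qed.

Lemma gev_sub (p q : V) (r r' c s : R) f : ball q r' `<=` ball p r -> gev p r c s f -> gev q r' c s f.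
Proof. by move=> S H n; exact: gn_sub S (H n). Qed.

Lemma gev_le (p : V) (r r' c s : R) f : r' <= r -> gev p r c s f -> gev p r' c s f.
Proof. by move=> rr; apply: gev_sub; exact: le_ball. Qed.

Section Bounds.
Variables (p : V) (r : R).

Lemma gevX a e s f g k : 0 <= a -> 0 <= e -> 0 <= s -> gev p r a s f -> gev p r e (s / 2) g ->
  gev p r (a * (2 * e) ^+ k) s (fun x => f x * g x ^+ k).
Proof.
move=> a0 e0 s0 Hf Hg; elim: k => [|k IH].
  by rewrite expr0 mulr1; apply: gev_eq Hf => x _; rewrite expr0 mulr1.
have H := gevM (mulr_ge0 a0 (exprn_ge0 k (mulr_ge0 (ler0n _ 2) e0))) e0 s0 IH Hg.
rewrite (_ : a * (2 * e) ^+ k.+1 = 2 * (a * (2 * e) ^+ k) * e); last by rewrite exprS; ring.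
by apply: gev_eq H => x _; rewrite exprSr mulrA.
Qed.

Lemma gev_sum (I : Type) (l : seq I) (c : I -> R) s (f : I -> V -> C) : 0 <= s ->
  (forall i, gev p r (c i) s (f i)) ->
  gev p r (\sum_(i <- l) c i) s (fun x => \sum_(i <- l) f i x).
Proof.
move=> s0 H; elim: l => [|i l IH].
  rewrite big_nil; under eq_fun do rewrite big_nil.
  by rewrite -(cn0 R); exact: gev_cst.
by rewrite big_cons; apply: gev_eq (gevD (H i) IH) => x _; rewrite big_cons.
Qed.

Lemma gev_lip c s f x y : gev p r c s f -> ball p r x -> ball p r y ->
  cn (f y - f x) <= 16 * (c * s) * `|y - x|.
Proof. by move=> H Ox Oy; have := gn_lip (H 1%N) Ox Oy; rewrite expr1 factS fact0 mulr1. Qed.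

End Bounds.

(** The Lipschitz bound makes [f] itself small near its zero; for the higher derivatives the small
    constant is paid for by a larger rate. Radius and rate depend on the constants only, neither on
    [p] nor on [f]. *)
Lemma gev_small (r c s e : R) : 0 < r -> 0 <= c -> 0 <= s -> 0 < e ->
  exists r' s', [/\ 0 < r', r' <= r, 0 <= s' & forall (p : V) f, gev p r c s f -> f p = 0 -> gev p r' e s' f].
Proof.
move=> r0 c0 s0 e0.
have K0 : 0 < 16 * (c * s) + 1 by rewrite ltr_pwDr // !mulr_ge0.
exists (Num.min r (e / (16 * (c * s) + 1))), (Num.max s (c * s / e)).
have sm0 : 0 <= Num.max s (c * s / e) by rewrite le_max s0.
split=> //; [by rewrite lt_min r0 divr_gt0|by rewrite ge_min lexx|].
move=> p f H fp n.
have rm : Num.min r (e / (16 * (c * s) + 1)) <= r by rewrite ge_min lexx.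
have H' := gev_le rm H n.
have B x : ball p (Num.min r (e / (16 * (c * s) + 1))) x -> cn (f x) <= e.
  move=> Ox; have Ox' : ball p r x by apply: le_ball Ox; rewrite ge_min lexx.
  have := gev_lip H (ballxx p r0) Ox'; rewrite fp subr0 => /le_trans; apply.
  move: Ox; rewrite -ball_normE /ball_ /= distrC lt_min => /andP[_ h].
  have h' := ltW h; move: h'; rewrite ler_pdivlMr // => h'.
  by apply: le_trans h'; rewrite mulrC ler_wpM2l // lerDl.
case: n H' => [|n] H'.
  split=> // x Ox; have [d _] := gn0 H' Ox; split=> //.
  by rewrite expr0 fact0 !mulr1; exact: B.
split=> [x Ox|k].
  have [d _] := gn0 H' Ox; split=> //.
  by rewrite expr0 fact0 !mulr1; exact: B.
apply: gn_mono (gnS H' k) => j; rewrite ler_wpM2r //.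
rewrite !exprS !mulrA.
apply: ler_pM; rewrite ?mulr_ge0 ?exprn_ge0 //; last by rewrite lerXn2r ?nnegrE // le_max lexx.
by rewrite [leRHS]mulrC -ler_pdivrMr // le_max lexx orbT.
Qed.

Lemma sum_geo_le2 (q : R) N : 0 <= q <= 1 / 2 -> \sum_(j < N) q ^+ j <= 2.
Proof.
move=> /andP[q0 q1]; elim: N => [|N IH]; first by rewrite big_ord0; lra.
rewrite big_ord_recl expr0; under eq_bigr do rewrite lift0 exprS.
rewrite -mulr_sumr.
have : q * \sum_(i < N) q ^+ i <= 1 / 2 * 2 by apply: ler_pM => //; apply: sumr_ge0 => i _; exact: exprn_ge0.
lra.
Qed.

(** Geometric series in [w = 1 - f / f p]. After shrinking, [w] has constant 1/8, so each power
    contributes a factor 1/4, the partial sums have a common bound and their limit inherits it. *)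
Lemma gev_inv (r c s d : R) : 0 < r -> 0 <= c -> 0 <= s -> 0 < d ->
  exists r' c' s', [/\ 0 < r', r' <= r, 0 <= c', 0 <= s' &
    forall (p : V) f, gev p r c s f -> d <= cn (f p) ->
      gev p r' c' s' (fun x => (f x)^-1) /\ forall x, ball p r' x -> f x != 0].
Proof.
move=> r0 c0 s0 d0.
have e0 : (0 : R) < 1 / 8 by lra.
have c20 : 0 <= 2 / d * (2 * c) by rewrite !mulr_ge0 // invr_ge0 ltW.
have [r' [s' [r'0 r'r s'0 H]]] := gev_small r0 c20 s0 e0.
exists r', (2 / d * 2), (2 * s'); split=> //; first by rewrite !mulr_ge0 // invr_ge0 ltW.
  by rewrite mulr_ge0.
move=> p f Hf dp.
have fp0 : f p != 0 by rewrite -cn_gt0 (lt_le_trans d0).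
have iV : cn (f p)^-1 <= 2 / d by apply: cnV_le.
pose w := fun x => 1 - (f p)^-1 * f x.
have wE x : w x = (f p)^-1 * (f p - f x) by rewrite /w mulrBr mulVf.
have Hw : gev p r (2 / d * (2 * c)) s w.
  have h1 : gev p r (cn (f p) + c) s (fun x => f p + - f x).
    apply: gevD; first exact: gev_cst.
    have := gevZ (-1) Hf; rewrite cnN cn1 mul1r.
    by apply: gev_eq => x _; rewrite mulN1r.
  have h2 := gevZ (f p)^-1 h1.
  apply: gev_eq (gev_mono _ s0 _ (lexx s) h2); first by move=> x _; rewrite wE.
    by rewrite mulr_ge0 ?addr_ge0 ?cn_ge0.
  have [_ b] := gev_at Hf (ballxx p r0).
  by apply: ler_pM => //; rewrite ?cn_ge0 ?addr_ge0 ?cn_ge0 //; lra.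
have wp : w p = 0 by rewrite /w mulVf // subrr.
have {}Hw := H p w Hw wp.
have wb x : ball p r' x -> cn (w x) <= 1 / 8 by move=> Ox; have [] := gev_at Hw Ox.
have f0 x : ball p r' x -> f x != 0.
  move=> /wb; apply: contraTneq; rewrite /w => ->; rewrite mulr0 subr0 cn1; lra.
split=> //.
pose g := fun N x => (f p)^-1 * \sum_(k < N) w x ^+ k.
have s2 : 0 <= 2 * s' by rewrite mulr_ge0.
have Hg N : gev p r' (2 / d * 2) (2 * s') (g N).
  have Hw' : gev p r' (1 / 8) (2 * s' / 2) w by rewrite (_ : 2 * s' / 2 = s') //; lra.
  have h (k : 'I_N) : gev p r' ((1 / 4) ^+ k) (2 * s') (fun x => w x ^+ k).
    have h1 : gev p r' 1 (2 * s') (fun=> 1 : C) by have := @gev_cst R p r' 1 _ s2; rewrite cn1.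
    have := gevX k ler01 (ltW e0) s2 h1 Hw'.
    rewrite (_ : 1 * (2 * (1 / 8)) ^+ k = (1 / 4) ^+ k); last by rewrite mul1r; congr (_ ^+ _); lra.
    by apply: gev_eq => x _; rewrite mul1r.
  have := gevZ (f p)^-1 (gev_sum (index_enum 'I_N) s2 h); apply: gev_mono => //.
    by rewrite mulr_ge0 ?cn_ge0 //; apply: sumr_ge0 => i _; rewrite exprn_ge0.
  apply: ler_pM => //; rewrite ?cn_ge0 //; first by apply: sumr_ge0 => i _; rewrite exprn_ge0.
  by apply: sum_geo_le2; apply/andP; split; lra.
have := gev_blf (ulim_blf R) (fun N _ => Hg N); rewrite mul1r; apply: gev_eq => x Ox.
apply: ulim_eq => e ep.
have q : 0 <= cn (w x) <= 1 / 2 by rewrite cn_ge0 (le_trans (wb _ Ox)) //; lra.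
have [N HN] := geo_small (cn (f x)^-1) q ep.
exists N => n Nn; apply: le_lt_trans (HN n Nn).
have -> : g n x - (f x)^-1 = - ((f x)^-1 * w x ^+ n).
  have E : (1 - w x) * \sum_(k < n) w x ^+ k = 1 - w x ^+ n.
    by rewrite -[1 in RHS](expr1n _ n) subrXX; congr (_ * _); apply: eq_bigr => k _; rewrite expr1n mul1r.
  have E2 : (f p)^-1 = (f x)^-1 * (1 - w x) by rewrite /w opprB addrC subrK mulrCA mulVf ?f0 ?mulr1.
  by rewrite /g E2 -mulrA E; ring.
by rewrite cnN; apply: le_trans (cnM _ _) _; rewrite ler_wpM2l ?cn_ge0 // cnX.
Qed.

End Germs.

(** * Taylor estimates and analytic germs *)

Section Taylor.
Variable R : realType.
Local Notation V := 'rV[R]_8.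
Local Notation C := R[i].
Local Notation Re := complex.Re.
Local Notation Im := complex.Im.

(** Integration of the bound by the mean value theorem for [K t^(m+1) / (m+1) - e phi], with [e]
    equal to 1 and to -1. *)
Lemma int_bound (phi dphi : R -> R) (K : R) (m : nat) : 0 <= K ->
  (forall t : R, 0 <= t <= 1 -> is_derive t 1 phi (dphi t)) ->
  (forall t : R, 0 <= t <= 1 -> `|dphi t| <= K * t ^+ m) -> phi 0 = 0 -> `|phi 1| <= K / m.+1%:R.
Proof.
move=> K0 D B p0.
have key (e : R) : e = 1 \/ e = -1 -> e * phi 1 <= K / m.+1%:R.
  move=> he.
  have Dp (t : R) : 0 <= t <= 1 -> is_derive t 1 (fun t : R => (K / m.+1%:R) * t ^+ m.+1 - e * phi t)
      (K * t ^+ m - e * dphi t).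
    move=> tI; have := D t tI => h.
    have h1 : is_derive t 1 (fun t : R => t ^+ m.+1) (m.+1%:R * t ^+ m).
      rewrite (_ : (fun t : R => t ^+ m.+1) = id ^+ m.+1); last by apply/funext => z; rewrite !fctE.
      have := @is_deriveX _ _ id m.+1 t 1 1 (is_derive_id _ _).
      by move=> hh; apply: is_derive_eq; rewrite /GRing.scale /= mulr1.
    have h2 := @is_deriveZ _ _ _ (fun t : R => t ^+ m.+1) (K / m.+1%:R) t 1 _ h1.
    have h3 := @is_deriveZ _ _ _ phi e t 1 _ h.
    have hh := is_deriveB h2 h3; apply: (is_derive_eq hh).
    by rewrite /GRing.scale /= mulrA divfK.
  have := @MVT_segment R _ (fun t => K * t ^+ m - e * dphi t) 0 1 ler01 _ _.
  move=> /(_ (fun t : R => (K / m.+1%:R) * t ^+ m.+1 - e * phi t)); case.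
  - by move=> t; rewrite in_itv /= => /andP[a b]; apply: Dp; rewrite !ltW.
  - apply: continuous_in_subspaceT => t; rewrite inE /= in_itv /= => /Dp h.
    by apply: differentiable_continuous; apply/derivable1_diffP; exact: ex_derive.
  move=> t; rewrite in_itv /= => tI.
  rewrite expr1n mulr1 expr0n /= mulr0 p0 mulr0 subrr subr0 subr0 mulr1 => E.
  rewrite -subr_ge0 E subr_ge0; apply: le_trans (B t tI).
  case: he => ->; first by rewrite mul1r ler_norm.
  by rewrite mulN1r -normrN ler_norm.
rewrite ler_norml; apply/andP; split; last by have := key 1 (or_introl erefl); rewrite mul1r.
by have := key (-1) (or_intror erefl); rewrite mulN1r lerNl.
Qed.

Fixpoint cpdw (w : seq 'I_8) (f : V -> C) : V -> C :=
  if w is k :: w' then cpdw w' (cpd k f) else f.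

(** Induction on the order: the first derivatives satisfy the bound one order lower, and integrating
    it along the segment from [p] builds up the factorial. *)
Lemma taylor_zero_bound (p : V) (r : R) m F f x : 0 < r -> gn p r m F f ->
  (forall w, (size w < m)%N -> cpdw w f p = 0) -> ball p r x ->
  cn (f x) <= F m * (16 * `|x - p|) ^+ m / m`!%:R.
Proof.
move=> r0; elim: m F f x => [|m IH] F f x H Z Ox.
  by have [_ b] := gn0 H Ox; rewrite expr0 fact0 mulr1 divr1.
set v := x - p.
have xE : x = p + v by rewrite /v addrC subrK.
have D t : 0 <= t <= 1 -> ball p r (p + t *: v).
  by apply: ball_segment; [exact: ballxx|rewrite -xE].
have Hk k t : 0 <= t <= 1 -> cn (cpd k f (p + t *: v)) <= F m.+1 * (16 * (t * `|v|)) ^+ m / m`!%:R.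
  move=> tI; have := IH _ _ _ (gnS H k) (fun w h => Z (k :: w) h) (D t tI).
  rewrite (_ : p + t *: v - p = t *: v); last by rewrite addrC addKr.
  by rewrite normrZ ger0_norm //; case/andP: tI.
pose K := 8 * (F m.+1 * (16 * `|v|) ^+ m / m`!%:R) * `|v|.
have FF : 0 <= F m.+1 * (16 * `|v|) ^+ m / m`!%:R.
  have := Hk ord0 1; rewrite ler01 lexx => /(_ isT); rewrite mul1r; exact/le_trans/cn_ge0.
have K0 : 0 <= K by rewrite /K; apply: mulr_ge0 => //; apply: mulr_ge0.
have f0 : f p = 0 by exact: (Z [::]).
have dB (G : 'I_8 -> R) t : 0 <= t <= 1 -> (forall k, `|G k| <= cn (cpd k f (p + t *: v))) ->
    `|\sum_(k < 8) v 0 k * G k| <= K * t ^+ m.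
  move=> tI HG; rewrite (_ : K * t ^+ m = 8 * (F m.+1 * (16 * (t * `|v|)) ^+ m / m`!%:R) * `|v|); last first.
    by rewrite /K !exprMn; ring.
  by apply: sum_norm_le => k; apply: le_trans (HG k) (Hk k t tI).
have B1 : `|Re (f x)| <= K / m.+1%:R.
  have := @int_bound (fun t => Re (f (p + t *: v)))
    (fun t => \sum_(k < 8) v 0 k * pd k (fun y => Re (f y)) (p + t *: v)) K m K0.
  rewrite scale1r -xE scale0r addr0 f0; apply => // t tI.
    by apply: is_derive_line; have [[d _] _] := gn0 H (D t tI).
  by apply: dB => // k; exact: (Re_le_cn (cpd k f _)).
have B2 : `|Im (f x)| <= K / m.+1%:R.
  have := @int_bound (fun t => Im (f (p + t *: v)))
    (fun t => \sum_(k < 8) v 0 k * pd k (fun y => Im (f y)) (p + t *: v)) K m K0.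
  rewrite scale1r -xE scale0r addr0 f0; apply => // t tI.
    by apply: is_derive_line; have [[_ d] _] := gn0 H (D t tI).
  by apply: dB => // k; exact: (Im_le_cn (cpd k f _)).
apply: (le_trans (lerD B1 B2)); rewrite le_eqVlt; apply/orP; left; apply/eqP.
rewrite /K factS natrM exprS; field.
by rewrite pnatr_eq0 -lt0n fact_gt0 /= addrC natr1 pnatr_eq0.
Qed.

(** For Gevrey bounds the Taylor estimate is [c (16 s |x - p|)^m], whose base is at most 1/2 here.
    The radius depends on [s] but not on [c]. *)
Lemma gev_zero (p : V) (r c s : R) f x : 0 < r -> 0 <= c -> 0 <= s -> gev p r c s f ->
  (forall w, cpdw w f p = 0) -> ball p r x -> 32 * s * `|x - p| <= 1 -> f x = 0.
Proof.
move=> r0 c0 s0 H Z Ox sx; apply: cn_eq0; apply/eqP; rewrite eq_le cn_ge0 andbT.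
apply/ler_addgt0Pr => e e0; rewrite add0r.
pose q := 16 * s * `|x - p|.
have q2 : 0 <= q <= 1 / 2 by rewrite /q !mulr_ge0 //=; lra.
have [N HN] := geo_small c q2 e0.
apply: le_trans (ltW (HN N (leqnn N))).
apply: le_trans (taylor_zero_bound r0 (H N) (fun w _ => Z w) Ox) _.
rewrite le_eqVlt; apply/orP; left; apply/eqP; rewrite /q !exprMn; field.
by rewrite pnatr_eq0 -lt0n fact_gt0.
Qed.

Lemma cReB (z w : C) : Re (z - w) = Re z - Re w. Proof. by rewrite cReD cReN. Qed.
Lemma cImB (z w : C) : Im (z - w) = Im z - Im w. Proof. by rewrite cImD cImN. Qed.

Lemma pr_triangle (pr : C -> R) (A B P Q : C) (c : R) : (forall z w, pr (z - w) = pr z - pr w) ->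
  pr A = pr B -> `|pr (A - P)| <= c -> `|pr (B - Q)| <= c -> `|pr (Q - P)| <= c + c.
Proof.
move=> prB E; rewrite !prB E => n1 n2.
rewrite (_ : _ - _ = (pr B - pr P) - (pr B - pr Q)); last by ring.
by apply: le_trans (ler_normB _ _) _; rewrite lerD.
Qed.

Definition mixed_diff (u : V -> R) (x a b : V) : R := u (x + a + b) - u (x + b) - u (x + a) + u x.

Lemma mixed_diffC u x a b : mixed_diff u x a b = mixed_diff u x b a.
Proof. by rewrite /mixed_diff (addrAC x a b); congr (_ + _); rewrite [LHS]addrAC. Qed.

Lemma schwarz_aux (u : V -> R) (p : V) (r : R) j k (x : V) (t : R) : 0 <= t ->
  (forall y, ball p r y -> differentiable u y) -> (forall y, ball p r y -> differentiable (pd j u) y) ->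
  ball p r x -> ball p r (x + t *: evec R j) -> ball p r (x + t *: evec R k) ->
  (forall a b, 0 <= a <= t -> 0 <= b <= t -> ball p r (x + a *: evec R k + b *: evec R j)) ->
  exists a b, [/\ 0 <= a <= t, 0 <= b <= t &
   mixed_diff u x (t *: evec R k) (t *: evec R j) = t ^+ 2 * pd k (pd j u) (x + a *: evec R k + b *: evec R j)].
Proof.
move=> t0 D1 D2 Ox Oj Ok Oab.
have evE (w : 'I_8 -> R) i : \sum_(l < 8) evec R i 0 l * w l = w i.
  rewrite (bigD1 i) //= big1 ?addr0 => [|l li]; first by rewrite /evec mxE !eqxx mul1r.
  by rewrite /evec mxE (negbTE li) andbF mul0r.
have tt : 0 <= t <= t by rewrite t0 lexx.
have t00 : 0 <= (0 : R) <= t by rewrite lexx t0.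
pose phi s := u (x + t *: evec R k + s *: evec R j) - u (x + s *: evec R j).
pose dphi s := pd j u (x + t *: evec R k + s *: evec R j) - pd j u (x + s *: evec R j).
have O0 b : 0 <= b <= t -> ball p r (x + b *: evec R j).
  by move=> bI; have := Oab 0 b t00 bI; rewrite scale0r addr0.
have Dp (s : R) : 0 <= s <= t -> is_derive s 1 phi (dphi s).
  move=> sI.
  have h1 := is_derive_line (D1 _ (Oab t s tt sI)); have h2 := is_derive_line (D1 _ (O0 s sI)).
  by have hh := is_deriveB h1 h2; apply: (is_derive_eq hh); rewrite !evE.
have [|//|s sI E] := @MVT_segment R phi dphi 0 t t0.
- by move=> s; rewrite in_itv /= => /andP[a b]; apply: Dp; rewrite !ltW.
- apply: continuous_in_subspaceT => s; rewrite inE /= in_itv /= => /Dp h.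
  by apply: differentiable_continuous; apply/derivable1_diffP; exact: ex_derive.
rewrite in_itv /= in sI.
have D3 (a : R) : 0 <= a <= 1 -> differentiable (pd j u) (x + s *: evec R j + a *: (t *: evec R k)).
  move=> /andP[a0 a1]; apply: D2; rewrite scalerA addrAC; apply: Oab => //.
  by rewrite mulr_ge0 //= ler_piMl.
have [a aI E2] := segment_MVT D3.
exists (a * t), s; split=> //; first by case/andP: aI => a0 a1; rewrite mulr_ge0 //= ler_piMl.
rewrite (_ : mixed_diff _ _ _ _ = phi t - phi 0); last by rewrite /mixed_diff /phi scale0r !addr0 opprB addrA addrAC.
rewrite E subr0 /dphi addrAC E2 scalerA [X in pd k _ X]addrAC.
under eq_bigr do rewrite mxE -mulrA.
by rewrite -mulr_sumr evE; ring.
Qed.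

(** The mixed second difference is symmetric and, by two mean value steps, equals [t^2] times either
    mixed derivative at a nearby point; the Lipschitz bound lets [t] tend to 0. The argument is run
    for the real and the imaginary part through [pr]. *)
Lemma schwarz (p : V) (r : R) F f j k x : gn p r 3 F f -> ball p r x ->
  cpd j (cpd k f) x = cpd k (cpd j f) x.
Proof.
move=> H Ox.
have D1 y : ball p r y -> cdiff f y by move=> /(gn0 H)[].
have D2 i y : ball p r y -> cdiff (cpd i f) y by move=> /(gn0 (gnS H i))[].
have F0 : 0 <= F 3%N by apply: le_trans (cn_ge0 _) (proj2 (gn0 (gnS (gnS (gnS H j) j) j) Ox)).
have [d d0 Hd] : exists2 d : R, 0 < d & forall v : V, `|v| <= 2 * d -> ball p r (x + v).
  move: Ox; rewrite -ball_normE /ball_ /= => Ox; exists ((r - `|p - x|) / 4).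
    by rewrite divr_gt0 // subr_gt0.
  by move=> v Hv; rewrite opprD addrA; apply: le_lt_trans (ler_normB _ _) _; lra.
have nv (a b : R) i l t : 0 <= a <= t -> 0 <= b <= t -> `|a *: evec R i + b *: evec R l| <= 2 * t.
  move=> /andP[a0 a1] /andP[b0 b1]; apply: le_trans (ler_normD _ _) _.
  by rewrite !normrZ !norm_evec !mulr1 !ger0_norm //; lra.
have L i l y : ball p r y -> cn (cpd i (cpd l f) y - cpd i (cpd l f) x) <= 16 * F 3%N * `|y - x|.
  by move=> Oy; exact: gn_lip (gnS (gnS H l) i) Ox Oy.
suff B t : 0 < t -> t <= d -> cn (cpd j (cpd k f) x - cpd k (cpd j f) x) <= 128 * F 3%N * t.
  apply/eqP; rewrite -subr_eq0; apply/eqP/cn_eq0/eqP; rewrite eq_le cn_ge0 andbT.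
  apply/ler_addgt0Pr => e e0; rewrite add0r.
  have K : 0 < 128 * F 3%N + 1 by lra.
  have := B (Num.min d (e / (128 * F 3%N + 1))).
  rewrite lt_min d0 divr_gt0 // ge_min lexx => /(_ isT isT) /le_trans; apply.
  apply: (@le_trans _ _ ((128 * F 3%N + 1) * Num.min d (e / (128 * F 3%N + 1)))).
    by rewrite ler_wpM2r ?lerDl // le_min !ltW // divr_gt0.
  by rewrite mulrC -ler_pdivlMr // ge_min lexx orbT.
move=> t0 td.
have tt : 0 <= t <= t by rewrite (ltW t0) lexx.
have t00 : 0 <= (0 : R) <= t by rewrite lexx (ltW t0).
have Oab i l a b : 0 <= a <= t -> 0 <= b <= t -> ball p r (x + a *: evec R i + b *: evec R l).
  by move=> aI bI; rewrite -addrA; apply: Hd; apply: le_trans (nv _ _ _ _ _ aI bI) _; lra.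
have O1 i : ball p r (x + t *: evec R i).
  by have := Oab i i t 0 tt t00; rewrite scale0r addr0.
have nn (i l : 'I_8) (c e : R) : 0 <= c <= t -> 0 <= e <= t -> cn (cpd i (cpd l f) (x + c *: evec R i + e *: evec R l) -
   cpd i (cpd l f) x) <= 32 * F 3%N * t.
  move=> cI eI; apply: le_trans (L i l _ (Oab i l c e cI eI)) _.
  have h := nv c e i l t cI eI.
  rewrite (_ : x + c *: evec R i + e *: evec R l - x = c *: evec R i + e *: evec R l); last by rewrite -(addrA x) (addrC x) addrK.

  rewrite (_ : 32 * F 3%N * t = 16 * F 3%N * (2 * t)); last by clear; ring.
  by rewrite ler_wpM2l // mulr_ge0.
have P (pr : C -> R) (prE : forall z, `|pr z| <= cn z) (prB : forall z w, pr (z - w) = pr z - pr w)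
   (prd : forall g i y, pr (cpd i g y) = pd i (fun y => pr (g y)) y)
   (prD : forall g y, cdiff g y -> differentiable (fun y => pr (g y)) y) :
   `|pr (cpd j (cpd k f) x - cpd k (cpd j f) x)| <= 64 * F 3%N * t.
  pose u y := pr (f y).
  have pdu i : pd i u = (fun y => pr (cpd i f y)) by apply/funext => y; rewrite prd.
  have Du y : ball p r y -> differentiable u y by move=> Oy; apply: prD; exact: D1.
  have Du2 i y : ball p r y -> differentiable (pd i u) y by move=> Oy; rewrite pdu; apply: prD; exact: D2.
  have [a [b [aI bI E]]] := schwarz_aux (ltW t0) Du (Du2 j) Ox (O1 j) (O1 k) (Oab k j).
  have [a' [b' [aI' bI' E']]] := schwarz_aux (ltW t0) Du (Du2 k) Ox (O1 k) (O1 j) (Oab j k).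
  have {E'}E' : pd k (pd j u) (x + a *: evec R k + b *: evec R j)
            = pd j (pd k u) (x + a' *: evec R j + b' *: evec R k).
    apply: (mulfI (_ : t ^+ 2 != 0)); first by rewrite expf_neq0 // gt_eqF.
    exact: etrans (esym E) (etrans (mixed_diffC _ _ _ _) E').
  rewrite !pdu -!prd in E'.
  have n1 := le_trans (prE _) (nn k j a b aI bI).
  have n2 := le_trans (prE _) (nn j k a' b' aI' bI').
  rewrite (_ : 64 * F 3%N * t = 32 * F 3%N * t + 32 * F 3%N * t); last by clear; ring.
  exact: (pr_triangle prB E' n1 n2).
have h1 := P (@complex.Re R) (@Re_le_cn R) cReB (fun _ _ _ => erefl) (fun _ _ => @proj1 _ _).
have h2 := P (@complex.Im R) (@Im_le_cn R) cImB (fun _ _ _ => erefl) (fun _ _ => @proj2 _ _).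
rewrite (_ : 128 * F 3%N * t = 64 * F 3%N * t + 64 * F 3%N * t); last by clear; ring.
exact: (lerD h1 h2).
Qed.

(** The working notion of analytic germ. Power series enter only through [analytic_gevp]. *)
Definition gevp (p : V) (f : V -> C) : Prop :=
  exists r c s, [/\ 0 < r, 0 <= c, 0 <= s & gev p r c s f].

Lemma gevp_intro (p : V) (r c s : R) f : 0 < r -> gev p r c s f -> gevp p f.
Proof.
move=> r0 H; have [_ b] := gev_at H (ballxx p r0).
have c0 : 0 <= c by exact: le_trans (cn_ge0 _) b.
exists r, c, `|s|; split=> // n; apply: gn_mono (H n) => j.
by rewrite ler_wpM2r // ler_wpM2l // (le_trans (ler_norm _)) // normrX.
Qed.

Lemma gevp_cdiff p f : gevp p f -> cdiff f p.
Proof. by move=> [r [c [s [r0 _ _ H]]]]; have [] := gev_at H (ballxx p r0). Qed.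

Lemma gevp_nearby p f : gevp p f -> \forall q \near p, gevp q f.
Proof.
move=> [r [c [s [r0 c0 s0 H]]]].
have : nbhs p (ball p r) by exact: nbhsx_ballx.
apply: filterS => q; rewrite -ball_normE /ball_ /= => pq.
exists (r - `|p - q|), c, s; split=> //; first by rewrite subr_gt0.
apply: gev_sub H => y; rewrite -!ball_normE /ball_ /= => qy.
by rewrite -(subrKA q) (le_lt_trans (ler_normD _ _)) // -ltrBrDl.
Qed.

Lemma nbhs_small (p : V) (P : V -> Prop) r : 0 < r -> (\forall q \near p, P q) ->
  exists r', [/\ 0 < r', r' <= r & forall q, ball p r' q -> P q].
Proof.
move=> r0 /nbhs_ballP[d /= d0 H]; exists (Num.min r d); split.
- by rewrite lt_min r0.
- by rewrite ge_min lexx.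
- by move=> q h; apply: H; apply: le_ball h; rewrite ge_min lexx orbT.
Qed.

Lemma gevp_eq p f g : (\forall x \near p, f x = g x) -> gevp p f -> gevp p g.
Proof.
move=> E [r [c [s [r0 c0 s0 H]]]]; have [r' [r'0 rr E']] := nbhs_small r0 E.
by exists r', c, s; split=> //; apply: gev_eq (gev_le rr H).
Qed.

Lemma gevpD p f g : gevp p f -> gevp p g -> gevp p (fun x => f x + g x).
Proof.
move=> [r [c [s [r0 c0 s0 H]]]] [r' [c' [s' [r'0 c'0 s'0 H']]]].
have h1 : gev p (Num.min r r') c (Num.max s s') f.
  by apply: gev_mono (gev_le _ H); rewrite // ?ge_min ?le_max lexx.
have h2 : gev p (Num.min r r') c' (Num.max s s') g.
  by apply: gev_mono (gev_le _ H'); rewrite // ?ge_min ?le_max lexx orbT.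
by apply: gevp_intro (gevD h1 h2); rewrite lt_min r0.
Qed.

Lemma gevpM p f g : gevp p f -> gevp p g -> gevp p (fun x => f x * g x).
Proof.
move=> [r [c [s [r0 c0 s0 H]]]] [r' [c' [s' [r'0 c'0 s'0 H']]]].
pose S := 2 * Num.max s s'.
have h1 : gev p (Num.min r r') c S f.
  apply: gev_mono (gev_le _ H); rewrite // ?ge_min ?lexx // /S.
  have : s <= Num.max s s' by rewrite le_max lexx.
  lra.
have h2 : gev p (Num.min r r') c' (S / 2) g.
  apply: gev_mono (gev_le _ H'); rewrite // ?ge_min ?lexx ?orbT // /S.
  have : s' <= Num.max s s' by rewrite le_max lexx orbT.
  lra.
have S0 : 0 <= S by rewrite /S mulr_ge0 // le_max s0.
by apply: gevp_intro (gevM c0 c'0 S0 h1 h2); rewrite lt_min r0.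
Qed.

Lemma gevp_cst p (c : C) : gevp p (fun=> c).
Proof. exact: gevp_intro ltr01 (gev_cst p 1 c (lexx 0)). Qed.

Lemma gevp_ext p f g : (forall x, f x = g x) -> gevp p f -> gevp p g.
Proof. by move=> /funext ->. Qed.

Lemma gevpN p f : gevp p f -> gevp p (fun x => - f x).
Proof.
move=> H; have := gevpM (gevp_cst p (-1)) H; apply: gevp_ext => x.
by rewrite mulN1r.
Qed.

Lemma gevp_conj p f : gevp p f -> gevp p (fun x => (f x)^*).
Proof. by move=> [r [c [s [r0 c0 s0 H]]]]; apply: gevp_intro r0 (gev_conj H). Qed.

Lemma gevp_cpd p f k : gevp p f -> gevp p (cpd k f).
Proof. by move=> [r [c [s [r0 c0 s0 H]]]]; apply: gevp_intro r0 (gev_cpd k c0 s0 H). Qed.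

Lemma gevpV p f : gevp p f -> f p != 0 -> gevp p (fun x => (f x)^-1).
Proof.
move=> [r [c [s [r0 c0 s0 H]]]]; rewrite -cn_gt0 => fp.
have [r' [c' [s' [r'0 _ _ _ K]]]] := gev_inv r0 c0 s0 fp.
by have [h _] := K p f H (lexx _); exact: gevp_intro h.
Qed.

Lemma gevp_sum p (I : Type) (l : seq I) (f : I -> V -> C) : (forall i, gevp p (f i)) ->
  gevp p (fun x => \sum_(i <- l) f i x).
Proof.
move=> H; elim: l => [|i l IH].
  by apply: gevp_ext (gevp_cst p 0) => x; rewrite big_nil.
by apply: gevp_ext (gevpD (H i) IH) => x; rewrite big_cons.
Qed.

Lemma gevp_schwarz p f j k : gevp p f -> cpd j (cpd k f) p = cpd k (cpd j f) p.
Proof. by move=> [r [c [s [r0 c0 s0 H]]]]; exact: schwarz (H 3%N) (ballxx p r0). Qed.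

Lemma gevp_zero p f : gevp p f -> (forall w, cpdw w f p = 0) -> \forall x \near p, f x = 0.
Proof.
move=> [r [c [s [r0 c0 s0 H]]]] Z.
have d0 : 0 < (32 * s + 1)^-1 by rewrite invr_gt0 ltr_wpDl // mulr_ge0.
near=> x; apply: (gev_zero r0 c0 s0 H Z); first by near: x; exact: nbhsx_ballx.
have : ball p (32 * s + 1)^-1 x by near: x; exact: nbhsx_ballx.
rewrite -ball_normE /ball_ /= distrC => h.
apply: le_trans (_ : (32 * s + 1) * (32 * s + 1)^-1 <= 1); last first.
  by rewrite mulfV // gt_eqF // -invr_gt0.
by apply: ler_pM; rewrite ?mulr_ge0 // ?lerDl // ltW.
Unshelve. all: by end_near.
Qed.

End Taylor.

(** * Power series, and functions vanishing on a hypersurface *)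

Section Analytic.
Variable R : realType.
Local Notation V := 'rV[R]_8.
Local Notation C := R[i].
Local Notation Re := complex.Re.
Local Notation Im := complex.Im.

Definition coordC (k : 'I_8) : V -> C := fun x => (x 0 k)%:C.

Lemma cdiff_coord k x : cdiff (coordC k) x /\ forall l, cpd l (coordC k) x = (l == k)%:R.
Proof.
apply: cdiff_of_estimate => e e0; near=> y.
rewrite (bigD1 k) //= big1 ?addr0; last by move=> l lk; rewrite (negbTE lk) mulr0.
rewrite eqxx mulr1 /coordC !mxE -rmorphB /= subrr cn0 mulr_ge0 // ltW.
Unshelve. all: by end_near.
Qed.

Lemma gev_coord (p : V) (e : R) k : 0 < e -> gev p e e (e^-1) (fun x => coordC k x - (p 0 k)%:C).
Proof.
move=> e0.
have B x : ball p e x -> cdiff (fun x => coordC k x - (p 0 k)%:C) x /\ cn (coordC k x - (p 0 k)%:C) <= e.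
  rewrite -ball_normE /ball_ /= => Ox; split.
    have [d _] := cdiff_coord k x; exact: (proj1 (cdiffD d (cdiff_cst _ x))).
  rewrite /coordC -rmorphB cn_real /= distrC.
  by have := coord_le_norm (p - x) k; rewrite !mxE => /le_trans; apply; exact: ltW.
move=> [|n].
  by split=> // x Ox; rewrite expr0 fact0 !mulr1; exact: B.
apply: (gn_of_cpd (G := fun l _ => (l == k)%:R)).
- by move=> x Ox; rewrite expr0 fact0 !mulr1; exact: B.
- move=> l x Ox; have [d E] := cdiff_coord k x.
  by have [_ ->] := cdiffD d (cdiff_cst (- (p 0 k)%:C) x); rewrite cpd_cst addr0 E.
- move=> l; apply: gn_mono (gn_cst p e n (l == k)%:R) => -[|j].
    rewrite expr1 factS fact0 mulr1 mulfV ?(gt_eqF e0) //.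
    by case: (l == k); rewrite /= ?cn1 ?cn0.
  by rewrite mulr_ge0 // mulr_ge0 ?exprn_ge0 ?invr_ge0 ?(ltW e0).
Qed.

Lemma gev_monomial (p : V) (e : R) (b : 'I_8 -> nat) (l : seq 'I_8) : 0 < e ->
  gev p e (\prod_(k <- l) (2 * e) ^+ b k) (2 * e^-1)
    (fun x => \prod_(k <- l) (coordC k x - (p 0 k)%:C) ^+ b k).
Proof.
move=> e0.
have s0 : 0 <= 2 * e^-1 by rewrite mulr_ge0 // invr_ge0 ltW.
elim: l => [|k l IH].
  rewrite big_nil; have := gev_cst p e 1 s0; rewrite cn1.
  by apply: gev_eq => x _; rewrite big_nil.
have P0 : 0 <= \prod_(k <- l) (2 * e) ^+ b k.
  by apply: prodr_ge0 => j _; rewrite exprn_ge0 // mulr_ge0 // ltW.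
have hk : gev p e e (2 * e^-1 / 2) (fun x => coordC k x - (p 0 k)%:C).
  by rewrite (_ : 2 * e^-1 / 2 = e^-1); [exact: gev_coord|field; rewrite gt_eqF].
have := gevX (b k) P0 (ltW e0) s0 IH hk; rewrite big_cons mulrC; apply: gev_eq => x _.
by rewrite big_cons mulrC.
Qed.

(** Absolute boundedness at the corner [a + (s, ..., s)] controls all partial sums at once: on the
    ball of radius [e = s / 2] a monomial has constant [(2 e)^b], which is its value at that corner.
    The common bound passes to the limit. *)
Lemma analytic_gevp (f : V -> R) (a : V) : analytic_at f a -> gevp a (fun x => (f x)%:C).
Proof.
move=> [r r0 [c Hc]].
pose s := r / 2; have s0 : 0 < s by rewrite divr_gt0.
pose x0 : V := a + const_mx s.
have x0E k : x0 0 k - a 0 k = s by rewrite !mxE addrAC subrr add0r.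
have [|[M HM] _] := Hc x0.
  rewrite (_ : x0 - a = const_mx s); last by rewrite /x0 addrAC subrr add0r.
  apply: le_lt_trans (_ : s < r); last by rewrite /s; lra.
  by apply: norm_le_coord => [|k]; rewrite ?(ltW s0) // mxE ger0_norm // ltW.
pose e := s / 2; have e0 : 0 < e by rewrite divr_gt0.
have s20 : 0 <= 2 * e^-1 by rewrite mulr_ge0 // invr_ge0 ltW.
pose P N x : C := (ps_partial c a N x)%:C.
have HP N : gev a e M (2 * e^-1) (P N).
  have h (b : {ffun 'I_8 -> 'I_N}) : gev a e (`|c (fun k => nat_of_ord (b k))| * \prod_(k < 8) `|x0 0 k - a 0 k| ^+ b k) (2 * e^-1)
     (fun x => (c (fun k => nat_of_ord (b k)))%:C * \prod_(k < 8) (coordC k x - (a 0 k)%:C) ^+ b k).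
    have se : s = 2 * e by rewrite /e; lra.
    rewrite -cn_real; under eq_bigr do rewrite x0E (gtr0_norm s0) se.
    have := gevZ (c (fun k => nat_of_ord (b k)))%:C (gev_monomial a (fun k => nat_of_ord (b k)) (index_enum 'I_8) e0).
    by apply: gev_eq.
  have H1 := gev_sum (index_enum _) s20 h.
  have A0 : 0 <= ps_abs_partial c a N x0.
    by apply: sumr_ge0 => b _; rewrite mulr_ge0 // prodr_ge0 // => k _; rewrite exprn_ge0.
  have H2 := gev_mono A0 s20 (HM N) (lexx (2 / e)) H1.
  apply: gev_eq H2 => x _; rewrite /P /ps_partial rmorph_sum; apply: eq_bigr => b _.
  rewrite rmorphM rmorph_prod; congr (_ * _); apply: eq_bigr => k _.
  by rewrite /coordC -rmorphB rmorphXn.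
have := gev_blf (ulim_blf R) (fun N _ => HP N).
move=> H; apply: gevp_intro e0 _; apply: gev_eq H => x Ox.
have [|_ cv] := Hc x.
  move: Ox; rewrite -ball_normE /ball_ /= distrC => /lt_trans; apply.
  by rewrite /e /s; lra.
apply: ulim_eq => d d0; move/cvgrPdist_lt: cv => /(_ d d0)[N _ HN]; exists N => n Nn.
by rewrite /P -rmorphB cn_real distrC; exact: HN.
Qed.

(** In place of an implicit function: [v] is in the kernel of the differential of [rho], and on each
    segment [t v + s e_k0] with [|s| <= e t] the intermediate value theorem finds a zero of [rho].
    There [u] vanishes, so its derivative along [v] is of order [e]. *)
Lemma vanishing_differential (rho u : V -> R) (q : V) k0 k :
  (\forall x \near q, differentiable rho x) -> rho q = 0 -> pd k0 rho q != 0 ->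
  differentiable u q -> (\forall x \near q, rho x = 0 -> u x = 0) ->
  pd k u q * pd k0 rho q = pd k0 u q * pd k rho q.
Proof.
move=> Dr rq rk Du Hu.
pose v : V := pd k0 rho q *: evec R k - pd k rho q *: evec R k0.
have evE (w : 'I_8 -> R) i : \sum_(l < 8) evec R i 0 l * w l = w i.
  rewrite (bigD1 i) //= big1 ?addr0 => [|l li]; first by rewrite /evec mxE !eqxx mul1r.
  by rewrite /evec mxE (negbTE li) andbF mul0r.
have vE (w : 'I_8 -> R) (t s : R) : \sum_(l < 8) (t *: v + s *: evec R k0) 0 l * w l
   = t * (pd k0 rho q * w k - pd k rho q * w k0) + s * w k0.
  rewrite (eq_bigr (fun l => t * pd k0 rho q * (evec R k 0 l * w l) +
    (- (t * pd k rho q) * (evec R k0 0 l * w l) + s * (evec R k0 0 l * w l)))); last first.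
    by move=> l _; rewrite /v /evec !mxE; clear; ring.
  by rewrite !big_split /= -!mulr_sumr !evE; clear; ring.
have vE0 t s : \sum_(l < 8) (t *: v + s *: evec R k0) 0 l * pd l rho q = s * pd k0 rho q.
  by rewrite vE [X in X - _]mulrC subrr mulr0 add0r.
suff B (e : R) : 0 < e -> e <= 1 ->
   `|pd k0 rho q * pd k u q - pd k rho q * pd k0 u q| <= e * (`|pd k0 u q| + `|pd k0 rho q|).
  apply/eqP; rewrite -subr_eq0 mulrC [X in _ - X]mulrC -normr_eq0 eq_le normr_ge0 andbT.
  apply/ler_addgt0Pr => d d0; rewrite add0r.
  set K := `|pd k0 u q| + `|pd k0 rho q| in B.
  have K0 : 0 <= K by rewrite addr_ge0.
  have := B (Num.min 1 (d / (K + 1))); rewrite lt_min ltr01 divr_gt0 ?ltr_wpDl // ge_min lexx.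
  move=> /(_ isT isT)/le_trans; apply.
  apply: (@le_trans _ _ (d / (K + 1) * (K + 1))); last by rewrite divfK // gt_eqF // ltr_wpDl.
  by apply: ler_pM; rewrite ?ge_min ?lexx ?orbT ?lerDl // le_min ler01 divr_ge0 ?addr_ge0 // ltW.
move=> e0 e1.
pose A := `|v| + 1; have A0 : 0 < A by rewrite ltr_wpDl.
have r0 : 0 < `|pd k0 rho q| by rewrite normr_gt0.
pose eta := e * `|pd k0 rho q| / (2 * A).
have eta0 : 0 < eta by rewrite divr_gt0 ?mulr_gt0.
have eA : eta * A = e * `|pd k0 rho q| / 2.
  by rewrite /eta; field; rewrite gt_eqF.
have Dq : differentiable rho q by exact: nbhs_singleton Dr.
have H1 := differentiable_estimate Dq eta0; have H2 := differentiable_estimate Du eta0.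
have [d [d0 _ Hd]] := nbhs_small ltr01 (filterI (filterI H1 H2) (filterI Hu Dr)).
pose t := d / (2 * A); have t0 : 0 < t by rewrite divr_gt0 ?mulr_gt0.
pose y s : V := q + (t *: v + s *: evec R k0).
have yq (s : R) : y s - q = t *: v + s *: evec R k0 by rewrite /y addrAC subrr add0r.
have yn (s : R) : `|s| <= e * t -> `|y s - q| <= t * A.
  move=> st; rewrite yq; apply: le_trans (ler_normD _ _) _.
  have -> : `|t *: v| = t * `|v| by rewrite normrZ gtr0_norm.
  have -> : `|s *: evec R k0| = `|s| by rewrite normrZ norm_evec mulr1.
  rewrite /A mulrDr mulr1 lerD2l.
  by apply: (le_trans st); rewrite ger_pMl.
have yb (s : R) : `|s| <= e * t -> ball q d (y s).
  move=> /yn h; rewrite -ball_normE /ball_ /= distrC; apply: le_lt_trans h _.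
  by rewrite (_ : t * A = d / 2); [lra|rewrite /t; field; rewrite gt_eqF].
have F1 (s : R) : `|s| <= e * t -> `|rho (y s) - s * pd k0 rho q| <= t * (e * `|pd k0 rho q| / 2).
  move=> h; have [[/= h1 _] _] := Hd _ (yb s h); rewrite rq subr0 yq vE0 in h1.
  apply: le_trans h1 _; rewrite -eA -yq mulrCA; apply: ler_wpM2l; first exact: ltW.
  exact: yn.
have F2 (s : R) : `|s| <= e * t -> rho (y s) = 0 ->
   `|pd k0 rho q * pd k u q - pd k rho q * pd k0 u q| <= e * (`|pd k0 u q| + `|pd k0 rho q|).
  move=> h rs; have [[/= _ h1] [/= Hu1 _]] := Hd _ (yb s h).
  rewrite (Hu1 rs) (nbhs_singleton Hu rq) yq vE subr0 sub0r normrN in h1.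
  set D := _ - _ in h1 *.
  have h2 : `|t * D| <= `|s * pd k0 u q| + t * (e * `|pd k0 rho q| / 2).
    rewrite -lerBlDl; apply: le_trans (_ : `|t * D + s * pd k0 u q| <= _).
      by rewrite lerBlDr -{1}(addrK (s * pd k0 u q) (t * D)); exact: ler_normB.
    apply: le_trans h1 _; rewrite -eA -yq mulrCA; apply: ler_wpM2l; first exact: ltW.
    exact: yn.
  rewrite normrM (gtr0_norm t0) in h2.
  rewrite -(ler_pM2l t0); apply: le_trans h2 _.
  have h3 : `|s * pd k0 u q| <= e * t * `|pd k0 u q| by rewrite normrM ler_wpM2r.
  have h4 : 0 <= t * (e * `|pd k0 rho q|) := mulr_ge0 (ltW t0) (mulr_ge0 (ltW e0) (normr_ge0 _)).
  apply: le_trans (lerD h3 (lexx _)) _.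
  rewrite (_ : t * (e * _) = e * t * `|pd k0 u q| + t * (e * `|pd k0 rho q|)); last by clear; ring.
  rewrite lerD2l; clear - h4; lra.
have et0 : 0 <= e * t := mulr_ge0 (ltW e0) (ltW t0).
have ett : - (e * t) <= e * t by rewrite -subr_ge0 opprK addr_ge0.
have cont : {within `[- (e * t), e * t], continuous (rho \o y)}.
  apply: continuous_in_subspaceT => s; rewrite inE /= in_itv /= -ler_norml => sI.
  have [_ [_ /= ds]] := Hd _ (yb s sI).
  apply: continuous_comp; last exact: differentiable_continuous.
  apply: cvgD; first exact: cvg_cst.
  by apply: cvgD; [exact: cvg_cst|apply: cvgZr_tmp; exact: cvg_id].
have [s sI sE] : exists2 s : R, `|s| <= e * t & rho (y s) = 0.
  have := @IVT R (rho \o y) (- (e * t)) (e * t) 0 ett cont.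
  move=> /(_ _)[|s]; last by rewrite in_itv /= -ler_norml => ? ?; exists s.
  have := F1 (e * t); have := F1 (- (e * t)); rewrite normrN ger0_norm // lexx => /(_ isT) g1 /(_ isT) g2.
  rewrite /= ge_min le_max; move: g1 g2; rewrite !ler_norml.
  case: (ltrgt0P (pd k0 rho q)) => [p0|p0|p0]; last by rewrite p0 eqxx in rk.
    move=> /andP[_ a1] /andP[a2 _].
    have ee : 0 < e * t * pd k0 rho q := mulr_gt0 (mulr_gt0 e0 t0) p0.
    have -> : rho (y (- (e * t))) <= 0 by clear - a1 ee; lra.
    by have -> : 0 <= rho (y (e * t)) by [clear - a2 ee; lra]; rewrite orbT.
  move=> /andP[a1 _] /andP[_ a2].
  have ee : 0 < e * t * - pd k0 rho q by rewrite mulrN oppr_gt0 nmulr_llt0 // (mulr_gt0 e0 t0).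
  have -> : 0 <= rho (y (- (e * t))) by clear - a1 ee; lra.
  by have -> : rho (y (e * t)) <= 0 by [clear - a2 ee; lra]; rewrite orbT.
exact: F2 sI sE.
Qed.

End Analytic.

(** * Cauchy formula and analyticity of holomorphic functions *)

Section Goursat.
Variable R : realType.
Local Notation C := R[i].
Local Notation Re := complex.Re.
Local Notation Im := complex.Im.

#[local] Instance ultra_proper : ProperFilter (@ultra). Proof. by case: ultraU. Qed.

Lemma ulim_le (u : nat -> C) M B : (forall n, cn (u n) <= M) -> (exists N, forall n, (N <= n)%N -> cn (u n) <= B) ->
  cn (ulim u) <= B.
Proof.
move=> H [N HN].
have bR n : `|Re (u n)| <= M by apply: le_trans (H n); exact: Re_le_cn.
have bI n : `|Im (u n)| <= M by apply: le_trans (H n); exact: Im_le_cn.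
have c : (fun n => cn (u n)) @ ultra --> `|rlim (fun n => Re (u n))| + `|rlim (fun n => Im (u n))|.
  by apply: cvgD; apply: cvg_norm; apply: rlim_cvg; [exact: bR|exact: bI].
rewrite /cn /= -(cvg_lim _ c) //; apply: limr_le; first by apply/cvg_ex; eexists; exact: c.
by apply: ultra_sub; exists N.
Qed.

Lemma ulim_im_ge0 (u : nat -> C) M : (forall n, cn (u n) <= M) -> (forall n, 0 <= Im (u n)) -> 0 <= Im (ulim u).
Proof.
move=> H P; have bI n : `|Im (u n)| <= M by apply: le_trans (H n); exact: Im_le_cn.
apply: limr_ge; last by apply: filterE => n; exact: P.
by apply/cvg_ex; eexists; exact: rlim_cvg bI.
Qed.

Definition grid (n k : nat) : R := k%:R / n.+1%:R - 1.
Definition rsum (n : nat) (g : R -> C) : C := (n.+1%:R^-1)%:C * \sum_(k < 2 * n.+1) g (grid n k).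

Lemma count_lt (N : nat) (y : R) : 0 <= y <= N%:R ->
  `|\sum_(k < N) (if k%:R < y then 1 else 0) - y| <= 1.
Proof.
elim: N => [|N IH] /andP[y0 yN].
  by rewrite big_ord0 sub0r normrN ger0_norm // (le_trans yN) ?ler01.
rewrite big_ord_recr /=; case: ltP => Ny; last by rewrite addr0 IH // y0.
rewrite (eq_bigr (fun=> 1)).
  by rewrite sumr_const card_ord; move: yN; rewrite -natr1 => yN; rewrite ler_norml; apply/andP; split; lra.
by move=> k _; rewrite (lt_trans _ Ny) // ltr_nat.
Qed.

Definition cut (a b : R) (g : R -> C) (t : R) : C := if a <= t < b then g t else 0.
(** An integral defined and linear for every bounded integrand. The half-open cut makes additivity
    in the interval exact already for the Riemann sums. *)
Definition linint (a b : R) (g : R -> C) : C := ulim (fun n => rsum n (cut a b g)).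
Definition cnt n (a b : R) : R :=
  n.+1%:R^-1 * \sum_(k < 2 * n.+1) (if a <= grid n k < b then 1 else 0).

Lemma cnt_bound n (a b : R) : -1 <= a -> a <= b -> b <= 1 -> `|cnt n a b - (b - a)| <= 2 * n.+1%:R^-1.
Proof.
move=> a1 ab b1.
have n0 : 0 < n.+1%:R :> R by rewrite ltr0n.
have key (y : R) : -1 <= y -> y <= 1 ->
    `|\sum_(k < 2 * n.+1) (if grid n k < y then 1 else 0) - (y + 1) * n.+1%:R| <= 1.
  move=> y1 y2.
  rewrite (eq_bigr (fun k : 'I_(2 * n.+1) => if k%:R < (y + 1) * n.+1%:R then 1 else 0)); last first.
    by move=> k _; rewrite /grid ltrBlDr ltr_pdivrMr.
  apply: count_lt; rewrite natrM; apply/andP; split; first by apply: mulr_ge0; [lra|exact: ltW].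
  by apply: ler_wpM2r; [exact: ltW|lra].
have E : cnt n a b - (b - a) = n.+1%:R^-1 *
   ((\sum_(k < 2 * n.+1) (if grid n k < b then 1 else 0) - (b + 1) * n.+1%:R) -
    (\sum_(k < 2 * n.+1) (if grid n k < a then 1 else 0) - (a + 1) * n.+1%:R)).
  rewrite /cnt (eq_bigr (fun k : 'I_(2 * n.+1) => (if grid n k < b then 1 else 0) - (if grid n k < a then 1 else 0))).
    by rewrite sumrB; field.
  move=> k _; case: ltP => kb; case: leP => ka /=; rewrite ?subr0 ?subrr //.
  by move: (le_lt_trans (le_trans ab kb) ka); rewrite ltxx.
rewrite E normrM gtr0_norm ?invr_gt0 // mulrC ler_wpM2r ?invr_ge0 ?(ltW n0) //.
apply: le_trans (ler_normB _ _) _; have := key b (le_trans a1 ab) b1; have := key a a1 (le_trans ab b1).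
by clear; move=> *; lra.
Qed.

Lemma cut_rsum n (a b : R) g M : -1 <= a -> a <= b -> b <= 1 -> (forall t, a <= t < b -> cn (g t) <= M) ->
  0 <= M -> cn (rsum n (cut a b g)) <= M * (b - a + 2 * n.+1%:R^-1).
Proof.
move=> a1 ab b1 H M0; have := cnt_bound n a1 ab b1; rewrite ler_norml => /andP[_ h].
apply: (@le_trans _ _ (M * cnt n a b)); last by rewrite ler_wpM2l // -lerBlDl.
have n0 : 0 < n.+1%:R^-1 :> R by rewrite invr_gt0 ltr0n.
rewrite /rsum cn_Zr gtr0_norm // /cnt mulrCA ler_wpM2l ?(ltW n0) // mulr_sumr.
apply: le_trans (cn_sum _ _) _; apply: ler_sum => k _; rewrite /cut.
by case: ifP => [/H|]; rewrite ?mulr1 // mulr0 cn0.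
Qed.

Lemma inv_small (K e : R) : 0 < e -> exists N, forall n, (N <= n)%N -> K * n.+1%:R^-1 <= e.
Proof.
move=> e0; have [K0|K0] := leP K 0.
  by exists 0%N => n _; apply: le_trans (ltW e0); rewrite mulr_le0_ge0.
exists (Num.truncn (K / e)) => n Nn; rewrite ler_pdivrMr ?ltr0n // mulrC -ler_pdivrMr //.
by apply: ltW; apply: lt_le_trans (truncnS_gt _) _; rewrite ler_nat ltnS.
Qed.

Lemma linint_blf (a b : R) : -1 <= a -> a <= b -> b <= 1 -> blf [set t | a <= t < b] (b - a) (linint a b).
Proof.
move=> a1 ab b1.
have bs g : bnd [set t | a <= t < b] g -> exists M, forall n, cn (rsum n (cut a b g)) <= M.
  move=> [M H]; exists (`|M| * (b - a + 2)) => n.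
  apply: le_trans (cut_rsum n a1 ab b1 _ (normr_ge0 M)) _.
    by move=> t Ht; apply: le_trans (H t Ht) (ler_norm _).
  rewrite ler_wpM2l // lerD2l ler_piMr // invf_le1 ?ler1n // ltr0n //.
split=> [|g1 g2 z B1 B2|g M H].
- by rewrite subr_ge0.
- have [M1 H1] := bs _ B1; have [M2 H2] := bs _ B2.
  have [_ L _] := ulim_blf R; rewrite /linint -L; last 2 first.
  + by exists M1 => n _; exact: H1.
  + by exists M2 => n _; exact: H2.
  congr ulim; apply/funext => n; rewrite /rsum mulrCA -mulrDr; congr (_ * _).
  rewrite mulr_sumr -big_split; apply: eq_bigr => k _; rewrite /cut; case: ifP => // _.
  by rewrite /= mulr0 addr0.
- have [E|ltab] := eqVneq a b.
    rewrite -E subrr mul0r /linint (_ : (fun _ => _) = fun=> 0); last first.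
      apply/funext => n; rewrite /rsum big1 ?mulr0 // => k _; rewrite /cut.
      by case: ifP => // /andP[/le_lt_trans h /h]; rewrite ltxx.
    by rewrite (blf0 (ulim_blf R)) cn0.
  have M0 : 0 <= M by apply: le_trans (cn_ge0 (g a)) (H a _); rewrite /= lexx lt_neqAle ltab ab.
  apply/ler_addgt0Pr => e e0.
  have [N HN] := inv_small (M * 2) e0.
  apply: (@ulim_le _ (M * (b - a + 2))) => [n|].
    apply: le_trans (cut_rsum n a1 ab b1 H M0) _.
    rewrite ler_wpM2l // lerD2l ler_piMr // invf_le1 ?ler1n // ltr0n //.
  exists N => n Nn; apply: le_trans (cut_rsum n a1 ab b1 H M0) _.
  by rewrite mulrDr mulrC lerD2l mulrA HN.
Qed.

Lemma linint_bound (a b : R) g M : -1 <= a -> a <= b -> b <= 1 -> (forall t, a <= t < b -> cn (g t) <= M) ->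
  cn (linint a b g) <= (b - a) * M.
Proof. by move=> h1 h2 h3 H; have [_ _] := linint_blf h1 h2 h3; apply. Qed.

Lemma linint_cst (a b : R) z : -1 <= a -> a <= b -> b <= 1 -> linint a b (fun=> z) = z * (b - a)%:C.
Proof.
move=> h1 h2 h3; apply: ulim_eq => e e0.
have e20 : 0 < e / 2 by rewrite divr_gt0.
have [N HN] := inv_small (cn z * 2) e20.
exists N => n Nn.
have -> : rsum n (cut a b (fun=> z)) = z * (cnt n a b)%:C.
  rewrite /rsum /cnt rmorphM /= mulrCA; congr (_ * _); rewrite rmorph_sum mulr_sumr.
  by apply: eq_bigr => k _; rewrite /cut; case: ifP; rewrite ?mulr1 ?mulr0.
rewrite -mulrBr -rmorphB /=; apply: (@le_lt_trans _ _ (e / 2)); last by rewrite ltr_pdivrMr // ltr_pMr // ltr1n.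
apply: le_trans (HN n Nn); apply: le_trans (cnM _ _) _; rewrite cn_real -mulrA ler_wpM2l ?cn_ge0 //.
exact: cnt_bound.
Qed.

Lemma linint_split (a m b : R) g : -1 <= a -> a <= m -> m <= b -> b <= 1 -> bnd [set t | a <= t < b] g ->
  linint a b g = linint a m g + linint m b g.
Proof.
move=> a1 am mb b1 [M H].
have ab := le_trans am mb; have m1 := le_trans a1 am; have m2 := le_trans mb b1.
have Z x y : -1 <= x -> x <= y -> y <= 1 -> (forall t, x <= t < y -> a <= t < b) ->
    bnd setT (fun n => rsum n (cut x y g)).
  move=> x1 xy y1 sub; exists (`|M| * (y - x + 2)) => n _.
  apply: le_trans (cut_rsum n x1 xy y1 _ (normr_ge0 M)) _.
    by move=> t Ht; apply: le_trans (H t (sub t Ht)) (ler_norm _).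
  rewrite ler_wpM2l // lerD2l ler_piMr // invf_le1 ?ler1n // ltr0n //.
rewrite /linint -(blfD (ulim_blf R)); last 2 first.
- by apply: Z => // t /andP[-> /lt_le_trans ->].
- by apply: Z => // t /andP[mt ->]; rewrite (le_trans am).
congr ulim; apply/funext => n; rewrite /rsum -mulrDr -big_split /=.
congr (_ * _); apply: eq_bigr => k _; rewrite /cut.
have [mk|mk] := leP m (grid n k); first by rewrite (le_trans am mk) /= add0r.
by rewrite (lt_le_trans mk mb) /= addr0.
Qed.

Lemma linint_im (a b : R) g : -1 <= a -> a <= b -> b <= 1 -> bnd [set t | a <= t < b] g ->
  (forall t, a <= t < b -> 1 / 2 <= Im (g t)) -> (b - a) / 2 <= Im (linint a b g).
Proof.
move=> a1 ab b1 B H.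
have := linint_cst ('i * (1 / 2)%:C) a1 ab b1.
have B' : bnd [set t : R | a <= t < b] (fun=> 'i * (1 / 2)%:C : C) := bnd_cst _ _.
have := blfB (linint_blf a1 ab b1) B B' => EB E.
have [M HM] := bndB B B'.
have : 0 <= Im (linint a b (fun t => g t - 'i * (1 / 2)%:C)).
  apply: (@ulim_im_ge0 _ (`|M| * (b - a + 2))) => n.
    apply: le_trans (cut_rsum n a1 ab b1 _ (normr_ge0 M)) _.
      by move=> t Ht; apply: le_trans (HM t Ht) (ler_norm _).
    rewrite ler_wpM2l // lerD2l ler_piMr // invf_le1 ?ler1n // ltr0n //.
  rewrite /rsum cImZ mulr_ge0 // Im_sum sumr_ge0 // => k _; rewrite /cut; case: ifP => // h.
  by rewrite cImB; have := H _ h; rewrite !(cImM, cReM) /= => ?; lra.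
by rewrite EB E cImB !(cImM, cReM) /= => ?; lra.
Qed.

(** The integral of [f dz] along the positively oriented boundary of a rectangle. *)
Definition rect (f : R -> R -> C) (a b c d : R) : C :=
  linint a b (fun s => f s c) - linint a b (fun s => f s d)
  + 'i * (linint c d (fun t => f b t) - linint c d (fun t => f a t)).

Definition rbnd (f : R -> R -> C) (a b c d M : R) : Prop :=
  forall s t, a <= s <= b -> c <= t <= d -> cn (f s t) <= M.

Lemma rbnd_x f (a b c d M a' b' t : R) : rbnd f a b c d M -> a <= a' -> b' <= b -> c <= t <= d ->
  bnd [set s | a' <= s < b'] (fun s => f s t).
Proof.
move=> B h1 h2 h3; exists M => s /= /andP[s1 s2]; apply: B => //.
by rewrite (le_trans h1) // (le_trans (ltW s2)).
Qed.
Lemma rbnd_y f (a b c d M c' d' s : R) : rbnd f a b c d M -> c <= c' -> d' <= d -> a <= s <= b ->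
  bnd [set t | c' <= t < d'] (fun t => f s t).
Proof.
move=> B h1 h2 h3; exists M => t /= /andP[t1 t2]; apply: B => //.
by rewrite (le_trans h1) // (le_trans (ltW t2)).
Qed.

Lemma rect_splitx f (a m b c d M : R) : -1 <= a -> a <= m -> m <= b -> b <= 1 -> -1 <= c -> c <= d -> d <= 1 ->
  rbnd f a b c d M -> rect f a b c d = rect f a m c d + rect f m b c d.
Proof.
move=> a1 am mb b1 c1 cd d1 B; rewrite /rect.
rewrite (@linint_split a m b (fun s => f s c)) ?(@linint_split a m b (fun s => f s d)) //; first ring.
  by apply: rbnd_x B _ _ _; rewrite ?lexx ?andbT.
by apply: rbnd_x B _ _ _; rewrite ?lexx ?andbT.
Qed.

Lemma rect_splity f (a b c m d M : R) : -1 <= a -> a <= b -> b <= 1 -> -1 <= c -> c <= m -> m <= d -> d <= 1 ->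
  rbnd f a b c d M -> rect f a b c d = rect f a b c m + rect f a b m d.
Proof.
move=> a1 ab b1 c1 cm md d1 B; rewrite /rect.
rewrite (@linint_split c m d (fun t => f a t)) ?(@linint_split c m d (fun t => f b t)) //; first ring.
  by apply: rbnd_y B _ _ _; rewrite ?lexx ?andbT.
by apply: rbnd_y B _ _ _; rewrite ?lexx ?andbT.
Qed.

Lemma rect_bound f (a b c d M : R) : -1 <= a -> a <= b -> b <= 1 -> -1 <= c -> c <= d -> d <= 1 ->
  rbnd f a b c d M -> cn (rect f a b c d) <= 2 * ((b - a) + (d - c)) * M.
Proof.
move=> a1 ab b1 c1 cd d1 B; rewrite /rect.
have hx t : c <= t <= d -> cn (linint a b (fun s => f s t)) <= (b - a) * M.
  by move=> h; apply: linint_bound => // s /andP[s1 s2]; apply: B => //; rewrite s1 ltW.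
have hy s : a <= s <= b -> cn (linint c d (fun t => f s t)) <= (d - c) * M.
  by move=> h; apply: linint_bound => // t /andP[s1 s2]; apply: B => //; rewrite s1 ltW.
apply: le_trans (cnD _ _) _; apply: (@le_trans _ _ ((b - a) * M + (b - a) * M + 1 * ((d - c) * M + (d - c) * M))).
  apply: lerD.
    by apply: le_trans (cnB _ _) _; apply: lerD; apply: hx; rewrite lexx ?andbT.
  apply: le_trans (cnM _ _) _; rewrite cni; apply: ler_wpM2l => //.
  by apply: le_trans (cnB _ _) _; apply: lerD; apply: hy; rewrite lexx ?andbT.
by rewrite le_eqVlt; apply/orP; left; apply/eqP; ring.
Qed.

Definition zc (s t : R) : C := s%:C + 'i * t%:C.

Lemma bnd_id (a b : R) (u : R) (k : C) : -1 <= a -> b <= 1 -> bnd [set t | a <= t < b] (fun t => k * (t - u)%:C).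
Proof.
move=> a1 b1; apply: bndM; first exact: bnd_cst.
exists (1 + `|u|) => t /= /andP[t1 t2]; rewrite cn_real; apply: le_trans (ler_normB _ _) _.
by rewrite lerD2r ler_norml; apply/andP; split; lra.
Qed.

(** The integrals of the linear part cancel between opposite sides, so only integrals of constants
    have to be known. *)
Lemma rect_affine f (a b c d M u v : R) (z0 D : C) :
  -1 <= a -> a <= b -> b <= 1 -> -1 <= c -> c <= d -> d <= 1 -> rbnd f a b c d M ->
  rect (fun s t => f s t - z0 - D * zc (s - u) (t - v)) a b c d = rect f a b c d.
Proof.
move=> a1 ab b1 c1 cd d1 B; rewrite /rect.
have Ex t : c <= t <= d -> linint a b (fun s => f s t - z0 - D * zc (s - u) (t - v)) =
   linint a b (fun s => f s t) - linint a b (fun s => D * (s - u)%:C) - (z0 + D * ('i * (t - v)%:C)) * (b - a)%:C.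
  move=> h; have Bf : bnd [set s | a <= s < b] (fun s => f s t) by apply: rbnd_x B _ _ h.
  have Bi := bnd_id u D a1 b1.
  rewrite -(blfB (linint_blf a1 ab b1) Bf Bi) -linint_cst //.
  rewrite -(blfB (linint_blf a1 ab b1)); [|exact: bndB|exact: bnd_cst].
  by congr linint; apply/funext => s; rewrite /zc; ring.
have Ey s : a <= s <= b -> linint c d (fun t => f s t - z0 - D * zc (s - u) (t - v)) =
   linint c d (fun t => f s t) - linint c d (fun t => D * 'i * (t - v)%:C) - (z0 + D * (s - u)%:C) * (d - c)%:C.
  move=> h; have Bf : bnd [set t | c <= t < d] (fun t => f s t) by apply: rbnd_y B _ _ h.
  have Bi := bnd_id v (D * 'i) c1 d1.
  rewrite -(blfB (linint_blf c1 cd d1) Bf Bi) -linint_cst //.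
  rewrite -(blfB (linint_blf c1 cd d1)); [|exact: bndB|exact: bnd_cst].
  by congr linint; apply/funext => t; rewrite /zc; ring.
rewrite !Ex ?Ey ?lexx ?ab ?cd //.
rewrite !rmorphB /=; ring.
Qed.

End Goursat.

(** * Goursat's theorem and Cauchy's formula on a square *)

Section Cauchy.
Variable R : realType.
Local Notation V := 'rV[R]_8.
Local Notation C := R[i].
Local Notation Re := complex.Re.
Local Notation Im := complex.Im.

Lemma bisection (P : R -> R -> R -> R -> Prop) (x y W H : R) : 0 <= W -> 0 <= H ->
  (forall a c w h, 0 <= w -> 0 <= h -> P a c w h -> P (a + w) c w h -> P a (c + h) w h ->
     P (a + w) (c + h) w h -> P a c (w + w) (h + h)) ->
  (forall u v, x <= u <= x + W -> y <= v <= y + H -> exists2 d : R, 0 < d &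
     forall a c w h, 0 <= w < d -> 0 <= h < d -> a <= u <= a + w -> c <= v <= c + h ->
       P a c w h) ->
  P x y W H.
Proof.
move=> W0 H0 step loc; apply: contrapT => nP.
pose w n : R := W / 2 ^+ n; pose h n : R := H / 2 ^+ n.
have half (t : R) n : t / 2 ^+ n = t / 2 ^+ n.+1 + t / 2 ^+ n.+1.
  by rewrite exprS; field; rewrite expf_neq0.
have w0 n : 0 <= w n by rewrite divr_ge0 ?exprn_ge0.
have h0 n : 0 <= h n by rewrite divr_ge0 ?exprn_ge0.
pose nx n (q : R * R) : R * R :=
  if `[< ~ P q.1 q.2 (w n.+1) (h n.+1) >] then q else
  if `[< ~ P (q.1 + w n.+1) q.2 (w n.+1) (h n.+1) >] then (q.1 + w n.+1, q.2) else
  if `[< ~ P q.1 (q.2 + h n.+1) (w n.+1) (h n.+1) >] then (q.1, q.2 + h n.+1) else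
  (q.1 + w n.+1, q.2 + h n.+1).
pose F := fix F n := if n is n'.+1 then nx n' (F n') else (x, y).
have nPF n : ~ P (F n).1 (F n).2 (w n) (h n).
  elim: n => [|n IH]; first by rewrite /w /h expr0 !divr1.
  move=> Q; apply: IH; rewrite /w /h (half W) (half H); move: Q => /=; rewrite /nx.
  case: asboolP => [|/contrapT P1]; first by [].
  case: asboolP => [|/contrapT P2]; first by [].
  case: asboolP => [|/contrapT P3]; first by [].
  by move=> P4; apply: step => //; [exact: (w0 n.+1)|exact: (h0 n.+1)].
have S1 n : (F n).1 <= (F n.+1).1 /\ (F n.+1).1 + w n.+1 <= (F n).1 + w n.
  have -> : w n = w n.+1 + w n.+1 by rewrite /w half.
  rewrite /= /nx; have := w0 n.+1; move: (w n.+1) => t t0.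
  by case: ifP => _; [|case: ifP => _; [|case: ifP => _]]; rewrite /=; split; lra.
have S2 n : (F n).2 <= (F n.+1).2 /\ (F n.+1).2 + h n.+1 <= (F n).2 + h n.
  have -> : h n = h n.+1 + h n.+1 by rewrite /h half.
  rewrite /= /nx; have := h0 n.+1; move: (h n.+1) => t t0.
  by case: ifP => _; [|case: ifP => _; [|case: ifP => _]]; rewrite /=; split; lra.
have lim (u t : nat -> R) : (forall n, 0 <= t n) ->
    (forall n, u n <= u n.+1 /\ u n.+1 + t n.+1 <= u n + t n) ->
    exists l, forall n, u n <= l <= u n + t n.
  move=> t0 S.
  have up m n : (m <= n)%N -> u m <= u n /\ u n + t n <= u m + t m.
    elim: n => [|n IH]; first by rewrite leqn0 => /eqP ->.
    rewrite leq_eqVlt => /orP[/eqP-> //|]; rewrite ltnS => /IH[a1 a2].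
    by have [b1 b2] := S n; split; [exact: le_trans b1|exact: le_trans a2].
  have ub n m : u m <= u n + t n.
    have [mn|/ltnW nm] := leqP m n.
      by apply: le_trans (proj1 (up _ _ mn)) _; rewrite lerDl.
    by apply: le_trans (proj2 (up _ _ nm)); rewrite lerDl.
  exists (sup (range u)) => n; apply/andP; split.
    apply: ub_le_sup; last by exists n.
    by exists (u 0%N + t 0%N) => _ [m _ <-].
  apply: ge_sup; first by exists (u 0%N), 0%N.
  by move=> _ [m _ <-].
have [u Hu] := lim _ _ w0 S1; have [v Hv] := lim _ _ h0 S2.
have Hu0 := Hu 0%N; have Hv0 := Hv 0%N.
rewrite /w /h expr0 !divr1 /= in Hu0 Hv0.
have [d d0 Hd] := loc u v Hu0 Hv0.
have small (t : R) : exists N, forall n, (N <= n)%N -> t / 2 ^+ n < d.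
  have [|N HN] := @geo_small R (2^-1) t d _ d0; first by apply/andP; split; lra.
  by exists N => n /HN; rewrite exprVn.
have [N1 HN1] := small W; have [N2 HN2] := small H.
apply: (nPF (maxn N1 N2)); apply: Hd => //.
- by rewrite w0 HN1 // leq_maxl.
- by rewrite h0 HN2 // leq_maxr.
Qed.

Definition cderivable (f : R -> R -> C) (u v : R) : Prop :=
  exists D : C, forall e : R, 0 < e -> exists2 d : R, 0 < d & forall s t,
    `|s - u| < d -> `|t - v| < d ->
    cn (f s t - f u v - D * zc (s - u) (t - v)) <= e * (`|s - u| + `|t - v|).

Lemma rbnd_sub f (a b c d a' b' c' d' M : R) : a <= a' -> b' <= b -> c <= c' -> d' <= d ->
  rbnd f a b c d M -> rbnd f a' b' c' d' M.
Proof.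
move=> aa bb cc dd B s t /andP[s1 s2] /andP[t1 t2].
by apply: B; [rewrite (le_trans aa s1) (le_trans s2 bb)|rewrite (le_trans cc t1) (le_trans t2 dd)].
Qed.

(** The estimate by [e (w + h)^2] is compatible with quartering, and near a point it follows from
    complex differentiability once the affine part has been removed by [rect_affine]. The derivative
    need not be continuous. *)
Lemma goursat f (a b c d M : R) : -1 <= a -> a <= b -> b <= 1 -> -1 <= c -> c <= d -> d <= 1 ->
  rbnd f a b c d M -> (forall u v, a <= u <= b -> c <= v <= d -> cderivable f u v) ->
  rect f a b c d = 0.
Proof.
move=> a1 ab b1 c1 cd d1 B Df.
have key (e : R) : 0 < e -> cn (rect f a b c d) <= e * ((b - a) + (d - c)) ^+ 2.
  move=> e0.
  pose P x y w h := a <= x -> x + w <= b -> c <= y -> y + h <= d ->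
    cn (rect f x (x + w) y (y + h)) <= e * (w + h) ^+ 2.
  have : P a c (b - a) (d - c).
    apply: bisection; rewrite ?subr_ge0 //.
    - move=> x y /= w h w0 h0 P1 P2 P3 P4 xa xb yc yd.
      have [x1 xw xww b2] : [/\ -1 <= x, x <= x + w, x + w <= x + (w + w) & x + (w + w) <= 1].
        by clear - a1 b1 w0 xa xb; split; lra.
      have [y1 yh yhh d2] : [/\ -1 <= y, y <= y + h, y + h <= y + (h + h) & y + (h + h) <= 1].
        by clear - c1 d1 h0 yc yd; split; lra.
      have B' := rbnd_sub xa xb yc yd B.
      have Bl := rbnd_sub (lexx x) xww (lexx y) (lexx _) B'.
      have Br := rbnd_sub xw (lexx _) (lexx y) (lexx _) B'.
      rewrite (rect_splitx x1 xw xww b2 y1 (le_trans yh yhh) d2 B').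
      rewrite (rect_splity x1 xw (le_trans xww b2) y1 yh yhh d2 Bl).
      rewrite (rect_splity (le_trans x1 xw) xww b2 y1 yh yhh d2 Br).
      have -> : e * (w + w + (h + h)) ^+ 2 = e * (w + h) ^+ 2 + e * (w + h) ^+ 2 + (e * (w + h) ^+ 2 + e * (w + h) ^+ 2).
        by clear; ring.
      have xwa := le_trans xa xw; have yhc := le_trans yc yh.
      have xwb := le_trans xww xb; have yhd := le_trans yhh yd.
      rewrite (addrA x w w) in xb *; rewrite (addrA y h h) in yd *.
      apply: le_trans (cnD _ _) _; apply: lerD; (apply: le_trans (cnD _ _) _; apply: lerD).
      * exact: P1.
      * exact: P3.
      * exact: P2.
      * exact: P4.
    - move=> u v /andP[u1 u2] /andP[v1 v2].
      have uab : a <= u <= b by rewrite u1 -[b](subrKC a).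
      have vcd : c <= v <= d by rewrite v1 -[d](subrKC c).
      have [D HD] := Df u v uab vcd.
      have e2 : 0 < e / 2 by rewrite divr_gt0.
      have [dl dl0 Hdl] := HD _ e2.
      exists dl => // x y w h /andP[w0 wd] /andP[h0 hd] /andP[xu1 xu2] /andP[yv1 yv2] xa xb yc yd.
      have B' := rbnd_sub xa xb yc yd B.
      have [x1 xw b2] : [/\ -1 <= x, x <= x + w & x + w <= 1].
        by clear - a1 b1 w0 xa xb; split; lra.
      have [y1 yh d2] : [/\ -1 <= y, y <= y + h & y + h <= 1].
        by clear - c1 d1 h0 yc yd; split; lra.
      rewrite -(rect_affine u v (f u v) D x1 xw b2 y1 yh d2 B').
      have E : e * (w + h) ^+ 2 = 2 * ((x + w - x) + (y + h - y)) * (e / 2 * (w + h)).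
        by clear; field.
      rewrite E; apply: (rect_bound x1 xw b2 y1 yh d2).
      move=> s t /andP[s1 s2] /andP[t1 t2].
      have su : `|s - u| <= w by rewrite ler_norml; clear - s1 s2 xu1 xu2; apply/andP; split; lra.
      have tv : `|t - v| <= h by rewrite ler_norml; clear - t1 t2 yv1 yv2; apply/andP; split; lra.
      apply: le_trans (Hdl s t _ _) _; [exact: le_lt_trans wd|exact: le_lt_trans hd|].
      by apply: ler_wpM2l; [exact: ltW|exact: lerD].
  by rewrite /P !subrKC; apply; rewrite ?lexx.
apply: cn_eq0; apply/eqP; rewrite eq_le cn_ge0 andbT; apply/ler_addgt0Pr => e e0; rewrite add0r.
pose K : R := ((b - a) + (d - c)) ^+ 2 + 1.
have K0 : 0 < K by rewrite ltr_pwDr // sqr_ge0.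
apply: le_trans (key (e / K) (divr_gt0 e0 K0)) _.
by rewrite mulrAC ler_pdivrMr // ler_wpM2l ?(ltW e0) // lerDl.
Qed.

Lemma zc_eq0 s t : (zc s t == 0 :> C) = (s == 0) && (t == 0).
Proof.
have [E|] := boolP (_ && _); first by case/andP: E => /eqP -> /eqP ->; rewrite /zc mulr0 addr0 eqxx.
apply: contraNF => /eqP E; move: (congr1 (@complex.Re R) E) (congr1 (@complex.Im R) E).
by rewrite /zc cReD cImD cReM cImM /= !(mul0r, mul1r, subr0, add0r, addr0, oppr0, mulr0) => -> ->; rewrite eqxx.
Qed.

Lemma cn_zc s t : cn (zc s t : C) = `|s| + `|t|.
Proof. by rewrite /cn /zc cReD cImD cReM cImM /= !(mul0r, mul1r, subr0, add0r, addr0, oppr0, mulr0). Qed.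

Lemma zcB s t u v : zc (s - u) (t - v) = zc s t - zc u v :> C.
Proof. by rewrite /zc !rmorphB /=; ring. Qed.

Definition bdry : set (R * R) := [set z | [&& `|z.1| <= 1, `|z.2| <= 1 & (`|z.1| == 1) || (`|z.2| == 1)]].
Definition contour (g : R * R -> C) : C := rect (fun s t => g (s, t)) (-1) 1 (-1) 1.

Lemma bdry_x (s : R) : -1 <= s < 1 -> bdry (s, -1) /\ bdry (s, 1).
Proof.
move=> /andP[s1 s2]; have h : `|s| <= 1 by rewrite ler_norml s1 ltW.
by rewrite /bdry /= normrN normr1 h lexx eqxx orbT.
Qed.
Lemma bdry_y (t : R) : -1 <= t < 1 -> bdry (-1, t) /\ bdry (1, t).
Proof.
move=> /andP[s1 s2]; have h : `|t| <= 1 by rewrite ler_norml s1 ltW.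
by rewrite /bdry /= normrN normr1 h lexx eqxx.
Qed.

Lemma contour_blf : blf bdry 8 contour.
Proof.
have Hb : blf [set t : R | -1 <= t < 1] (1 - (-1)) (@linint R (-1) 1) by apply: linint_blf; lra.
have [_ L B] := Hb.
have bx (g : R * R -> C) : bnd bdry g -> [/\ bnd [set t : R | -1 <= t < 1] (fun s => g (s, -1)),
    bnd [set t : R | -1 <= t < 1] (fun s => g (s, 1)), bnd [set t : R | -1 <= t < 1] (fun s => g (-1, s))
    & bnd [set t : R | -1 <= t < 1] (fun s => g (1, s))].
  move=> [M H]; split; exists M => t Ht; apply: H; by case: (bdry_x Ht) (bdry_y Ht) => ? ? [].
split=> [|g1 g2 z B1 B2|g M H].
- by [].
- have [x1 x2 x3 x4] := bx _ B1; have [y1 y2 y3 y4] := bx _ B2.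
  by rewrite /contour /rect !L //; ring.
- have h : [/\ cn (linint (-1) 1 (fun s => g (s, -1))) <= 2 * M, cn (linint (-1) 1 (fun s => g (s, 1))) <= 2 * M,
      cn (linint (-1) 1 (fun s => g (-1, s))) <= 2 * M & cn (linint (-1) 1 (fun s => g (1, s))) <= 2 * M].
    have e2 : 2 = 1 - (-1) :> R by lra.
    by rewrite e2; split; apply: B => t Ht; apply: H; case: (bdry_x Ht) (bdry_y Ht) => ? ? [].
  have [h1 h2 h3 h4] := h; rewrite /contour /rect.
  apply: le_trans (cnD _ _) _; apply: (@le_trans _ _ ((2 * M + 2 * M) + 1 * (2 * M + 2 * M))).
    apply: lerD; first by apply: le_trans (cnB _ _) _; exact: lerD.
    apply: le_trans (cnM _ _) _; rewrite cni; apply: ler_wpM2l => //.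
    by apply: le_trans (cnB _ _) _; exact: lerD.
  by rewrite le_eqVlt; apply/orP; left; apply/eqP; ring.
Qed.

Definition cauchy_kernel (u v : R) (z : R * R) : C := (zc z.1 z.2 - zc u v)^-1.

Lemma bdry_far u v z : `|u| <= 1 / 2 -> `|v| <= 1 / 2 -> bdry z -> 1 / 2 <= cn (zc z.1 z.2 - zc u v : C).
Proof.
move=> hu hv; case: z => s t /= /and3P[s1 t1 h]; rewrite -zcB cn_zc.
have a1 := ler_normB (s - u) (- u); have a2 := ler_normB (t - v) (- v).
move: a1 a2; rewrite !opprK !normrN !subrK => a1 a2.
case/orP: h => /eqP h; have p1 := normr_ge0 (s - u); have p2 := normr_ge0 (t - v); lra.
Qed.

Lemma kernel_bnd u v : `|u| <= 1 / 2 -> `|v| <= 1 / 2 -> bnd bdry (cauchy_kernel u v).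
Proof.
move=> hu hv; exists (2 / (1 / 2)) => z Hz; apply: cnV_le; [lra|exact: bdry_far].
Qed.

Lemma cderivable_div f u v u0 v0 c : cderivable f u0 v0 -> zc u0 v0 != zc u v :> C ->
  cderivable (fun s t => (f s t - c) * (zc s t - zc u v)^-1) u0 v0.
Proof.
move=> [D HD] ne; set z0 : C := zc u0 v0 - zc u v.
have z00 : z0 != 0 by rewrite subr_eq0.
set g0 := f u0 v0 - c; pose D' := (D - g0 / z0) / z0.
exists D' => e e0.
have m0 : 0 < cn z0 by rewrite cn_gt0.
pose m := cn z0 / 2; have mm : 0 < m by rewrite divr_gt0.
have e'0 : 0 < e * m / 4 by rewrite !mulr_gt0 // invr_gt0.
have [d d0 Hd] := HD _ e'0.
pose K := cn D' + 1; have K0 : 0 < K by rewrite ltr_pwDr // cn_ge0.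
exists (Num.min d (Num.min (m / 2) (e * m / (8 * K)))).
  rewrite !lt_min d0 !divr_gt0 //= ?mulr_gt0 //.
move=> s t; rewrite !lt_min => /and3P[s1 s2 s3] /and3P[t1 t2 t3].
set h : C := zc (s - u0) (t - v0).
have hn : cn h = `|s - u0| + `|t - v0| by rewrite cn_zc.
have zE : zc s t - zc u v = z0 + h by rewrite /z0 /h zcB; ring.
have zm : m <= cn (z0 + h).
  have := cnB (z0 + h) h; rewrite addrK hn; move: s2 t2; rewrite /m; clear; lra.
have zn : z0 + h != 0 by rewrite -cn_gt0 (lt_le_trans mm).
set r := f s t - f u0 v0 - D * h.
have rb : cn r <= e * m / 4 * cn h by rewrite hn; exact: Hd.
have fE : f s t - c = g0 + D * h + r by rewrite /g0 /r; ring.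
rewrite fE zE.
have -> : (g0 + D * h + r) / (z0 + h) - g0 * z0^-1 - D' * h = (r - D' * h * h) / (z0 + h).
  by rewrite /D'; field; rewrite zn z00.
apply: le_trans (cnM _ _) _.
apply: (@le_trans _ _ ((e * m / 4 * cn h + e * m / 4 * cn h) * (2 / m))); last first.
  by rewrite -hn le_eqVlt; apply/orP; left; apply/eqP; field; rewrite gt_eqF.
apply: ler_pM; rewrite ?cn_ge0 //; last exact: cnV_le.
apply: le_trans (cnB _ _) _; apply: lerD => //.
apply: le_trans (cnM _ _) _; apply: ler_wpM2r; first exact: cn_ge0.
apply: le_trans (cnM _ _) _; rewrite hn.
have H1 : `|s - u0| + `|t - v0| <= e * m / (4 * K).
  have -> : e * m / (4 * K) = e * m / (8 * K) + e * m / (8 * K) by field; rewrite gt_eqF.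
  by rewrite lerD // ltW.
apply: (@le_trans _ _ (K * (e * m / (4 * K)))).
  by apply: ler_pM => //; rewrite ?cn_ge0 ?addr_ge0 // /K lerDl.
by rewrite le_eqVlt; apply/orP; left; apply/eqP; field; rewrite gt_eqF.
Qed.

(** The integral of the kernel is left unevaluated. The difference quotient [q] is bounded and
    complex differentiable off the pole, so only a square of side [2 d] around the pole contributes,
    and [d] is arbitrary. *)
Lemma cauchy_formula f M u v : rbnd f (-1) 1 (-1) 1 M ->
  (forall s t, -1 <= s <= 1 -> -1 <= t <= 1 -> cderivable f s t) ->
  `|u| <= 1 / 2 -> `|v| <= 1 / 2 ->
  contour (fun z => f z.1 z.2 * cauchy_kernel u v z) = f u v * contour (cauchy_kernel u v).
Proof.
move=> B Df hu hv.
have /andP[u1 u2] : - (1 / 2) <= u <= 1 / 2 by rewrite -ler_norml.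
have /andP[v1 v2] : - (1 / 2) <= v <= 1 / 2 by rewrite -ler_norml.
have uI : -1 <= u <= 1 by clear - u1 u2; apply/andP; split; lra.
have vI : -1 <= v <= 1 by clear - v1 v2; apply/andP; split; lra.
pose q s t := (f s t - f u v) * (zc s t - zc u v)^-1.
have bf : bnd bdry (fun z => f z.1 z.2).
  by exists M => -[s t] /= /and3P[s1 t1 _]; apply: B; rewrite -ler_norml.
have bk := kernel_bnd hu hv.
suff E : contour (fun z => q z.1 z.2) = 0.
  have bfk := bndM bf bk.
  have bc := bndM (bnd_cst bdry (f u v)) bk.
  rewrite -(blfZ contour_blf (f u v) bk); apply/eqP; rewrite -subr_eq0 -(blfB contour_blf bfk bc); apply/eqP.
  by rewrite -[RHS]E; congr contour; apply/funext => z; rewrite /q /cauchy_kernel mulrBl.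
have M0 : 0 <= M by apply: le_trans (B _ _ uI vI); exact: cn_ge0.
have [M' Bq] : exists M', rbnd q (-1) 1 (-1) 1 M'.
  have [D HD] := Df u v uI vI; have [d d0 Hd] := HD 1 ltr01.
  exists ((cn D + 2) + (M + M) * (2 / d)) => s t hs ht; rewrite /q.
  set z := zc s t - zc u v.
  have nn : 0 <= (M + M) * (2 / d) by rewrite mulr_ge0 ?addr_ge0 // divr_ge0 // ltW.
  have [z0|zn] := eqVneq z 0.
    by rewrite z0 invr0 mulr0 cn0 addr_ge0 // addr_ge0 // cn_ge0.
  have [zd|zd] := ltP (cn z) d.
    rewrite -[leLHS]addr0; apply: lerD => //.
    have zE : z = zc (s - u) (t - v) by rewrite zcB.
    have hz : cn z = `|s - u| + `|t - v| by rewrite zE cn_zc.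
    have := Hd s t; rewrite -zE -hz mul1r => h.
    have -> : (f s t - f u v) / z = D + (f s t - f u v - D * z) / z by field.
    apply: le_trans (cnD _ _) _; apply: lerD => //.
    apply: le_trans (cnM _ _) _; apply: (@le_trans _ _ (cn z * (2 / cn z))).
      apply: ler_pM; rewrite ?cn_ge0 //; last by apply: cnV_le => //; rewrite cn_gt0.
      by apply: h; apply: le_lt_trans zd; rewrite hz ?lerDl ?lerDr.
    by rewrite mulrCA divff ?mulr1 // gt_eqF // cn_gt0.
  rewrite -[leLHS]add0r; apply: lerD; first by rewrite addr_ge0 // cn_ge0.
  apply: le_trans (cnM _ _) _; apply: ler_pM; rewrite ?cn_ge0 //; last exact: cnV_le.
  by apply: le_trans (cnB _ _) _; apply: lerD; exact: B.
have M'0 : 0 <= M' by apply: le_trans (Bq _ _ uI vI); exact: cn_ge0.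
have small (d : R) : 0 < d -> d <= 1 / 2 -> cn (rect q (-1) 1 (-1) 1) <= 8 * d * M'.
  move=> d0 d2.
  have Bs a b c e : -1 <= a -> b <= 1 -> -1 <= c -> e <= 1 -> rbnd q a b c e M'.
    by move=> h1 h2 h3 h4 s t /andP[s1 s2] /andP[t1 t2]; apply: Bq; apply/andP; split; clear - h1 h2 h3 h4 s1 s2 t1 t2; lra.
  have Z a b c e : -1 <= a -> a <= b -> b <= 1 -> -1 <= c -> c <= e -> e <= 1 ->
      [|| b < u, u < a, e < v | v < c] -> rect q a b c e = 0.
    move=> h1 h2 h3 h4 h5 h6 far; apply: (@goursat _ _ _ _ _ M') => //; first exact: Bs.
    move=> s t /andP[s1 s2] /andP[t1 t2]; apply: cderivable_div.
      by apply: Df; apply/andP; split; clear - h1 h2 h3 h4 h5 h6 s1 s2 t1 t2; lra.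
    rewrite -subr_eq0 -zcB zc_eq0 !subr_eq0.
    by apply/negP => /andP[/eqP su /eqP tv]; rewrite -su -tv !ltNge s1 s2 t1 t2 in far.
  have [x1 x2 x3 x4] : [/\ -1 <= u - d, u - d <= u + d, u + d <= 1 & u - d <= 1].
    by clear - u1 u2 d0 d2; split; lra.
  have [y1 y2 y3 y4] : [/\ -1 <= v - d, v - d <= v + d, v + d <= 1 & v - d <= 1].
    by clear - v1 v2 d0 d2; split; lra.
  have n1 : -1 <= 1 :> R by clear; lra.
  have x5 := le_trans x1 x2; have y5 := le_trans y1 y2.
  have n0 := lexx (-1 : R); have p0 := lexx (1 : R).
  have cu1 : u - d < u by rewrite ltrBlDr ltrDl.
  have cu2 : u < u + d by rewrite ltrDl.
  have cv1 : v - d < v by rewrite ltrBlDr ltrDl.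
  have cv2 : v < v + d by rewrite ltrDl.
  rewrite (rect_splitx n0 x1 x4 p0 n0 n1 p0 (Bs _ _ _ _ n0 p0 n0 p0)).
  rewrite (rect_splitx x1 x2 x3 p0 n0 n1 p0 (Bs _ _ _ _ x1 p0 n0 p0)).
  rewrite (rect_splity x1 x2 x3 n0 y1 y4 p0 (Bs _ _ _ _ x1 x3 n0 p0)).
  rewrite (rect_splity x1 x2 x3 y1 y2 y3 p0 (Bs _ _ _ _ x1 x3 y1 p0)).
  rewrite (Z (-1) (u - d) (-1) 1 n0 x1 x4 n0 n1 p0); last by rewrite cu1.
  rewrite (Z (u + d) 1 (-1) 1 x5 x3 p0 n0 n1 p0); last by rewrite cu2 orbT.
  rewrite (Z (u - d) (u + d) (-1) (v - d) x1 x2 x3 n0 y1 y4); last by rewrite cv1 !orbT.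
  rewrite (Z (u - d) (u + d) (v + d) 1 x1 x2 x3 y5 y3 p0); last by rewrite cv2 !orbT.
  rewrite !(add0r, addr0); have -> : 8 * d * M' = 2 * ((u + d - (u - d)) + (v + d - (v - d))) * M' by clear; ring.
  exact: (rect_bound x1 x2 x3 y1 y2 y3 (Bs _ _ _ _ x1 x3 y1 y3)).
apply: cn_eq0; apply/eqP; rewrite eq_le cn_ge0 andbT; apply/ler_addgt0Pr => e e0; rewrite add0r.
pose K := 8 * M' + 2 * e + 1; have K0 : 0 < K by rewrite ltr_pwDr // addr_ge0 ?mulr_ge0 // ltW.
apply: le_trans (small (e / K) _ _) _.
- by rewrite divr_gt0.
- rewrite ler_pdivrMr // /K; clear - M'0 e0; lra.
- have -> : 8 * (e / K) * M' = e * (8 * M') / K by clear; ring.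
  rewrite ler_pdivrMr // ler_wpM2l ?(ltW e0) // /K; clear - M'0 e0; lra.
Qed.

(** Each of the four sides contributes an imaginary part of at least 1: the relevant integrand is
    [1 / (t^2 + 1)], at least 1/2 on an interval of length 2. *)
Lemma contour_kernel0 : contour (cauchy_kernel 0 0) != 0.
Proof.
have z0 : zc 0 0 = 0 :> C by apply/eqP; rewrite zc_eq0 eqxx.
have KE s t : cauchy_kernel 0 0 (s, t) = (s / (s ^+ 2 + t ^+ 2)) +i* (- (t / (s ^+ 2 + t ^+ 2))).
  rewrite /cauchy_kernel z0 subr0 /=; have -> : zc s t = s +i* t :> C; last by [].
  by apply: eqReIm; rewrite /zc !(cReD, cImD, cReM, cImM) /= !(mul0r, mul1r, subr0, add0r, addr0, oppr0, mulr0).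
suff : 0 < Im (contour (cauchy_kernel 0 0)).
  by apply: contraTN => /eqP ->; rewrite ltxx.
have bk : bnd bdry (cauchy_kernel 0 0) by apply: kernel_bnd; rewrite normr0; lra.
have side (g : R -> C) : bnd [set t : R | -1 <= t < 1] g -> (forall t, -1 <= t < 1 -> 1 / 2 <= Im (g t)) ->
    1 <= Im (linint (-1) 1 g).
  by move=> Bg Hg; have := linint_im (lexx _) _ (lexx _) Bg Hg; rewrite opprK => h; have := h ltac:(lra); lra.
have nb (g : R -> C) z : bnd [set t : R | -1 <= t < 1] g -> bnd [set t : R | -1 <= t < 1] (fun t => z * g t).
  by move=> Bg; apply: bndM => //; exact: bnd_cst.
have Hb : blf [set t : R | -1 <= t < 1] (1 - (-1)) (@linint R (-1) 1) by apply: linint_blf; lra.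
have [M HM] := bk.
have B1 : bnd [set t : R | -1 <= t < 1] (fun s => cauchy_kernel 0 0 (s, -1)) by exists M => t /bdry_x[] *; exact: HM.
have B2 : bnd [set t : R | -1 <= t < 1] (fun s => cauchy_kernel 0 0 (s, 1)) by exists M => t /bdry_x[] *; exact: HM.
have B3 : bnd [set t : R | -1 <= t < 1] (fun s => cauchy_kernel 0 0 (-1, s)) by exists M => t /bdry_y[] *; exact: HM.
have B4 : bnd [set t : R | -1 <= t < 1] (fun s => cauchy_kernel 0 0 (1, s)) by exists M => t /bdry_y[] *; exact: HM.
have q (t : R) : -1 <= t < 1 -> 1 / 2 <= 1 / (t ^+ 2 + 1).
  move=> /andP[t1 t2]; have p : 0 < t ^+ 2 + 1 by rewrite ltr_pwDr // sqr_ge0.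
  rewrite ler_pdivlMr // mul1r mulrC ler_pdivrMr // mul1r.
  have : 0 <= (1 - t) * (1 + t) by apply: mulr_ge0; clear - t1 t2; lra.
  by clear; nra.
have S1 : 1 <= Im (linint (-1) 1 (fun s => cauchy_kernel 0 0 (s, -1))).
  by apply: side => // t /q; rewrite KE /= sqrrN expr1n mulNr opprK.
have S2 : 1 <= Im ((-1) * linint (-1) 1 (fun s => cauchy_kernel 0 0 (s, 1))).
  rewrite -(blfZ Hb _ B2); apply: side => [|t /q]; first exact: nb.
  by rewrite KE mulN1r cImN /= expr1n opprK.
have S3 : 1 <= Im (- 'i * linint (-1) 1 (fun t => cauchy_kernel 0 0 (-1, t))).
  rewrite -(blfZ Hb _ B3); apply: side => [|t /q]; first exact: nb.
  by rewrite KE mulNr cImN cImM /= sqrrN expr1n (addrC 1); clear; lra.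
have S4 : 1 <= Im ('i * linint (-1) 1 (fun t => cauchy_kernel 0 0 (1, t))).
  rewrite -(blfZ Hb _ B4); apply: side => [|t /q]; first exact: nb.
  by rewrite KE cImM /= expr1n (addrC 1); clear; lra.
rewrite /contour /rect mulrBr cImD !cImB.
have sum4 (w1 w2 w3 w4 : R) : 1 <= w1 -> 1 <= - w2 -> 1 <= - w3 -> 1 <= w4 -> 0 < w1 - w2 + (w4 - w3).
  by clear; move=> *; lra.
by move: S1 S2 S3 S4; rewrite mulN1r mulNr !cImN; exact: sum4.
Qed.

End Cauchy.

(** * Analyticity of holomorphic functions of four variables *)

Section Holomorphic.
Variable R : realType.
Local Notation V := 'rV[R]_8.
Local Notation C := R[i].
Local Notation Re := complex.Re.
Local Notation Im := complex.Im.

Lemma gev_prod (I : Type) (l : seq I) (c s : R) : 0 <= c -> 0 <= s ->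
  exists c' s', [/\ 0 <= c', 0 <= s' & forall (p : V) r (f : I -> V -> C),
    (forall j, gev p r c s (f j)) -> gev p r c' s' (fun x => \prod_(j <- l) f j x)].
Proof.
move=> c0 s0; elim: l => [|j l [c' [s' [c'0 s'0 H]]]].
  exists 1, s; split=> // p r f _; under eq_fun do rewrite big_nil.
  by have h : gev p r (cn (1 : C)) s (fun=> 1) by [exact: gev_cst]; rewrite cn1 in h.
exists (2 * c * c'), (s + 2 * s'); split; rewrite ?mulr_ge0 ?addr_ge0 ?mulr_ge0 // => p r f Hf.
under eq_fun do rewrite big_cons.
apply: gevM => //; first by rewrite addr_ge0 ?mulr_ge0.
  by apply: gev_mono (Hf j) => //; rewrite lerDl mulr_ge0.
by apply: gev_mono (H p r f Hf) => //; clear - s0 s'0; lra.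
Qed.

Lemma split_x (j : 'I_4) : @fintype.split 4 4 (xcoord j) = inl j.
Proof. exact: (@unsplitK 4 4 (inl j)). Qed.
Lemma split_y (j : 'I_4) : @fintype.split 4 4 (ycoord j) = inr j.
Proof. exact: (@unsplitK 4 4 (inr j)). Qed.

Lemma coordP (P : 'I_8 -> Prop) : (forall j, P (xcoord j)) -> (forall j, P (ycoord j)) -> forall k, P k.
Proof.
move=> Hx Hy k; rewrite -(@splitK 4 4 k); case: (@fintype.split 4 4 k) => j; [exact: Hx|exact: Hy].
Qed.

Lemma sum_coord2 (v : V) (g : 'I_8 -> C) j (a b : R) : (forall l, v 0 (xcoord l) = if l == j then a else 0) ->
  (forall l, v 0 (ycoord l) = if l == j then b else 0) ->
  \sum_(k < 8) (v 0 k)%:C * g k = a%:C * g (xcoord j) + b%:C * g (ycoord j).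
Proof.
move=> Ha Hb; rewrite (@big_split_ord _ _ _ 4 4) /=; congr (_ + _); rewrite (bigD1 j) //= big1 ?addr0 => [|l lj].
- by rewrite (Ha j) eqxx.
- by rewrite (Ha l) (negbTE lj) mul0r.
- by rewrite (Hb j) eqxx.
- by rewrite (Hb l) (negbTE lj) mul0r.
Qed.

Variables (p : V) (rho : R).
Hypothesis rho0 : 0 < rho.

Definition polypt (z : 'I_4 -> R * R) : V :=
  \row_k (p 0 k + rho * match @fintype.split 4 4 k with inl j => (z j).1 | inr j => (z j).2 end).
Definition polycoord (x : V) (j : 'I_4) : R * R :=
  ((x 0 (xcoord j) - p 0 (xcoord j)) / rho, (x 0 (ycoord j) - p 0 (ycoord j)) / rho).

Lemma polypt_x z j : polypt z 0 (xcoord j) = p 0 (xcoord j) + rho * (z j).1.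
Proof. by rewrite mxE split_x. Qed.
Lemma polypt_y z j : polypt z 0 (ycoord j) = p 0 (ycoord j) + rho * (z j).2.
Proof. by rewrite mxE split_y. Qed.

Lemma polycoordK x : polypt (polycoord x) = x.
Proof.
have rn : rho != 0 by rewrite gt_eqF.
by apply/rowP; apply: coordP => j; rewrite ?polypt_x ?polypt_y /= mulrC divfK // addrC subrK.
Qed.

Lemma polycoord_le x j (e : R) : `|x - p| <= e -> `|(polycoord x j).1| <= e / rho /\ `|(polycoord x j).2| <= e / rho.
Proof.
have h k : `|x - p| <= e -> `|x 0 k - p 0 k| <= e.
  by apply: le_trans; have := coord_le_norm (x - p) k; rewrite !mxE.
by move=> H; rewrite /= !normrM normfV (gtr0_norm rho0) !ler_pM2r ?invr_gt0 // !h.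
Qed.

Lemma polypt_le z : (forall j, `|(z j).1| <= 1 /\ `|(z j).2| <= 1) -> `|polypt z - p| <= rho.
Proof.
move=> H; apply: norm_le_coord; first exact: ltW.
by apply: coordP => j; rewrite 2!mxE ?split_x ?split_y [in X in `|X|]mxE addrAC subrr add0r normrM (gtr0_norm rho0)
  ger_pMr //; case: (H j).
Qed.

Definition updz (z : 'I_4 -> R * R) (j : 'I_4) (w : R * R) (l : 'I_4) : R * R := if l == j then w else z l.

Lemma cderivable_slice f z j : (forall x, `|x - p| <= rho -> cdiff f x /\ forall j, dzbar j f x = 0) ->
  (forall l, `|(z l).1| <= 1 /\ `|(z l).2| <= 1) ->
  forall u v, -1 <= u <= 1 -> -1 <= v <= 1 -> cderivable (fun s t => f (polypt (updz z j (s, t)))) u v.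
Proof.
move=> Hf Hz u v hu hv; set y := polypt (updz z j (u, v)).
have yp : `|y - p| <= rho.
  by apply: polypt_le => l; rewrite /updz; case: ifP => _; [rewrite !ler_norml /= hu hv|exact: Hz].
have [dy bary] := Hf y yp.
exists (rho%:C * cpd (xcoord j) f y) => e e0.
have er0 : 0 < e / rho by rewrite divr_gt0.
have [d d0 Hd] : exists2 d : R, 0 < d & forall x, `|x - y| < d ->
    cn (f x - f y - \sum_(k < 8) ((x - y) 0 k)%:C * cpd k f y) <= e / rho * `|x - y|.
  have /nbhs_ballP[d /= d0 H] := cdiff_estimate dy er0.
  by exists d => // x xy; apply: H; rewrite -ball_normE /= distrC.
exists (d / (2 * rho)); first by rewrite divr_gt0 // mulr_gt0.
move=> s t hs ht; set x := polypt (updz z j (s, t)).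
have cx l : x 0 (xcoord l) - y 0 (xcoord l) = if l == j then rho * (s - u) else 0.
  by rewrite !polypt_x /updz; case: ifP => _ /=; ring.
have cy l : x 0 (ycoord l) - y 0 (ycoord l) = if l == j then rho * (t - v) else 0.
  by rewrite !polypt_y /updz; case: ifP => _ /=; ring.
have cx' l : (x - y) 0 (xcoord l) = if l == j then rho * (s - u) else 0 by rewrite [(x - y) 0 _]mxE [(- y) 0 _]mxE; exact: cx.
have cy' l : (x - y) 0 (ycoord l) = if l == j then rho * (t - v) else 0 by rewrite [(x - y) 0 _]mxE [(- y) 0 _]mxE; exact: cy.
have nxy : `|x - y| <= rho * (`|s - u| + `|t - v|).
  apply: norm_le_coord; first by rewrite mulr_ge0 ?addr_ge0 // ltW.
  have pos : 0 <= rho * (`|s - u| + `|t - v|) by rewrite mulr_ge0 ?addr_ge0 // ltW.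
  apply: coordP => l; rewrite [(x - y) 0 _]mxE [(- y) 0 _]mxE ?(cx l) ?(cy l); case: ifP => _; rewrite ?normr0 //;
    by rewrite normrM (gtr0_norm rho0) ler_pM2l // ?lerDl ?lerDr.
have small : `|x - y| < d.
  apply: le_lt_trans nxy _; rewrite mulrC -ltr_pdivlMr //.
  have -> : d / rho = d / (2 * rho) + d / (2 * rho) by field; rewrite gt_eqF.
  exact: ltrD.
have := Hd x small.
have cr : cpd (ycoord j) f y = 'i * cpd (xcoord j) f y.
  have := bary j; rewrite /dzbar => /eqP; rewrite mulf_eq0 => /orP[/eqP h|/eqP h].
    by have := congr1 (@complex.Re R) h => /= /eqP; rewrite div1r invr_eq0 pnatr_eq0.
  have ii : 'i * 'i = -1 :> C by rewrite -expr2 sqr_i.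
  have -> : cpd (ycoord j) f y = - ('i * 'i) * cpd (ycoord j) f y by rewrite ii opprK mul1r.
  have -> : cpd (xcoord j) f y = - 'i * cpd (ycoord j) f y by rewrite mulNr; apply/eqP; rewrite -addr_eq0 h.
  ring.
have -> : \sum_(k < 8) ((x - y) 0 k)%:C * cpd k f y = rho%:C * cpd (xcoord j) f y * zc (s - u) (t - v).
  rewrite (sum_coord2 (fun k => cpd k f y) cx' cy') cr /zc.
  by move: (cpd (xcoord j) f y) => q; rewrite !rmorphM /=; clear; ring.
move=> h; apply: le_trans h _.
apply: (@le_trans _ _ (e / rho * (rho * (`|s - u| + `|t - v|)))).
  by apply: ler_wpM2l nxy; exact: ltW.
by rewrite mulrA divfK // gt_eqF.
Qed.

End Holomorphic.

Section HolomorphicGerm.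
Variable R : realType.
Local Notation V := 'rV[R]_8.
Local Notation C := R[i].

(** Uniformity in the boundary point [z] is what allows integration over it. *)
Lemma kernel_gev (p : V) (rho : R) : 0 < rho -> exists r c s, [/\ 0 < r, r <= rho / 2, 0 <= c, 0 <= s &
  forall j z, bdry z -> gev p r c s
    (fun x => cauchy_kernel (polycoord p rho x j).1 (polycoord p rho x j).2 z)].
Proof.
move=> rho0; have r20 : 0 < rho / 2 by rewrite divr_gt0.
pose e := rho / 2.
have s0 : 0 <= e^-1 by rewrite invr_ge0 ltW.
pose c1 := 2 + cn (- (rho^-1)%:C : C) * e + cn ('i * - (rho^-1)%:C : C) * e : R.
have c10 : 0 <= c1 by rewrite !addr_ge0 ?mulr_ge0 ?cn_ge0 // ltW.
have [r [c [s [r0 rr c0 s0' H]]]] := @gev_inv R e c1 (e^-1) 1 r20 c10 s0 ltr01.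
exists r, c, s; split=> // j z Hz.
pose g (x : V) : C := zc z.1 z.2 + (- (rho^-1)%:C) * (coordC (xcoord j) x - (p 0 (xcoord j))%:C)
  + ('i * - (rho^-1)%:C) * (coordC (ycoord j) x - (p 0 (ycoord j))%:C).
have gE x : g x = zc z.1 z.2 - zc (polycoord p rho x j).1 (polycoord p rho x j).2.
  by rewrite /g /zc /coordC /= !rmorphM !rmorphB /=; ring.
have gz : gev p e c1 e^-1 g.
  apply: (@gev_mono R p e (cn (zc z.1 z.2 : C) + cn (- (rho^-1)%:C : C) * e + cn ('i * - (rho^-1)%:C : C) * e) e^-1) => //.
  - by rewrite !addr_ge0 ?mulr_ge0 ?cn_ge0 // ltW.
  - rewrite !lerD2r cn_zc; case/and3P: Hz; clear; move=> *; lra.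
  - by apply: gevD; [apply: gevD; [exact: gev_cst|apply: gevZ; exact: gev_coord]|apply: gevZ; exact: gev_coord].
have [] := H p g gz.
  rewrite gE /polycoord /= !subrr !mul0r -zcB !subr0 cn_zc.
  by case/and3P: Hz => h1 h2 /orP[] /eqP ->; rewrite ?lerDl ?lerDr.
by move=> G _; apply: gev_eq G => x _; rewrite gE.
Qed.

(** Cauchy's formula one variable at a time. In [K k z x] the first [k] variables of [f] are
    boundary points. At [k = 4] only kernels depend on [x], and each integration lowers [k]; at
    [k = 0] there remains [f] times a product of kernel integrals, nonzero near [p], by which one
    divides. *)
Theorem holomorphic_gevp (U : set V) (f : V -> C) (p : V) : open U -> U p -> holomorphic_on U f -> gevp p f.
Proof.
move=> oU Up Hf.
have dp : cdiff f p by case: (Hf p Up) => ? [].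
have [rho [M [rho0 [Hin HM]]]] : exists rho M, 0 < rho /\ (forall x, `|x - p| <= rho -> U x) /\
    (forall x, `|x - p| <= rho -> cn (f x) <= M).
  have N1 : \forall x \near p, U x by exact: open_nbhs_nbhs.
  have N2 := cdiff_cont dp ltr01.
  have [r [r0 _ Hr]] := nbhs_small ltr01 (filterI N1 N2).
  have in_ x : `|x - p| <= r / 2 -> ball p r x.
    move=> h; rewrite -ball_normE /= distrC; apply: le_lt_trans h _.
    by rewrite ltr_pdivrMr // ltr_pMr // ltr1n.
  exists (r / 2), (cn (f p) + 1); split; first by rewrite divr_gt0.
  split=> x /in_ /Hr[// _ h]; have := cnD (f x - f p) (f p); rewrite subrK => /le_trans; apply.
  by rewrite addrC lerD2l ltW.
have Hf' x : `|x - p| <= rho -> cdiff f x /\ forall j, dzbar j f x = 0.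
  by move=> /Hin /Hf[? []].
have M0 : 0 <= M by apply: le_trans (HM p _); rewrite ?cn_ge0 // subrr normr0 ltW.
have [r [c [s [r0 rr c0 s0 Hk]]]] := kernel_gev p rho0.
pose w x := polycoord p rho x.
pose mix k (z : 'I_4 -> R * R) x := polypt p rho (fun j => if (j < k)%N then z j else w x j).
pose fac k (z : 'I_4 -> R * R) x (j : 'I_4) := if (j < k)%N then cauchy_kernel (w x j).1 (w x j).2 (z j)
  else contour (cauchy_kernel (w x j).1 (w x j).2).
pose K k z x := f (mix k z x) * \prod_(j < 4) fac k z x j.
have wb x j : ball p r x -> `|(w x j).1| <= 1 / 2 /\ `|(w x j).2| <= 1 / 2.
  rewrite -ball_normE /= distrC => /ltW h.
  have [h1 h2] := polycoord_le rho0 j h.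
  have e : r / rho <= 1 / 2 by rewrite ler_pdivrMr // (le_trans rr) // mulrC div1r.
  by split; exact: le_trans e.
have key k : (k <= 4)%N -> exists c' s', [/\ 0 <= c', 0 <= s' &
    forall z, (forall j, bdry (z j)) -> gev p r c' s' (K (4 - k)%N z)].
  elim: k => [_|k IH k4].
    have [c' [s' [c'0 s'0 H]]] := gev_prod (index_enum 'I_4) c0 s0.
    exists (M * c'), s'; split; rewrite ?mulr_ge0 // => z Hz.
    have b1 : `|polypt p rho z - p| <= rho by apply: polypt_le => // j; have /and3P[] := Hz j.
    apply: (@gev_mono R p r (cn (f (polypt p rho z)) * c') s'); rewrite ?mulr_ge0 ?cn_ge0 //.
      by rewrite ler_wpM2r // HM.
    apply: (@gev_eq R p r _ _ (fun x => f (polypt p rho z) * \prod_(j < 4) cauchy_kernel (w x j).1 (w x j).2 (z j))).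
      move=> x _; rewrite /K /mix /fac subn0; congr (f (polypt p rho _) * _); first by apply/funext => j; rewrite ltn_ord.
      by apply: eq_bigr => j _; rewrite ltn_ord.
    by apply: gevZ; apply: H => j; exact: Hk.
  have [c' [s' [c'0 s'0 H]]] := IH (ltnW k4).
  exists (8 * c'), s'; split; rewrite ?mulr_ge0 // => z Hz.
  have mS : (4 - k = (4 - k.+1).+1)%N by rewrite subnSK.
  rewrite mS in H; set m := (4 - k.+1)%N in H *.
  have m4 : (m < 4)%N by rewrite /m; clear - k4; lia.
  pose i := Ordinal m4.
  have Hu ze : bdry ze -> forall j, bdry (updz z i ze j) by move=> ? j; rewrite /updz; case: ifP.
  apply: (@gev_eq R p r _ _ (fun x => contour (fun ze => K m.+1 (updz z i ze) x))); last first.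
    by apply: (gev_blf (contour_blf R)) => ze Hze; apply: H; exact: Hu.
  move=> x Ox.
  pose rest := \prod_(j < 4 | j != i) fac m z x j.
  pose F s t := f (polypt p rho (updz (fun j => if (j < m)%N then z j else w x j) i (s, t))).
  have in1 (j : 'I_4) : `|(if (j < m)%N then z j else w x j).1| <= 1 /\ `|(if (j < m)%N then z j else w x j).2| <= 1.
    case: ifP => _; first by have /and3P[] := Hz j.
    by have [h1 h2] := wb x j Ox; split; [apply: le_trans h1 _|apply: le_trans h2 _]; clear; lra.
  have KE ze : K m.+1 (updz z i ze) x = rest * (F ze.1 ze.2 * cauchy_kernel (w x i).1 (w x i).2 ze).
    have f1 : fac m.+1 (updz z i ze) x i = cauchy_kernel (w x i).1 (w x i).2 ze by rewrite /fac /updz ltnSn eqxx.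
    rewrite /K (bigD1 i) //= f1.
    have -> : \prod_(j < 4 | j != i) fac m.+1 (updz z i ze) x j = rest.
      apply: eq_bigr => j ji; rewrite /fac /updz (negbTE ji) ltnS leq_eqVlt.
      by rewrite (_ : (j == m :> nat) = false) //; apply: contraNF ji => /eqP h; apply/eqP/val_inj.
    have -> : f (mix m.+1 (updz z i ze) x) = F ze.1 ze.2; last by ring.
    rewrite /F /mix -surjective_pairing; congr (f (polypt p rho _)); apply/funext => j; rewrite /updz ltnS leq_eqVlt.
    have [->|ji] := eqVneq j i; first by rewrite eqxx.
    by rewrite (_ : (j == m :> nat) = false) //; apply: contraNF ji => /eqP h; apply/eqP/val_inj.
  have [hu hv] := wb x i Ox.
  have BF : rbnd F (-1) 1 (-1) 1 M.
    move=> a b ha hb; apply: HM; apply: polypt_le => // l; rewrite /updz; case: ifP => _; last exact: in1.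
    by rewrite !ler_norml ha hb.
  have bk := kernel_bnd hu hv.
  have bF : bnd (@bdry R) (fun ze => F ze.1 ze.2).
    by exists M => -[a b] /and3P[/= ha hb _]; apply: BF; rewrite -ler_norml.
  under eq_fun do rewrite KE.
  rewrite (blfZ (contour_blf R) rest (bndM bF bk)) (cauchy_formula BF _ hu hv); last first.
    by move=> a b ha hb; apply: cderivable_slice.
  have f1 : fac m z x i = contour (cauchy_kernel (w x i).1 (w x i).2) by rewrite /fac ltnn.
  rewrite /K (bigD1 i) //= f1 -/rest.
  have -> : f (mix m z x) = F (w x i).1 (w x i).2; last by ring.
  rewrite /F /mix -surjective_pairing; congr (f (polypt p rho _)); apply/funext => j; rewrite /updz.
  by have [->|//] := eqVneq j i; rewrite ltnn.
(* At [k = 0] the boundary point no longer enters, so any choice will do. *)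
pose z1 (j : 'I_4) : R * R := (1, 1).
have bz1 j : bdry (z1 j) by rewrite /bdry /= normr1 lexx eqxx.
have [c1 [s1 [c10 s10 H1]]] := key 4%N (leqnn _).
have Hc j : gevp p (fun x => contour (cauchy_kernel (w x j).1 (w x j).2)).
  apply: (gevp_intro r0); apply: (gev_blf (contour_blf R) (f := fun z x => cauchy_kernel (w x j).1 (w x j).2 z)).
  by move=> z; exact: Hk.
have cp j : contour (cauchy_kernel (w p j).1 (w p j).2) != 0.
  by rewrite /w /polycoord /= !subrr !mul0r contour_kernel0.
have HP : gevp p (fun x => \prod_(j < 4) contour (cauchy_kernel (w x j).1 (w x j).2)).
  rewrite /index_enum; elim: (Finite.enum _) => [|j l IH].
    by apply: gevp_ext (gevp_cst p 1) => x; rewrite big_nil.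
  by apply: gevp_ext (gevpM (Hc j) IH) => x; rewrite big_cons.
have np : \prod_(j < 4) contour (cauchy_kernel (w p j).1 (w p j).2) != 0.
  by apply/prodf_neq0 => j _; exact: cp.
have HK := gevp_intro r0 (H1 z1 bz1).
have := gevpM HK (gevpV HP np); apply: gevp_eq.
have N0 := cdiff_cont (gevp_cdiff HP).
have cn0 : 0 < cn (\prod_(j < 4) contour (cauchy_kernel (w p j).1 (w p j).2)) by rewrite cn_gt0.
have := N0 _ cn0; apply: filterS => x hx.
have nx : \prod_(j < 4) contour (cauchy_kernel (w x j).1 (w x j).2) != 0.
  by apply: contraTN hx => /eqP ->; rewrite sub0r cnN ltxx.
have -> : K (4 - 4)%N z1 x = f x * \prod_(j < 4) contour (cauchy_kernel (w x j).1 (w x j).2).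
  by rewrite /K /mix /= polycoordK.
by rewrite mulfK.
Qed.

End HolomorphicGerm.

(** * Extension of CR functions *)

Ltac gen_cpd := repeat match goal with |- context [cpd ?k ?f ?x] => generalize (cpd k f x) end; clear.

Section ComplexPartials.
Variable R : realType.
Local Notation V := 'rV[R]_8.
Local Notation C := R[i].
Local Notation Re := complex.Re.
Local Notation Im := complex.Im.

Definition cdir := ('I_4 + 'I_4)%type.
Definition pz (k : cdir) (f : V -> C) : V -> C :=
  match k with inl j => dz j f | inr j => dzbar j f end.
Definition cbar (k : cdir) : cdir := match k with inl j => inr j | inr j => inl j end.

(** A common shape for the holomorphic and antiholomorphic derivatives, with [e] equal to [- 'i] or
    ['i], so that each rule is proved once. *)
Lemma pzE k : exists j (e : C), cn e = 1 /\
  forall f x, pz k f x = (1 / 2)%:C * (cpd (xcoord j) f x + e * cpd (ycoord j) f x).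
Proof.
case: k => j; exists j; last by exists 'i; rewrite cni.
by exists (- 'i); split=> [|f x]; rewrite ?cnN ?cni //= /dz mulNr.
Qed.

Lemma pz_near k f g x : (\forall y \near x, f y = g y) -> cdiff f x -> pz k g x = pz k f x.
Proof. by move=> E df; have [_ H] := cdiff_near E df; have [j [e [_ PE]]] := pzE k; rewrite !PE !H. Qed.

Lemma pzD k f g x : cdiff f x -> cdiff g x -> pz k (fun y => f y + g y) x = pz k f x + pz k g x.
Proof. by move=> df dg; have [_ H] := cdiffD df dg; have [j [e [_ E]]] := pzE k; rewrite !E !H; gen_cpd; intros; ring. Qed.

Lemma pzN k f x : cdiff f x -> pz k (fun y => - f y) x = - pz k f x.
Proof. by move=> df; have [_ H] := cdiffN df; have [j [e [_ E]]] := pzE k; rewrite !E !H; gen_cpd; intros; ring. Qed.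

Lemma pzM k f g x : cdiff f x -> cdiff g x -> pz k (fun y => f y * g y) x = pz k f x * g x + f x * pz k g x.
Proof. by move=> df dg; have [_ H] := cdiffM df dg; have [j [e [_ E]]] := pzE k; rewrite !E !H; gen_cpd; intros; ring. Qed.

Lemma pz_cst k c x : pz k (fun=> c) x = 0.
Proof. by have [j [e [_ E]]] := pzE k; rewrite !E !cpd_cst mulr0 addr0 mulr0. Qed.

Lemma pz_sum k (I : Type) (l : seq I) (F : I -> V -> C) x : (forall i, cdiff (F i) x) ->
  pz k (fun y => \sum_(i <- l) F i y) x = \sum_(i <- l) pz k (F i) x.
Proof.
move=> dF; have [_ H] := cdiff_sum l dF; have [j [e [_ E]]] := pzE k; rewrite E !H mulr_sumr -big_split mulr_sumr.
by apply: eq_bigr => i _ /=; rewrite E.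
Qed.

Lemma pzV k f x : cdiff f x -> f x != 0 -> pz k (fun y => (f y)^-1) x = - pz k f x * (f x)^-1 ^+ 2.
Proof. by move=> df f0; have [_ H] := cdiffV df f0; have [j [e [_ E]]] := pzE k; rewrite !E !H; gen_cpd; intros; ring. Qed.

Lemma pz_conj k f x : cdiff f x -> pz k (fun y => (f y)^*) x = (pz (cbar k) f x)^*.
Proof.
move=> df; have [_ H] := cdiff_conj df.
by case: k => j; rewrite /pz /cbar /dz /dzbar !H; gen_cpd; case=> a1 a2 [b1 b2]; apply: eqReIm => /=; ring.
Qed.

Definition zco (j : 'I_4) : V -> C := fun x => coordC (xcoord j) x + 'i * coordC (ycoord j) x.

Lemma gevp_coordC (p : V) k : gevp p (coordC k).
Proof.
apply: (gevp_eq (f := fun x => (coordC k x - (p 0 k)%:C) + (p 0 k)%:C)).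
  by near=> x; rewrite subrK.
by apply: gevpD; [exact: gevp_intro (ltr01) (gev_coord p k (ltr01))|exact: gevp_cst].
Unshelve. all: by end_near.
Qed.

Lemma gevp_zco (p : V) j : gevp p (zco j).
Proof. by apply: gevpD; [|apply: gevpM; [exact: gevp_cst|]]; exact: gevp_coordC. Qed.

Lemma pz_zco j l x : pz (inl l) (zco j) x = (l == j)%:R /\ pz (inr l) (zco j) x = 0.
Proof.
have [d1 e1] := cdiff_coord (xcoord j) x; have [d2 e2] := cdiff_coord (ycoord j) x.
have [d3 e3] := cdiffM (cdiff_cst 'i x) d2; have [_ e4] := cdiffD d1 d3.
have xx i : (xcoord i == xcoord j) = (i == j) by rewrite (inj_eq (@lshift_inj 4 4)).
have yy i : (ycoord i == ycoord j) = (i == j) by rewrite (inj_eq (@rshift_inj 4 4)).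
have xy i i' : (xcoord i == ycoord i') = false by exact: (@eq_lrshift 4 4).
have yx i i' : (ycoord i == xcoord i') = false by exact: (@eq_rlshift 4 4).
have ii : 'i * 'i = -1 :> C by rewrite -expr2 sqr_i.
have half : (1 / 2)%:C + (1 / 2)%:C = 1 :> C by rewrite -rmorphD /=; congr (_ %:C); lra.
rewrite /= /dz /dzbar /zco !e4 !e3 !cpd_cst !e1 !e2 xx yy xy yx !mul0r !add0r mulr0 addr0.
set n := (l == j)%:R; split.
  have -> : (1 / 2)%:C * (n - 'i * ('i * n)) = (1 / 2)%:C * n - (1 / 2)%:C * ('i * 'i) * n by ring.
  by rewrite ii mulrN1 mulNr opprK -mulrDl half mul1r.
have -> : (1 / 2)%:C * (n + 'i * ('i * n)) = (1 / 2)%:C * (n + ('i * 'i) * n) by ring.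
by rewrite ii mulN1r subrr mulr0.
Qed.

Lemma gn_pz (p : V) r n F k f : gn p r n.+1 F f -> gn p r n (fun j => F j.+1) (pz k f).
Proof.
move=> H; have [j [e [e1 E]]] := pzE k.
have G1 := gnS H (xcoord j); have G2 := gnZ e (gnS H (ycoord j)).
have := gnZ (1 / 2)%:C (gnD G1 G2); rewrite cn_real e1.
have -> : (fun j => `|1 / 2| * (F j.+1 + 1 * F j.+1)) = (fun j => F j.+1).
  by apply/funext => i; rewrite ger0_norm; lra.
by apply: gn_eq => x _; rewrite E.
Qed.

Lemma gevp_pz p k f : gevp p f -> gevp p (pz k f).
Proof.
move=> H; have [j [e [e1 E]]] := pzE k.
apply: (gevp_ext (f := fun x => (1 / 2)%:C * (cpd (xcoord j) f x + e * cpd (ycoord j) f x))) => //.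
apply: gevpM; first exact: gevp_cst.
by apply: gevpD; [|apply: gevpM; [exact: gevp_cst|]]; exact: gevp_cpd.
Qed.

Lemma pz_comm p k l f : gevp p f -> pz k (pz l f) p = pz l (pz k f) p.
Proof.
move=> H; have [j [e [_ E]]] := pzE k; have [j' [e' [_ E']]] := pzE l.
have d i : cdiff (cpd i f) p by apply: gevp_cdiff; exact: gevp_cpd.
have half c i i' m : cpd m (fun x => (1 / 2)%:C * (cpd i f x + c * cpd i' f x)) p =
   (1 / 2)%:C * (cpd m (cpd i f) p + c * cpd m (cpd i' f) p).
  have [d1 e1] := cdiffM (cdiff_cst c p) (d i').
  have [d2 e2] := cdiffD (d i) d1; have [_ ->] := cdiffM (cdiff_cst (1 / 2)%:C p) d2.
  by rewrite e2 e1 !cpd_cst !mul0r !add0r.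
have fE := funext (E f); have fE' := funext (E' f).
rewrite E E' fE fE' !half !(gevp_schwarz (xcoord j) _ H) !(gevp_schwarz (ycoord j) _ H).
by gen_cpd; intros; ring.
Qed.

Lemma cpd_pz j f x : cpd (xcoord j) f x = pz (inl j) f x + pz (inr j) f x /\
  cpd (ycoord j) f x = 'i * (pz (inl j) f x - pz (inr j) f x).
Proof.
have ii : 'i * 'i = -1 :> C by rewrite -expr2 sqr_i.
have half : (1 / 2)%:C + (1 / 2)%:C = 1 :> C by rewrite -rmorphD /=; congr (_ %:C); lra.
rewrite /= /dz /dzbar; move: ii half; gen_cpd => v u ii; set c := (1 / 2)%:C => half; split.
  by match goal with |- ?u = _ => transitivity ((c + c) * u); first by rewrite half mul1r end; ring.
match goal with |- ?v = _ => transitivity (- ('i * 'i) * (c + c) * v); first by rewrite ii opprK half !mul1r end.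
ring.
Qed.

(** The shifted factorial records that [i] derivatives have already been taken, so that a
    differential operator can be iterated on a fixed ball. *)
Lemma conv_geo_shift n i (a e s : R) : 0 <= a -> 0 <= e -> 0 <= s ->
  conv n (fun j => a * s ^+ j * (j + i)`!%:R) (fun j => e * (s / 2) ^+ j * j`!%:R)
  <= 2 * a * e * s ^+ n * (n + i)`!%:R.
Proof.
move=> a0 e0 s0; rewrite convE.
apply: (@le_trans _ _ (\sum_(j < n.+1) a * e * s ^+ n * (n + i)`!%:R * 2^-1 ^+ (n - j))).
  apply: ler_sum => -[j jn] _ /=; rewrite ltnS in jn.
  have -> : 'C(n, j)%:R * (a * s ^+ j * (j + i)`!%:R) * (e * (s / 2) ^+ (n - j) * (n - j)`!%:R)
    = (a * e * s ^+ n * 2^-1 ^+ (n - j)) * ('C(n, j) * (j + i)`! * (n - j)`!)%:R.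
    by rewrite !natrM exprMn -[X in _ = _ * _ * (s ^+ X) * _ * _](subnKC jn) exprD; ring.
  rewrite [leRHS]mulrAC; apply: ler_wpM2l; first by rewrite !mulr_ge0 ?exprn_ge0 ?invr_ge0.
  rewrite ler_nat -(leq_pmul2r (fact_gt0 j)).
  have -> : ('C(n, j) * (j + i)`! * (n - j)`! * j`! = n`! * (j + i)`!)%N.
    by rewrite -(bin_fact jn); move: (j + i)`! (n - j)`! j`! 'C(n, j) => x y z w; lia.
  rewrite -(leq_pmul2r (fact_gt0 i)).
  have H1 : ('C(j + i, i) * (i`! * j`!) = (j + i)`!)%N by have := bin_fact (leq_addl j i); rewrite addnK.
  have H2 : ('C(n + i, i) * (i`! * n`!) = (n + i)`!)%N by have := bin_fact (leq_addl n i); rewrite addnK.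
  rewrite -H1 -H2.
  have -> : (n`! * ('C(j + i, i) * (i`! * j`!)) * i`! = (n`! * j`! * i`! * i`!) * 'C(j + i, i))%N.
    by move: 'C(j + i, i) n`! i`! j`! => x y z w; lia.
  have -> : ('C(n + i, i) * (i`! * n`!) * j`! * i`! = (n`! * j`! * i`! * i`!) * 'C(n + i, i))%N.
    by move: 'C(n + i, i) n`! i`! j`! => x y z w; lia.
  by rewrite leq_mul2l leq_bin2l ?orbT // leq_add2r.
rewrite -mulr_sumr (_ : 2 * a * e * s ^+ n * (n + i)`!%:R = a * e * s ^+ n * (n + i)`!%:R * 2); last by ring.
apply: ler_wpM2l; first by rewrite !mulr_ge0 // exprn_ge0.
have -> : \sum_(j < n.+1) 2^-1 ^+ (n - j) = \sum_(j < n.+1) (2^-1 : R) ^+ j.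
  rewrite (reindex_inj rev_ord_inj) /=; apply: eq_bigr => j _.
  by rewrite subSS subKn // -ltnS.
by apply: sum_geo_le2; clear; apply/andP; split; lra.
Qed.

Definition nabla (k : cdir) (a : V -> C) (f : V -> C) : V -> C := fun x => a x * pz k f x.

Lemma gn_nabla (p : V) r k a f c s al i : 0 <= c -> 0 <= s -> 0 <= al ->
  (forall n, gn p r n (fun j => c * s ^+ j * (j + i)`!%:R) f) -> gev p r al (s / 2) a ->
  forall n, gn p r n (fun j => c * (2 * al * s) * s ^+ j * (j + i.+1)`!%:R) (nabla k a f).
Proof.
move=> c0 s0 al0 Hf Ha n; have H := gn_pz k (Hf n.+1).
have := gnM H (Ha n); rewrite /nabla.
rewrite (_ : (fun x => a x * pz k f x) = (fun x => pz k f x * a x)); last by apply/funext => x; rewrite mulrC.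
apply: gn_mono => j.
have := @conv_geo_shift j i.+1 (c * s) al s (mulr_ge0 c0 s0) al0 s0.
have -> : 2 * (c * s) * al * s ^+ j * (j + i.+1)`!%:R = c * (2 * al * s) * s ^+ j * (j + i.+1)`!%:R by ring.
apply: le_trans; rewrite le_eqVlt; apply/orP; left; apply/eqP; congr conv.
by apply/funext => l; rewrite exprS addSnnS; ring.
Qed.

(** The inequality [(j + i)! <= 2^(j+i) j! i!] separates the two orders; the growth [i!] is exactly
    what the denominators of an exponential series compensate. *)
Lemma gn_iter_nabla (p : V) r k a f c s al : 0 <= c -> 0 <= s -> 0 <= al ->
  gev p r c s f -> gev p r al (s / 2) a ->
  forall i, gev p r (c * (4 * al * s) ^+ i * i`!%:R) (2 * s) (iter i (nabla k a) f).
Proof.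
move=> c0 s0 al0 Hf Ha i.
have H n : gn p r n (fun j => c * (2 * al * s) ^+ i * s ^+ j * (j + i)`!%:R) (iter i (nabla k a) f).
  elim: i n => [|i IH] n; first by apply: gn_mono (Hf n) => j; rewrite expr0 mulr1 addn0.
  have c'0 : 0 <= c * (2 * al * s) ^+ i by rewrite mulr_ge0 // exprn_ge0 // !mulr_ge0.
  by apply: gn_mono (gn_nabla k c'0 s0 al0 IH Ha n) => j; rewrite exprSr !mulrA.
move=> n; apply: gn_mono (H n) => j.
have -> : c * (4 * al * s) ^+ i * i`!%:R * (2 * s) ^+ j * j`!%:R =
  (c * (2 * al * s) ^+ i * s ^+ j) * (2 ^ (j + i) * (j`! * i`!))%:R.
  rewrite (_ : 4 * al * s = 2 * (2 * al * s)); last by ring.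
  by rewrite natrM natrX exprD natrM !exprMn; ring.
apply: ler_wpM2l; first by rewrite !mulr_ge0 ?exprn_ge0 // !mulr_ge0.
rewrite ler_nat -(bin_fact (leq_addr i j)) addKn leq_mul2r; apply/orP; right.
rewrite addnC -[X in (X ^ _)%N]/(1 + 1)%N expnDn (bigD1 (Ordinal (leq_addl i j : j < (i + j).+1)%N)) //=.
by rewrite !exp1n !muln1 leq_addr.
Qed.

Lemma pzX k f x n : cdiff f x -> cdiff (fun y => f y ^+ n) x /\
  pz k (fun y => f y ^+ n.+1) x = n.+1%:R * (f x ^+ n * pz k f x).
Proof.
move=> df; have dX m : cdiff (fun y => f y ^+ m) x.
  elim: m => [|m IH]; first exact: cdiff_cst.
  by have [d _] := cdiffM df IH; rewrite (_ : (fun y => _) = fun y => f y * f y ^+ m) //; apply/funext => y; rewrite exprS.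
split; first exact: dX.
elim: n => [|n IH]; first by rewrite expr0 !mul1r.
rewrite (_ : (fun y => _) = fun y => f y * f y ^+ n.+1); last by apply/funext => y; rewrite exprS.
by rewrite (pzM k df (dX n.+1)) IH -[in RHS]natr1 exprS; ring.
Qed.

Lemma succ_half_pow n : n.+1%:R * (1 / 2) ^+ n <= 2 :> R.
Proof.
elim: n => [|n IH]; first by rewrite expr0; lra.
have h : (1 / 2 : R) ^+ n <= 1 by apply: exprn_ile1; lra.
have -> : n.+2%:R * (1 / 2) ^+ n.+1 = (n.+1%:R * (1 / 2) ^+ n) / 2 + (1 / 2) ^+ n / 2 :> R.
  by rewrite exprS -[n.+2%:R]natr1; ring.
by move: IH h; clear; lra.
Qed.

(* [F = sum_i (- rho) ^ i / i! N ^ i f] is constant along [N] and restricts to [f] on [rho = 0]. *)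
Lemma constant_extension p k (f rho : V -> C) : gevp p f -> gevp p rho -> rho p = 0 -> pz k rho p != 0 ->
  exists2 F, gevp p F & (\forall x \near p, pz k F x = 0) /\ (\forall x \near p, rho x = 0 -> F x = f x).
Proof.
move=> Gf Gr r0 kr0.
have Ga : gevp p (fun x => (pz k rho x)^-1) by apply: gevpV => //; exact: gevp_pz.
have [r1 [c1 [s1 [r10 c10 s10 H1]]]] := Gf.
have [r2 [c2 [s2 [r20 c20 s20 H2]]]] := Ga.
have [r3 [c3 [s3 [r30 c30 s30 H3]]]] := Gr.
pose s := s1 + 2 * s2; have s0 : 0 <= s by rewrite addr_ge0 ?mulr_ge0.
pose B := 4 * c2 * s; have B0 : 0 <= B by rewrite !mulr_ge0.
(* Target size of [rho] on the small ball: with [e * B <= 1 / 4] the term of index [i] is at most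
   [c1 * (1 / 2) ^+ i]. *)
pose e := (4 * (B + 1))^-1; have e0 : 0 < e by rewrite invr_gt0 mulr_gt0 // ltr_pwDr.
have eB : e * B <= 1 / 4.
  by rewrite /e mulrC ler_pdivrMr ?mulr_gt0 // ?ltr_pwDr //; clear - B0; lra.
have [r4 [s4 [r40 r43 s40 H4]]] := gev_small r30 c30 s30 e0.
have NZ : \forall x \near p, pz k rho x != 0.
  have n0 : 0 < cn (pz k rho p) by rewrite cn_gt0.
  have := cdiff_cont (gevp_cdiff (gevp_pz k Gr)) n0; apply: filterS => x h.
  by apply: contraTN h => /eqP ->; rewrite sub0r cnN ltxx.
have m0 : 0 < Num.min r1 (Num.min r2 r4) by rewrite !lt_min r10 r20 r40.
have [r [rp rm Hnz]] := nbhs_small m0 NZ.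
move: rm; rewrite !le_min => /and3P[rr1 rr2 rr4].
set a := fun x => (pz k rho x)^-1 in Ga H2.
pose N i := iter i (nabla k a) f.
have HN i : gev p r (c1 * B ^+ i * i`!%:R) (2 * s) (N i).
  apply: gn_iter_nabla => //.
    by apply: gev_mono (gev_le rr1 H1) => //; rewrite lerDl mulr_ge0.
  by apply: gev_mono (gev_le rr2 H2) => //; rewrite /s; clear - s10; lra.
pose S := 2 * s + 2 * s4.
have Hr : gev p r e s4 rho by apply: gev_le (H4 p rho H3 r0).
have Hmr : gev p r e (S / 2) (fun x => - rho x).
  apply: gev_eq (fun x _ => mulN1r _) _; rewrite (_ : e = cn (-1 : C) * e); last by rewrite cnN cn1 mul1r.
  by apply: gevZ; apply: gev_mono Hr => //; [exact: ltW|rewrite /S; clear - s0; lra].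
pose term i x := (i`!%:R^-1)%:C * (N i x * (- rho x) ^+ i).
have Hterm i : gev p r (c1 * (1 / 2) ^+ i) S (term i).
  have S0 : 0 <= S by rewrite addr_ge0 ?mulr_ge0.
  have fi0 : 0 < i`!%:R :> R by rewrite ltr0n fact_gt0.
  have ci0 : 0 <= c1 * B ^+ i * i`!%:R by rewrite !mulr_ge0 ?exprn_ge0.
  have HN' : gev p r (c1 * B ^+ i * i`!%:R) S (N i).
    by apply: gev_mono (HN i) => //; [rewrite mulr_ge0|rewrite /S lerDl mulr_ge0].
  have := gevZ (i`!%:R^-1)%:C (gevX i ci0 (ltW e0) S0 HN' Hmr).
  apply: gev_mono => //; first by rewrite mulr_ge0 ?cn_ge0 // mulr_ge0 // exprn_ge0 // mulr_ge0 // ltW.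
  rewrite cn_real ger0_norm ?invr_ge0 ?(ltW fi0) //.
  have -> : i`!%:R^-1 * (c1 * B ^+ i * i`!%:R * (2 * e) ^+ i) = c1 * (2 * (e * B)) ^+ i.
    by rewrite !exprMn; field; rewrite gt_eqF.
  apply: ler_wpM2l => //; apply: lerXn2r; rewrite ?nnegrE ?mulr_ge0 // ?(ltW e0) //; clear - eB; lra.
pose P n x := \sum_(i < n) term i x.
have S0 : 0 <= S by rewrite addr_ge0 ?mulr_ge0.
have HP n : gev p r (2 * c1) S (P n).
  apply: gev_mono (gev_sum (index_enum 'I_n) S0 (fun i : 'I_n => Hterm i)) => //.
    by apply: sumr_ge0 => i _; rewrite mulr_ge0 // exprn_ge0.
  by rewrite -mulr_sumr mulrC; apply: ler_wpM2r => //; apply: sum_geo_le2; clear; apply/andP; split; lra.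
pose F x := ulim (fun n => P n x).
have HF : gev p r (1 * (2 * c1)) S F by apply: (gev_blf (ulim_blf R)) => n _; exact: HP.
have dF l x : ball p r x -> cpd l F x = ulim (fun n => cpd l (P n) x).
  by move=> Ox; have [_ E] := gn_blf (ulim_blf R) 0 (fun n (_ : setT n) m => HP n m); exact: E.
have nb : \forall x \near p, ball p r x by exact: nbhsx_ballx.
exists F; first exact: gevp_intro rp HF.
split; last first.
  apply: filterS nb => x Ox rx; rewrite /F; apply: ulim_eq => e' e'0; exists 1%N => -[//|n] _.
  rewrite /P big_ord_recl big1 ?addr0 => [|i _]; rewrite /term ?rx.
    by rewrite fact0 invr1 expr0 mulr1 mul1r subrr cn0.
  by rewrite oppr0 lift0 expr0n mulr0 mulr0.
have dN i x : ball p r x -> cdiff (N i) x by move=> Ox; have [] := gev_at (HN i) Ox.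
have dr x : ball p r x -> cdiff rho x by move=> Ox; have [] := gev_at Hr Ox.
(* The operator [a * pz k] maps [rho] to 1, so the derivative of a partial sum telescopes to one
   last term, which tends to 0. *)
have tele n x : ball p r x -> a x * pz k (P n.+1) x = (n`!%:R^-1)%:C * (N n.+1 x * (- rho x) ^+ n).
  move=> Ox; have dt i : cdiff (term i) x by have [] := gev_at (Hterm i) Ox.
  have dmr : cdiff (fun y => - rho y) x by have [] := cdiffN (dr x Ox).
  have ax : a x * pz k rho x = 1 by rewrite /a mulVf // Hnz.
  have tE i : a x * pz k (term i.+1) x =
      (i.+1`!%:R^-1)%:C * (N i.+2 x * (- rho x) ^+ i.+1) - (i`!%:R^-1)%:C * (N i.+1 x * (- rho x) ^+ i).
    have [dX _] := pzX k i.+1 dmr; have [_ eX] := pzX k i dmr.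
    have [dM _] := cdiffM (dN i.+1 x Ox) dX.
    rewrite /term (pzM k (cdiff_cst _ _) dM) pz_cst mul0r add0r (pzM k (dN i.+1 x Ox) dX) eX (pzN k (dr x Ox)).
    have -> : N i.+2 x = a x * pz k (N i.+1) x by [].
    have f1 : (i`!%:R^-1)%:C = (i.+1`!%:R^-1)%:C * i.+1%:R :> C.
      rewrite -(rmorph_nat (real_complex R)) -rmorphM /= factS natrM invfM; congr (_ %:C).
      by rewrite mulrAC mulVf ?mul1r // pnatr_eq0.
    rewrite f1; transitivity ((i.+1`!%:R^-1)%:C * (a x * pz k (N i.+1) x * (- rho x) ^+ i.+1) -
      (i.+1`!%:R^-1)%:C * i.+1%:R * (N i.+1 x * (- rho x) ^+ i) * (a x * pz k rho x)).
      clear; ring.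
    by rewrite ax mulr1; clear; ring.
  elim: n => [|n IH].
    rewrite /P (_ : (fun _ => _) = term 0%N); last by apply/funext => y; rewrite big_ord1.
    rewrite /term fact0 invr1 (_ : (fun _ => _) = N 0%N); last by apply/funext => y; rewrite mul1r expr0 mulr1.
    by rewrite mul1r expr0 mulr1.
  rewrite /P (_ : (fun _ => _) = fun y => P n.+1 y + term n.+1 y); last by apply/funext => y; rewrite big_ord_recr.
  by rewrite pzD ?dt // ?mulrDr ?IH ?tE 1?addrC ?subrK //; have [] := gev_at (HP n.+1) Ox.
apply: filterS nb => x Ox.
have [j [ej [ej1 PE]]] := pzE k.
have bl l : bnd setT (fun n => cpd l (P n) x).
  exists (2 * c1 * S * (2 * S) ^+ 0 * 0`!%:R) => n _.
  have c20' : 0 <= 2 * c1 by rewrite mulr_ge0.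
  by have [] := gn0 (gev_cpd l c20' S0 (HP n) 0%N) Ox.
have pzF : pz k F x = ulim (fun n => pz k (P n) x).
  rewrite PE !dF // -(blfZ (ulim_blf R)) // -(blfD (ulim_blf R)) //; last by apply: bndM => //; exact: bnd_cst.
  rewrite -(blfZ (ulim_blf R)); last by apply: bndD => //; apply: bndM => //; exact: bnd_cst.
  by congr ulim; apply/funext => n; rewrite PE.
have bp : bnd setT (fun n => pz k (P n) x).
  rewrite (_ : (fun n => _) = fun n => (1 / 2)%:C * (cpd (xcoord j) (P n) x + ej * cpd (ycoord j) (P n) x)); last by apply/funext => n; exact: PE.
  by apply: bndM; [exact: bnd_cst|apply: bndD => //; apply: bndM => //; exact: bnd_cst].
have az : a x != 0 by rewrite invr_eq0 Hnz.
apply: (mulfI az); rewrite mulr0 pzF -(blfZ (ulim_blf R)) //.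
apply: ulim_eq => e' e'0.
have h12 : 0 <= (1 / 2 : R) <= 1 / 2 by clear; apply/andP; split; lra.
have [M HM] := geo_small (2 * c1 * B + 1) h12 e'0.
exists M.+1 => -[//|n]; rewrite ltnS => /HM h; rewrite subr0 tele //.
apply: le_lt_trans h; apply: le_trans (cnM _ _) _; rewrite cn_real.
have [_ b1] := gev_at (HN n.+1) Ox.
have b2 : cn ((- rho x) ^+ n) <= e ^+ n.
  apply: le_trans (cnX _ _) _; apply: lerXn2r; rewrite ?nnegrE ?cn_ge0 ?(ltW e0) // cnN.
  by have [] := gev_at Hr Ox.
have fi0 : 0 < n`!%:R :> R by rewrite ltr0n fact_gt0.
rewrite ger0_norm ?invr_ge0 ?(ltW fi0) //.
apply: (@le_trans _ _ (n`!%:R^-1 * (c1 * B ^+ n.+1 * n.+1`!%:R * e ^+ n))).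
  apply: ler_wpM2l; first by rewrite invr_ge0 ltW.
  by apply: le_trans (cnM _ _) _; apply: ler_pM => //; rewrite ?cn_ge0.
have -> : n`!%:R^-1 * (c1 * B ^+ n.+1 * n.+1`!%:R * e ^+ n) = c1 * B * (n.+1%:R * (e * B) ^+ n).
  rewrite factS natrM exprS [(e * B) ^+ n]exprMn; move: (n.+1%:R : R) (n`!%:R : R) fi0 (B ^+ n) (e ^+ n) => m1 fa fi0 x1 x2.
  by rewrite -[RHS]mul1r -(mulVf (lt0r_neq0 fi0)); ring.
have nn : n.+1%:R * (1 / 2) ^+ n <= 2 :> R.
  exact: succ_half_pow.
apply: (@le_trans _ _ (c1 * B * (2 * (1 / 2) ^+ n))); last first.
  rewrite mulrA [_ * 2]mulrC !mulrA; apply: ler_wpM2r; first by apply: exprn_ge0; clear; lra.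
  by rewrite lerDl.
apply: ler_wpM2l; first by rewrite mulr_ge0.
apply: (@le_trans _ _ (n.+1%:R * (1 / 2) ^+ n * (1 / 2) ^+ n)).
  rewrite -mulrA -exprMn; apply: ler_wpM2l => //; apply: lerXn2r; rewrite ?nnegrE ?mulr_ge0 // ?(ltW e0) //; clear - eB; lra.
by apply: ler_wpM2r => //; apply: exprn_ge0; lra.
Qed.

End ComplexPartials.

(** * Germs of real-analytic functions on the hypersurface *)

Section GermRing.
Variables (R : realType) (rr : 'rV[R]_8 -> R) (p : 'rV[R]_8).
Local Notation V := 'rV[R]_8.
Local Notation C := R[i].

Definition geqg (f g : V -> C) : Prop := \forall x \near p, rr x = 0 -> f x = g x.

Lemma geq_refl f : geqg f f. Proof. by near=> x. Unshelve. all: by end_near. Qed.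
Lemma geq_sym f g : geqg f g -> geqg g f. Proof. by apply: filterS => x h /h. Qed.
Lemma geq_trans f g h : geqg f g -> geqg g h -> geqg f h.
Proof. by apply: filterS2 => x h1 h2 r0; rewrite h1 // h2. Qed.
Lemma geq_near f g : (\forall x \near p, f x = g x) -> geqg f g.
Proof. by apply: filterS => x h _. Qed.
Lemma geqD f f' g g' : geqg f f' -> geqg g g' -> geqg (fun x => f x + g x) (fun x => f' x + g' x).
Proof. by apply: filterS2 => x h1 h2 r0; rewrite h1 // h2. Qed.
Lemma geqM f f' g g' : geqg f f' -> geqg g g' -> geqg (fun x => f x * g x) (fun x => f' x * g' x).
Proof. by apply: filterS2 => x h1 h2 r0; rewrite h1 // h2. Qed.
Lemma geqN f f' : geqg f f' -> geqg (fun x => - f x) (fun x => - f' x).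
Proof. by apply: filterS => x h1 r0; rewrite h1. Qed.
Lemma geq_conj f f' : geqg f f' -> geqg (fun x => (f x)^*) (fun x => (f' x)^*).
Proof. by apply: filterS => x h1 r0; rewrite h1. Qed.

(* A class of functions modulo equality on [rr = 0] near [p] is encoded by a chosen representative. *)
Definition grep (f : V -> C) : V -> C := xget (fun=> 0) [set g | gevp p g /\ geqg f g].

Lemma grepP f : gevp p f -> gevp p (grep f) /\ geqg f (grep f).
Proof. by move=> gf; apply: (@xgetPex _ (fun=> 0) [set g | gevp p g /\ geqg f g]); exists f; split=> //; exact: geq_refl. Qed.

Lemma grep_eq f g : geqg f g -> grep f = grep g.
Proof.
move=> e; rewrite /grep; congr xget; apply/seteqP; split=> h [gh fh]; split=> //.
  exact: geq_trans (geq_sym e) fh.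
exact: geq_trans e fh.
Qed.

Record germ := Germ { gfun : V -> C; gfunP : gevp p gfun /\ grep gfun = gfun }.

Lemma mk_subproof f : gevp p (grep (if `[< gevp p f >] then f else fun=> 0)) /\
  grep (grep (if `[< gevp p f >] then f else fun=> 0)) = grep (if `[< gevp p f >] then f else fun=> 0).
Proof.
set f' := if _ then _ else _; have gf : gevp p f' by rewrite /f'; case: asboolP => // _; exact: gevp_cst.
by have [h1 h2] := grepP gf; split=> //; apply: grep_eq; exact: geq_sym.
Qed.
Definition mk f : germ := Germ (mk_subproof f).

Lemma gfun_gevp x : gevp p (gfun x). Proof. by case: (gfunP x). Qed.

Lemma gfun_mk f : gevp p f -> geqg (gfun (mk f)) f.
Proof. by move=> gf; rewrite /mk /=; case: asboolP => // _; apply: geq_sym; case: (grepP gf). Qed.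

Lemma germ_ext x y : geqg (gfun x) (gfun y) -> x = y.
Proof.
case: x y => f [gf ef] [g [gg eg]] /= e; have E : f = g by rewrite -ef -eg; exact: grep_eq.
by subst g; congr Germ; exact: Prop_irrelevance.
Qed.

Lemma mk_gfun x : mk (gfun x) = x.
Proof. by apply: germ_ext; exact: gfun_mk (gfun_gevp x). Qed.

Lemma mk_eq f g : gevp p f -> gevp p g -> geqg f g -> mk f = mk g.
Proof.
move=> gf gg e; apply: germ_ext; apply: geq_trans (gfun_mk gf) _.
by apply: geq_trans e _; apply: geq_sym; exact: gfun_mk.
Qed.

Lemma germP x : exists2 f, gevp p f & x = mk f.
Proof. by exists (gfun x); [exact: gfun_gevp|rewrite mk_gfun]. Qed.

Definition gadd x y := mk (fun z => gfun x z + gfun y z).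
Definition gmul x y := mk (fun z => gfun x z * gfun y z).
Definition gopp x := mk (fun z => - gfun x z).
Definition gcst c := mk (fun=> c).
Definition gconj x := mk (fun z => (gfun x z)^*).

Lemma gaddE f g : gevp p f -> gevp p g -> gadd (mk f) (mk g) = mk (fun z => f z + g z).
Proof.
move=> gf gg; apply: mk_eq; [|exact: gevpD|by apply: geqD; exact: gfun_mk].
by apply: gevpD; exact: gfun_gevp.
Qed.
Lemma gmulE f g : gevp p f -> gevp p g -> gmul (mk f) (mk g) = mk (fun z => f z * g z).
Proof.
move=> gf gg; apply: mk_eq; [|exact: gevpM|by apply: geqM; exact: gfun_mk].
by apply: gevpM; exact: gfun_gevp.
Qed.
Lemma goppE f : gevp p f -> gopp (mk f) = mk (fun z => - f z).
Proof.
move=> gf; apply: mk_eq; [|exact: gevpN|by apply: geqN; exact: gfun_mk].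
by apply: gevpN; exact: gfun_gevp.
Qed.
Lemma gconjE f : gevp p f -> gconj (mk f) = mk (fun z => (f z)^*).
Proof.
move=> gf; apply: mk_eq; [|exact: gevp_conj|by apply: geq_conj; exact: gfun_mk].
by apply: gevp_conj; exact: gfun_gevp.
Qed.

HB.instance Definition _ := gen_eqMixin germ.
HB.instance Definition _ := gen_choiceMixin germ.

Ltac germs := unfold associative, commutative, left_id, left_inverse, left_distributive; repeat match goal with |- forall x : germ, _ => let f := fresh "f" in let gf := fresh "g" f in
  let x := fresh "x" in intro x; have [f gf ->] := germP x end.

Lemma gaddA : associative gadd.
Proof. by germs; rewrite !gaddE //; try exact: gevpD; congr mk; apply/funext => z; rewrite addrA. Qed.
Lemma gaddC : commutative gadd.
Proof. by germs; rewrite !gaddE //; congr mk; apply/funext => z; rewrite addrC. Qed.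
Lemma gadd0 : left_id (gcst 0) gadd.
Proof. by germs; rewrite gaddE //; [congr mk; apply/funext => z; rewrite add0r|exact: gevp_cst]. Qed.
Lemma gaddN : left_inverse (gcst 0) gopp gadd.
Proof. by germs; rewrite goppE // gaddE //; [congr mk; apply/funext => z; rewrite addNr|exact: gevpN]. Qed.

HB.instance Definition _ := GRing.isZmodule.Build germ gaddA gaddC gadd0 gaddN.

Lemma gmulA : associative gmul.
Proof. by germs; rewrite !gmulE //; try exact: gevpM; congr mk; apply/funext => z; rewrite mulrA. Qed.
Lemma gmulC : commutative gmul.
Proof. by germs; rewrite !gmulE //; congr mk; apply/funext => z; rewrite mulrC. Qed.
Lemma gmul1 : left_id (gcst 1) gmul.
Proof. by germs; rewrite gmulE //; [congr mk; apply/funext => z; rewrite mul1r|exact: gevp_cst]. Qed.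
Lemma gmulDl : left_distributive gmul gadd.
Proof.
germs; rewrite gaddE // !gmulE // ?gaddE //; try exact: gevpM; try exact: gevpD.
by congr mk; apply/funext => z; rewrite mulrDl.
Qed.

HB.instance Definition _ := GRing.Zmodule_isComPzRing.Build germ gmulA gmulC gmul1 gmulDl.

Lemma mkD f g : gevp p f -> gevp p g -> mk (fun z => f z + g z) = mk f + mk g.
Proof. by move=> gf gg; rewrite -gaddE. Qed.
Lemma mkM f g : gevp p f -> gevp p g -> mk (fun z => f z * g z) = mk f * mk g.
Proof. by move=> gf gg; rewrite -gmulE. Qed.
Lemma mkN f : gevp p f -> mk (fun z => - f z) = - mk f.
Proof. by move=> gf; rewrite -goppE. Qed.
Lemma gcst0 : gcst 0 = 0. Proof. by []. Qed.
Lemma gcst1 : gcst 1 = 1. Proof. by []. Qed.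
Lemma gcstD a b : gcst (a + b) = gcst a + gcst b.
Proof. by rewrite -mkD //; exact: gevp_cst. Qed.
Lemma gcstM a b : gcst (a * b) = gcst a * gcst b.
Proof. by rewrite -mkM //; exact: gevp_cst. Qed.
Lemma gconjD (x y : germ) : gconj (x + y) = gconj x + gconj y.
Proof.
move: x y; germs; rewrite -mkD // !gconjE //; last exact: gevpD.
by rewrite -mkD; try exact: gevp_conj; congr mk; apply/funext => z; rewrite rmorphD.
Qed.
Lemma gconjM (x y : germ) : gconj (x * y) = gconj x * gconj y.
Proof.
move: x y; germs; rewrite -mkM // !gconjE //; last exact: gevpM.
by rewrite -mkM; try exact: gevp_conj; congr mk; apply/funext => z; rewrite rmorphM.
Qed.
Lemma gconjK (x : germ) : gconj (gconj x) = x.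
Proof.
move: x; germs; rewrite !gconjE //; last exact: gevp_conj.
by congr mk; apply/funext => z; rewrite conjcK.
Qed.

Hypothesis rrp : rr p = 0.
Definition gev0 (x : germ) : C := gfun x p.
(** Representatives agree on the hypersurface, and [p] lies on it by [rrp]. *)
Lemma gev0E f : gevp p f -> gev0 (mk f) = f p.
Proof. by move=> gf; exact: (nbhs_singleton (gfun_mk gf)). Qed.
Lemma gev0D (x y : germ) : gev0 (x + y) = gev0 x + gev0 y.
Proof. by move: x y; germs; rewrite -mkD // !gev0E //; exact: gevpD. Qed.
Lemma gev0M (x y : germ) : gev0 (x * y) = gev0 x * gev0 y.
Proof. by move: x y; germs; rewrite -mkM // !gev0E //; exact: gevpM. Qed.
Lemma gev0_cst c : gev0 (gcst c) = c.
Proof. by rewrite gev0E //; exact: gevp_cst. Qed.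
Lemma gev0_conj (x : germ) : gev0 (gconj x) = (gev0 x)^*.
Proof. by move: x; germs; rewrite gconjE // !gev0E //; exact: gevp_conj. Qed.

Lemma gevp_nonzero f : gevp p f -> f p != 0 -> \forall x \near p, f x != 0.
Proof.
move=> gf f0; have n0 : 0 < cn (f p) by rewrite cn_gt0.
have := cdiff_cont (gevp_cdiff gf) n0; apply: filterS => x h.
by apply: contraTN h => /eqP ->; rewrite sub0r cnN ltxx.
Qed.

Lemma germ_unit (x : germ) : gev0 x != 0 -> exists y, x * y = 1.
Proof.
move: x; germs; rewrite gev0E // => f0; exists (mk (fun z => (f z)^-1)).
rewrite -mkM //; last exact: gevpV.
apply: mk_eq; [by apply: gevpM => //; exact: gevpV|exact: gevp_cst|].
by apply: geq_near; apply: filterS (gevp_nonzero gf f0) => z /divff.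
Qed.

End GermRing.

Ltac gen_pz := repeat match goal with |- context [pz ?k ?f ?x] => generalize (pz k f x) end; clear.

(** * Tangential derivations of germs and extension from the hypersurface *)

Section Tangential.
Variables (R : realType) (rr : 'rV[R]_8 -> R) (p : 'rV[R]_8).
Local Notation V := 'rV[R]_8.
Local Notation C := R[i].
Local Notation geqg := (geqg rr p).
Local Notation mk := (mk rr p).
Local Notation germ := (germ rr p).
Ltac germs := repeat match goal with |- forall x : germ, _ => let f := fresh "f" in let gf := fresh "g" f in
  let x := fresh "x" in intro x; have [f gf ->] := germP x end.

Variable rho : V -> C.
Hypothesis rhoE : forall x, rho x = (rr x)%:C.
Hypothesis Gr : gevp p rho.
Hypothesis rrp : rr p = 0.
Variable j0 : 'I_4.
Local Notation k0 := (inr j0 : cdir).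
Hypothesis nz0 : pz k0 rho p != 0.

Lemma cpd_rho k x : cpd k rho x = (pd k rr x)%:C.
Proof. by rewrite (funext rhoE) /cpd /= pd_cst. Qed.

Lemma real_transversal : exists m, pd m rr p != 0.
Proof.
apply: contrapT => H; have Z m : pd m rr p = 0 by apply: contrapT => /eqP h; apply: H; exists m.
by move: nz0; have [j [e [_ ->]]] := pzE R k0; rewrite !cpd_rho !Z mulr0 addr0 mulr0 eqxx.
Qed.

Lemma near_nearby (P : V -> Prop) : (\forall x \near p, P x) -> \forall x \near p, \forall y \near x, P y.
Proof. exact: nbhs_interior. Qed.

Lemma complex_ratio (f1 f2 g1 g2 a b : R) : a != 0 -> f1 * a = g1 * b -> f2 * a = g2 * b ->
  f1 +i* f2 = (g1 +i* g2) / a%:C * b%:C.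
Proof.
move=> a0 h1 h2; have ac : a%:C != 0 :> C by apply: contraNneq a0 => /(congr1 (@complex.Re R)) /= ->.
apply: (mulIf ac); rewrite mulrAC divfK //; apply: eqReIm; rewrite !(cReM, cImM) /=; lra.
Qed.

Lemma near_and (P Q : V -> Prop) : (\forall x \near p, P x) -> (\forall x \near p, Q x) ->
  \forall x \near p, P x /\ Q x.
Proof. exact: filterI. Qed.

Lemma vanish_grad f : gevp p f -> geqg f (fun=> 0) ->
  \forall x \near p, rr x = 0 -> exists la, forall l, cpd l f x = la * cpd l rho x.
Proof.
move=> gf f0; have [m pm] := real_transversal.
have nm : \forall x \near p, cpd m rho x != 0.
  by apply: gevp_nonzero; [exact: gevp_cpd|rewrite cpd_rho; apply: contraNneq pm => /(congr1 (@complex.Re R)) /= ->].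
have n1 := near_nearby (near_and (gevp_nearby Gr) f0).
apply: filterS2 nm (near_and (gevp_nearby gf) n1) => x xm [gfx nx] rx.
have dx : differentiable (fun y => complex.Re (f y)) x /\ differentiable (fun y => complex.Im (f y)) x.
  exact: gevp_cdiff.
have drr : \forall y \near x, differentiable rr y.
  by apply: filterS nx => y [/gevp_cdiff]; rewrite (funext rhoE) => -[h _] _; exact: h.
have pmx : pd m rr x != 0 by apply: contraNneq xm => h; rewrite cpd_rho h.
have rx0 : rr x = 0 by [].
have nR : \forall y \near x, rr y = 0 -> complex.Re (f y) = 0.
  by apply: filterS nx => y [_ h] /h ->.
have nI : \forall y \near x, rr y = 0 -> complex.Im (f y) = 0.
  by apply: filterS nx => y [_ h] /h ->.
exists (cpd m f x / (pd m rr x)%:C) => l; rewrite cpd_rho.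
apply: complex_ratio; [exact: pmx|exact: (vanishing_differential l drr rx0 pmx (proj1 dx) nR)|].
exact: (vanishing_differential l drr rx0 pmx (proj2 dx) nI).
Qed.

Lemma vanish_pz f : gevp p f -> geqg f (fun=> 0) ->
  \forall x \near p, rr x = 0 -> exists la, forall k, pz k f x = la * pz k rho x.
Proof.
move=> gf f0; apply: filterS (vanish_grad gf f0) => x h /h[la H]; exists la => k.
by have [j [e [_ E]]] := pzE R k; rewrite !E !H; gen_cpd; intros; ring.
Qed.

(** The derivative [pz k] corrected in the single direction [k0] so as to annihilate [rho]. These
    are the coordinate fields of the hypersurface once the conjugate of [z_j0] is eliminated, which
    is why they commute; [tg k0] is zero. *)
Definition tg (k : cdir) (f : V -> C) : V -> C :=
  fun x => pz k f x - pz k rho x * (pz k0 rho x)^-1 * pz k0 f x.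

Lemma gevp_a : gevp p (fun x => (pz k0 rho x)^-1).
Proof. by apply: gevpV => //; exact: gevp_pz. Qed.
Lemma near_nz : \forall x \near p, pz k0 rho x != 0.
Proof. by apply: gevp_nonzero => //; exact: gevp_pz. Qed.

Lemma gevp_tg k f : gevp p f -> gevp p (tg k f).
Proof.
move=> gf; apply: gevpD; first exact: gevp_pz.
by apply: gevpN; apply: gevpM; [apply: gevpM; [exact: gevp_pz|exact: gevp_a]|exact: gevp_pz].
Qed.

Lemma tg_add k f g x : cdiff f x -> cdiff g x -> tg k (fun y => f y + g y) x = tg k f x + tg k g x.
Proof. by move=> df dg; rewrite /tg !(pzD _ df dg); gen_pz; intros; ring. Qed.
Lemma tg_opp k f x : cdiff f x -> tg k (fun y => - f y) x = - tg k f x.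
Proof. by move=> df; rewrite /tg !(pzN _ df); gen_pz; intros; ring. Qed.
Lemma tg_mul k f g x : cdiff f x -> cdiff g x -> tg k (fun y => f y * g y) x = tg k f x * g x + f x * tg k g x.
Proof.
by move=> df dg; rewrite /tg !(pzM _ df dg); gen_pz; intros; ring.
Qed.

Lemma tg_vanish k f : gevp p f -> geqg f (fun=> 0) -> geqg (tg k f) (fun=> 0).
Proof.
move=> gf f0; apply: filterS2 near_nz (vanish_pz gf f0) => x nx h /h[la H].
by rewrite /tg !H mulrCA -mulrA mulVf // mulr1 subrr.
Qed.

Lemma geq_tg k f g : gevp p f -> gevp p g -> geqg f g -> geqg (tg k f) (tg k g).
Proof.
move=> gf gg e; have gh : gevp p (fun x => f x + - g x) by apply: gevpD => //; exact: gevpN.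
have : geqg (tg k (fun x => f x + - g x)) (fun=> 0).
  by apply: tg_vanish => //; apply: filterS e => x h /h ->; rewrite subrr.
apply: filterS2 (near_and (gevp_nearby gf) (gevp_nearby gg)) => x [gfx ggx] h /h.
have dg := gevp_cdiff ggx; have [dn _] := cdiffN dg.
by rewrite (tg_add _ (gevp_cdiff gfx) dn) (tg_opp _ dg); exact: subr0_eq.
Qed.

Lemma pz_tg k l f x : gevp x rho -> gevp x f -> pz k0 rho x != 0 ->
  pz k (tg l f) x = pz k (pz l f) x - (pz k (pz l rho) x * (pz k0 rho x)^-1 * pz k0 f x
    - pz l rho x * pz k (pz k0 rho) x * (pz k0 rho x)^-1 ^+ 2 * pz k0 f x
    + pz l rho x * (pz k0 rho x)^-1 * pz k (pz k0 f) x).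
Proof.
move=> gr gf nx; have d1 := gevp_cdiff (gevp_pz l gf); have d2 := gevp_cdiff (gevp_pz l gr).
have d3 := gevp_cdiff (gevp_pz k0 gr); have d4 := gevp_cdiff (gevp_pz k0 gf).
have [d5 _] := cdiffV d3 nx; have [d6 _] := cdiffM d2 d5; have [d7 _] := cdiffM d6 d4.
have [d8 _] := cdiffN d7.
rewrite /tg (pzD k d1 d8) (pzN k d7) (pzM k d6 d4) (pzM k d2 d5) (pzV k d3 nx).
by gen_pz; intros; ring.
Qed.

Lemma tg_comm k l f x : gevp x rho -> gevp x f -> pz k0 rho x != 0 ->
  tg k (tg l f) x = tg l (tg k f) x.
Proof.
move=> gr gf nx; rewrite {1}/tg [in RHS]/tg !pz_tg //.
rewrite (pz_comm k l gf) (pz_comm k l gr) (pz_comm l k0 gr) (pz_comm k k0 gr) (pz_comm l k0 gf) (pz_comm k k0 gf).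
by gen_pz; intros; ring.
Qed.

Definition gX (k : cdir) (x : germ) : germ := mk (tg k (gfun x)).

Lemma gXE k f : gevp p f -> gX k (mk f) = mk (tg k f).
Proof.
move=> gf; have gg := gfun_gevp (mk f); apply: mk_eq; [exact: gevp_tg|exact: gevp_tg|].
by apply: geq_tg => //; exact: gfun_mk.
Qed.

Lemma near_cdiff f : gevp p f -> \forall x \near p, cdiff f x.
Proof. by move=> /gevp_nearby; apply: filterS => x /gevp_cdiff. Qed.

Lemma gXD k (x y : germ) : gX k (x + y) = gX k x + gX k y.
Proof.
move: x y; germs; rewrite -mkD // !gXE //; last exact: gevpD.
rewrite -mkD; [|exact: gevp_tg|exact: gevp_tg].
apply: mk_eq; [by apply: gevp_tg; exact: gevpD|by apply: gevpD; exact: gevp_tg|apply: geq_near].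
by apply: filterS2 (near_cdiff gf) (near_cdiff gf0) => z d1 d2; rewrite tg_add.
Qed.

Lemma gXM k (x y : germ) : gX k (x * y) = gX k x * y + x * gX k y.
Proof.
move: x y; germs; rewrite -mkM // !gXE //; last exact: gevpM.
have g1 := gevp_tg k gf; have g2 := gevp_tg k gf0.
rewrite -!mkM // -mkD //; try exact: gevpM.
apply: mk_eq; [by apply: gevp_tg; exact: gevpM|by apply: gevpD; exact: gevpM|apply: geq_near].
by apply: filterS2 (near_cdiff gf) (near_cdiff gf0) => z d1 d2; rewrite tg_mul.
Qed.

Lemma gX_cst k c : gX k (gcst rr p c) = 0.
Proof.
rewrite gXE; last exact: gevp_cst.
by congr mk; apply/funext => x; rewrite /tg !pz_cst mulr0 subrr.
Qed.

Lemma gX_comm k l (x : germ) : gX k (gX l x) = gX l (gX k x).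
Proof.
move: x; germs; rewrite (gXE l gf) (gXE k gf) !gXE; try exact: gevp_tg.
apply: mk_eq; [by do 2 apply: gevp_tg|by do 2 apply: gevp_tg|apply: geq_near].
by apply: filterS3 (gevp_nearby Gr) (gevp_nearby gf) near_nz => z h1 h2 h3; exact: tg_comm.
Qed.

Lemma pz_rho_conj k x : cdiff rho x -> pz k rho x = (pz (cbar k) rho x)^*.
Proof.
move=> dr; rewrite -(pz_conj k dr); congr (pz k _ x); apply/funext => y.
by rewrite rhoE /= oppr0.
Qed.

Lemma conj_tg (x y z w : C) : (x - y * z^-1 * w)^* = x^* - y^* * (z^*)^-1 * w^*.
Proof. by rewrite rmorphB !rmorphM fmorphV. Qed.
Lemma conj_T (u x y z w : C) : (- 'i * u^-1 * (x - y * z^-1 * w))^* = 'i * (u^*)^-1 * (x^* - y^* * (z^*)^-1 * w^*).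
Proof.
have ci : (- 'i)^* = 'i :> C by apply: eqReIm; rewrite /= ?oppr0 ?opprK.
by rewrite rmorphM; congr (_ * _); [rewrite rmorphM fmorphV; congr (_ * _); exact: ci|exact: conj_tg].
Qed.

Lemma conj_tg_frame (a1 a2 a3 u v w : C) : v != 0 -> u != 0 ->
  a3 - w * u^-1 * a2 = a3 - w * v^-1 * a1 - w * u^-1 * (a2 - u * v^-1 * a1).
Proof. by move=> v0 u0; field; rewrite u0 v0. Qed.
Lemma conj_T_frame (c b1 b2 u v : C) : v != 0 -> u != 0 ->
  c * v^-1 * (b2 - v * u^-1 * b1) = - c * u^-1 * (b1 - u * v^-1 * b2).
Proof. by move=> v0 u0; field; rewrite u0 v0. Qed.

Lemma nzbar : pz (inl j0) rho p != 0.
Proof. by rewrite pz_rho_conj ?conjc_eq0 //; exact: gevp_cdiff. Qed.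

Definition gr_ (k : cdir) : germ := mk (pz k rho).
Definition w0 : germ := mk (fun x => (pz (inl j0) rho x)^-1).

Lemma gevp_w0 : gevp p (fun x => (pz (inl j0) rho x)^-1).
Proof. by apply: gevpV; [exact: gevp_pz|exact: nzbar]. Qed.

Lemma gr_w0 : gr_ (inl j0) * w0 = 1.
Proof.
rewrite -mkM; [|exact: gevp_pz|exact: gevp_w0].
apply: mk_eq; [by apply: gevpM; [exact: gevp_pz|exact: gevp_w0]|exact: gevp_cst|apply: geq_near].
by apply: filterS (gevp_nonzero (gevp_pz (inl j0) Gr) nzbar) => z /divff.
Qed.

(** The conjugate field is corrected in the direction [inl j0] instead of [k0]; rewriting it in the
    commuting fields produces the combination [L3]. *)
Lemma gX_conj a (x : germ) : gconj (gX (inr a) x) =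
  gX (inl a) (gconj x) - gr_ (inl a) * w0 * gX (inl j0) (gconj x).
Proof.
move: x; germs; have gc := gevp_conj gf.
have gt k := gevp_tg k gf; have gtc k := gevp_tg k gc; have gw := gevp_w0.
have gp k := gevp_pz k Gr.
rewrite (gXE (inr a) gf) (gconjE rr gf) (gconjE rr (gt _)) !(gXE _ gc) /gr_ /w0.
have g1 := gevpM (gp (inl a)) gw; have g2 := gevpM g1 (gtc (inl j0)).
rewrite -(mkM rr (gp _) gw) -(mkM rr g1 (gtc _)) -(mkN rr g2) -(mkD rr (gtc _) (gevpN g2)).
apply: mk_eq; [exact: gevp_conj|by apply: gevpD => //; apply: gevpN; apply: gevpM => //; exact: gevpM|apply: geq_near].
apply: filterS3 (near_cdiff Gr) (near_cdiff gf) (near_and near_nz (gevp_nonzero (gp (inl j0)) nzbar)).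
move=> z dr df [n1 n2].
have e1 := esym (pz_rho_conj (inl a) dr); have e2 := esym (pz_rho_conj (inl j0) dr).
have e3 := pz_conj (inl a) df; have e4 := pz_conj (inl j0) df; have e5 := pz_conj (inr j0) df.
rewrite [cbar _]/= in e1; rewrite [cbar _]/= in e2; rewrite [cbar _]/= in e3; rewrite [cbar _]/= in e4; rewrite [cbar _]/= in e5.
transitivity ((pz (inr a) f z)^* - pz (inl a) rho z * (pz (inl j0) rho z)^-1 * (pz (inr j0) f z)^*).
  by rewrite -e1 -e2; exact: conj_tg.
rewrite /tg e3 e4 e5.
exact: conj_tg_frame.
Qed.

Lemma gT_conj (x : germ) : gconj (gcst rr p (- 'i) * w0 * gX (inl j0) x) = gcst rr p (- 'i) * w0 * gX (inl j0) (gconj x).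
Proof.
move: x; germs; have gc := gevp_conj gf.
have gt k := gevp_tg k gf; have gtc k := gevp_tg k gc; have gw := gevp_w0.
have gp k := gevp_pz k Gr; have gi := gevp_cst p (- 'i : C).
rewrite (gXE (inl j0) gf) (gconjE rr gf) !(gXE _ gc) /w0 /gcst.
have g1 := gevpM gi gw; have g2 := gevpM g1 (gt (inl j0)); have g3 := gevpM g1 (gtc (inl j0)).
rewrite -(mkM rr gi gw) -(mkM rr g1 (gt _)) -(mkM rr g1 (gtc _)) (gconjE rr g2).
apply: mk_eq; [exact: gevp_conj|exact: g3|apply: geq_near].
apply: filterS3 (near_cdiff Gr) (near_cdiff gf) (near_and near_nz (gevp_nonzero (gp (inl j0)) nzbar)).
move=> z dr df [n1 n2].
have e1 := esym (pz_rho_conj (inl j0) dr); have e2 := esym (pz_rho_conj (inr j0) dr).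
have e4 := pz_conj (inl j0) df; have e5 := pz_conj (inr j0) df.
rewrite [cbar _]/= in e1; rewrite [cbar _]/= in e2; rewrite [cbar _]/= in e4; rewrite [cbar _]/= in e5.
have K u v : u = (pz (inl j0) rho z)^* -> v = (pz (inr j0) rho z)^* ->
    (- 'i * (pz (inl j0) rho z)^-1 * tg (inl j0) f z)^* =
    'i * u^-1 * ((pz (inl j0) f z)^* - u * v^-1 * (pz (inr j0) f z)^*) by move=> -> ->; exact: conj_T.
apply: etrans (K _ _ (esym e2) (esym e1)) _.
rewrite /tg e4 e5.
exact: conj_T_frame.
Qed.

Lemma gX_zco l j : gX (inr l) (mk (zco j)) = 0 /\ gX (inl l) (mk (zco j)) = gcst rr p (l == j)%:R.
Proof.
rewrite !gXE; try exact: gevp_zco.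
by split; congr mk; apply/funext => x; rewrite /tg !(proj2 (pz_zco _ _ _)) ?(proj1 (pz_zco _ _ _)) mulr0 subr0.
Qed.

(** The conditions pass to every derivative of [u]: on the hypersurface its differential is
    proportional to that of [rho], and the vanishing component along [k0] makes the factor zero. So
    all derivatives vanish at [p], and analyticity concludes. *)
Lemma transversal_zero u : gevp p u -> (\forall x \near p, pz k0 u x = 0) -> geqg u (fun=> 0) ->
  \forall x \near p, u x = 0.
Proof.
pose Q u := [/\ gevp p u, \forall x \near p, pz k0 u x = 0 & geqg u (fun=> 0)].
have QD u1 u2 (c1 c2 : C) : Q u1 -> Q u2 -> Q (fun x => c1 * (u1 x + c2 * u2 x)).
  move=> [g1 z1 e1] [g2 z2 e2].
  have gc c := gevp_cst p (c : C); have g3 := gevpM (gc c2) g2; have g4 := gevpD g1 g3.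
  split; first exact: gevpM.
    apply: filterS3 (near_and z1 z2) (near_cdiff g1) (near_and (near_cdiff g2) (near_and (near_cdiff g3) (near_cdiff g4))).
    move=> x [h1 h2] d1 [d2 [d3 d4]].
    rewrite (pzM k0 (cdiff_cst c1 x) d4) (pzD k0 d1 d3) (pzM k0 (cdiff_cst c2 x) d2).
    by rewrite -/k0 h1 h2 !pz_cst !(mul0r, mulr0, addr0).
  by apply: filterS2 e1 e2 => x h1 h2 r0; rewrite h1 // h2 // mulr0 addr0 mulr0.
have Qpz k u0 : Q u0 -> Q (pz k u0).
  move=> [g z e]; have gk := gevp_pz k g; split; first exact: gk.
    apply: filterS2 (gevp_nearby g) (near_nearby z) => x gx zx.
    rewrite (pz_comm k0 k gx) (_ : 0 = pz k (fun=> 0) x); last by rewrite pz_cst.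
    apply: pz_near; last exact: cdiff_cst.
    by apply: filterS zx => y ->.
  apply: filterS3 z near_nz (vanish_pz g e) => x zx nx h /h[la H].
  have la0 : la = 0 by apply: (mulIf nx); rewrite -H zx mul0r.
  by rewrite H la0 mul0r.
have Qcpd l u0 : Q u0 -> Q (cpd l u0).
  move=> q; pattern l; apply: coordP => j.
    rewrite (funext (fun x => proj1 (cpd_pz j u0 x))).
    by have := QD _ _ 1 1 (Qpz (inl j) _ q) (Qpz (inr j) _ q); congr Q; apply/funext => x; rewrite !mul1r.
  rewrite (funext (fun x => proj2 (cpd_pz j u0 x))).
  by have := QD _ _ 'i (-1) (Qpz (inl j) _ q) (Qpz (inr j) _ q); congr Q; apply/funext => x; rewrite mulN1r.
move=> gu zu eu; apply: gevp_zero => // w.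
have : Q u by [].
elim: w u {gu zu eu} => [|l w IH] u q /=; last by apply: IH; exact: Qcpd.
by case: q => _ _ /nbhs_singleton; apply.
Qed.

(** [f] is replaced by its extension [F] constant along [k0]: the full jet of [F] at [p] is governed
    by the tangential derivatives of [f]. *)
Lemma tangential_zero f : gevp p f -> (forall w : seq cdir, foldl (fun g k => tg k g) f w p = 0) ->
  geqg f (fun=> 0).
Proof.
move=> gf Hf.
have Grp : rho p = 0 by rewrite rhoE rrp.
have [F gF [zF eF]] := constant_extension gf Gr Grp nz0.
have {}eF : geqg F f by apply: filterS eF => x h r0; apply: h; rewrite rhoE r0.
suff : \forall x \near p, F x = 0.
  by move=> F0; apply: geq_trans (geq_sym eF) _; exact: geq_near.
pose a x := (pz k0 rho x)^-1.
(* A full frame: the tangential fields and one normalized transversal field. Vanishing of all its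
   words is then transferred to the coordinate derivatives. *)
pose op k (g : V -> C) := if k == k0 then nabla k0 a g else tg k g.
pose flat u := gevp p u /\ forall w : seq cdir, foldl (fun g k => op k g) u w p = 0.
have gop k u : gevp p u -> gevp p (op k u).
  by move=> gu; rewrite /op; case: eqP => _; [apply: gevpM; [exact: gevp_a|exact: gevp_pz]|exact: gevp_tg].
have opE k g x : op k g x = (if k == k0 then 0 else pz k g x) +
     (if k == k0 then a x else - (pz k rho x * a x)) * pz k0 g x.
  by rewrite /op; case: eqP => _; rewrite ?add0r // /tg mulNr.
have op_near k u u' : gevp p u -> (\forall x \near p, u x = u' x) -> \forall x \near p, op k u x = op k u' x.
  move=> gu e; apply: filterS2 (near_cdiff gu) (near_nearby e) => x dx ex.
  by rewrite !opE !(pz_near _ ex dx).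
have op_nearw w u u' : gevp p u -> (\forall x \near p, u x = u' x) ->
    foldl (fun g k => op k g) u w p = foldl (fun g k => op k g) u' w p.
  elim: w u u' => [|k w IH] u u' gu e /=; first exact: nbhs_singleton e.
  by apply: IH; [exact: gop|exact: op_near].
have op_zero w u : gevp p u -> (\forall x \near p, u x = 0) -> foldl (fun g k => op k g) u w p = 0.
  move=> gu e; rewrite (op_nearw w u (fun=> 0) gu e).
  elim: w {gu e} => [//|k w IH] /=; rewrite (_ : op k (fun=> 0) = fun=> 0) //.
  by apply/funext => x; rewrite opE !pz_cst mulr0 addr0; case: ifP.
(* Vanishing to finite order, so that stability under multiplication can be proved by induction on
   the order. *)
pose Z n u := gevp p u /\ forall w : seq cdir, (size w <= n)%N -> foldl (fun g k => op k g) u w p = 0.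
have ZD n u1 u2 : Z n u1 -> Z n u2 -> Z n (fun x => u1 x + u2 x).
  move=> [g1 h1] [g2 h2]; split; first exact: gevpD.
  move=> w; elim: w n u1 u2 g1 h1 g2 h2 => [|k w IH] n u1 u2 g1 h1 g2 h2 sw.
    by have /= -> := h1 [::] isT; have /= -> := h2 [::] isT; rewrite addr0.
  case: n sw h1 h2 => // n sw h1 h2; rewrite /= (op_nearw w _ (fun x => op k u1 x + op k u2 x)).
  - apply: (IH n) => //; try exact: gop.
    + by move=> w' sw'; exact: (h1 (k :: w')).
    + by move=> w' sw'; exact: (h2 (k :: w')).
  - by apply: gop; exact: gevpD.
  - apply: filterS2 (near_cdiff g1) (near_cdiff g2) => x d1 d2.
    by rewrite !opE !(pzD _ d1 d2); case: ifP => _; gen_pz; intros; ring.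
have ZM n u c : gevp p c -> Z n u -> Z n (fun x => c x * u x).
  elim: n u c => [|n IH] u c gc [gu hu].
    by split=> [|[|//] _]; [exact: gevpM|have /= -> := hu [::] isT; rewrite mulr0].
  split; first exact: gevpM.
  case=> [|k w] sw; first by have /= -> := hu [::] isT; rewrite mulr0.
  rewrite /= (op_nearw w _ (fun x => op k c x * u x + c x * op k u x)).
  - have Zu : Z n u by split=> // w' sw'; apply: hu; exact: leqW.
    have Zk : Z n (op k u) by split=> [|w' sw']; [exact: gop|exact: (hu (k :: w'))].
    by have [_] := ZD _ _ _ (IH _ _ (gop k c gc) Zu) (IH _ _ gc Zk); apply.
  - by apply: gop; exact: gevpM.
  - apply: filterS2 (near_cdiff gc) (near_cdiff gu) => x d1 d2.
    by rewrite !opE !(pzM _ d1 d2); case: ifP => _; gen_pz; intros; ring.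
have flatP u : flat u <-> forall n, Z n u.
  by split=> [[g h] n|h]; [split=> // w _; exact: h|split=> [|w]; [case: (h 0%N)|case: (h (size w)) => _; apply]].
have flat_op k u : flat u -> flat (op k u).
  by move=> [g h]; split=> [|w]; [exact: gop|exact: (h (k :: w))].
have flatM u c : gevp p c -> flat u -> flat (fun x => c x * u x).
  by move=> gc /flatP h; apply/flatP => n; exact: ZM.
have flatD u1 u2 : flat u1 -> flat u2 -> flat (fun x => u1 x + u2 x).
  by move=> /flatP h1 /flatP h2; apply/flatP => n; exact: ZD.
have flat_near u u' : flat u -> (\forall x \near p, u x = u' x) -> flat u'.
  by move=> [g h] e; split=> [|w]; [exact: gevp_eq e g|rewrite -(op_nearw w u u')].
have flat_pz k u : flat u -> flat (pz k u).
  move=> fu; have [gu _] := fu; have f0 := flatM _ _ (gevp_pz k Gr) (flat_op k0 _ fu).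
  have f1 := flat_op k _ fu.
  have [kk|kk] := eqVneq k k0.
    rewrite kk in f0 f1 *; apply: flat_near f0 _; apply: filterS near_nz => x nx.
    by rewrite opE eqxx add0r /a mulrA divff // mul1r.
  apply: flat_near (flatD _ _ f1 f0) _; near=> x.
  by rewrite (opE k u x) (opE k0 u x) eqxx (negbTE kk) add0r mulNr (mulrA _ (a x)) subrK.
have flat_cpd l u : flat u -> flat (cpd l u).
  move=> q; pattern l; apply: coordP => j.
    by apply: flat_near (flatD _ _ (flat_pz (inl j) _ q) (flat_pz (inr j) _ q)) _; near=> x; rewrite (proj1 (cpd_pz _ _ _)).
  have f2 := flatM _ _ (gevp_cst p (-1 : C)) (flat_pz (inr j) _ q).
  have := flatM _ _ (gevp_cst p ('i : C)) (flatD _ _ (flat_pz (inl j) _ q) f2).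
  by move=> f3; apply: flat_near f3 _; near=> x; rewrite (proj2 (cpd_pz _ _ _)) mulN1r.
have flatF : flat F.
  split=> // w.
  have gfw v : gevp p (foldl (fun g k => tg k g) f v) by elim/last_ind: v => [//|v k IH]; rewrite foldl_rcons; exact: gevp_tg.
  have : [/\ gevp p F, \forall x \near p, pz k0 F x = 0 & forall v, foldl (fun g k => tg k g) F v p = 0].
    split=> // v.
    have E : geqg (foldl (fun g k => tg k g) F v) (foldl (fun g k => tg k g) f v) /\ gevp p (foldl (fun g k => tg k g) F v).
      elim/last_ind: v => [//|v k [IH1 IH2]]; rewrite !foldl_rcons; split; last exact: gevp_tg.
      exact: geq_tg.
    by have [/nbhs_singleton ->] := E; rewrite ?Hf.
  elim: w F {gF zF eF} => [|k w IH] F0 [gF zF hF]; first exact: (hF [::]).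
  rewrite /=; have [->|kk] := eqVneq k k0.
    apply: op_zero; first exact: gop.
    by apply: filterS zF => x zx; rewrite opE eqxx zx mulr0 addr0.
  apply: IH; split; first exact: gop.
  - have e : \forall x \near p, pz k F0 x = op k F0 x.
      by apply: filterS zF => x zx; rewrite opE (negbTE kk) zx mulr0 addr0.
    apply: filterS3 (near_nearby e) (near_nearby zF) (gevp_nearby gF) => x ex zx gx.
    rewrite (pz_near k0 ex (gevp_cdiff (gevp_pz k gx))) (pz_comm k0 k gx) (_ : 0 = pz k (fun=> 0) x); last by rewrite pz_cst.
    by apply: pz_near; [apply: filterS zx => y ->|exact: cdiff_cst].
  - by move=> v; have := hF (k :: v); rewrite /= /op (negbTE kk).
apply: gevp_zero => // w; elim: w F flatF {gF zF eF} => [|l w IH] F0 f0; first by case: f0 => _ /(_ [::]).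
by apply: IH; exact: flat_cpd.
Unshelve. all: by end_near.
Qed.

Lemma germ_flat (x : germ) : (forall w : seq cdir, gev0 (foldl (fun y k => gX k y) x w) = 0) -> x = 0.
Proof.
move: x; germs => H; rewrite -(gcst0 rr p); apply: mk_eq => //; first exact: gevp_cst.
apply: tangential_zero => // w.
have E v : foldl (fun y k => gX k y) (mk f) v = mk (foldl (fun g k => tg k g) f v) /\ gevp p (foldl (fun g k => tg k g) f v).
  elim/last_ind: v => [//|v k [IH1 IH2]]; rewrite !foldl_rcons IH1 gXE //; split=> //; exact: gevp_tg.
by have [e g] := E w; have := H w; rewrite e gev0E.
Qed.

(** The extension is the one constant along [k0]. Each remaining [dzbar] derivative is again
    constant along [k0], and it vanishes on the hypersurface because [f] is CR, so
    [transversal_zero] applies. *)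
Lemma cr_extension f : gevp p f -> (forall b, gX (inr b) (mk f) = 0) ->
  exists F, [/\ gevp p F, geqg F f & forall j, \forall x \near p, dzbar j F x = 0].
Proof.
move=> gf Hf.
have Grp : rho p = 0 by rewrite rhoE rrp.
have [F gF [zF eF]] := constant_extension gf Gr Grp nz0.
have {}eF : geqg F f by apply: filterS eF => x h r0; apply: h; rewrite rhoE r0.
exists F; split; [exact: gF|exact: eF|move=> b].
have gk := gevp_pz (inr b) gF.
apply: (transversal_zero gk).
  apply: filterS2 (near_nearby zF) (gevp_nearby gF) => x zx gx.
  rewrite (pz_comm k0 (inr b) gx) (_ : 0 = pz (inr b) (fun=> 0) x); last by rewrite pz_cst.
  by apply: pz_near; [apply: filterS zx => y ->|exact: cdiff_cst].
have e1 : geqg (tg (inr b) f) (fun=> 0).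
  have := Hf b; rewrite gXE // => h.
  have := gfun_mk rr (gevp_tg (inr b) gf); rewrite h -(gcst0 rr p) => h'.
  by apply: geq_trans (geq_sym h') _; apply: gfun_mk; exact: gevp_cst.
have e2 := geq_trans (geq_tg (inr b) gF gf eF) e1.
by apply: filterS2 e2 zF => x h zx r0; have := h r0; rewrite /tg zx mulr0 subr0.
Qed.

End Tangential.

(** * Classification of generic points *)

Definition o1 : 'I_3 := @Ordinal 3 1 isT.
Definition o2 : 'I_3 := @Ordinal 3 2 isT.

Lemma sum_o3 (A : comPzRingType) (F : 'I_3 -> A) : \sum_c F c = F ord0 + F o1 + F o2.
Proof. by rewrite !big_ord_recl big_ord0 addr0 addrA; congr (F _ + F _ + F _); apply: val_inj. Qed.
Lemma case_o3 (c : 'I_3) : [\/ c = ord0, c = o1 | c = o2].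
Proof.
by case: c => [[|[|[|//]]] p]; [apply: Or31|apply: Or32|apply: Or33]; apply: val_inj.
Qed.

Section Minors.
Variables (A : comPzRingType) (Lb : 'I_3 -> A -> A) (io r0 : A) (r : 'I_3 -> A).
Local Notation m2 := (minor2 Lb io r0 r).
Local Notation m3 := (minor3 Lb io r0 r).
Lemma minor2C a b : m2 a b = m2 b a.
Proof. by rewrite /minor2; move: (z3 _ _ _ _) => z; ring. Qed.
Lemma minor3C a b k : m3 a b k = m3 b a k.
Proof. by rewrite /minor3 /minor2; move: (z3 _ _ _ _) => z; ring. Qed.
Lemma minor3A a b k : m3 a b k = m3 b k a.
Proof. by rewrite /minor3 /minor2; move: (z3 _ _ _ _) => z; ring. Qed.

(** Cofactors of a 3 by 3 matrix written with cyclic indices carry no signs. *)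
Definition cyc3 (c : 'I_3) : 'I_3 := if c == ord0 then o1 else if c == o1 then o2 else ord0.
Lemma inverse3 di : di * m3 ord0 o1 o2 = 1 -> exists zi : 'I_3 -> 'I_3 -> A,
  (forall a c, \sum_b z3 Lb io r0 r a b * zi b c = (a == c)%:R) /\
  (forall a c, \sum_b zi a b * z3 Lb io r0 r b c = (a == c)%:R).
Proof.
rewrite /minor3 /minor2; move: (z3 _ _ _ _) => z e.
exists (fun b c => di * (z (cyc3 c) (cyc3 b) * z (cyc3 (cyc3 c)) (cyc3 (cyc3 b)) - z (cyc3 c) (cyc3 (cyc3 b)) * z (cyc3 (cyc3 c)) (cyc3 b))).
have [e0 e1 e2] : [/\ cyc3 ord0 = o1, cyc3 o1 = o2 & cyc3 o2 = ord0] by [].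
by split=> a c; rewrite sum_o3; case: (case_o3 a) => ->; case: (case_o3 c) => ->;
  rewrite !(e0, e1, e2) /= -?e; ring.
Qed.
End Minors.

Lemma cancel_mid (A : comPzRingType) (x g u v : A) : u * v = 1 -> x * g = x * (g * v) * u.
Proof. by move=> e; transitivity (x * g * (u * v)); [rewrite e mulr1|ring]. Qed.

Lemma hh_lift (A : comPzRingType) (io w : A) (g : 'I_4 -> A) j0 Z : g j0 * w = 1 ->
  hh io (g j0) (fun a : 'I_3 => g (lift j0 a) * w) j0 (lift j0) Z = io * \sum_j g j * Z j.
Proof.
move=> gw; rewrite /hh (bigD1_ord j0) //=; congr (_ * (_ + _)); apply: eq_bigr => a _; congr (_ * _).
by rewrite mulrCA gw mulr1.
Qed.

(** * The germ ring at a point as an instance of the abstract frame *)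

Section Point.
Variables (R : realType) (G : set 'rV[R]_8) (U0 : set 'rV[R]_8) (rr : 'rV[R]_8 -> R).
Local Notation V := 'rV[R]_8.
Local Notation C := R[i].
Local Notation Re := complex.Re.
Local Notation Im := complex.Im.
Hypothesis ld : local_defining G U0 rr.
Hypothesis hnd : holomorphically_nondegenerate G.
Variable rho : V -> C.
Hypothesis rhoE : forall x, rho x = (rr x)%:C.

Lemma ld_gevp U f x : local_defining G U f -> U x -> gevp x (fun y => (f y)%:C).
Proof. by move=> [_ [an _]] Ux; exact: analytic_gevp (an x Ux). Qed.
Lemma gevp_real_diff (f : V -> R) x : gevp x (fun y => (f y)%:C) -> differentiable f x.
Proof. by move=> /gevp_cdiff [h _]; exact: h. Qed.
Lemma ld_near U f x : local_defining G U f -> U x -> \forall y \near x, U y.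
Proof. by move=> [oU _] Ux; exact: (open_nbhs_nbhs (conj oU Ux)). Qed.

Lemma proportional U f x : local_defining G U f -> U x -> U0 x -> G x ->
  exists2 la : R, la != 0 & forall k, pd k f x = la * pd k rr x.
Proof.
move=> lf Ux U0x Gx.
have [k1 nk1] := (proj1 (proj2 (proj2 ld))) x U0x.
have [k2 nk2] := (proj1 (proj2 (proj2 lf))) x Ux.
have rx : rr x = 0 by apply/(proj2 (proj2 (proj2 ld)) x U0x).
have H k : pd k f x * pd k1 rr x = pd k1 f x * pd k rr x.
  apply: vanishing_differential => //.
  - by apply: filterS (ld_near ld U0x) => y Uy; exact: (gevp_real_diff (ld_gevp ld Uy)).
  - exact: (gevp_real_diff (ld_gevp lf Ux)).
  - apply: filterS2 (ld_near ld U0x) (ld_near lf Ux) => y Uy Uy' ry.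
    by apply/(proj2 (proj2 (proj2 lf)) y Uy'); apply/(proj2 (proj2 (proj2 ld)) y Uy).
have E k : pd k f x = pd k1 f x / pd k1 rr x * pd k rr x.
  by apply: (mulIf nk1); rewrite H mulrAC divfK.
exists (pd k1 f x / pd k1 rr x) => //.
by apply: contra_neq nk2 => e; rewrite E e mul0r.
Qed.

Lemma pz_real (f : V -> R) j x : pz (inl j) (fun y => (f y)%:C) x =
  (1 / 2)%:C * ((pd (xcoord j) f x)%:C - 'i * (pd (ycoord j) f x)%:C).
Proof. by rewrite /pz /dz !(cpd_rho (fun _ => erefl)). Qed.

Lemma re_pairing (f : V -> R) (Z : hvf R) x :
  \sum_(k < 8) re_field Z x 0 k * pd k f x = 2 * Re (\sum_j Z j x * pz (inl j) (fun y => (f y)%:C) x).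
Proof.
rewrite (@big_split_ord _ _ _ 4 4) /= Re_sum mulr_sumr -big_split; apply: eq_bigr => j _ /=.
rewrite [dz _ _ _](pz_real f j x) -/(xcoord j) -/(ycoord j) /re_field !mxE split_x split_y.
by case: (Z j x) => a b /=; move: (pd _ f x) (pd _ f x) => u v; field.
Qed.

Lemma ratio_aux (h u v e la : C) : h * (la * u + e * (la * v)) = la * (h * (u + e * v)).
Proof. by ring. Qed.
Lemma pz_proportional U f x : local_defining G U f -> U x -> U0 x -> G x ->
  exists2 la : R, la != 0 & forall k, pz k (fun y => (f y)%:C) x = la%:C * pz k rho x.
Proof.
move=> lf Ux U0x Gx; have [la la0 H] := proportional lf Ux U0x Gx; exists la => // k.
have [j [e [_ E]]] := pzE R k; rewrite !E !(cpd_rho rhoE) !(cpd_rho (fun _ => erefl)) !H !rmorphM /=.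
exact: ratio_aux.
Qed.

Lemma tangent_at (Z : hvf R) U f x : local_defining G U f -> U x -> U0 x -> G x ->
  Re (\sum_j Z j x * pz (inl j) rho x) = 0 -> \sum_(k < 8) re_field Z x 0 k * pd k f x = 0.
Proof.
move=> lf Ux U0x Gx H; have [la _ E] := proportional lf Ux U0x Gx.
under eq_bigr do rewrite E mulrCA.
by rewrite -mulr_sumr re_pairing -(funext rhoE) H mulr0 mulr0.
Qed.

Lemma fsumE (I : Type) (s : seq I) (F : I -> V -> C) x : (\sum_(i <- s) F i) x = \sum_(i <- s) F i x.
Proof. by elim: s => [|i s IH]; rewrite ?big_nil // !big_cons -IH. Qed.

Lemma near_all (I : finType) (P : I -> V -> Prop) (q : V) : (forall i, \forall x \near q, P i x) ->
  \forall x \near q, forall i, P i x.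
Proof.
move=> H; have : \forall x \near q, forall i, i \in enum I -> P i x.
  elim: (enum I) => [|i s IH]; first by apply: filterS (filterT : nbhs q setT) => x _ i.
  by apply: filterS2 (H i) IH => x h1 h2 l; rewrite inE => /orP[/eqP ->|/h2].
by apply: filterS => x h i; apply: h; rewrite mem_enum.
Qed.

(** Nondegeneracy speaks of an open set on which everything holds at once: the interior of the set
    of good points. The complex pairing with the gradient of [rho] vanishes there, so both [Z] and
    ['i * Z] have tangent real parts. *)
Lemma complex_tangent q (Z : hvf R) : U0 q -> G q -> (forall j, gevp q (Z j)) ->
  (forall l j, \forall x \near q, dzbar j (Z l) x = 0) ->
  (\forall x \near q, G x -> \sum_j Z j x * pz (inl j) rho x = 0) -> forall j, \forall x \near q, Z j x = 0.
Proof.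
move=> U0q Gq gZ dZ tZ.
pose P x := [/\ U0 x, (forall j, gevp x (Z j)), (forall l j, dzbar j (Z l) x = 0) &
  G x -> \sum_j Z j x * pz (inl j) rho x = 0].
have nP : \forall x \near q, P x.
  have n1 : \forall x \near q, forall j, gevp x (Z j) by apply: near_all => j; exact: gevp_nearby.
  have n2 : \forall x \near q, forall l j, dzbar j (Z l) x = 0 by apply: near_all => l; apply: near_all => j; exact: dZ.
  by apply: filterS3 (near_and (ld_near ld U0q) n1) n2 tZ => x [h1 h2] h3 h4; split.
have Pin x : (P : set V)° x -> P x by exact: interior_subset.
have [|||W [oW Wq] HW] := hnd Gq (open_interior (P : set V)) _ _ (Z := Z).
- exact: nP.
- move=> j a /Pin[_ h1 h2 _]; have [d1 d2] := gevp_cdiff (h1 j); split; [exact: d1|split; [exact: d2|exact: h2]].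
- split=> U f lf x /Pin[U0x _ _ h] Ux Gx; apply: (tangent_at lf) => //; first by rewrite h.
  by under eq_bigr do rewrite -mulrA; rewrite -mulr_sumr h // mulr0.
by move=> j; apply: filterS (open_nbhs_nbhs (conj oW Wq)) => x Wx; exact: HW.
Qed.

Variable j0 : 'I_4.

Section At.
Variable q : V.
Hypotheses (Uq : U0 q) (Gq : G q) (nz : pz (inr j0 : cdir) rho q != 0).
Local Notation A := (germ rr q).
Local Notation mk := (mk rr q).
Local Notation X0 := (gX rho j0 (inl j0) : A -> A).
Local Notation XX := (fun a : 'I_3 => gX rho j0 (inl (lift j0 a)) : A -> A).
Local Notation Lb := (fun a : 'I_3 => gX rho j0 (inr (lift j0 a)) : A -> A).
Local Notation cst := (gcst rr q).
Local Notation io := (cst 'i).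
Local Notation r0 := (gr_ rr q rho (inl j0)).
Local Notation w0 := (w0 rr q rho j0).
Local Notation r := (fun a : 'I_3 => gr_ rr q rho (inl (lift j0 a)) * w0).
Local Notation ev := (@gev0 R rr q).
Local Notation cj := (@gconj R rr q).

Lemma at_gevp : gevp q rho. Proof. by rewrite (funext rhoE); exact: ld_gevp ld Uq. Qed.
Lemma at_zero : rr q = 0. Proof. by apply/(proj2 (proj2 (proj2 ld)) q Uq). Qed.
Lemma at_G : \forall x \near q, G x <-> rr x = 0.
Proof. by apply: filterS (ld_near ld Uq) => x Ux; exact: (proj2 (proj2 (proj2 ld)) x Ux). Qed.
Local Notation gr := at_gevp.
Local Notation rq := at_zero.

Lemma at_der k : derivation (gX rho j0 k : A -> A).
Proof. by split=> x y; [apply: (gXD rhoE gr nz)|apply: (gXM rhoE gr nz)]. Qed.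
Lemma at_comm k l (x : A) : gX rho j0 k (gX rho j0 l x) = gX rho j0 l (gX rho j0 k x).
Proof. exact: (gX_comm rhoE gr nz). Qed.
Lemma gcstN c : cst (- c) = - cst c.
Proof. by apply: (addrI (cst c)); rewrite -gcstD !subrr gcst0. Qed.
Lemma at_io2 : io * io = -1.
Proof. by rewrite -gcstM -gcst1 -gcstN; congr cst; rewrite -expr2 sqr_i. Qed.
Lemma at_cst k c : gX rho j0 k (cst c) = 0. Proof. exact: (gX_cst rhoE gr nz). Qed.
Lemma at_r0w0 : r0 * w0 = 1. Proof. exact: (gr_w0 rhoE gr nz). Qed.
Lemma at_cjLb a x : cj (Lb a x) = L3 X0 XX r a (cj x).
Proof. exact: (gX_conj rhoE gr nz). Qed.
Lemma at_cjT x : cj (T3 X0 io w0 x) = T3 X0 io w0 (cj x).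
Proof. by rewrite /T3 -gcstN; exact: (gT_conj rhoE gr nz). Qed.
Lemma at_X0f0 : X0 (mk (zco j0)) = 1.
Proof. by rewrite (proj2 (gX_zco rhoE gr nz j0 j0)) eqxx. Qed.
Lemma at_Lbf0 b : Lb b (mk (zco j0)) = 0.
Proof. exact: (proj1 (gX_zco rhoE gr nz (lift j0 b) j0)). Qed.
Lemma cst_nat k : cst k%:R = k%:R.
Proof. by elim: k => [|k IH]; [exact: gcst0|rewrite -!natr1 gcstD IH gcst1]. Qed.
Lemma at_qE k : cst (k.+1%:R^-1) * k.+1%:R = 1.
Proof. by rewrite -cst_nat -gcstM mulVf ?gcst1 // pnatr_eq0. Qed.
Lemma at_evD x y : ev (x + y) = ev x + ev y. Proof. exact: (gev0D rq). Qed.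
Lemma at_evM x y : ev (x * y) = ev x * ev y. Proof. exact: (gev0M rq). Qed.
Lemma at_evC x : ev (cj x) = (ev x)^*. Proof. exact: (gev0_conj rq). Qed.
Lemma at_ev1 : ev 1 = 1. Proof. by rewrite -gcst1 (gev0_cst rq). Qed.
Lemma at_unit x : ev x != 0 -> exists y, y * x = 1.
Proof. by move=> /(germ_unit rq)[y h]; exists y; rewrite mulrC. Qed.
Lemma at_cjx (x : A) : x * cj x = 0 -> x = 0.
Proof.
have [f gf ->] := germP x; rewrite (gconjE rr gf) -(mkM rr gf (gevp_conj gf)) -(gcst0 rr q) => h.
apply: mk_eq => //; first exact: gevp_cst.
have := gfun_mk rr (gevpM gf (gevp_conj gf)); rewrite h => h1.
have h2 := gfun_mk rr (gevp_cst q (0 : C)).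
apply: filterS2 h1 h2 => y e1 e2 ry; have := e1 ry; rewrite e2 // => /esym/eqP.
by rewrite mulf_eq0 conjc_eq0 orbb => /eqP.
Qed.
Lemma at_k0 (x : A) : gX rho j0 (inr j0) x = 0.
Proof.
have [f gf ->] := germP x; rewrite (gXE rhoE gr nz _ gf) -(gcst0 rr q); apply: mk_eq.
- exact: (gevp_tg gr nz).
- exact: gevp_cst.
- apply: filterS (gevp_nonzero (gevp_pz (inr j0) gr) nz) => y ny _.
  by rewrite /tg divff // mul1r subrr.
Qed.

Lemma geq_of_mk f g : gevp q f -> gevp q g -> mk f = mk g -> geqg rr q f g.
Proof.
move=> gf gg h; have h1 := gfun_mk rr gf; rewrite h in h1.
exact: geq_trans (geq_sym h1) (gfun_mk rr gg).
Qed.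

(** The component [- sum_a v_a r_a] along [j0] makes the field tangential, and it is CR because [v]
    lies in the Levi kernel. All four components extend holomorphically, and [complex_tangent]
    forces the field to vanish. *)
Lemma at_nondeg v : (forall a b, Lb b (v a) = 0) -> (forall b, \sum_a v a * z3 Lb io r0 r a b = 0) ->
  (exists a, ev (v a) != 0) -> False.
Proof.
move=> Hv Hz [a1 na].
have ext (x : A) : (forall b, Lb b x = 0) -> exists F, [/\ gevp q F, x = mk F & forall j, \forall y \near q, dzbar j F y = 0].
  have [f gf ->] := germP x => Hx.
  have [b|F [gF eF dF]] := cr_extension rhoE gr rq nz gf.
    by case: (unliftP j0 b) => [a ->|->]; [exact: Hx|exact: at_k0].
  by exists F; split=> //; apply: mk_eq => //; exact: geq_sym.
have /choice[F HF] : forall a, exists F, [/\ gevp q F, v a = mk F & forall j, \forall y \near q, dzbar j F y = 0].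
  by move=> a; apply: ext => b; exact: Hv.
have Lr b c : Lb b (r c) = - io * w0 * z3 Lb io r0 r c b.
  by apply: Lb_r; [exact: at_io2|exact: at_r0w0].
have rot (x y t u : A) : x = y * t -> u * x = y * (u * t) by move=> ->; rewrite mulrCA.
have [b|F0 [gF0 eF0 dF0]] := ext (- \sum_a v a * r a).
  rewrite (derN _ (at_der _)) (der_sum _ (at_der _)) -[RHS]oppr0; congr (- _).
  transitivity (- io * w0 * \sum_a v a * z3 Lb io r0 r a b); last by rewrite Hz mulr0.
  rewrite mulr_sumr; apply: eq_bigr => a _.
  rewrite (proj2 (at_der (inr (lift j0 b)))) Hv mul0r add0r; apply: rot; exact: Lr.
pose Z : hvf R := fun j => if unlift j0 j is Some a then F a else F0.
have Z0 : Z j0 = F0 by rewrite /Z unlift_none.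
have Za a : Z (lift j0 a) = F a by rewrite /Z liftK.
have gZ j : gevp q (Z j) by rewrite /Z; case: (unlift j0 j) => [a|//]; case: (HF a).
have CT : forall j, \forall x \near q, Z j x = 0; last first.
  have := CT (lift j0 a1); rewrite Za => /nbhs_singleton h.
  have [gF eF _] := HF a1; move: na; rewrite eF (gev0E rq gF) h eqxx.
  by [].
apply: (complex_tangent Uq Gq gZ).
- by move=> l j; rewrite /Z; case: (unlift j0 l) => [a|]; [case: (HF a)|exact: dF0].
- have e : \sum_j mk (Z j) * gr_ rr q rho (inl j) = 0.
    rewrite (bigD1_ord j0) //= Z0 -eF0; under eq_bigr do rewrite Za.
    have -> : \sum_(i < 3) mk (F i) * gr_ rr q rho (inl (lift j0 i)) = (\sum_a v a * r a) * r0.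
      rewrite mulr_suml; apply: eq_bigr => a _; have [_ -> _] := HF a.
      exact: (cancel_mid _ _ at_r0w0).
    by rewrite mulNr addNr.
  have gs : gevp q (fun x => \sum_j Z j x * pz (inl j) rho x).
    by apply: gevp_sum => j; apply: gevpM => //; apply: gevp_pz; exact: gr.
  have e' : mk (fun x => \sum_j Z j x * pz (inl j) rho x) = mk (fun=> 0).
    rewrite [RHS](gcst0 rr q) -e /gr_.
    have aux (s : seq 'I_4) : mk (fun x => \sum_(j <- s) Z j x * pz (inl j) rho x) = \sum_(j <- s) mk (Z j) * mk (pz (inl j) rho).
      elim: s => [|j s IH]; first by rewrite big_nil -(gcst0 rr q); congr mk; apply: funext => x; rewrite big_nil.
      rewrite big_cons -IH -mkM; [|exact: gZ|by apply: gevp_pz; exact: gr].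
      rewrite -mkD; [|by apply: gevpM; [exact: gZ|apply: gevp_pz; exact: gr]|].
        by congr mk; apply: funext => x; rewrite big_cons.
      by apply: gevp_sum => l; apply: gevpM => //; apply: gevp_pz; exact: gr.
    by rewrite -aux.
  have h := geq_of_mk gs (gevp_cst q (0 : C)) e'.
  by apply: filterS2 h at_G => x hx Gx /Gx /hx.
Qed.

Definition bounded_at n := bounded X0 XX Lb cj io r0 w0 r (fun c : R => cst c%:C) ev j0 (lift j0) n.

(** Transports units and zeros between germs at [q] and functions that do not depend on [q]. *)
Definition rep (x : A) (f : V -> C) := gevp q f /\ x = mk f.

Lemma rep_mk f : gevp q f -> rep (mk f) f. Proof. by []. Qed.
Lemma rep_cst c : rep (cst c) (fun=> c). Proof. by split=> //; exact: gevp_cst. Qed.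
Lemma repD x y f g : rep x f -> rep y g -> rep (x + y) (f + g).
Proof. by move=> [gf ->] [gg ->]; split; [exact: gevpD|rewrite -(mkD rr gf gg)]. Qed.
Lemma repM x y f g : rep x f -> rep y g -> rep (x * y) (f * g).
Proof. by move=> [gf ->] [gg ->]; split; [exact: gevpM|rewrite -(mkM rr gf gg)]. Qed.
Lemma repN x f : rep x f -> rep (- x) (- f).
Proof. by move=> [gf ->]; split; [exact: gevpN|rewrite -(mkN rr gf)]. Qed.
Lemma rep_cj x f : rep x f -> rep (cj x) (fun y => (f y)^*).
Proof. by move=> [gf ->]; split; [exact: gevp_conj|rewrite (gconjE rr gf)]. Qed.
Lemma rep_X k x f : rep x f -> rep (gX rho j0 k x) (tg rho j0 k f).
Proof. by move=> [gf ->]; split; [exact: (gevp_tg gr nz)|exact: (gXE rhoE gr nz)]. Qed.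
Lemma rep_sum (I : Type) (s : seq I) (x : I -> A) (f : I -> V -> C) : (forall i, rep (x i) (f i)) ->
  rep (\sum_(i <- s) x i) (\sum_(i <- s) f i).
Proof.
move=> H; elim: s => [|i s IH]; last by rewrite !big_cons; exact: repD.
by rewrite !big_nil -(gcst0 rr q); exact: rep_cst.
Qed.
Lemma rep_ev x f : rep x f -> ev x = f q.
Proof. by move=> [gf ->]; exact: (gev0E rq gf). Qed.

Definition decf f := f q != 0 \/ geqg rr q f (fun=> 0).
Lemma rep_zero x f : rep x f -> geqg rr q f (fun=> 0) -> x = 0.
Proof. by move=> [gf ->] h; rewrite -(gcst0 rr q); apply: mk_eq => //; exact: gevp_cst. Qed.
Lemma rep_dec x f : rep x f -> decf f -> dec ev x.
Proof. by move=> Hx [h|h]; [right; rewrite (rep_ev Hx)|left; exact: rep_zero h]. Qed.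
Lemma rep_inv x f : rep x f -> f q != 0 -> rep (mk (fun y => (f y)^-1)) (fun y => (f y)^-1) /\ mk (fun y => (f y)^-1) * x = 1.
Proof.
move=> [gf ->] n0; have gv := gevpV gf n0; split; first exact: rep_mk.
rewrite -(mkM rr gv gf) -(gcst1 rr q); apply: mk_eq.
- exact: gevpM.
- exact: gevp_cst.
- by apply: filterS (gevp_nonzero gf n0) => y ny _; rewrite mulVf.
Qed.

Definition concl n := forall (U : set V) (Zs : 'I_n.+1 -> hvf R), open U -> U q ->
  (forall i, hvf_holomorphic U (Zs i)) -> (forall i, tangent_on G U (re_field (Zs i))) ->
  exists c : 'I_n.+1 -> R, (exists i, c i != 0) /\
    forall j, \forall x \near q, \sum_i (c i)%:C * Zs i j x = 0.

(** [L], [Lb] and [T] span all tangential derivations, so the predicate is stable under every word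
    of [germ_flat]. *)
Lemma flat_words h : flat_module X0 XX Lb io w0 r ev h -> h = 0.
Proof.
move=> [P [Ph Plc PL PT Pev]]; apply: (germ_flat rhoE gr rq nz) => w.
have PM c x : P x -> P (c * x).
  move=> Px; have -> : c * x = (c - 1) * x + x by rewrite mulrBl mul1r subrK.
  exact: Plc.
have PX0 x : P x -> P (X0 x).
  move=> Px; rewrite (X0E X0 at_io2 at_r0w0); apply: PM; exact: PT.
have PX k x : P x -> P (gX rho j0 k x).
  case: k => b Px.
    case: (unliftP j0 b) => [a ->|->]; last exact: PX0.
    have -> : XX a x = r a * X0 x + L3 X0 XX r a x by rewrite /L3 addrC subrK.
    by apply: Plc; [exact: PX0|exact: (proj1 (PL a x Px))].
  case: (unliftP j0 b) => [a ->|->]; first exact: (proj2 (PL a x Px)).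
  rewrite at_k0 -(mul0r x); exact: PM.
have : P (foldl (fun y k => gX rho j0 k y) h w).
  by elim: w h Ph => [//|k w IH] h' Ph'; apply: IH; exact: PX.
exact: Pev.
Qed.

Lemma hh_sum (Z : 'I_4 -> A) : hh io r0 r j0 (lift j0) Z = io * \sum_j gr_ rr q rho (inl j) * Z j.
Proof.
exact: (hh_lift io Z at_r0w0).
Qed.

Lemma real_comb (X : Type) n (fs : seq (X -> R)) (D : 'I_n.+1 -> X) : (size fs <= n)%N ->
  exists c : 'I_n.+1 -> R, (exists i, c i != 0) /\ forall F, List.In F fs -> \sum_i c i * F (D i) = 0.
Proof.
move=> sn; pose M : 'M[R]_(n.+1, n) := \matrix_(i, k) nth (fun=> 0) fs k (D i).
have kM : kermx M != 0.
  rewrite kermx_eq0 /row_free; apply/negP => /eqP e; have := rank_leq_col M; rewrite e; lia.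
have [i [l h]] : exists i l, kermx M i l != 0.
  apply: contrapT => H; move/eqP: kM; apply; apply/matrixP => i l; rewrite [RHS]mxE.
  by apply: contrapT => /eqP e; apply: H; exists i, l.
exists (fun l => kermx M i l); split; first by exists l.
move=> F HF; have [k [kn <-]] : exists k, (k < size fs)%N /\ nth (fun=> 0) fs k = F.
  elim: fs {sn M kM h i l} HF => //= g s IH [->|/IH[k [kn e]]]; first by exists 0%N.
  by exists k.+1.
have kn' : (k < n)%N by exact: leq_trans kn sn.
have := congr1 (fun B : 'M[R]_(n.+1, n) => B i (Ordinal kn')) (mulmx_ker M); rewrite !mxE => e.
by rewrite -[RHS]e; apply: eq_bigr => l' _; rewrite !mxE.
Qed.

Lemma pz_holo U (f : V -> C) : open U -> U q -> holomorphic_on U f -> forall j, \forall x \near q, dzbar j f x = 0.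
Proof. by move=> oU Uq' hf j; apply: filterS (open_nbhs_nbhs (conj oU Uq')) => x Ux; have [_ [_ h]] := hf x Ux; exact: h. Qed.

Lemma Lb_holo f b : gevp q f -> (forall j, \forall x \near q, dzbar j f x = 0) -> gX rho j0 (inr b) (mk f) = 0.
Proof.
move=> gf h; rewrite (gXE rhoE gr nz _ gf) -(gcst0 rr q); apply: mk_eq.
- exact: (gevp_tg gr nz).
- exact: gevp_cst.
- apply: filterS2 (h b) (h j0) => x e1 e2 _.
  by rewrite /tg /pz e1 e2 mulr0 subr0.
Qed.

Lemma Re_mulc (c : R) (w : C) : Re (c%:C * w) = c * Re w.
Proof. by case: w => a b /=; rewrite mul0r subr0. Qed.

(** Linear algebra gives a real combination annihilated by all functionals. Its [hh] is then zero,
    that is, [sum_j Z_j rho_j] vanishes on the hypersurface and not only its real part, so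
    [complex_tangent] applies. *)
Theorem concl_of_bounded n : bounded_at n -> concl n.
Proof.
move=> [Gr [Gc [sz Hlin HB]]] U Zs oU Uq' hol tan.
have gZ i j : gevp q (Zs i j) by exact: (holomorphic_gevp oU Uq' (hol i j)).
have dZ i j := pz_holo oU Uq' (hol i j).
pose D i : 'I_4 -> A := fun j => mk (Zs i j).
pose fs : seq (('I_4 -> A) -> R) := [seq (fun Z => Re (ev (F Z))) | F <- Gr] ++
  ([seq (fun Z => Re (ev (F Z))) | F <- Gc] ++ [seq (fun Z => Im (ev (F Z))) | F <- Gc]).
have [|c [c0 Hc]] := @real_comb _ n fs D; first by rewrite !size_cat !size_map; apply: leq_trans sz; rewrite mul2n -addnn.
exists c; split=> //.
pose Z : hvf R := fun j x => \sum_i (c i)%:C * Zs i j x.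
have gZc j : gevp q (Z j) by apply: gevp_sum => i; apply: gevpM => //; exact: gevp_cst.
have mkZ j : mk (Z j) = \sum_i cst (c i)%:C * D i j.
  have [_ ->] := @rep_sum _ (index_enum 'I_n.+1) (fun i => cst (c i)%:C * D i j) (fun i => (fun=> (c i)%:C) * Zs i j)
    (fun i => repM (rep_cst (c i)%:C) (rep_mk (gZ i j))).
  by congr mk; apply: funext => x; rewrite fsumE.
pose Zg : 'I_4 -> A := fun j => mk (Z j).
have lin F : List.In F (Gr ++ Gc) -> ev (F Zg) = \sum_i (c i)%:C * ev (F (D i)).
  move=> /Hlin[F1 F2].
  have F0 : F (fun=> 0) = 0.
    have := F2 0 (fun=> 0); rewrite (_ : (fun j => _) = (fun=> 0)); last by apply: funext => j; rewrite mulr0.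
    by move=> ->; rewrite (gcst0 rr q) mul0r.
  have Fs (s : seq 'I_n.+1) : ev (F (fun j => \sum_(i <- s) cst (c i)%:C * D i j)) = \sum_(i <- s) (c i)%:C * ev (F (D i)).
    elim: s => [|i s IH].
      rewrite big_nil (_ : (fun j => _) = (fun=> 0)); last by apply: funext => j; rewrite big_nil.
      by rewrite F0 -(gcst0 rr q) (gev0_cst rq).
    rewrite big_cons (_ : (fun j => _) = (fun j => cst (c i)%:C * D i j + \sum_(i <- s) cst (c i)%:C * D i j)); last first.
      by apply: funext => j; rewrite big_cons.
    by rewrite F1 F2 at_evD at_evM (gev0_cst rq) IH.
  by rewrite -Fs; congr (ev (F _)); apply: funext => j; exact: mkZ.
have ReF F : List.In F (Gr ++ Gc) -> Re (ev (F Zg)) = \sum_i c i * Re (ev (F (D i))).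
  by move=> HF; rewrite lin // Re_sum; apply: eq_bigr => i _; rewrite Re_mulc.
have ImF F : List.In F (Gr ++ Gc) -> Im (ev (F Zg)) = \sum_i c i * Im (ev (F (D i))).
  move=> HF; rewrite lin //.
  have ImD (x y : C) : Im (x + y) = Im x + Im y by case: x y => [a1 a2] [b1 b2].
  rewrite (big_morph _ ImD (id1 := 0)) //; apply: eq_bigr => i _; case: (ev (F (D i))) => a1 a2 /=; rewrite mul0r addr0.
  by [].
have inGr F : List.In F Gr -> List.In F (Gr ++ Gc) by rewrite In_cat; left.
have inGc F : List.In F Gc -> List.In F (Gr ++ Gc) by rewrite In_cat; right.
have in_map (T1 T2 : Type) (g : T1 -> T2) x s : List.In x s -> List.In (g x) [seq g y | y <- s].
  by elim: s => //= y s IH [->|/IH]; [left|right].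
have rG : gevp q rho := gr.
pose S := fun x => \sum_j pz (inl j) rho x * Z j x.
have gS : gevp q S by apply: gevp_sum => j; apply: gevpM => //; exact: gevp_pz.
have repS : \sum_j gr_ rr q rho (inl j) * Zg j = mk S.
  have [_ ->] := @rep_sum _ (index_enum 'I_4) (fun j => gr_ rr q rho (inl j) * Zg j) (fun j => pz (inl j) rho * Z j)
    (fun j => repM (rep_mk (gevp_pz (inl j) gr)) (rep_mk (gZc j))).
  by congr mk; apply: funext => x; rewrite fsumE.
have hE : hh io r0 r j0 (lift j0) Zg = io * mk S by rewrite hh_sum repS.
have SRe : \forall x \near q, rr x = 0 -> Re (S x) = 0.
  apply: filterS3 (ld_near ld Uq) (open_nbhs_nbhs (conj oU Uq')) at_G => x U0x Ux Gx rx.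
  have t i : Re (\sum_j Zs i j x * pz (inl j) rho x) = 0.
    have := tan i U0 rr ld x Ux U0x (proj2 Gx rx); rewrite re_pairing -(funext rhoE) => /eqP.
    by rewrite mulf_eq0 pnatr_eq0 /= => /eqP.
  have -> : S x = \sum_i (c i)%:C * \sum_j Zs i j x * pz (inl j) rho x.
    rewrite /S /Z; under eq_bigr do rewrite mulr_sumr; rewrite exchange_big; apply: eq_bigr => i _ /=.
    by rewrite mulr_sumr; apply: eq_bigr => j _; rewrite mulrCA; congr (_ * _); exact: mulrC.
  by rewrite Re_sum big1 // => i _; rewrite Re_mulc t mulr0.
have aZ : adm Lb cj io r0 r j0 (lift j0) Zg.
  split=> [b j|].
    rewrite /Zg mkZ (der_sum _ (at_der _)) big1 // => i _.
    rewrite (proj2 (at_der _)) at_cst mul0r add0r /D (Lb_holo _ (gZ i j)) ?mulr0 //.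
  rewrite hE; have g1 : gevp q (fun x => 'i * S x) by apply: gevpM => //; exact: gevp_cst.
  have -> : io * mk S = mk (fun x => 'i * S x) by rewrite (mkM rr (gevp_cst q _) gS).
  rewrite (gconjE rr g1); apply: mk_eq => //; first exact: gevp_conj.
  apply: filterS SRe => x h rx; have := h rx; case: (S x) => a1 a2 /= ->.
  by simpc.
have h0 : io * mk S = 0.
  rewrite -hE; apply: flat_words; apply: HB => // F HF.
    rewrite (ReF F (inGr F HF)); apply: (Hc (fun Z => Re (ev (F Z)))); rewrite !In_cat; left; exact: (in_map _ _ (fun F Z => Re (ev (F Z)))).
  apply/eqP; rewrite eq_complex (ReF F (inGc F HF)) (ImF F (inGc F HF)); apply/andP; split; apply/eqP.
    apply: (Hc (fun Z => Re (ev (F Z)))); rewrite !In_cat; right; left; exact: (in_map _ _ (fun F Z => Re (ev (F Z)))).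
  apply: (Hc (fun Z => Im (ev (F Z)))); rewrite !In_cat; right; right; exact: (in_map _ _ (fun F Z => Im (ev (F Z)))).
have S0 : mk S = mk (fun=> 0).
  have aux (x : A) : io * x = 0 -> x = 0.
    by move=> e; rewrite -[x]opprK -[- x]mulN1r -at_io2 -mulrA e mulr0 oppr0.
  by rewrite (aux _ h0); exact: (esym (gcst0 rr q)).
have nS := geq_of_mk gS (gevp_cst q (0 : C)) S0.
apply: (complex_tangent Uq Gq gZc).
- move=> l j; have nd : \forall x \near q, forall i, dzbar j (Zs i l) x = 0 by apply: near_all => i; exact: dZ.
  have ng : \forall x \near q, forall i, gevp x (Zs i l) by apply: near_all => i; exact: gevp_nearby.
  apply: filterS2 nd ng => x dx gx.
  have dc i : cdiff (fun y => (c i)%:C * Zs i l y) x.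
    by apply: gevp_cdiff; apply: gevpM; [exact: gevp_cst|exact: gx].
  rewrite [LHS](pz_sum (inr j) (index_enum 'I_n.+1) dc) big1 // => i _.
  rewrite pzM; [|exact: cdiff_cst|exact: gevp_cdiff].
  by rewrite pz_cst mul0r add0r /= dx mulr0.
- apply: filterS2 nS at_G => x h Gx /Gx /h; rewrite /S => e; rewrite -[RHS]e; apply: eq_bigr => j _; exact: mulrC.
Qed.

(** The frame acting on plain functions. The tensors are instantiated a second time in the ring of
    functions, so that one and the same function can be tested at different base points. *)
Definition ffLb (a : 'I_3) (f : V -> C) : V -> C := tg rho j0 (inr (lift j0 a)) f.
Definition ff0 : V -> C := pz (inl j0) rho.
Definition ffr (a : 'I_3) : V -> C := pz (inl (lift j0 a)) rho * (fun x => (pz (inl j0) rho x)^-1).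
Definition ffi : V -> C := fun=> 'i.
Definition ffcj (f : V -> C) : V -> C := fun x => (f x)^*.
Definition ffinv (f : V -> C) : V -> C := fun x => (f x)^-1.

Lemma rep_Lb a x f : rep x f -> rep (Lb a x) (ffLb a f). Proof. exact: rep_X. Qed.
Lemma rep_z a b : rep (z3 Lb io r0 r a b) (z3 ffLb ffi ff0 ffr a b).
Proof.
apply: repM; first by apply: repM; [exact: rep_cst|apply: rep_mk; apply: gevp_pz; exact: gr].
apply: rep_Lb; apply: repM; apply: rep_mk; first by apply: gevp_pz; exact: gr.
exact: (gevp_w0 rhoE gr nz).
Qed.
Lemma rep_minor2 a b : rep (minor2 Lb io r0 r a b) (minor2 ffLb ffi ff0 ffr a b).
Proof. by apply: repD; [|apply: repN]; apply: repM; exact: rep_z. Qed.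
Lemma rep_minor3 a b k : rep (minor3 Lb io r0 r a b k) (minor3 ffLb ffi ff0 ffr a b k).
Proof.
have H x y z u v w f g h f' g' h' : rep x f -> rep y g -> rep z h -> rep u f' -> rep v g' -> rep w h' ->
  rep (x * (y * z - u * v)) (f * (g * h - f' * g')) by move=> *; apply: repM => //; apply: repD; [|apply: repN]; exact: repM.
apply: repD; last by apply: repN; apply: H; try exact: rep_z; exact: (rep_z a a).
apply: repD; first by apply: repM; [exact: rep_minor2|exact: rep_z].
by apply: repN; apply: H; try exact: rep_z; exact: (rep_z a a).
Qed.

Lemma bounded_mono m n : (m <= n)%N -> bounded_at m -> bounded_at n.
Proof. by move=> mn [Gr [Gc [s H1 H2]]]; exists Gr, Gc; split=> //; exact: leq_trans s mn. Qed.

Definition levi_inverse := exists zi : 'I_3 -> 'I_3 -> A,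
  (forall a c, \sum_b z3 Lb io r0 r a b * zi b c = (a == c)%:R) /\
  (forall a c, \sum_b zi a b * z3 Lb io r0 r b c = (a == c)%:R).
Definition annihilated := exists n : 'I_3 -> A, [/\ exists b, ev (n b) != 0,
  forall b, \sum_c n c * Lb b (r c) = 0 & forall b b', \sum_c n c * Lb b (Lb b' (r c)) = 0].

Lemma at_full : minor3 ffLb ffi ff0 ffr ord0 o1 o2 q != 0 -> levi_inverse /\ bounded_at 24.
Proof.
move=> n0; have [_ e] := rep_inv (rep_minor3 ord0 o1 o2) n0.
have [zi [ziE ziE']] := inverse3 e.
split; first by exists zi.
exact: (bounded_full_rank j0 (lift j0) (at_der _) (fun a => at_der _) (fun a => at_der _) (fun b f => at_comm _ _ f)
  (fun a b f => at_comm _ _ f) at_io2 (fun b => at_cst _ _) at_r0w0 (@gconjD R rr q) (@gconjM R rr q) (@gconjK R rr q)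
  (fun c => at_cst _ _) (fun a c => at_cst _ _) (fun a c => at_cst _ _) at_cjLb at_cjT at_qE at_evD at_evM at_evC ziE ziE').
Qed.

Section Two.
Variables (a b k : 'I_3).
Local Notation df := (ffinv (minor2 ffLb ffi ff0 ffr a b)).
Local Notation di := (mk df).
Hypothesis n2 : minor2 ffLb ffi ff0 ffr a b q != 0.
Lemma rep_di : rep di df. Proof. exact: (proj1 (rep_inv (rep_minor2 a b) n2)). Qed.
Lemma rep_c2 i : rep (c2 Lb io r0 r a b k di i) (c2 ffLb ffi ff0 ffr a b k df i).
Proof.
have H x y z u f g h f' : rep x f -> rep y g -> rep z h -> rep u f' ->
  rep (- di * (x * y - z * u)) (- df * (f * g - h * f')).
  move=> *; apply: repM; first by apply: repN; exact: rep_di.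
  by apply: repD; [|apply: repN]; exact: repM.
by rewrite /c2; case: ifP => _; apply: H; exact: rep_z.
Qed.
Lemma rep_Sc2 m i : rep (Sc2 Lb io r0 r a b k di m i) (Sc2 ffLb ffi ff0 ffr a b k df m i).
Proof. by apply: rep_Lb; exact: rep_c2. Qed.
Lemma rep_S2 m i : rep (S2 Lb io r0 r a b k di m i) (S2 ffLb ffi ff0 ffr a b k df m i).
Proof. by apply: rep_sum => l; apply: repM; [exact: rep_Sc2|exact: rep_z]. Qed.
Lemma rep_detSc : rep (detSc Lb io r0 r a b k di) (detSc ffLb ffi ff0 ffr a b k df).
Proof. by apply: repD; [|apply: repN]; apply: repM; exact: rep_Sc2. Qed.
Lemma rep_q2 o : rep (q2 Lb cj io r0 r a b k di o) (q2 ffLb ffcj ffi ff0 ffr a b k df o).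
Proof. by apply: rep_sum => l; apply: repM; [apply: rep_cj; exact: rep_S2|exact: rep_Sc2]. Qed.

Definition list2 : seq (V -> C) := [:: S2 ffLb ffi ff0 ffr a b k df ord0 ord0; S2 ffLb ffi ff0 ffr a b k df ord0 ord_max;
  S2 ffLb ffi ff0 ffr a b k df ord_max ord_max; detSc ffLb ffi ff0 ffr a b k df;
  q2 ffLb ffcj ffi ff0 ffr a b k df ord0; q2 ffLb ffcj ffi ff0 ffr a b k df ord_max].
Lemma list2_gevp f : List.In f list2 -> gevp q f.
Proof.
case=> [<-|]; first exact: (proj1 (rep_S2 _ _)).
case=> [<-|]; first exact: (proj1 (rep_S2 _ _)).
case=> [<-|]; first exact: (proj1 (rep_S2 _ _)).
case=> [<-|]; first exact: (proj1 rep_detSc).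
case=> [<-|]; first exact: (proj1 (rep_q2 _)).
by case=> [<-|//]; exact: (proj1 (rep_q2 _)).
Qed.

Lemma at_two : (forall F : 'I_3 -> A, \sum_c F c = F a + F b + F k) -> (forall c : 'I_3, [\/ c = a, c = b | c = k]) ->
  a != k -> b != k -> geqg rr q (minor3 ffLb ffi ff0 ffr a b k) (fun=> 0) ->
  (forall f, List.In f list2 -> decf f) -> bounded_at 17.
Proof.
move=> cov cases3 ak bk m30 Hd.
have diE := proj2 (rep_inv (rep_minor2 a b) n2).
have m3 := rep_zero (rep_minor3 a b k) m30.
have d1 := rep_dec (rep_S2 ord0 ord0) (Hd _ (or_introl erefl)).
have d2 := rep_dec (rep_S2 ord0 ord_max) (Hd _ (or_intror (or_introl erefl))).
have d3 := rep_dec (rep_S2 ord_max ord_max) (Hd _ (or_intror (or_intror (or_introl erefl)))).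
have d4 := rep_dec rep_detSc (Hd _ (or_intror (or_intror (or_intror (or_introl erefl))))).
have d5 : forall o, dec ev (q2 Lb cj io r0 r a b k di o).
  move=> o; case: (case2 o) => ->.
    exact: (rep_dec (rep_q2 ord0) (Hd _ (or_intror (or_intror (or_intror (or_intror (or_introl erefl))))))).
  exact: (rep_dec (rep_q2 ord_max) (Hd _ (or_intror (or_intror (or_intror (or_intror (or_intror (or_introl erefl)))))))).
exact: (bounded_rank_two j0 (lift j0) (at_der _) (fun a => at_der _) (fun a => at_der _) (fun b f => at_comm _ _ f)
  (fun a b f => at_comm _ _ f) (fun a b f => at_comm _ _ f) at_io2 (fun b => at_cst _ _) at_r0w0 (@gconjD R rr q) (@gconjM R rr q)
  (@gconjK R rr q) (fun c => at_cst _ _) (fun a c => at_cst _ _) (fun a c => at_cst _ _) at_cjLb at_cjT at_X0f0 at_qE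
  at_evD at_evM at_evC at_ev1 at_unit at_nondeg cov cases3 ak bk diE m3 d1 d2 d3 d4 d5).
Qed.
End Two.

Section One.
Variables (a k k' : 'I_3).
Local Notation df := (ffinv (z3 ffLb ffi ff0 ffr a a)).
Local Notation zi := (mk df).
Hypothesis n1 : z3 ffLb ffi ff0 ffr a a q != 0.
Lemma rep_zi : rep zi df. Proof. exact: (proj1 (rep_inv (rep_z a a) n1)). Qed.
Lemma rep_s1 e : rep (s1 Lb io r0 r a zi e) (s1 ffLb ffi ff0 ffr a df e).
Proof. by apply: rep_Lb; apply: repM; [apply: repN; exact: rep_zi|exact: rep_z]. Qed.
Lemma rep_s1' : rep (s1' Lb io r0 r a k k' zi) (s1' ffLb ffi ff0 ffr a k k' df).
Proof.
apply: repD; first by apply: repM; [apply: rep_Lb; exact: rep_s1|exact: rep_s1].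
by apply: repN; apply: repM; [exact: rep_s1|apply: rep_Lb; exact: rep_s1].
Qed.
Definition list1 : seq (V -> C) := [:: s1 ffLb ffi ff0 ffr a df k; s1' ffLb ffi ff0 ffr a k k' df].
Lemma list1_gevp f : List.In f list1 -> gevp q f.
Proof.
case=> [<-|]; first exact: (proj1 (rep_s1 _)).
by case=> [<-|//]; exact: (proj1 rep_s1').
Qed.

Lemma at_one : (forall F : 'I_3 -> A, \sum_c F c = F a + F k + F k') -> (forall c : 'I_3, [\/ c = a, c = k | c = k']) ->
  a != k -> a != k' -> k != k' -> geqg rr q (minor2 ffLb ffi ff0 ffr a k) (fun=> 0) ->
  geqg rr q (minor2 ffLb ffi ff0 ffr a k') (fun=> 0) -> geqg rr q (minor3 ffLb ffi ff0 ffr a k k') (fun=> 0) ->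
  (forall f, List.In f list1 -> decf f) -> annihilated /\ bounded_at 20.
Proof.
move=> cov cases3 ak ak' kk' m1 m2 m30 Hd.
have ziE := proj2 (rep_inv (rep_z a a) n1).
have e1 := rep_zero (rep_minor2 a k) m1.
have e2 := rep_zero (rep_minor2 a k') m2.
have e3 := rep_zero (rep_minor3 a k k') m30.
have d1 := rep_dec (rep_s1 k) (Hd _ (or_introl erefl)).
have d2 := rep_dec rep_s1' (Hd _ (or_intror (or_introl erefl))).
split.
  exact: (rank_one_annihilator (fun a => at_der _) (fun b f => at_comm _ _ f)
  (fun a b f => at_comm _ _ f) (fun a b f => at_comm _ _ f) at_io2 (fun b => at_cst _ _) at_r0w0 (@gconjD R rr q) (@gconjM R rr q)
  (@gconjK R rr q) at_cjLb at_cjT at_X0f0 at_ev1 at_unit at_nondeg cov cases3 ak ak' kk' ziE at_cjx e1 e2 e3 d1).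
exact: (bounded_rank_one j0 (lift j0) (at_der _) (fun a => at_der _) (fun a => at_der _) (fun b f => at_comm _ _ f)
  (fun a b f => at_comm _ _ f) (fun a b f => at_comm _ _ f) at_io2 (fun b => at_cst _ _) at_r0w0 (@gconjD R rr q) (@gconjM R rr q)
  (@gconjK R rr q) (fun c => at_cst _ _) (fun a c => at_cst _ _) (fun a c => at_cst _ _) at_cjLb at_cjT at_X0f0 at_Lbf0 at_qE
  at_evD at_evM at_evC at_ev1 at_unit at_nondeg cov cases3 ak ak' kk' ziE at_cjx e1 e2 e3 d1 d2).
Qed.
End One.

(** With zero diagonal and zero minors [|z_ab|^2 = 0], so the Levi matrix vanishes and constant
    coefficients give a forbidden field. *)
Lemma at_levi_nonzero : (forall a, geqg rr q (z3 ffLb ffi ff0 ffr a a) (fun=> 0)) ->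
  (forall a b, a != b -> geqg rr q (minor2 ffLb ffi ff0 ffr a b) (fun=> 0)) -> False.
Proof.
move=> h1 h2.
have e1 a := rep_zero (rep_z a a) (h1 a).
have z0 a b : z3 Lb io r0 r a b = 0.
  have [->|ab] := eqVneq a b; first exact: e1.
  have := rep_zero (rep_minor2 a b) (h2 a b ab); rewrite /minor2 e1 mul0r sub0r => e.
  apply: at_cjx; have -> : cj (z3 Lb io r0 r a b) = - z3 Lb io r0 r b a; last by rewrite mulrN.
  exact: (cjz3 (fun a => at_der _) (fun b f => at_comm _ _ f) (fun a b f => at_comm _ _ f) at_io2 at_r0w0
    (@gconjD R rr q) (@gconjM R rr q) (@gconjK R rr q) at_cjLb at_cjT at_X0f0).
apply: (at_nondeg (v := fun=> 1)).
- by move=> a b; exact: (der1 (at_der _)).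
- by move=> b; rewrite big1 // => a _; rewrite z0 mulr0.
- by exists ord0; rewrite at_ev1 oner_neq0.
Qed.

End At.
End Point.

(** * Moving to a generic point *)

Section Generic.
Variables (R : realType) (G : set 'rV[R]_8) (U0 : set 'rV[R]_8) (rr : 'rV[R]_8 -> R).
Local Notation V := 'rV[R]_8.
Local Notation C := R[i].
Hypothesis ld : local_defining G U0 rr.
Hypothesis hnd : holomorphically_nondegenerate G.
Variable rho : V -> C.
Hypothesis rhoE : forall x, rho x = (rr x)%:C.
Variable j0 : 'I_4.
Local Notation m2 := (minor2 (ffLb rho j0) (ffi (R:=R)) (ff0 rho j0) (ffr rho j0)).
Local Notation m3 := (minor3 (ffLb rho j0) (ffi (R:=R)) (ff0 rho j0) (ffr rho j0)).
Local Notation zf := (z3 (ffLb rho j0) (ffi (R:=R)) (ff0 rho j0) (ffr rho j0)).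

Lemma near_list (fs : seq (V -> C)) p : (forall f, List.In f fs -> gevp p f) ->
  \forall x \near p, forall f, List.In f fs -> gevp x f.
Proof.
elim: fs => [|f fs IH] H; first by apply: filterS (filterT : nbhs p setT) => x _ f.
have h1 := gevp_nearby (H f (or_introl erefl)).
have h2 := IH (fun g Hg => H g (or_intror Hg)).
by apply: filterS2 h1 h2 => x g1 g2 g /= [<-|/g2].
Qed.

(** Induction on the list: either the base point can be moved to where the next function is nonzero,
    or that function vanishes on the hypersurface near [p]. Both alternatives are open, hence are
    added to [P] and survive the later moves. *)
Lemma generic_list (fs : seq (V -> C)) p (P : V -> Prop) : (\forall x \near p, P x) -> U0 p -> G p ->
  (forall f, List.In f fs -> gevp p f) ->
  exists q, [/\ P q, U0 q, G q & forall f, List.In f fs -> decf rr q f].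
Proof.
elim: fs p P => [|f fs IH] p P nP Up Gp gfs.
  by exists p; split=> //; exact: nbhs_singleton nP.
have [[q1 [[nq1 U1 G1] [g1 n1]]]|H] := pselect (exists q1, [/\ (\forall x \near q1, P x), U0 q1 & G q1] /\
    ((forall g, List.In g (f :: fs) -> gevp q1 g) /\ f q1 != 0)).
  have nf := gevp_nonzero (g1 f (or_introl erefl)) n1.
  have [q [[Pq fq] Uq Gq dq]] := IH q1 (fun x => P x /\ f x != 0) (near_and nq1 nf) U1 G1 (fun g Hg => g1 g (or_intror Hg)).
  by exists q; split=> // g /= [<-|/dq //]; left.
have hz : geqg rr p f (fun=> 0).
  apply: filterS3 (near_nearby nP) (near_list gfs) (near_and (ld_near ld Up) (at_G ld Up)) => x Px gx [Ux Gx] rx.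
  apply: contrapT => /eqP fx; apply: H; exists x; split; [split=> //; exact/Gx|split=> //].
have [q [[Pq fq] Uq Gq dq]] := IH p (fun x => P x /\ geqg rr x f (fun=> 0)) (near_and nP (near_nearby hz)) Up Gp
  (fun g Hg => gfs g (or_intror Hg)).
by exists q; split=> // g /= [<-|/dq //]; right.
Qed.

Definition good q := [/\ U0 q, G q & pz (inr j0 : cdir) rho q != 0].

(** [levi_inverse] and [annihilated] are kept beside the bounds: they rule out the first and the
    last alternative under a nondegeneracy assumption. *)
Definition outcome q := [\/ levi_inverse rr rho j0 q /\ bounded_at rr rho j0 q 24, bounded_at rr rho j0 q 17 |
  annihilated rr rho j0 q /\ bounded_at rr rho j0 q 20].

Lemma good_near q : good q -> \forall x \near q, U0 x /\ pz (inr j0 : cdir) rho x != 0.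
Proof.
by move=> [Uq Gq nz]; apply: near_and; [exact: ld_near ld Uq|exact: (gevp_nonzero (gevp_pz _ (at_gevp ld rhoE Uq)) nz)].
Qed.

Lemma outcome_two q (P : V -> Prop) a b k : good q -> (\forall x \near q, P x) -> m2 a b q != 0 ->
  geqg rr q (m3 a b k) (fun=> 0) -> (forall x (F : 'I_3 -> germ rr x), \sum_c F c = F a + F b + F k) ->
  (forall c : 'I_3, [\/ c = a, c = b | c = k]) -> a != k -> b != k ->
  exists x, [/\ P x, good x & outcome x].
Proof.
move=> gq nP n2 z3' cov cases3 ak bk; have [Uq Gq nz] := gq.
have gm := proj1 (rep_minor2 ld rhoE Uq nz a b).
have N := near_and (near_and nP (good_near gq)) (near_and (gevp_nonzero gm n2) (near_nearby z3')).
have [x [[[Px [_ nx]] [n2x z3x]] Ux Gx dx]] := generic_list N Uq Gq (fun f Hf => @list2_gevp _ _ _ _ ld _ rhoE _ _ Uq nz a b k n2 f Hf).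
exists x; split; [exact: Px|by split|apply: Or32].
exact: (at_two ld hnd rhoE Ux Gx nx n2x (cov x) cases3 ak bk z3x dx).
Qed.

Lemma outcome_one q (P : V -> Prop) a k k' : good q -> (\forall x \near q, P x) -> zf a a q != 0 ->
  geqg rr q (m2 a k) (fun=> 0) -> geqg rr q (m2 a k') (fun=> 0) -> geqg rr q (m3 a k k') (fun=> 0) ->
  (forall x (F : 'I_3 -> germ rr x), \sum_c F c = F a + F k + F k') ->
  (forall c : 'I_3, [\/ c = a, c = k | c = k']) -> a != k -> a != k' -> k != k' ->
  exists x, [/\ P x, good x & outcome x].
Proof.
move=> gq nP n2 h1 h2 h3 cov cases3 ak ak' kk'; have [Uq Gq nz] := gq.
have gm := proj1 (rep_z ld rhoE Uq nz a a).
have N := near_and (near_and nP (good_near gq)) (near_and (near_and (gevp_nonzero gm n2) (near_nearby h1))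
  (near_and (near_nearby h2) (near_nearby h3))).
have [x [[[Px [_ nx]] [[n2x h1x] [h2x h3x]]] Ux Gx dx]] := generic_list N Uq Gq (fun f Hf => @list1_gevp _ _ _ _ ld _ rhoE _ _ Uq nz a k k' n2 f Hf).
exists x; split; [exact: Px|by split|apply: Or33].
exact: (at_one ld hnd rhoE Ux Gx nx n2x (cov x) cases3 ak ak' kk' h1x h2x h3x dx).
Qed.

(** A first move fixes the Levi rank, for which principal minors suffice because the matrix is
    skew-Hermitian. The tensors of the kernel have the chosen minor in their denominators, so their
    dichotomies require a second move, made in [outcome_two] and [outcome_one]. *)
Theorem classify p (P : V -> Prop) : good p -> (\forall x \near p, P x) -> exists x, [/\ P x, good x & outcome x].
Proof.
move=> gp nP; have [Up Gp nzp] := gp.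
pose fs := [:: m3 ord0 o1 o2; m2 ord0 o1; m2 ord0 o2; m2 o1 o2; zf ord0 ord0; zf o1 o1; zf o2 o2].
have gfs f : List.In f fs -> gevp p f.
  case=> [<-|]; first exact: (proj1 (rep_minor3 ld rhoE Up nzp _ _ _)).
  case=> [<-|]; first exact: (proj1 (rep_minor2 ld rhoE Up nzp _ _)).
  case=> [<-|]; first exact: (proj1 (rep_minor2 ld rhoE Up nzp _ _)).
  case=> [<-|]; first exact: (proj1 (rep_minor2 ld rhoE Up nzp _ _)).
  case=> [<-|]; first exact: (proj1 (rep_z ld rhoE Up nzp _ _)).
  case=> [<-|]; first exact: (proj1 (rep_z ld rhoE Up nzp _ _)).
  by case=> [<-|//]; exact: (proj1 (rep_z ld rhoE Up nzp _ _)).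
have [q [[nPq nzq] Uq Gq dq]] := generic_list (near_and (near_nearby nP) (filterS (fun x => proj2 (B := _)) (good_near gp))) Up Gp gfs.
have gq : good q by split.
have d3 := dq _ (or_introl erefl).
have d01 := dq _ (or_intror (or_introl erefl)).
have d02 := dq _ (or_intror (or_intror (or_introl erefl))).
have d12 := dq _ (or_intror (or_intror (or_intror (or_introl erefl)))).
have d0 := dq _ (or_intror (or_intror (or_intror (or_intror (or_introl erefl))))).
have d1 := dq _ (or_intror (or_intror (or_intror (or_intror (or_intror (or_introl erefl)))))).
have d2 := dq _ (or_intror (or_intror (or_intror (or_intror (or_intror (or_intror (or_introl erefl))))))).
have e201 : m3 o2 ord0 o1 = m3 ord0 o1 o2 by exact: minor3A.
have e021 : m3 ord0 o2 o1 = m3 ord0 o1 o2 by exact: (etrans (minor3C _ _ _ _ _ _ _) e201).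
have e120 : m3 o1 o2 ord0 = m3 ord0 o1 o2 by symmetry; exact: minor3A.
have e102 : m3 o1 ord0 o2 = m3 ord0 o1 o2 by exact: minor3C.
have cas1 c := case_o3 c.
have cov1 x (F : 'I_3 -> germ rr x) : \sum_c F c = F ord0 + F o2 + F o1 by rewrite sum_o3 addrAC.
have cov2 x (F : 'I_3 -> germ rr x) : \sum_c F c = F o1 + F o2 + F ord0 by rewrite sum_o3 -addrA addrC.
have cov3 x (F : 'I_3 -> germ rr x) : \sum_c F c = F o1 + F ord0 + F o2 by rewrite sum_o3 (addrC (F ord0)).
have cov4 x (F : 'I_3 -> germ rr x) : \sum_c F c = F o2 + F ord0 + F o1 by rewrite sum_o3 addrC addrA.
have ca1 c : [\/ c = ord0, c = o2 | c = o1] by case: (cas1 c) => ->; [exact: Or31|exact: Or33|exact: Or32].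
have ca2 c : [\/ c = o1, c = o2 | c = ord0] by case: (cas1 c) => ->; [exact: Or33|exact: Or31|exact: Or32].
have ca3 c : [\/ c = o1, c = ord0 | c = o2] by case: (cas1 c) => ->; [exact: Or32|exact: Or31|exact: Or33].
have ca4 c : [\/ c = o2, c = ord0 | c = o1] by case: (cas1 c) => ->; [exact: Or32|exact: Or33|exact: Or31].
have tr f g : f = g -> geqg rr q g (fun=> 0) -> geqg rr q f (fun=> 0) by move=> ->.
case: d3 => [n3|h3].
  exists q; split; [exact: (nbhs_singleton nPq)|exact: gq|].
  by apply: Or31; exact: (at_full ld rhoE Uq Gq nzq n3).
case: d01 => [n|h01].
  exact: (outcome_two gq nPq n h3 (fun x F => sum_o3 F) case_o3 isT isT).
case: d02 => [n|h02]; first exact: (outcome_two gq nPq n (tr _ _ e021 h3) cov1 ca1 isT isT).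
case: d12 => [n|h12]; first exact: (outcome_two gq nPq n (tr _ _ e120 h3) cov2 ca2 isT isT).
case: d0 => [n|h0].
  exact: (outcome_one gq nPq n h01 h02 h3 (fun x F => sum_o3 F) case_o3 isT isT isT).
have h10 := tr _ _ (minor2C _ _ _ _ o1 ord0) h01.
have h20 := tr _ _ (minor2C _ _ _ _ o2 ord0) h02.
have h21 := tr _ _ (minor2C _ _ _ _ o2 o1) h12.
case: d1 => [n|h1]; first exact: (outcome_one gq nPq n h10 h12 (tr _ _ e102 h3) cov3 ca3 isT isT isT).
case: d2 => [n|h2]; first exact: (outcome_one gq nPq n h20 h21 (tr _ _ e201 h3) cov4 ca4 isT isT isT).
exfalso; apply: (at_levi_nonzero ld hnd rhoE Uq Gq nzq).
  by move=> a; case: (cas1 a) => ->; [exact: h0|exact: h1|exact: h2].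
move=> a b; case: (cas1 a) => ->; case: (cas1 b) => -> ab.
- exact: (False_ind _ (negP ab (eqxx _))).
- exact: h01.
- exact: h02.
- exact: h10.
- exact: (False_ind _ (negP ab (eqxx _))).
- exact: h12.
- exact: h20.
- exact: h21.
- exact: (False_ind _ (negP ab (eqxx _))).
Qed.

End Generic.

(** * Annihilation of words in an arbitrary CR basis *)

Section Words.
Variables (A : comPzRingType) (n : nat) (J : finType) (Lb : 'I_n -> A -> A) (nu Rh : J -> A).
Hypothesis dLb : forall b, derivation (Lb b).
Hypothesis p0 : \sum_j nu j * Rh j = 0.
Hypothesis p1 : forall b, \sum_j nu j * Lb b (Rh j) = 0.
Hypothesis p2 : forall b b', \sum_j nu j * Lb b (Lb b' (Rh j)) = 0.
Variables (m : nat) (al : 'I_m -> 'I_n -> A) (R0 : A).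
Definition Dal l x := \sum_b al l b * Lb b x.
Lemma dDal l : derivation (Dal l).
Proof.
split=> x y; rewrite /Dal.
  by rewrite -big_split; apply: eq_bigr => b _ /=; rewrite (proj1 (dLb b)) mulrDr.
by rewrite mulr_suml mulr_sumr -big_split; apply: eq_bigr => b _ /=; rewrite (proj2 (dLb b)); ring.
Qed.
Lemma pairD l : \sum_j nu j * Dal l (Rh j) = 0.
Proof.
rewrite /Dal; under eq_bigr do rewrite mulr_sumr; rewrite exchange_big big1 // => b _ /=.
transitivity (al l b * \sum_j nu j * Lb b (Rh j)); last by rewrite p1 mulr0.
by rewrite mulr_sumr; apply: eq_bigr => j _; ring.
Qed.
Lemma pairDD l k : \sum_j nu j * Dal l (Dal k (Rh j)) = 0.
Proof.
rewrite {1}/Dal; under eq_bigr do rewrite mulr_sumr; rewrite exchange_big big1 // => b _ /=.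
transitivity (al l b * \sum_c (Lb b (al k c) * (\sum_j nu j * Lb c (Rh j)) + al k c * \sum_j nu j * Lb b (Lb c (Rh j)))).
  rewrite mulr_sumr.
  under [RHS]eq_bigr do rewrite 2!mulr_sumr -big_split mulr_sumr.
  rewrite [RHS]exchange_big; apply: eq_bigr => j _ /=; rewrite /Dal (der_sum _ (dLb b)) 2!mulr_sumr; apply: eq_bigr => c _.
  by rewrite (proj2 (dLb b)); ring.
by rewrite big1 ?mulr0 // => c _; rewrite p1 p2 !mulr0 addr0.
Qed.
(** By the Leibniz rule the change of basis [al] and the factor [R0] add only terms of lower order,
    already annihilated. So the condition depends neither on the basis nor on the defining
    function. *)
Lemma pair_words w : (size w <= 2)%N -> \sum_j nu j * foldr Dal (R0 * Rh j) w = 0.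
Proof.
case: w => [|l [|k [|//]]] _ /=.
- transitivity (R0 * \sum_j nu j * Rh j); last by rewrite p0 mulr0.
  by rewrite mulr_sumr; apply: eq_bigr => j _; ring.
- transitivity (Dal l R0 * (\sum_j nu j * Rh j) + R0 * \sum_j nu j * Dal l (Rh j)); last by rewrite p0 pairD; ring.
  by rewrite !mulr_sumr -big_split; apply: eq_bigr => j _ /=; rewrite (proj2 (dDal l)); ring.
- transitivity (Dal l (Dal k R0) * (\sum_j nu j * Rh j) + Dal k R0 * (\sum_j nu j * Dal l (Rh j))
    + Dal l R0 * (\sum_j nu j * Dal k (Rh j)) + R0 * \sum_j nu j * Dal l (Dal k (Rh j))).
    rewrite !mulr_sumr -!big_split; apply: eq_bigr => j _ /=.
    by rewrite (proj2 (dDal k)) (proj1 (dDal l)) !(proj2 (dDal l)); ring.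
  by rewrite p0 !pairD pairDD; ring.
Qed.
End Words.

(** * Levels of nondegeneracy *)

Lemma foldr_nseq (X Y : Type) (f : X -> Y -> Y) g n l : foldr f g (nseq n l) = iter n (f l) g.
Proof. by elim: n => //= n ->. Qed.
Lemma frac_aux (F : fieldType) (la a b : F) : b != 0 -> la * a = la * b * (a / b).
Proof. by move=> b0; rewrite -mulrA; congr (_ * _); rewrite mulrCA mulfV ?mulr1. Qed.

Section Levels.
Variables (R : realType) (G : set 'rV[R]_8) (U0 : set 'rV[R]_8) (rr : 'rV[R]_8 -> R).
Local Notation V := 'rV[R]_8.
Local Notation C := R[i].
Hypothesis ld : local_defining G U0 rr.
Variable rho : V -> C.
Hypothesis rhoE : forall x, rho x = (rr x)%:C.
Variables (j0 : 'I_4) (q : V).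
Hypotheses (Uq : U0 q) (Gq : G q) (nz : pz (inr j0 : cdir) rho q != 0).
Variables (U : set V) (rho2 : V -> R) (Ls : 'I_3 -> 'I_4 -> V -> C).
Hypotheses (ld2 : local_defining G U rho2) (Uq2 : U q) (cb : cr_basis G U rho2 Ls).
Local Notation A := (germ rr q).
Local Notation mk := (mk rr q).
Local Notation Lb := (fun a : 'I_3 => gX rho j0 (inr (lift j0 a)) : A -> A).
Local Notation cst := (gcst rr q).
Local Notation io := (cst 'i).
Local Notation r0 := (gr_ rr q rho (inl j0)).
Local Notation w0 := (w0 rr q rho j0).
Local Notation r := (fun a : 'I_3 => gr_ rr q rho (inl (lift j0 a)) * w0).
Local Notation ev := (@gev0 R rr q).
Local Notation P2 := (fun y => (rho2 y)%:C).
Local Notation gr := (at_gevp ld rhoE Uq).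
Local Notation rq := (at_zero ld Uq Gq).

Definition al (l b : 'I_3) : A := mk (Ls l (lift j0 b)).
(** The gradient normalized by its component [j0]; on the hypersurface it is the same for all
    defining functions. *)
Definition Rhat (j : 'I_4) : A := if unlift j0 j is Some a then r a else 1.
Local Notation D := (Dal Lb al).
Local Notation R2 := (mk (pz (inl j0) P2)).

Lemma gevp_rho2 : gevp q P2. Proof. exact: ld_gevp ld2 Uq2. Qed.
Lemma gevp_Ls l j : gevp q (Ls l j).
Proof.
have [H _] := cb; have [hR hI] := H l j.
have g1 := analytic_gevp (hR q Uq2); have g2 := analytic_gevp (hI q Uq2).
apply: gevp_ext (gevpD g1 (gevpM (gevp_cst q 'i) g2)) => x.
by rewrite -complexE.
Qed.

Lemma prop_near : \forall x \near q, G x -> exists2 la : R, la != 0 & forall k, pz k P2 x = la%:C * pz k rho x.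
Proof.
apply: filterS2 (ld_near ld Uq) (ld_near ld2 Uq2) => x U0x Ux Gx.
exact: (pz_proportional ld rhoE ld2 Ux U0x Gx).
Qed.

Lemma gr2E j : mk (pz (inl j) P2) = R2 * Rhat j.
Proof.
rewrite /Rhat; case: (unliftP j0 j) => [a ->|->]; last by rewrite mulr1.
have gw := gevp_w0 rhoE gr nz.
have ga := gevp_pz (inl (lift j0 a)) gr.
have g2 k := gevp_pz k gevp_rho2.
have e : R2 * r a = mk (fun z => pz (inl j0) P2 z * (pz (inl (lift j0 a)) rho z * (pz (inl j0) rho z)^-1)).
  exact: esym (etrans (mkM rr (g2 (inl j0)) (gevpM ga gw)) (congr1 (fun t => R2 * t) (mkM rr ga gw))).
rewrite e; apply: mk_eq; [exact: g2|by apply: gevpM; [exact: g2|exact: gevpM]|].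
have n0 := gevp_nonzero (gevp_pz (inl j0) gr) (nzbar rhoE gr nz).
apply: filterS3 prop_near (at_G ld Uq) n0 => x H Gx nx /Gx /H[la _ E].
by rewrite !E; exact: frac_aux.
Qed.

Lemma R2_neq0 : ev R2 != 0.
Proof.
rewrite (gev0E rq (gevp_pz _ gevp_rho2)).
have [la la0 ->] := nbhs_singleton prop_near Gq.
rewrite mulf_neq0 ?(nzbar rhoE gr nz) //.
by apply: contra la0 => /eqP/(congr1 (@complex.Re R)) /= ->.
Qed.

Lemma Ls_tangent : \forall x \near q, G x -> forall l, \sum_j Ls l j x * pz (inr j) rho x = 0.
Proof.
have [_ [H _]] := cb.
apply: filterS2 prop_near (ld_near ld2 Uq2) => x Hx Ux Gx l.
have [la la0 E] := Hx Gx; have := H x Ux Gx l.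
have -> : \sum_j Ls l j x * dzbar j P2 x = la%:C * \sum_j Ls l j x * pz (inr j) rho x.
  by rewrite mulr_sumr; apply: eq_bigr => j _; rewrite [RHS]mulrCA; congr (_ * _); exact: (E (inr j)).
move/eqP; rewrite mulf_eq0 => /orP[/eqP/(congr1 (@complex.Re R)) /= e|/eqP //].
by rewrite e eqxx in la0.
Qed.

(** Tangency determines the component of [Ls l] along [j0], so on the hypersurface the field is the
    combination of the [Lb] with its other three components. *)
Lemma crE l f : gevp q f -> gevp q (cr_apply (Ls l) f) /\ mk (cr_apply (Ls l) f) = D l (mk f).
Proof.
move=> gf; have gp j : gevp q (fun x => Ls l j x * dzbar j f x).
  by apply: gevpM; [exact: gevp_Ls|exact: (gevp_pz (inr j) gf)].
have g1 : gevp q (cr_apply (Ls l) f) by exact: gevp_sum.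
split=> //.
have rp : rep (D l (mk f)) (\sum_b Ls l (lift j0 b) * tg rho j0 (inr (lift j0 b)) f).
  apply: rep_sum => b; apply: repM; first exact: (rep_mk rr (gevp_Ls l (lift j0 b))).
  exact: (rep_X ld rhoE Uq nz (inr (lift j0 b)) (rep_mk rr gf)).
have [g2 ->] := rp; apply: mk_eq => //.
apply: filterS3 Ls_tangent (at_G ld Uq) (gevp_nonzero (gevp_pz (inr j0) gr) nz) => x Hx Gx nx /Gx /Hx /(_ l) T.
rewrite fsumE /cr_apply (bigD1_ord j0) //=.
have T' : \sum_b Ls l (lift j0 b) x * pz (inr (lift j0 b)) rho x = - (Ls l j0 x * pz (inr j0) rho x).
  have := T; rewrite (bigD1_ord j0) //= => h.
  by apply/eqP; rewrite -addr_eq0 addrC; apply/eqP; exact: h.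
transitivity (\sum_b Ls l (lift j0 b) x * pz (inr (lift j0 b)) f x
  - (\sum_b Ls l (lift j0 b) x * pz (inr (lift j0 b)) rho x) * ((pz (inr j0) rho x)^-1 * pz (inr j0) f x)).
  rewrite T' mulNr opprK addrC; congr (_ + _).
  by rewrite -mulrA mulVKf.
rewrite mulr_suml -sumrB; apply: eq_bigr => b _.
transitivity (Ls l (lift j0 b) x * tg rho j0 (inr (lift j0 b)) f x); last by [].
by rewrite /tg mulrBr !mulrA.
Qed.

Lemma cr_word w f : gevp q f -> gevp q (foldr (fun l => cr_apply (Ls l)) f w) /\
  mk (foldr (fun l => cr_apply (Ls l)) f w) = foldr D (mk f) w.
Proof.
move=> gf; elim: w => [//|l w [g e]] /=; have [g' e'] := crE l g.
by split; [exact: g'|exact: (etrans e' (congr1 (D l) e))].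
Qed.

Definition word (alpha : 'I_3 -> nat) : seq 'I_3 := nseq (alpha ord0) ord0 ++ nseq (alpha (lift ord0 ord0)) (lift ord0 ord0) ++
  nseq (alpha ord_max) ord_max.

Lemma cr_pow_word alpha f : cr_pow Ls alpha f = foldr (fun l => cr_apply (Ls l)) f (word alpha).
Proof.
by rewrite /word !foldr_cat !foldr_nseq.
Qed.

Lemma cr_vecE alpha j : cr_vec rho2 Ls alpha q 0 j = ev (foldr D (R2 * Rhat j) (word alpha)).
Proof.
rewrite /cr_vec mxE cr_pow_word -gr2E.
have [g e] := cr_word (word alpha) (gevp_pz (inl j) gevp_rho2).
by rewrite -e (gev0E rq g).
Qed.

Lemma size_word alpha : size (word alpha) = (\sum_(l < 3) alpha l)%N.
Proof.
rewrite /word !size_cat !size_nseq !big_ord_recl big_ord0 addn0; congr (_ + (_ + alpha _))%N.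
exact: val_inj.
Qed.

(** Completed at [j0] so as to annihilate [Rhat], the vector [n] becomes a nonzero linear form on
    [C^4] that vanishes on all vectors of order at most two. *)
Lemma not_E_full2 : annihilated rr rho j0 q -> ~ E_full rho2 Ls 2 q.
Proof.
move=> [n [[b nb] n1 n2]] EF.
pose nu (j : 'I_4) : A := if unlift j0 j is Some a then n a else - \sum_a n a * r a.
have sumnu (F : 'I_4 -> A) : \sum_j nu j * F j = - (\sum_a n a * r a) * F j0 + \sum_a n a * F (lift j0 a).
  by rewrite (bigD1_ord j0) //= /nu unlift_none; congr (_ + _); apply: eq_bigr => a _; rewrite liftK.
have Ra a : Rhat (lift j0 a) = r a by rewrite /Rhat liftK.
have R0 : Rhat j0 = 1 by rewrite /Rhat unlift_none.
have dL b' : derivation (Lb b') by exact: (at_der ld rhoE Uq nz).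
have p0 : \sum_j nu j * Rhat j = 0.
  rewrite sumnu R0 mulr1; under [X in _ + X]eq_bigr do rewrite Ra.
  by rewrite addNr.
have p1 b' : \sum_j nu j * Lb b' (Rhat j) = 0.
  rewrite sumnu R0 (der1 (dL b')) mulr0 add0r; under eq_bigr do rewrite Ra.
  exact: n1.
have p2 b1 b2 : \sum_j nu j * Lb b1 (Lb b2 (Rhat j)) = 0.
  rewrite sumnu R0 (der1 (dL b2)) (der0 (dL b1)) mulr0 add0r; under eq_bigr do rewrite Ra.
  exact: n2.
have ev0' : ev 0 = 0 by rewrite -(gcst0 rr q) (gev0_cst rq).
have evs (F : 'I_4 -> A) : ev (\sum_j F j) = \sum_j ev (F j).
  by apply: (big_morph _ (at_evD ld Uq Gq) ev0').
have key alpha : (\sum_(l < 3) alpha l <= 2)%N -> \sum_j ev (nu j) * cr_vec rho2 Ls alpha q 0 j = 0.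
  move=> sa; transitivity (ev (\sum_j nu j * foldr D (R2 * Rhat j) (word alpha))).
    by rewrite evs; apply: eq_bigr => j _; rewrite (at_evM ld Uq Gq) cr_vecE.
  by rewrite (@pair_words _ _ _ Lb nu Rhat dL p0 p1 p2) ?size_word.
have [c Hc] := EF (\row_j (j == lift j0 b)%:R).
have : \sum_j ev (nu j) * (\row_j (j == lift j0 b)%:R : 'rV[C]_4) 0 j = ev (n b).
  rewrite (bigD1 (lift j0 b)) //= mxE eqxx mulr1 big1 ?addr0 => [|j /negbTE jb]; first by rewrite /nu liftK.
  by rewrite mxE jb mulr0.
rewrite Hc; under eq_bigr do rewrite summxE mulr_sumr; rewrite exchange_big big1 /= => [e|a Ha].
  by move: nb; rewrite -e eqxx.
transitivity (c a * \sum_j ev (nu j) * cr_vec rho2 Ls (fun l => a l) q 0 j); last by rewrite key // mulr0.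
by rewrite mulr_sumr; apply: eq_bigr => j _; rewrite mxE mulrCA.
Qed.

(** The basis stays independent after its column [j0] is dropped, because tangency recovers that
    column from the others. *)
Lemma ev_al_inj (y : 'I_3 -> C) : (forall l, \sum_b ev (al l b) * y b = 0) -> forall b, y b = 0.
Proof.
move=> Hy.
pose N : 'M[C]_3 := \matrix_(l, b) Ls l (lift j0 b) q.
have evN l b : ev (al l b) = Ls l (lift j0 b) q by exact: (gev0E rq (gevp_Ls l (lift j0 b))).
have Nfree : row_free N.
  rewrite -kermx_eq0; apply/eqP/matrixP => i l; rewrite [RHS]mxE.
  have [_ [_ H3]] := cb; apply: (H3 q Uq2 Gq (fun l => kermx N i l)).
  have Hb b : \sum_l kermx N i l * Ls l (lift j0 b) q = 0.
    have := congr1 (fun B : 'M[C]_3 => B i b) (mulmx_ker N); rewrite !mxE => e.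
    by rewrite -[RHS]e; apply: eq_bigr => l' _; rewrite !mxE.
  move=> j; case: (unliftP j0 j) => [b ->|->]; first exact: Hb.
  apply/eqP; rewrite -(mulIr_eq0 _ (mulIf nz)); apply/eqP.
  have T := nbhs_singleton Ls_tangent Gq.
  have e : \sum_l kermx N i l * \sum_j Ls l j q * pz (inr j) rho q = 0 by rewrite big1 // => l' _; rewrite T mulr0.
  rewrite -[RHS]e; under [RHS]eq_bigr do rewrite (bigD1_ord j0) //= mulrDr.
  rewrite big_split /= [X in _ = _ + X](_ : _ = 0) ?addr0.
    by rewrite mulr_suml; apply: eq_bigr => l' _; exact: (esym (mulrA _ _ _)).
  under eq_bigr do rewrite mulr_sumr; rewrite exchange_big big1 // => b _ /=.
  under eq_bigr do rewrite mulrA.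
  by rewrite -mulr_suml Hb mul0r.
have Nu : N \in unitmx by rewrite -row_free_unit.
have e : N *m (\col_b y b) = 0.
  apply/matrixP => l i; rewrite !mxE -[RHS](Hy l); apply: eq_bigr => b _; by rewrite !mxE evN.
have := congr1 (mulmx (invmx N)) e; rewrite mulKmx // mulmx0 => e' b.
by have := congr1 (fun B : 'cV[C]_3 => B b 0) e'; rewrite !mxE.
Qed.

(** Orders zero and one already span: a form that vanishes on those four vectors annihilates [Rhat]
    and its [Lb] derivatives, hence the rows of the invertible Levi matrix. *)
Lemma levi_E_full k : (0 < k)%N -> levi_inverse rr rho j0 q -> E_full rho2 Ls k q.
Proof.
move=> k0 [zi [ziE _]] w.
have dL b' : derivation (Lb b') by exact: (at_der ld rhoE Uq nz).
have ev0' : ev 0 = 0 by rewrite -(gcst0 rr q) (gev0_cst rq).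
(* Four multi-indices: zero and the three unit ones. The value [inord 1] is really 1 because
   [0 < k]. *)
pose e (i : 'I_4) : {ffun 'I_3 -> 'I_k.+1} := if unlift ord0 i is Some l then [ffun m => if m == l then inord 1 else ord0] else [ffun=> ord0].
have e0 : word (fun l => e ord0 l) = [::] by rewrite /e unlift_none /word !ffunE.
have inord1 : (inord 1 : 'I_k.+1) = 1%N :> nat by rewrite inordK.
have el l : word (fun m => e (lift ord0 l) m) = [:: l].
  rewrite /e liftK /word !ffunE.
  by case: (case_o3 l) => ->; rewrite /= inord1 /=; congr [:: _]; apply: val_inj.
pose M : 'M[C]_4 := \matrix_(i, j) cr_vec rho2 Ls (fun l => e i l) q 0 j.
have Mfull : row_full M.
  rewrite /row_full -mxrank_tr -/(row_free M^T) -kermx_eq0; apply/eqP/matrixP => i0 j1; rewrite [RHS]mxE.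
  pose v (j : 'I_4) : C := kermx M^T i0 j; rewrite -/(v j1).
  have Hv i : \sum_j v j * cr_vec rho2 Ls (fun l => e i l) q 0 j = 0.
    have := congr1 (fun B : 'M[C]_4 => B i0 i) (mulmx_ker M^T); rewrite mxE [RHS]mxE => h.
    by rewrite -[RHS]h; apply: eq_bigr => j _; congr (_ * _); rewrite [RHS]mxE [RHS]mxE.
  have s0 : \sum_j v j * ev (Rhat j) = 0.
    have cr0 j : cr_vec rho2 Ls (fun l => e ord0 l) q 0 j = ev R2 * ev (Rhat j).
      by rewrite cr_vecE e0; exact: (at_evM ld Uq Gq R2 (Rhat j)).
    have := Hv ord0; under eq_bigr do rewrite cr0 mulrCA.
    by rewrite -mulr_sumr => /eqP; rewrite mulf_eq0 (negbTE R2_neq0) => /eqP.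
  have s1 l : \sum_j v j * ev (D l (Rhat j)) = 0.
    have := Hv (lift ord0 l).
    have -> : \sum_j v j * cr_vec rho2 Ls (fun m => e (lift ord0 l) m) q 0 j
      = ev (D l R2) * (\sum_j v j * ev (Rhat j)) + ev R2 * \sum_j v j * ev (D l (Rhat j)).
      rewrite !mulr_sumr -big_split; apply: eq_bigr => j _ /=.
      have -> : cr_vec rho2 Ls (fun m => e (lift ord0 l) m) q 0 j = ev (D l R2) * ev (Rhat j) + ev R2 * ev (D l (Rhat j)).
        rewrite cr_vecE el; transitivity (ev (D l (R2 * Rhat j))); first by [].
        by rewrite (proj2 (dDal dL al l)) (at_evD ld Uq Gq) !(at_evM ld Uq Gq).
      rewrite mulrDr.
      by congr (_ + _); rewrite mulrCA.
    by rewrite s0 mulr0 add0r => /eqP; rewrite mulf_eq0 (negbTE R2_neq0) => /eqP.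
  have Ra a : Rhat (lift j0 a) = r a by rewrite /Rhat liftK.
  have R0 : Rhat j0 = 1 by rewrite /Rhat unlift_none.
  have y0 : forall b, \sum_a v (lift j0 a) * ev (Lb b (r a)) = 0.
    apply: ev_al_inj => l; have := s1 l; rewrite (bigD1_ord j0) //= R0 (der1 (dDal dL al l)) ev0' mulr0 add0r => h.
    rewrite -[RHS]h; under eq_bigr do rewrite mulr_sumr; rewrite exchange_big; apply: eq_bigr => a _ /=.
    rewrite Ra /Dal (big_morph _ (at_evD ld Uq Gq) ev0') mulr_sumr; apply: eq_bigr => b _.
    by rewrite (at_evM ld Uq Gq) mulrCA.
  have zv b : \sum_a v (lift j0 a) * ev (z3 Lb io r0 r a b) = 0.
    transitivity (ev (io * r0) * \sum_a v (lift j0 a) * ev (Lb b (r a))); last by rewrite y0 mulr0.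
    rewrite mulr_sumr; apply: eq_bigr => a _.
    have h : ev (z3 Lb io r0 r a b) = ev (io * r0) * ev (Lb b (r a)) := at_evM ld Uq Gq _ _.
    by rewrite h; exact: mulrCA.
  have va a : v (lift j0 a) = 0.
    transitivity (\sum_b (\sum_c v (lift j0 c) * ev (z3 Lb io r0 r c b)) * ev (zi b a)); last first.
      by rewrite big1 // => b _; rewrite zv mul0r.
    under eq_bigr do rewrite mulr_suml; rewrite exchange_big /=.
    transitivity (\sum_c v (lift j0 c) * ev ((c == a)%:R : A)).
      rewrite (bigD1 a) //= eqxx (at_ev1 ld Uq Gq) mulr1 big1 ?addr0 // => c /negbTE ->.
      by rewrite ev0' mulr0.
    apply: eq_bigr => c _; rewrite -(ziE c a) (big_morph _ (at_evD ld Uq Gq) ev0') mulr_sumr.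
    by apply: eq_bigr => b _; rewrite (at_evM ld Uq Gq) mulrA.
  case: (unliftP j0 j1) => [a ->|->]; first exact: va.
  have := s0; rewrite (bigD1_ord j0) //= R0 (at_ev1 ld Uq Gq) mulr1 big1 ?addr0 // => a _.
  by rewrite va mul0r.
have [x wE] : exists x : 'rV[C]_4, w = x *m M.
  by exists (w *m pinvmx M); rewrite mulmxKpV // submx_full.
exists (fun a => \sum_i x 0 i * (a == e i)%:R).
have se i : (\sum_(l < 3) nat_of_ord (e i l) <= k)%N.
  rewrite -(size_word (fun l => e i l)); case: (unliftP ord0 i) => [l ->|->]; [by rewrite el|by rewrite e0].
rewrite wE; apply/rowP => j; rewrite !mxE summxE.
under [RHS]eq_bigr do rewrite mxE mulr_suml.
rewrite exchange_big /=; apply: eq_bigr => i _.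
rewrite (bigD1 (e i)) ?se //= eqxx mulr1 big1 ?addr0; first by rewrite !mxE.
by move=> a /andP[_ /negbTE ->]; rewrite mulr0 mul0r.
Qed.

End Levels.

(** * From nearby points back to the given point *)

Section Identity.
Variable R : realType.
Local Notation V := 'rV[R]_8.
Local Notation C := R[i].

Lemma cpdw_near_zero w (f : V -> C) p : (\forall x \near p, f x = 0) -> cpdw w f p = 0.
Proof.
elim: w f => [|k w IH] f nf; first exact: nbhs_singleton nf.
apply: IH; apply: filterS (near_nearby nf) => x zx.
have E : \forall y \near x, (fun=> 0 : C) y = f y by apply: filterS zx => y ->.
by have [_ ->] := cdiff_near E (cdiff_cst 0 x); exact: cpd_cst.
Qed.

Lemma gev_common (I : finType) (f : I -> V -> C) xi : (forall i, gevp xi (f i)) ->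
  exists r s : R, [/\ 0 < r, 0 <= s & forall i, exists2 c : R, 0 <= c & gev xi r c s (f i)].
Proof.
move=> gf.
have : exists r s : R, [/\ 0 < r, 0 <= s & forall i, i \in enum I -> exists2 c : R, 0 <= c & gev xi r c s (f i)].
  elim: (enum I) => [|i l [r [s [r0 s0 H]]]]; first by exists 1, 0.
  have [r1 [c1 [s1 [r10 c10 s10 H1]]]] := gf i.
  exists (Num.min r r1), (s + s1); split; [by rewrite lt_min r0|exact: addr_ge0|].
  move=> i'; rewrite inE => /orP[/eqP ->|/H[c c0 Hc]].
    exists c1 => //; apply: (@gev_mono _ _ _ c1 s1) => //; first by rewrite lerDr.
    by apply: gev_le H1; rewrite ge_min lexx orbT.
  exists c => //; apply: (@gev_mono _ _ _ c s) => //; first by rewrite lerDl.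
  by apply: gev_le Hc; rewrite ge_min lexx.
by move=> [r [s [r0 s0 H]]]; exists r, s; split=> // i; apply: H; rewrite mem_enum.
Qed.

(* The neighbourhood [W] does not depend on the coefficients: the functions have Gevrey bounds with a common rate. *)
Lemma identity_nbhs (I : finType) (f : I -> V -> C) xi : (forall i, gevp xi (f i)) ->
  exists2 W : set V, nbhs xi W & forall p, W p -> forall c : I -> C,
    (\forall x \near p, \sum_i c i * f i x = 0) -> forall x, W x -> \sum_i c i * f i x = 0.
Proof.
move=> /gev_common[r [s [r0 s0 Hg]]].
have /choice[c0 Hc0] : forall i, exists c : R, 0 <= c /\ gev xi r c s (f i) by move=> i; have [c] := Hg i; exists c.
have Hc i : gev xi r (c0 i) s (f i) := proj2 (Hc0 i).
have c00 i : 0 <= c0 i := proj1 (Hc0 i).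
pose e := Num.min (r / 4) (64 * s + 1)^-1.
have s64 : 0 < 64 * s + 1 by rewrite ltr_wpDl // mulr_ge0.
have e0 : 0 < e by rewrite lt_min divr_gt0 // invr_gt0.
exists (ball xi e); first exact: nbhsx_ballx.
move=> p pe c nz x xe.
have pe' : `|xi - p| < e by move: pe; rewrite -ball_normE.
have xe' : `|xi - x| < e by move: xe; rewrite -ball_normE.
have er : e <= r / 4 by rewrite ge_min lexx.
have es : e <= (64 * s + 1)^-1 by rewrite ge_min lexx orbT.
have xp : `|x - p| < e + e.
  rewrite (_ : x - p = (xi - p) - (xi - x)); last by rewrite opprB [RHS]addrC addrA subrK.
  by apply: le_lt_trans (ler_normB _ _) _; exact: ltrD.
have gF : gev xi r (\sum_i cn (c i) * c0 i) s (fun y => \sum_i c i * f i y).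
  by apply: gev_sum => // i; apply: gevZ; exact: Hc.
have sub : ball p (r / 2) `<=` ball xi r.
  move=> y; rewrite -!ball_normE /ball_ /= => py.
  rewrite (_ : xi - y = (xi - p) + (p - y)); last by rewrite addrA subrK.
  by apply: le_lt_trans (ler_normD _ _) _; lra.
apply: (gev_zero _ _ s0 (gev_sub sub gF)).
- by rewrite divr_gt0.
- by apply: sumr_ge0 => i _; rewrite mulr_ge0 ?cn_ge0.
- by move=> w; apply: cpdw_near_zero.
- by rewrite -ball_normE /ball_ /= distrC; lra.
- have h : (64 * s + 1) * e <= 1 by rewrite -[leRHS](mulfV (lt0r_neq0 s64)) ler_pM2l.
  have h2 : s * `|x - p| <= s * (e + e) by rewrite ler_wpM2l // ltW.
  by clear - h h2 e0; nra.
Qed.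

Variables (G : set V) (xi : V).

(** The coefficients are known only after [p], and [p] only after the neighbourhood; [identity_nbhs]
    provides one that works for all coefficients, so a relation valid near [p] reaches [xi]. *)
Lemma dim_of_concl n : (forall W, nbhs xi W -> exists2 p, W p & concl G p n) -> dim_aut_le G xi n.
Proof.
move=> H U Zs aut; have [oU [Uxi _]] := aut ord0.
have gZ i j : gevp xi (Zs i j).
  by have [_ [_ [hol _]]] := aut i; exact: (holomorphic_gevp oU Uxi (hol j)).
have /choice[W HW] : forall j, exists W : set V, nbhs xi W /\ forall p, W p -> forall c : 'I_n.+1 -> C,
    (\forall x \near p, \sum_i c i * Zs i j x = 0) -> forall x, W x -> \sum_i c i * Zs i j x = 0.
  by move=> j; have [W nW HW] := identity_nbhs (fun i => gZ i j); exists W.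
have nW : \forall x \near xi, forall j, W j x by apply: near_all => j; exact: (proj1 (HW j)).
have nU : \forall x \near xi, U x by exact: (open_nbhs_nbhs (conj oU Uxi)).
have [p [Wp Up] Cp] := H _ (near_and nW nU).
have [||c [c0 Hc]] := Cp U Zs oU Up.
- by move=> i; have [_ [_ [hol _]]] := aut i.
- by move=> i; have [_ [_ [_ tan]]] := aut i.
exists c; split=> //; exists ((fun x => forall j, W j x) : set V)°.
  by split; [exact: open_interior|exact: nW].
move=> x /interior_subset Wx j.
exact: (proj2 (HW j) p (Wp j) (fun i => (c i)%:C) (Hc j) x (Wx j)).
Qed.
End Identity.

Lemma half_sum_eq0 (R : realType) (a b : R) : (1 / 2)%:C * (a%:C + 'i * b%:C) = 0 -> a = 0 /\ b = 0.
Proof.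
move=> h; have := congr1 (@complex.Re R) h; have := congr1 (@complex.Im R) h.
by rewrite /= => h1 h2; split; lra.
Qed.

(** * Exclusion of ranks and the three bounds *)

Section Conclusion.
Variables (R : realType) (G U0 : set 'rV[R]_8) (rr : 'rV[R]_8 -> R).
Local Notation V := 'rV[R]_8.
Local Notation C := R[i].
Hypotheses (ld : local_defining G U0 rr) (hnd : holomorphically_nondegenerate G).
Let rho : V -> C := fun x => (rr x)%:C.
Let rhoE x : rho x = (rr x)%:C. Proof. by []. Qed.

Lemma good_index p : U0 p -> G p -> exists j0, good G U0 rho j0 p.
Proof.
move=> Up Gp; have [k nk] := (proj1 (proj2 (proj2 ld))) p Up.
have [j nj] : exists j, pz (inr j : cdir) rho p != 0; last by exists j.
apply: contrapT => H; have Z j : pz (inr j : cdir) rho p = 0 by apply: contrapT => /eqP h; apply: H; exists j.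
have E j : pd (xcoord j) rr p = 0 /\ pd (ycoord j) rr p = 0.
  by have := Z j; rewrite /pz /dzbar !(cpd_rho rhoE); exact: half_sum_eq0.
by apply: (negP nk); apply/eqP; move: k {nk}; apply: coordP => j; [exact: (proj1 (E j))|exact: (proj2 (E j))].
Qed.

Lemma near_outcome p (P : V -> Prop) : U0 p -> G p -> (\forall x \near p, P x) ->
  exists j0 x, [/\ P x, good G U0 rho j0 x & outcome rr rho j0 x].
Proof.
move=> Up Gp nP; have [j0 gp] := good_index Up Gp.
by have [x Hx] := classify ld hnd rhoE gp nP; exists j0, x.
Qed.

Lemma concl_mono j0 x m n : good G U0 rho j0 x -> (m <= n)%N -> bounded_at rr rho j0 x m -> concl G x n.
Proof.
move=> [Ux Gx nx] mn b; exact: (concl_of_bounded ld hnd rhoE Ux Gx nx (bounded_mono mn b)).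
Qed.

(** Near a point off [S] the analytic function defining [S] stays nonzero, so the move to a generic
    point can be kept off [S]. *)
Lemma near_nondegenerate xi l (W : set V) : U0 xi -> G xi -> generically_l_nondegenerate G l -> nbhs xi W ->
  exists j0 x, [/\ W x, good G U0 rho j0 x, outcome rr rho j0 x & l_nondegenerate_at G l x].
Proof.
move=> Uxi Gxi [S [[SG anS] [prop lS]]] nW.
have oU0 : open U0 by case: ld.
have [|p [[Wp Up] [Gp nSp]]] := prop (W° `&` U0) (openI (open_interior W) oU0).
  by exists xi; split.
have [U1 [f [oU1 [U1p [anf Hf]]]]] := anS p Gp.
have gf := analytic_gevp (anf p U1p).
have f0 : (f p)%:C != 0 :> C.
  by apply/eqP => /(congr1 (@complex.Re R)) /= e; apply: nSp; apply/(Hf p U1p Gp).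
have N := near_and (Wp : \forall x \near p, W x) (near_and (open_nbhs_nbhs (conj oU1 U1p) : \forall x \near p, U1 x) (gevp_nonzero gf f0)).
have [j0 [x [[Wx [U1x fx]] gx ox]]] := near_outcome Up Gp N.
exists j0, x; split=> //; have [_ Gx _] := gx; apply: lS => // Sx.
by move: fx; have /(Hf x U1x Gx) -> := Sx; rewrite eqxx.
Qed.

End Conclusion.

Theorem theorem17 (R : realType) (G : set 'rV[R]_8) (xi : 'rV[R]_8) :
  real_analytic_hypersurface G ->
  holomorphically_nondegenerate G ->
  G xi ->
  dim_aut_le G xi 24 /\
  (generically_l_nondegenerate G 2 -> dim_aut_le G xi 17) /\
  (generically_l_nondegenerate G 3 -> dim_aut_le G xi 20).
Proof.
move=> hG hnd Gxi; have [U0 [rr [Uxi ld]]] := hG xi Gxi.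
have rhoE x : (rr x)%:C = (rr x)%:C :> R[i] by [].
split; [|split=> gen]; apply: dim_of_concl => W nW.
- have [j0 [x [Wx gx ox]]] := near_outcome ld hnd Uxi Gxi nW; exists x => //.
  by case: ox => [[_ b]|b|[_ b]]; apply: (concl_mono ld hnd gx _ b).
- have [j0 [x [Wx gx ox [_ [Gx [U [rho2 [Ls [Ux [ld2 [cb [E2 nE1]]]]]]]]]]]] := near_nondegenerate ld hnd Uxi Gxi gen nW.
  exists x => //; have [Ux0 _ nx] := gx.
  case: ox => [[lv _]|b|[an _]].
  (* An invertible Levi form spans at order 1, while 2-nondegeneracy requires failure at that
     order. *)
  + by exfalso; apply: nE1; apply: (levi_E_full ld rhoE Ux0 Gx nx ld2 Ux cb _ lv).
  + exact: (concl_mono ld hnd gx _ b).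
  + by exfalso; exact: (not_E_full2 ld rhoE Ux0 Gx nx ld2 Ux cb an E2).
- have [j0 [x [Wx gx ox [_ [Gx [U [rho2 [Ls [Ux [ld2 [cb [E3 nE2]]]]]]]]]]]] := near_nondegenerate ld hnd Uxi Gxi gen nW.
  exists x => //; have [Ux0 _ nx] := gx.
  case: ox => [[lv _]|b|[_ b]].
  + by exfalso; apply: nE2; apply: (levi_E_full ld rhoE Ux0 Gx nx ld2 Ux cb _ lv).
  (* In rank two nothing has to be excluded, since 17 is at most 20. *)
  + by apply: (concl_mono ld hnd gx _ b).
  + exact: (concl_mono ld hnd gx _ b).
Qed.
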